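(* Let $Q,B$ be $n\times n$ real matrices satisfying the standing assumptions, with local homogeneous dimension $D$ and volume function $V$. Assume that there exist $\gamma>0$ and a number $2\le D_\infty<D$ such that $$V(t)\ge\gamma\min\{t^{D},t^{D_\infty}\}\qquad\text{for every }t>0 .$$ Let $r>2$, with $r<\frac{2D}{D-2}$ when $D>2$, let $q$ satisfy $\frac2q=D\left(\frac12-\frac1r\right)$, and let $1<q_\infty<\infty$ be such that $$\frac{2}{q_\infty}\le D_\infty\left(\frac12-\frac1r\right).$$ Then there exists a constant $C>0$ (depending on $n$, $r$ and the fixed data $Q,B,D_\infty,q_\infty$) such that for every $\varphi\in L^2(\mathbb R^n)$ and every $F$ with $\big\|e^{\frac{\operatorname{tr}B}{2}t}\|F(\cdot,t)\|_{L^{r'}(\mathbb R^n)}\big\|_{L^{q'}_t\cap L^{q_\infty'}_t}<\infty$, the solution $u$ of $$\partial_t u-i\operatorname{tr}(Q\nabla^2u)-\langle Bx,\nabla u\rangle=F(x,t),\qquad u(x,0)=\varphi(x),$$ satisfies $$\Big\|e^{\frac{\operatorname{tr}B}{2}t}\|u(\cdot,t)\|_{L^r(\mathbb R^n)}\Big\|_{L^q_t+L^{q_\infty}_t}\le C\left\{\|\varphi\|_{L^2(\mathbb R^n)}+\Big\|e^{\frac{\operatorname{tr}B}{2}t}\|F(\cdot,t)\|_{L^{r'}(\mathbb R^n)}\Big\|_{L^{q'}_t\cap L^{q_\infty'}_t}\right\}.$$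
   Context: Standing assumptions. $n\ge2$; $Q,B$ are constant real $n\times n$ matrices, $Q=Q^\star\ge0$ ($^\star$ is transpose). $\operatorname{Ker}Q$ contains no nontrivial invariant subspace of $B^\star$; equivalently the Gramian $Q(t)=\int_0^te^{sB}Qe^{sB^\star}ds$ is positive definite for every $t>0$. Moreover $Q,B$ are in canonical form: $Q=\begin{pmatrix}Q_0&0\\0&0\end{pmatrix}$ with $Q_0=Q_0^\star>0$ of size $p_0\times p_0$, and with respect to the block partition $n=p_0+p_1+\dots+p_\nu$, $p_0\ge p_1\ge\dots\ge p_\nu\ge1$, the matrix $B$ has subdiagonal blocks $B_1,\dots,B_\nu$, where $B_j$ is $p_j\times p_{j-1}$ of rank $p_j$ (in block position row $j$, column $j-1$, blocks numbered from $0$), all blocks strictly below the subdiagonal are zero, and all blocks on or above the diagonal are arbitrary. If $Q$ is invertible then $p_0=n$ and there are no other blocks. Local homogeneous dimension: $D=p_0+3p_1+5p_2+\dots+(2\nu+1)p_\nu$ (so $D=n$ when $Q$ is invertible). Volume function: $V(t)=\det Q(t)$, $t>0$. Primes denote Hölder conjugate exponents; $\nabla,\nabla^2$ are the gradient and Hessian in $x\in\mathbb R^n$. The $t$-norms are over $\mathbb R$. $L^{a}+L^{b}$ has norm $\|f\|_{L^a+L^b}=\inf\{\|f_1\|_{L^a}+\|f_2\|_{L^b}: f=f_1+f_2\}$, and $L^a\cap L^b$ has norm $\|f\|_{L^a}+\|f\|_{L^b}$. Solution. The solution is given, for $t\in\mathbb R$, by Duhamel's formula $u(\cdot,t)=U(t)\varphi+\int_0^tU(t-s)F(\cdot,s)\,ds$,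 where $\{U(t)\}_{t\in\mathbb R}$ is the group defined on Schwartz functions by $U(0)\phi=\phi$, and $$U(t)\phi(x)=\frac{(4\pi)^{-n/2}e^{-i\pi n/4}}{\sqrt{V(t)}}\int_{\mathbb R^n}e^{\frac i4\langle Q(t)^{-1}(y-e^{tB}x),\,y-e^{tB}x\rangle}\phi(y)\,dy\quad(t>0),$$ $$U(t)\phi(x)=\frac{(4\pi)^{-n/2}e^{i\pi n/4}e^{|t|\operatorname{tr}B}}{\sqrt{V(|t|)}}\int_{\mathbb R^n}e^{-\frac i4\langle Q(|t|)^{-1}(x-e^{|t|B}y),\,x-e^{|t|B}y\rangle}\phi(y)\,dy\quad(t<0),$$ and $U(t)$ is extended by density to $L^2(\mathbb R^n)$ and, for $t\ne0$ and $r\ge2$, to a bounded operator $L^{r'}(\mathbb R^n)\to L^r(\mathbb R^n)$. *)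

(* Defs.v *)
From HB Require Import structures.
From mathcomp Require Import all_boot all_order all_algebra complex.
From mathcomp Require Import all_classical all_reals all_analysis.

Set Implicit Arguments.
Unset Strict Implicit.
Unset Printing Implicit Defensive.

Import Order.TTheory GRing.Theory Num.Theory.
Import numFieldNormedType.Exports.

Local Open Scope classical_set_scope.
Local Open Scope ring_scope.

Definition measure_matrix_display (d : measure_display) : measure_display.
Proof. exact: d. Qed.

Section matrix_measurable.
Context (d : measure_display) (T : measurableType d) (m n : nat).

Definition mx_cylinders : set (set 'M[T]_(m, n)) :=
  [set A | exists (i : 'I_m) (j : 'I_n) (Y : set T),
     measurable Y /\ A = [set M : 'M[T]_(m, n) | Y (M i j)]].

(* For T = R this is the Borel sigma-algebra of R^(m * n). *)
HB.instance Definition _ :=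
  @isMeasurable.Build (measure_matrix_display d) 'M[T]_(m, n) <<s mx_cylinders >>
    (@sigma_algebra0 _ setT mx_cylinders)
    (@sigma_algebraC _ mx_cylinders)
    (@sigma_algebra_bigcup _ setT mx_cylinders).

Lemma measurable_coord (i : 'I_m) (j : 'I_n) :
  measurable_fun setT (fun M : 'M[T]_(m, n) => M i j).
Proof.
move=> _ Y mY; rewrite setTI; apply: sub_sigma_algebra.
by exists i, j, Y.
Qed.

Lemma measurable_fun_mx (d' : measure_display) (S : measurableType d')
    (f : S -> 'M[T]_(m, n)) :
  (forall i j, measurable_fun setT (fun s => f s i j)) -> measurable_fun setT f.
Proof.
move=> mf; apply: (@measurability _ _ _ _ _ _ mx_cylinders) => //.
move=> _ [_ [i [j [Y [mY ->]]]] <-].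
have := mf i j measurableT Y mY.
by rewrite !setTI.
Qed.
End matrix_measurable.

Section lebesgue_measure_cV.
Variable R : realType.

Definition cons_cV n (p : measurableTypeR R * 'cV[R]_n) : 'cV[R]_n.+1 :=
  col_mx (const_mx p.1 : 'cV_1) p.2.

Definition uncons_cV n (v : 'cV[R]_n.+1) : measurableTypeR R * 'cV[R]_n :=
  (v ord0 ord0, \col_i v (lift ord0 i) ord0).

Lemma cons_cVK n : cancel (@cons_cV n) (@uncons_cV n).
Proof.
move=> [a v]; rewrite /uncons_cV /cons_cV /=; congr pair.
  have -> : ord0 = lshift n ord0 :> 'I_(1 + n) by apply/val_inj.
  exact: (etrans (col_mxEu _ _ _ _) (mxE _ _ _ _)).
apply/matrixP => i j; rewrite mxE [j]ord1.
have -> : lift ord0 i = rshift 1 i :> 'I_(1 + n) by apply/val_inj.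
exact: col_mxEd.
Qed.

Lemma measurable_cons_cV n : measurable_fun setT (@cons_cV n).
Proof.
apply: measurable_fun_mx => i j.
have [k ->|k ->] := @split_ordP 1 n i.
  rewrite (_ : (fun p => _) = fst); first exact: measurable_fst.
  by apply/funext => p; exact: (etrans (col_mxEu _ _ _ _) (mxE _ _ _ _)).
rewrite (_ : (fun p => _) = (fun v : 'cV[R]_n => v k j) \o snd).
  exact: (measurableT_comp (measurable_coord k j) measurable_snd).
by apply/funext => p; exact: col_mxEd.
Qed.

Lemma measurable_uncons_cV n : measurable_fun setT (@uncons_cV n).
Proof.
apply/measurable_fun_pair; first exact: measurable_coord.
apply: measurable_fun_mx => i j; under eq_fun do rewrite mxE.
exact: measurable_coord.
Qed.

Section step.
Context (n : nat) (m : {sigma_finite_measure set 'cV[R]_n -> \bar R}).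
Local Open Scope ereal_scope.

Definition lebesgue_cV_step : set 'cV[R]_n.+1 -> \bar R :=
  pushforward (@lebesgue_measure R \x m) (@cons_cV n).

Let step0 : lebesgue_cV_step set0 = 0.
Proof. by rewrite /lebesgue_cV_step /pushforward preimage_set0 measure0. Qed.

Let step_ge0 A : 0 <= lebesgue_cV_step A.
Proof. by apply: integral_ge0 => x _; exact: measure_ge0. Qed.

Let step_sigma_additive : semi_sigma_additive lebesgue_cV_step.
Proof.
move=> F mF tF mUF; rewrite /lebesgue_cV_step /pushforward preimage_bigcup.
apply: measure_semi_sigma_additive.
- by move=> k; rewrite -[X in measurable X]setTI; exact: measurable_cons_cV.
- apply/trivIsetP => i j _ _ ij; rewrite -preimage_setI.
  by move/trivIsetP : tF => /(_ _ _ _ _ ij) ->//; rewrite preimage_set0.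
- by rewrite -preimage_bigcup -[X in measurable X]setTI; exact: measurable_cons_cV.
Qed.

HB.instance Definition _ := isMeasure.Build _ _ _ lebesgue_cV_step
  step0 step_ge0 step_sigma_additive.

Let step_sigma_finite : sigma_finite setT lebesgue_cV_step.
Proof.
have /sigma_finiteP[F [TF ndF Foo]] := sigma_finiteT (@lebesgue_measure R).
have /sigma_finiteP[G [TG ndG Goo]] := sigma_finiteT m.
exists (fun k => @uncons_cV n @^-1` (F k `*` G k)).
  apply/esym/seteqP; split => // v _.
  have : setT (uncons_cV v).1 by [].
  have : setT (uncons_cV v).2 by [].
  rewrite TF TG => -[j _ Gj] [i _ Fi].
  exists (maxn i j) => //; split.
    by move: Fi; exact/subsetPset/ndF/leq_maxl.
  by move: Gj; exact/subsetPset/ndG/leq_maxr.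
move=> k; have [mF Fk] := Foo k; have [mG Gk] := Goo k; split.
  rewrite -[X in measurable X]setTI; apply: measurable_uncons_cV => //.
  exact: measurableX.
rewrite /lebesgue_cV_step /pushforward -comp_preimage.
rewrite (_ : @uncons_cV n \o @cons_cV n = id); last exact/funext/cons_cVK.
rewrite preimage_id.
by rewrite product_measure1E// lte_mul_pinfty// ge0_fin_numE.
Qed.

HB.instance Definition _ := @Measure_isSigmaFinite.Build _ _ _ lebesgue_cV_step
  step_sigma_finite.

Definition lebesgue_cV_succ :
  {sigma_finite_measure set 'cV[R]_n.+1 -> \bar R} := lebesgue_cV_step.
End step.

(* n-fold product of the Lebesgue measure of R, transported to columns; the
   space 'cV_0 is a point, of mass 1. *)
Fixpoint lebesgue_cV (n : nat) : {sigma_finite_measure set 'cV[R]_n -> \bar R} :=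
  if n is k.+1 then lebesgue_cV_succ (lebesgue_cV k) else \d_(0 : 'cV[R]_0).

Lemma lebesgue_cV_box n (A : 'I_n -> set R) : (forall i, measurable (A i)) ->
  lebesgue_cV n [set v | forall i, A i (v i ord0)] =
    (\prod_(i < n) @lebesgue_measure R (A i))%E.
Proof.
elim: n A => [|n IHn] A mA.
  rewrite big_ord0 /= diracE mem_set//= => -[]//.
rewrite big_ord_recl -IHn; last by move=> i; exact: mA.
rewrite /= /lebesgue_cV_step /pushforward.
rewrite (_ : _ @^-1` _ = A ord0 `*`
    [set v : 'cV[R]_n | forall i, A (lift ord0 i) (v i ord0)]).
  rewrite product_measure1E//; first exact: mA.
  rewrite (_ : [set v | _] = \bigcap_(i in [set: 'I_n])
      ((fun v : 'cV[R]_n => v i ord0) @^-1` A (lift ord0 i))).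
    apply: fin_bigcap_measurable => // i _; rewrite -[X in measurable X]setTI.
    exact: measurable_coord.
  by apply/seteqP; split => v /= h i; [move=> _|]; exact: h.
have E0 (x : measurableTypeR R * 'cV[R]_n) : cons_cV x ord0 ord0 = x.1.
  by rewrite -[in RHS](cons_cVK x).
have Ek (x : measurableTypeR R * 'cV[R]_n) k :
    cons_cV x (lift ord0 k) ord0 = x.2 k ord0.
  by rewrite -[in RHS](cons_cVK x) /= mxE.
apply/seteqP; split => x /=.
  by move=> h; split => [|i]; [rewrite -E0|rewrite -Ek]; exact: h.
move=> [h0 hk] i; case: (unliftP ord0 i) => [k ->|->]; last by rewrite E0.
by rewrite Ek.
Qed.

End lebesgue_measure_cV.

Section complex_functions.
Context (R : realType) (d : measure_display) (T : measurableType d).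

Definition cmeasurable (f : T -> R[i]) : Prop :=
  measurable_fun setT (fun x => complex.Re (f x)) /\
  measurable_fun setT (fun x => complex.Im (f x)).

Definition cintegral (mu : {measure set T -> \bar R}) (A : set T)
    (f : T -> R[i]) : R[i] :=
  Complex (\int[mu]_(x in A) complex.Re (f x)) (\int[mu]_(x in A) complex.Im (f x)).

Definition Lp_norm (mu : {measure set T -> \bar R}) (p : \bar R)
    (f : T -> R[i]) : \bar R :=
  Lnorm mu p (fun x => (ComplexField.Normc.normc (f x))%:E).

Definition in_Lp (mu : {measure set T -> \bar R}) (p : \bar R)
    (f : T -> R[i]) : Prop :=
  cmeasurable f /\ (Lp_norm mu p f < +oo)%E.

End complex_functions.

Definition expi (R : realType) (theta : R) : R[i] :=
  Complex (cos theta) (sin theta).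

Section schwartz.
Context (R : realType) (n : nat).

(* partials [:: i1; ...; ik] f = d_i1 ... d_ik f *)
Definition partials (s : seq 'I_n) (f : 'cV[R]_n -> R) : 'cV[R]_n -> R :=
  foldr (fun i g => fun x => 'D_(delta_mx i 0) g x) f s.

(* No continuity is required: differentiability of all the partials gives it.
   `|x| is the maximum norm. *)
Definition rschwartz (f : 'cV[R]_n -> R) : Prop :=
  forall s : seq 'I_n,
    (forall x, differentiable (partials s f) x) /\
    (forall k : nat, exists M : R, forall x, `|x| ^+ k * `|partials s f x| <= M).

Definition schwartz (f : 'cV[R]_n -> R[i]) : Prop :=
  rschwartz (fun x => complex.Re (f x)) /\ rschwartz (fun x => complex.Im (f x)).
End schwartz.

Section matrices.
Context (R : realType).

Definition dotmul n (x y : 'cV[R]_n) : R := (x^T *m y) 0 0.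

Definition symmetric n (A : 'M[R]_n) : Prop := A^T = A.

Definition psd n (A : 'M[R]_n) : Prop :=
  forall x : 'cV[R]_n, 0 <= dotmul (A *m x) x.

Definition pos_def n (A : 'M[R]_n) : Prop :=
  forall x : 'cV[R]_n, x != 0 -> 0 < dotmul (A *m x) x.

(* A subspace of R^n is the row space of some W, its vectors being written as
   rows x^T: then x is in Ker Q iff x^T Q^T = 0, and B^T x becomes x^T B. *)
Definition no_invariant_subspace n (Q B : 'M[R]_n) : Prop :=
  forall W : 'M[R]_n, (W <= kermx Q^T)%MS -> stablemx W B -> W = 0.

Definition canonical_form n nu (p : 'I_nu.+1 -> nat)
    (np : n = (\sum_(j < nu.+1) p j)%N) (Q B : 'M[R]_n) : Prop :=
  let Qb := submxblock (castmx (np, np) Q) in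
  let Bb := submxblock (castmx (np, np) B) in
  [/\ forall i j : 'I_nu.+1, (i <= j)%N -> (1 <= p j <= p i)%N,
      symmetric (Qb ord0 ord0) /\ pos_def (Qb ord0 ord0),
      forall i j, (i != ord0) || (j != ord0) -> Qb i j = 0,
      forall i j : 'I_nu.+1, i = j.+1 :> nat -> \rank (Bb i j) = p i &
      forall i j : 'I_nu.+1, (j.+1 < i)%N -> Bb i j = 0].

Definition standing_assumptions n nu (p : 'I_nu.+1 -> nat)
    (np : n = (\sum_(j < nu.+1) p j)%N) (Q B : 'M[R]_n) : Prop :=
  [/\ (2 <= n)%N, symmetric Q, psd Q, no_invariant_subspace Q B &
      canonical_form np Q B].

Definition local_hom_dim nu (p : 'I_nu.+1 -> nat) : nat :=
  (\sum_(j < nu.+1) j.*2.+1 * p j)%N.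

Definition expmx n (A : 'M[R]_n) : 'M[R]_n :=
  limn (series (fun k => k`!%:R^-1 *: A ^+ k)).

Definition gramian n (Q B : 'M[R]_n) (t : R) : 'M[R]_n :=
  \matrix_(i, j) \int[@lebesgue_measure R]_(s in `[0, t])
    (expmx (s *: B) *m Q *m expmx (s *: B^T)) i j.

Definition volume n (Q B : 'M[R]_n) (t : R) : R := \det (gramian Q B t).
End matrices.

Section evolution.
Context (R : realType) (n : nat) (Q B : 'M[R]_n).
Local Notation vec := 'cV[R]_n.
Local Notation C := R[i].
Local Notation leb := (@lebesgue_measure R).
Local Notation lebn := (lebesgue_cV R n).
Local Open Scope complex_scope.

Definition U (t : R) (phi : vec -> C) (x : vec) : C :=
  let tau := `|t| in
  let phase (z : vec) := 4^-1 * dotmul (invmx (gramian Q B tau) *m z) z in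
  let c := (4 * pi) `^ (- (n%:R / 2)) / Num.sqrt (volume Q B tau) in
  if t == 0 then phi x
  else if 0 < t then
    c%:C * expi (- (pi * n%:R / 4)) *
    cintegral lebn setT
      (fun y => expi (phase (y - expmx (tau *: B) *m x)) * phi y)
  else
    (c * expR (tau * \tr B))%:C * expi (pi * n%:R / 4) *
    cintegral lebn setT
      (fun y => expi (- phase (x - expmx (tau *: B) *m y)) * phi y).

(* g is the value at f of the extension by density of U(t) to an operator
   L^p -> L^p': the graph of the extension is the closure, in L^p x L^p', of
   the graph of U(t) on Schwartz functions. *)
Definition U_ext (p p' : \bar R) (t : R) (f g : vec -> C) : Prop :=
  [/\ in_Lp lebn p f, in_Lp lebn p' g &
      forall eps : R, 0 < eps -> exists psi : vec -> C,
        [/\ schwartz psi,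
            (Lp_norm lebn p (f \- psi)%R < eps%:E)%E &
            (Lp_norm lebn p' (g \- U t psi)%R < eps%:E)%E]].

(* w is the L^r-valued integral of U(t - s) F(s) over s from 0 to t, for
   U(t - s) : L^r' -> L^r; G is a jointly measurable version of the integrand,
   and for t < 0 the integral is minus the integral over [t, 0]. *)
Definition duhamel (r : R) (F : R -> vec -> C) (t : R) (w : vec -> C) : Prop :=
  let I : set R := `[Num.min 0 t, Num.max 0 t]%classic in
  in_Lp lebn r%:E w /\
  exists G : R -> vec -> C,
    [/\ cmeasurable (fun sx : measurableTypeR R * vec => G sx.1 sx.2),
        {ae leb, forall s, I s ->
           U_ext (hoelder_conjugate r%:E) r%:E (t - s) (F s) (G s)},
        (\int[leb]_(s in I) Lp_norm lebn r%:E (G s) < +oo)%E &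
        {ae lebn, forall x,
           w x = (Num.sg t)%:C * cintegral leb I (fun s => G s x)}].

(* u solves d_t u - i tr(Q D^2 u) - <Bx, D u> = F, u(0) = phi, i.e. u is given
   by Duhamel's formula. Functions of (x, t) are written with t first; the
   formula determines u(t) up to null sets, for almost every t. *)
Definition is_solution (r : R) (phi : vec -> C) (F u : R -> vec -> C) : Prop :=
  {ae leb, forall t, cmeasurable (u t) /\
     exists v w : vec -> C,
       [/\ U_ext 2%:E 2%:E t phi v, duhamel r F t w &
           {ae lebn, forall x, u t x = v x + w x}]}.

Definition weighted_norm (r : \bar R) (F : R -> vec -> C) (t : R) : \bar R :=
  ((expR (\tr B / 2 * t))%:E * Lp_norm lebn r (F t))%E.
End evolution.

Section time_norms.
Context (R : realType).
Local Notation leb := (@lebesgue_measure R).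
Local Open Scope ereal_scope.

Definition cap_norm (a b : \bar R) (f : R -> \bar R) : \bar R :=
  'N[leb]_a [f] + 'N[leb]_b [f].

(* Real-valued pieces suffice, f being real-valued; a non-measurable f, or one
   infinite on a set of positive measure, has norm +oo. *)
Definition sum_norm (a b : \bar R) (f : R -> \bar R) : \bar R :=
  ereal_inf [set N | exists f1 f2 : R -> R,
    [/\ measurable_fun setT f1, measurable_fun setT f2,
        {ae leb, forall t, f t = (f1 t + f2 t)%:E} &
        N = 'N[leb]_a [EFin \o f1] + 'N[leb]_b [EFin \o f2]]].
End time_norms.

(* Main.v *)
(** Idea. Completing the square in the Gramian turns [U t] into a chirp of size
   [vol t ^-1/2], so that [e^(tr B t / 2) U t] is an L^2 isometry with kernel bounded by
   [vol |t| ^-1/2]. Gaussian regularisation makes these bounds rigorous for [U t (U s)^*],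
   and interpolating between L^2 and L^1 -> L^oo gives the L^r' -> L^r bound
   [C vol |t - s| ^-(1/2 - 1/r)]. The hypothesis on [vol] dominates that kernel by
   [|t - s| ^-(2/q) + |t - s| ^-(2/qoo)], and the Hardy-Littlewood-Sobolev inequality applies
   to both exponents.
   TT* then yields the homogeneous estimate, and the inhomogeneous one is read off from
   the dispersive bound. Norms in L^q + L^qoo are controlled by testing against
   L^q' /\ L^qoo'. Measurable representatives of [U t] on L^2 and L^r' come from fast
   converging Schwartz approximations, so that every solution agrees almost everywhere
   with the one constructed. *)
From HB Require Import structures.
Require Import Defs.
From mathcomp Require Import all_boot all_order all_algebra complex.
From mathcomp Require Import all_classical all_reals all_analysis.
From mathcomp Require Import measurable_realfun ess_sup_inf borel_hierarchy.

From mathcomp Require Import ring lra zify.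

Set Implicit Arguments.
Unset Strict Implicit.
Unset Printing Implicit Defensive.

Import Order.TTheory GRing.Theory Num.Theory.
Import numFieldNormedType.Exports.

Local Open Scope classical_set_scope.
Local Open Scope ring_scope.

Notation cabs := ComplexField.Normc.normc.
Notation mfun_pair := measurable_fun_pair.
Notation mfun_ifT := measurable_fun_ifT.
Notation mpair1 := measurable_pair1.
Notation mpair2 := measurable_pair2.
Notation mfunTS := measurable_funTS.
Notation mfunN := measurable_funN.
Notation mfunD := measurable_funD.
Notation mfunX := measurable_funX.
Notation mfunB := measurable_funB.
Notation mfun_ltr := measurable_fun_ltr.
Notation mindic := measurable_indic.
Notation mtypeR := measurableTypeR.
Notation mcst := measurable_cst.
Notation eq_int := eq_integral.
Notation int_ge0 := integral_ge0.
Notation ge0_finE := ge0_fin_numE.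
Notation sfmeasure X R := {sigma_finite_measure set X -> \bar R}.
Notation mfunT := (measurable_fun setT).
Notation mEFinP := measurable_EFinP.
Notation mcompT := measurableT_comp.
Notation mfunM := measurable_funM.
Notation emfunM := emeasurable_funM.
Notation mfst := measurable_fst.
Notation msnd := measurable_snd.
Notation mfubiniF := measurable_fun_fubini_tonelli_F.
Notation mfubiniG := measurable_fun_fubini_tonelli_G.

(** The signed Gramian $q(t)=\int_0^te^{sB}Qe^{sB^\star}ds$ is a cocycle,
    $q(t)=q(s)+e^{sB}q(t-s)e^{sB^\star}$. Hence the quadratic phases of $U(t)$ and $U(s)$ differ by
    a form whose determinant is a multiple of vol(t-s)/(vol(t)vol(s)); this is why the kernel of
    $U(t)U(s)^*$ has a size depending on $t-s$ only, and the group law of $U$ is never invoked. Here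
    vol is $V(t)e^{-t\operatorname{tr}B}$, not $V$: for $\operatorname{tr}B>0$ the lower bound
    survives because $V$ then grows at least like $e^{2t\operatorname{tr}B}$. From $2\le D_\infty<D$
    and the range of $r$ one gets $2<q<q_\infty$, as Hardy-Littlewood-Sobolev and the splitting of
    $L^q+L^{q_\infty}$ require. The definition of a solution fixes at each time only a member of a
    graph closure. The obstacle is to exhibit a jointly measurable solution: it is a pointwise limit
    of absolutely convergent integrals, applied to a Gaussian damping of $\varphi$ and to
    truncations of $F$ whose level is chosen measurably in time. *)

Lemma le_of_eq d (T : porderType d) (x y : T) : x = y -> (x <= y)%O.
Proof. by move=> ->. Qed.

(** * Complex-valued integrals *)

Section ComplexBasics.
Context (R : realType).
Implicit Types z w : R[i].

Lemma cabsE z : cabs z = Num.sqrt (complex.Re z ^+ 2 + complex.Im z ^+ 2).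
Proof. by case: z. Qed.

Lemma cabs_ge0 z : 0 <= cabs z.
Proof. by rewrite cabsE sqrtr_ge0. Qed.

Lemma sqr_cabs z : cabs z ^+ 2 = complex.Re z ^+ 2 + complex.Im z ^+ 2.
Proof. by rewrite cabsE sqr_sqrtr// addr_ge0// sqr_ge0. Qed.

Lemma cabs0 : cabs (0 : R[i]) = 0.
Proof. exact: ComplexField.Normc.normc0. Qed.

Lemma cabsM z w : cabs (z * w) = cabs z * cabs w.
Proof. exact: ComplexField.Normc.normcM. Qed.

Lemma cabsD z w : cabs (z + w) <= cabs z + cabs w.
Proof. exact: le_normcD. Qed.

Lemma cabsN z : cabs (- z) = cabs z.
Proof. exact: normcN. Qed.

Lemma cabs_distC z w : cabs (z - w) = cabs (w - z).
Proof. by rewrite -opprB cabsN. Qed.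

Lemma cabs0_eq0 z : cabs z = 0 -> z = 0.
Proof. exact: ComplexField.Normc.eq0_normc. Qed.

Lemma cabsJ z : cabs (conjc z) = cabs z.
Proof. by case: z => a b; rewrite !cabsE /= sqrrN. Qed.

Lemma cabs_real (x : R) : cabs (x%:C)%C = `|x|.
Proof. by rewrite cabsE /= expr0n addr0 sqrtr_sqr. Qed.

Lemma cabs_expi (x : R) : cabs (expi x) = 1.
Proof. by rewrite cabsE /= cos2Dsin2 sqrtr1. Qed.

Lemma expiD (x y : R) : expi (x + y) = expi x * expi y.
Proof.
rewrite /expi cosD sinD; apply/eqP; rewrite eq_complex /=.
by rewrite eqxx /= addrC [X in X + _]mulrC [sin y * _]mulrC eqxx.
Qed.

Lemma expi0 : expi 0 = 1 :> R[i].
Proof. by rewrite /expi cos0 sin0. Qed.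

Lemma expiN (x : R) : expi (- x) = conjc (expi x).
Proof. by rewrite /expi cosN sinN. Qed.

Lemma ReD z w : complex.Re (z + w) = complex.Re z + complex.Re w.
Proof. by case: z; case: w. Qed.
Lemma ImD z w : complex.Im (z + w) = complex.Im z + complex.Im w.
Proof. by case: z; case: w. Qed.
Lemma ReN z : complex.Re (- z) = - complex.Re z.
Proof. by case: z. Qed.
Lemma ImN z : complex.Im (- z) = - complex.Im z.
Proof. by case: z. Qed.
Lemma ReM z w : complex.Re (z * w) =
  complex.Re z * complex.Re w - complex.Im z * complex.Im w.
Proof. by case: z; case: w. Qed.
Lemma ImM z w : complex.Im (z * w) =
  complex.Re z * complex.Im w + complex.Im z * complex.Re w.
Proof. by case: z => a b; case: w => c d /=; rewrite [_ + b * _]addrC addrC. Qed.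
Lemma ReJ z : complex.Re (conjc z) = complex.Re z.
Proof. by case: z. Qed.
Lemma ImJ z : complex.Im (conjc z) = - complex.Im z.
Proof. by case: z. Qed.

Lemma complexE z w : complex.Re z = complex.Re w -> complex.Im z = complex.Im w -> z = w.
Proof. by case: z => a b; case: w => c d /= -> ->. Qed.

Lemma abs_Re z : `|complex.Re z| <= cabs z.
Proof.
by rewrite cabsE -sqrtr_sqr ler_sqrt ?addr_ge0 ?sqr_ge0// lerDl sqr_ge0.
Qed.

Lemma abs_Im z : `|complex.Im z| <= cabs z.
Proof.
by rewrite cabsE -sqrtr_sqr ler_sqrt ?addr_ge0 ?sqr_ge0// lerDr sqr_ge0.
Qed.

Lemma cabs_ReIm z : cabs z <= `|complex.Re z| + `|complex.Im z|.
Proof.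
rewrite -(@ler_pXn2r _ 2) ?nnegrE ?cabs_ge0 ?addr_ge0// sqr_cabs sqrrD.
rewrite !real_normK ?num_real//; have := normr_ge0 (complex.Re z).
have := normr_ge0 (complex.Im z); nra.
Qed.

Lemma mulcJ z : z * conjc z = ((cabs z ^+ 2)%:C)%C.
Proof.
by rewrite sqr_cabs; case: z => a b; apply: complexE => /=; ring.
Qed.
End ComplexBasics.

Ltac nonneg := move=> *; cbv beta;
  first [ exact: poweR_ge0 | exact: cabs_ge0 | exact: Lnorm_ge0
        | rewrite lee_fin; nonneg | apply: mulr_ge0; nonneg | apply: mule_ge0; nonneg
        | exact: powR_ge0 | exact: sqr_ge0 | exact: expR_ge0 | done ].

Section ComplexMeasurable.
Context (R : realType) d (T : measurableType d).
Implicit Types f g : T -> R[i].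

Lemma cmeas_cabs f : cmeasurable f -> mfunT (fun x => cabs (f x)).
Proof.
move=> [mR mI]; under eq_fun do rewrite cabsE -powR12_sqrt ?addr_ge0 ?sqr_ge0//.
apply: mcompT (measurable_powR _) _.
by apply: mfunD; exact: mfunX.
Qed.

Lemma cmeasD f g : cmeasurable f -> cmeasurable g -> cmeasurable (fun x => f x + g x).
Proof.
move=> [mR mI] [mR' mI']; split.
  by under eq_fun do rewrite ReD; exact: mfunD.
by under eq_fun do rewrite ImD; exact: mfunD.
Qed.

Lemma cmeasN f : cmeasurable f -> cmeasurable (fun x => - f x).
Proof.
move=> [mR mI]; split.
  by under eq_fun do rewrite ReN; exact: mfunN.
by under eq_fun do rewrite ImN; exact: mfunN.
Qed.

Lemma cmeasB f g : cmeasurable f -> cmeasurable g -> cmeasurable (fun x => f x - g x).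
Proof. by move=> mf mg; apply: cmeasD => //; exact: cmeasN. Qed.

Lemma cmeasM f g : cmeasurable f -> cmeasurable g -> cmeasurable (fun x => f x * g x).
Proof.
move=> [mR mI] [mR' mI']; split.
  under eq_fun do rewrite ReM.
  by apply: mfunB; exact: mfunM.
under eq_fun do rewrite ImM.
by apply: mfunD; exact: mfunM.
Qed.

Lemma cmeasJ f : cmeasurable f -> cmeasurable (fun x => conjc (f x)).
Proof.
move=> [mR mI]; split.
  by under eq_fun do rewrite ReJ.
by under eq_fun do rewrite ImJ; exact: mfunN.
Qed.

Lemma cmeas_cst (c : R[i]) : cmeasurable (fun _ : T => c).
Proof. by split; exact: mcst. Qed.

Lemma cmeas_real (h : T -> R) : mfunT h -> cmeasurable (fun x => ((h x)%:C)%C).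
Proof. by move=> mh; split => //=; exact: mcst. Qed.

Lemma cmeas_expi (h : T -> R) : mfunT h -> cmeasurable (fun x => expi (h x)).
Proof.
move=> mh; split => /=.
  by apply: mcompT mh; apply: continuous_measurable_fun; exact: continuous_cos.
by apply: mcompT mh; apply: continuous_measurable_fun; exact: continuous_sin.
Qed.

Lemma cmeas_comp d' (T' : measurableType d') (h : T' -> T) f :
  cmeasurable f -> mfunT h -> cmeasurable (fun x => f (h x)).
Proof.
move=> [mR mI] mh; split.
  exact: (mcompT mR mh).
exact: (mcompT mI mh).
Qed.

Lemma cmeas_indic (E : set T) f : measurable E -> cmeasurable f ->
  cmeasurable (fun x => ((\1_E x : R)%:C)%C * f x).
Proof.
by move=> mE mf; apply: cmeasM => //; apply: cmeas_real; exact: mindic.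
Qed.

End ComplexMeasurable.

Section ComplexIntegral.
Context (R : realType) d (T : measurableType d) (mu : {measure set T -> \bar R}).
Implicit Types f g : T -> R[i].

Definition cintegrable f := cmeasurable f /\ (\int[mu]_x (cabs (f x))%:E < +oo)%E.

Lemma cintg_cabs f : cintegrable f -> mu.-integrable setT (fun x => (cabs (f x))%:E).
Proof.
move=> [mf foo]; apply/integrableP; split.
  by apply/mEFinP; exact: cmeas_cabs.
by under eq_int do rewrite gee0_abs ?lee_fin ?cabs_ge0//.
Qed.

Lemma cintg_Re f : cintegrable f -> mu.-integrable setT (EFin \o (fun x => complex.Re (f x))).
Proof.
move=> If; have [[mR mI] _] := If; apply: le_integrable (cintg_cabs If) => //.
  exact/mEFinP.
by move=> x _ /=; rewrite lee_fin (le_trans (abs_Re _))// ler_norm.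
Qed.

Lemma cintg_Im f : cintegrable f -> mu.-integrable setT (EFin \o (fun x => complex.Im (f x))).
Proof.
move=> If; have [[mR mI] _] := If; apply: le_integrable (cintg_cabs If) => //.
  exact/mEFinP.
by move=> x _ /=; rewrite lee_fin (le_trans (abs_Im _))// ler_norm.
Qed.

Lemma cintg_le f (h : T -> R) : cmeasurable f -> mu.-integrable setT (EFin \o h) ->
  (forall x, cabs (f x) <= h x) -> cintegrable f.
Proof.
move=> mf /integrableP[mh hoo] fh; split=> //.
apply: le_lt_trans hoo; apply: ge0_le_integral => //.
- nonneg.
- by apply/mEFinP; exact: cmeas_cabs.
- exact: mcompT.
- by move=> x _ /=; rewrite lee_fin (le_trans (fh x))// ler_norm.
Qed.

Lemma integrable_EFinZ (k : R) (h : T -> R) : mu.-integrable setT (EFin \o h) ->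
  mu.-integrable setT (EFin \o (fun x => k * h x)).
Proof.
move=> mh; rewrite (_ : _ \o _ = fun x => (k%:E * (EFin \o h) x)%E) //.
exact: integrableZl.
Qed.

Lemma cintgD f g : cintegrable f -> cintegrable g -> cintegrable (fun x => f x + g x).
Proof.
move=> If Ig; have := integrableD measurableT (cintg_cabs If) (cintg_cabs Ig).
have [mf _] := If; have [mg _] := Ig.
move=> /(cintg_le (cmeasD mf mg)); apply => x; exact: cabsD.
Qed.

Lemma cintgZ (c : R[i]) f : cintegrable f -> cintegrable (fun x => c * f x).
Proof.
move=> If; have [mf _] := If.
have := integrableZl measurableT (cabs c) (cintg_cabs If).
move=> /(cintg_le (cmeasM (cmeas_cst T c) mf)); apply => x.
by rewrite cabsM.
Qed.

Lemma cintegralD f g : cintegrable f -> cintegrable g ->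
  cintegral mu setT (fun x => f x + g x) = cintegral mu setT f + cintegral mu setT g.
Proof.
move=> If Ig; rewrite /cintegral; apply: complexE => /=.
  rewrite -RintegralD//; [|exact: cintg_Re|exact: cintg_Re].
  by apply: eq_Rintegral => x _; rewrite ReD.
rewrite -RintegralD//; [|exact: cintg_Im|exact: cintg_Im].
by apply: eq_Rintegral => x _; rewrite ImD.
Qed.

Lemma cintegralZ (c : R[i]) f : cintegrable f ->
  cintegral mu setT (fun x => c * f x) = c * cintegral mu setT f.
Proof.
move=> If; have mR := cintg_Re If; have mI := cintg_Im If.
rewrite /cintegral; apply: complexE; rewrite ?ReM ?ImM /=.
  rewrite -!RintegralZl// -RintegralB//; [|exact: integrable_EFinZ|exact: integrable_EFinZ].
  by apply: eq_Rintegral => x _; rewrite ReM.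
rewrite -!RintegralZl// -RintegralD//; [|exact: integrable_EFinZ|exact: integrable_EFinZ].
by apply: eq_Rintegral => x _; rewrite ImM.
Qed.

Lemma cintegralN f : cintegrable f ->
  cintegral mu setT (fun x => - f x) = - cintegral mu setT f.
Proof.
move=> If; rewrite -[RHS]mulN1r -cintegralZ//; congr cintegral.
by apply/funext => x; rewrite mulN1r.
Qed.

Lemma cintegralB f g : cintegrable f -> cintegrable g ->
  cintegral mu setT (fun x => f x - g x) = cintegral mu setT f - cintegral mu setT g.
Proof.
move=> If Ig; rewrite cintegralD ?cintegralN//.
have := cintgZ (-1) Ig; congr cintegrable.
by apply/funext => x; rewrite mulN1r.
Qed.

Lemma cintegralJ f : cintegrable f ->
  cintegral mu setT (fun x => conjc (f x)) = conjc (cintegral mu setT f).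
Proof.
move=> If; rewrite /cintegral; apply: complexE => /=.
  by apply: eq_Rintegral => x _; rewrite ReJ.
rewrite -mulN1r -RintegralZl//; last exact: cintg_Im.
by apply: eq_Rintegral => x _; rewrite ImJ mulN1r.
Qed.

(** Multiplying $f$ by the conjugate of its own integral $z$ turns $|z|^2$ into the real part of an
    integral, to which the monotonicity of real integrals applies; a factor $|z|$ is then divided
    out. *)
Lemma cabs_cintegral f : cintegrable f ->
  ((cabs (cintegral mu setT f))%:E <= \int[mu]_x (cabs (f x))%:E)%E.
Proof.
move=> If; set z := cintegral mu setT f.
have zE : z = cintegral mu setT f by [].
clearbody z; have [z0|z0] := eqVneq (cabs z) 0.
  by rewrite z0; apply: int_ge0 => x _; rewrite lee_fin cabs_ge0.
have zgt : 0 < cabs z by rewrite lt_neqAle eq_sym z0 cabs_ge0.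
have Ic := cintg_cabs If.
suff : cabs z <= \int[mu]_x (cabs (f x)).
  rewrite -lee_fin => /le_trans; apply; rewrite /Rintegral fineK//.
  exact: integrable_fin_num.
rewrite -(ler_pM2l zgt) -expr2.
have -> : cabs z ^+ 2 = complex.Re (cintegral mu setT (fun x => conjc z * f x)).
  by rewrite cintegralZ// -zE mulrC mulcJ.
rewrite -RintegralZl// /cintegral; apply: le_Rintegral => //.
- exact: (cintg_Re (cintgZ _ If)).
- exact: integrable_EFinZ.
- move=> x _; apply: le_trans (ler_norm _) _; apply: le_trans (abs_Re _) _.
  by rewrite cabsM cabsJ.
Qed.

Lemma eq_cintegral f g : (forall x, f x = g x) -> cintegral mu setT f = cintegral mu setT g.
Proof. by move=> fg; congr cintegral; exact/funext. Qed.

Lemma ae_eq_cintegral f g : cmeasurable f -> cmeasurable g ->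
  {ae mu, forall x, f x = g x} -> cintegral mu setT f = cintegral mu setT g.
Proof.
move=> [mf mf'] [mg mg'] fg; rewrite /cintegral /Rintegral; congr Complex; congr fine;
  apply: ae_eq_integral => //; try exact/mEFinP;
  by apply: filterS fg => x + _ /= => ->.
Qed.

End ComplexIntegral.

(** * Fatou bounds and converse Hoelder duality *)

Section LpDuality.
Context d (T : measurableType d) (R : realType).
Implicit Types (mu : {measure set T -> \bar R}).
Local Open Scope ereal_scope.

Lemma le_integralT mu (f1 f2 : T -> \bar R) : (forall x, 0 <= f1 x) ->
  mfunT f1 -> mfunT f2 -> (forall x, f1 x <= f2 x) ->
  \int[mu]_x f1 x <= \int[mu]_x f2 x.
Proof. by move=> f10 mf1 mf2 f12; apply: ge0_le_integral. Qed.

Lemma integralZlT mu (f : T -> \bar R) (k : R) : (forall x, 0 <= f x) ->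
  mfunT f -> (0 <= k)%R ->
  \int[mu]_x (k%:E * f x) = k%:E * \int[mu]_x f x.
Proof. by move=> f0 mf k0; rewrite ge0_integralZl. Qed.

Lemma mfun_poweR (p : R) (f : T -> \bar R) : mfunT f ->
  mfunT (fun x => f x `^ p).
Proof. by move=> mf; apply: mcompT (measurable_poweR p) mf. Qed.

Lemma mfun_powR (p : R) (f : T -> R) : mfunT f ->
  mfunT (fun x => f x `^ p)%R.
Proof. by move=> mf; apply: mcompT (measurable_powR p) mf. Qed.

Lemma le_powR (x y p : R) : (0 <= p -> 0 <= x -> x <= y -> x `^ p <= y `^ p)%R.
Proof.
by move=> p0 x0 xy; apply: ge0_ler_powR => //; rewrite nnegrE// (le_trans x0).
Qed.

Lemma le_limn_einf (u v : (\bar R)^nat) :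
  (forall n, u n <= v n) -> limn_einf u <= limn_einf v.
Proof.
move=> uv; rewrite !limn_einf_lim; apply: lee_lim; [exact: is_cvg_einfs|exact: is_cvg_einfs|].
apply: nearW => n; apply: le_ereal_inf_tmp => _ [m /= nm <-].
by apply: ge_ereal_inf; exists (u m); [exists m|exact: uv].
Qed.

Lemma limn_einf_le (u : (\bar R)^nat) C : (forall n, u n <= C) -> limn_einf u <= C.
Proof.
move=> uC; have := @le_limn_einf u (cst C) uC.
by rewrite (cvg_limn_einf_sup (@cvg_cst _ C _ _ _)).1.
Qed.

(** The limiting device of the whole development: a bound uniform along an approximation passes to
    the almost everywhere limit, whether or not the approximation is monotone or the limit
    finite. *)
Lemma fatou_le mu (f_ : nat -> T -> \bar R) (f : T -> \bar R) C :
  (forall n, mfunT (f_ n)) -> (forall n x, 0 <= f_ n x) ->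
  mfunT f -> (forall x, 0 <= f x) ->
  {ae mu, forall x, f_ ^~ x @ \oo --> f x} ->
  (forall n, \int[mu]_x f_ n x <= C) -> \int[mu]_x f x <= C.
Proof.
move=> mf_ f_0 mf f0 ff fC.
have mli : mfunT (fun x => limn_einf (f_ ^~ x)).
  (* The lower limit is written as minus the upper limit of the opposites, whose measurability is
     known. *)
  under eq_fun do rewrite -[X in limn_einf X](funext (fun y => oppeK (f_ y _))).
  under eq_fun do rewrite (limn_einfN (fun y => - f_ y _)).
  apply: mcompT => //; apply: measurable_fun_limn_esup => n.
  exact: mcompT.
have li0 x : 0 <= limn_einf (f_ ^~ x).
  rewrite limn_einf_lim; apply: lime_ge; first exact: is_cvg_einfs.
  by apply: nearW => n; apply: le_ereal_inf_tmp => _ [m /= nm <-].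
rewrite (@ge0_ae_eq_integral _ _ _ mu setT f (fun x => limn_einf (f_ ^~ x)))//; last first.
  apply: filterS ff => x fx _; by rewrite (cvg_limn_einf_sup fx).1.
apply: le_trans (limn_einf_le fC).
exact: fatou.
Qed.

Lemma Lnorm_ge0E mu (p : R) (h : T -> \bar R) : (forall x, 0 <= h x) ->
  'N[mu]_p%:E[h] = (\int[mu]_x (h x `^ p)) `^ p^-1.
Proof.
move=> h0; rewrite unlock /=; congr (_ `^ _); apply: eq_int => x _.
by rewrite gee0_abs.
Qed.

Lemma poweRVK (x : \bar R) (p : R) : (0 <= x) -> (p != 0)%R -> (x `^ p^-1) `^ p = x.
Proof. by move=> x0 p0; rewrite -poweRrM mulVf// poweRe1. Qed.

Lemma poweRKV (x : \bar R) (p : R) : (0 <= x) -> (p != 0)%R -> (x `^ p) `^ p^-1 = x.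
Proof. by move=> x0 p0; rewrite -poweRrM mulfV// poweRe1. Qed.

Lemma lee_poweR (x y : \bar R) (p : R) : (0 <= p)%R -> 0 <= x -> x <= y -> x `^ p <= y `^ p.
Proof.
move=> p0 x0 xy; apply: gt0_ler_poweR => //; rewrite in_itv /= leey andbT//.
exact: le_trans xy.
Qed.

Lemma Lnorm_le mu (p : R) (h : T -> \bar R) C : (0 < p)%R -> 0 <= C -> (forall x, 0 <= h x) ->
  ('N[mu]_p%:E[h] <= C) <-> (\int[mu]_x (h x `^ p) <= C `^ p).
Proof.
move=> p0 C0 h0; rewrite Lnorm_ge0E//.
have i0 : 0 <= \int[mu]_x h x `^ p by apply: int_ge0 => x _; exact: poweR_ge0.
split=> [h1|h1].
  rewrite -[leLHS](@poweRVK _ p) ?gt_eqF//; apply: lee_poweR => //; [exact: ltW|exact: poweR_ge0].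
rewrite -[leRHS](@poweRKV _ p) ?gt_eqF//; apply: lee_poweR => //; by rewrite invr_ge0 ltW.
Qed.

(** The identities behind testing a function against its own power $h^{p-1}$. *)
Lemma conj_exp_gt1 (p q : R) : (1 < p)%R -> (p^-1 + q^-1 = 1)%R ->
  [/\ (1 < q)%R, ((p - 1) * q = p)%R & ((q - 1) * p = q)%R].
Proof.
move=> p1 pq; have p0 : (p != 0)%R by rewrite gt_eqF// (lt_trans _ p1).
have q0 : (q != 0)%R.
  apply/eqP => q0; move: pq; rewrite q0 invr0 addr0 => /eqP.
  by rewrite invr_eq1 => /eqP pE; move: p1; rewrite pE ltxx.
have pqE : (q + p = p * q)%R.
  have := congr1 (fun x => x * (p * q))%R pq; rewrite mulrDl mul1r => <-.
  by rewrite mulrA mulVf// mul1r [X in (_ = q + X)%R]mulrCA mulVf// mulr1.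
split.
- have : (0 < q^-1)%R by rewrite -(ltrD2l p^-1) pq addr0 invf_lt1// (lt_trans _ p1).
  rewrite invr_gt0 => q'0; rewrite -invf_lt1// -(ltrD2l p^-1) pq ltrDr.
  by rewrite invr_gt0 (lt_trans _ p1).
- by rewrite mulrBl mul1r -pqE addrAC subrr add0r.
- by rewrite mulrBl mul1r mulrC -pqE addrK.
Qed.

(** Converse of Hoelder's inequality in a form with few test functions, all bounded and supported on
    sets of finite measure, while [h] may take the value +oo. Testing against $h_N^{p-1}$ for a
    truncation $h_N$ gives $X\le CX^{1/q}$ with $X=\int h_N^p$, hence $X\le C^p$; Fatou removes the
    truncation. *)
Lemma Lnorm_dual (mu : sfmeasure T R) (p q : R)
    (h : T -> \bar R) (C : R) :
  (1 < p)%R -> (p^-1 + q^-1 = 1)%R -> mfunT h ->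
  (forall x, 0 <= h x) -> (0 <= C)%R ->
  (forall g : T -> R, mfunT g -> (forall x, 0 <= g x)%R ->
    (exists M, forall x, g x <= M)%R ->
    (exists2 A, measurable A /\ mu A < +oo & forall x, ~ A x -> g x = 0%R) ->
    \int[mu]_x (h x * (g x)%:E) <= C%:E * 'N[mu]_q%:E[EFin \o g]) ->
  'N[mu]_p%:E[h] <= C%:E.
Proof.
move=> p1 pq mh h0 C0 H.
have [q1 pq1 qp1] := conj_exp_gt1 p1 pq.
have p0 : (0 < p)%R by exact: lt_trans p1.
have q0 : (0 < q)%R by exact: lt_trans q1.
have /sigma_finiteP[A [AT ndA Aoo]] := sigma_finiteT mu.
(* A cut in height and in support: both serve to make $h_N^{p-1}$ an admissible test function and
   $\int h_N^p$ finite. *)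
pose hN N x : R := (fine (mine (h x) N%:R%:E) * \1_(A N) x)%R.
have mhN N : mfunT (hN N).
  apply: mfunM; last by apply: mindic; have [] := Aoo N.
  apply: mcompT => //; exact: measurable_mine.
have fin_min N x : mine (h x) N%:R%:E \is a fin_num.
  rewrite ge0_finE; first by rewrite gt_min ltry orbT.
  by rewrite le_min h0 lee_fin ler0n.
have hN0 N x : (0 <= hN N x)%R.
  by rewrite mulr_ge0// fine_ge0// le_min h0 lee_fin ler0n.
have hNle N x : (hN N x)%:E <= h x.
  rewrite /hN indicE; case: (_ \in _); last by rewrite mulr0.
  by rewrite mulr1 fineK// ge_min lexx.
have hNN N x : (hN N x <= N%:R)%R.
  rewrite /hN indicE; case: (_ \in _); last by rewrite mulr0 ler0n.
  by rewrite mulr1 -lee_fin fineK// ge_min lexx orbT.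
have main N : \int[mu]_x ((hN N x)%:E `^ p) <= C%:E `^ p.
  pose X := \int[mu]_x ((hN N x)%:E `^ p).
  pose g x := (hN N x `^ (p - 1))%R.
  have mg : mfunT g by exact: mcompT (measurable_powR _) (mhN N).
  have := H g mg (fun x => powR_ge0 _ _).
  have bg : exists M, forall x, (g x <= M)%R.
    by exists (N%:R `^ (p - 1))%R => x; apply: le_powR; rewrite // subr_ge0 ltW.
  have sg : exists2 A0, measurable A0 /\ mu A0 < +oo & forall x, ~ A0 x -> g x = 0%R.
    exists (A N) => // x Ax; rewrite /g /hN indicE memNset// mulr0 powR0// subr_eq0.
    by rewrite gt_eqF.
  move=> /(_ bg sg).
  rewrite Lnorm_ge0E; last by move=> x /=; rewrite lee_fin powR_ge0.
  have -> : \int[mu]_x ((EFin \o g) x `^ q) = X.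
    apply: eq_int => x _ /=; rewrite /g.
    by rewrite -powRrM pq1.
  move=> hX.
  have X0 : 0 <= X by apply: int_ge0 => x _; exact: poweR_ge0.
  have XX : X <= C%:E * X `^ q^-1.
    apply: le_trans hX; apply: le_integralT => //.
    - nonneg.
    - by apply: mfun_poweR; exact/mEFinP.
    - by apply: emfunM => //; exact/mEFinP.
    move=> x /=; rewrite -(mulr_powRB1 (hN0 N x) p0) EFinM.
    by apply: lee_wpmul2r; rewrite ?lee_fin ?powR_ge0.
  (* Finiteness is what allows a power of $X$ to be cancelled in [XX]. *)
  have Xoo : X < +oo.
    apply: (@le_lt_trans _ _ (\int[mu]_x ((N%:R `^ p)%:E * (\1_(A N) x)%:E))).
      apply: le_integralT => //.
      - nonneg.
      - by apply: mfun_poweR; exact/mEFinP.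
      - apply/mEFinP; apply: mfunM => //.
        by apply: mindic; have [] := Aoo N.
      move=> x /=; rewrite /hN indicE; case: (_ \in _); last first.
        by rewrite !mulr0 powR0 ?gt_eqF// mule0.
      rewrite mulr1 mule1 lee_fin; apply: le_powR; first exact: ltW.
        by apply: fine_ge0; rewrite le_min h0 lee_fin ler0n.
      by rewrite -lee_fin fineK// ge_min lexx orbT.
    rewrite integralZlT ?powR_ge0//; last first.
      by apply/mEFinP; apply: mindic; have [] := Aoo N.
    rewrite integral_indic//; last by have [] := Aoo N.
    by rewrite setIT lte_mul_pinfty// ?lee_fin ?powR_ge0//; have [] := Aoo N.
  rewrite -/X; have := XX; have := X0; move: Xoo.
  case: X {XX X0 hX} => // x _; rewrite lee_fin le_eqVlt => /predU1P[<- _|x0].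
    by rewrite poweR_EFin lee_fin powR_ge0.
  rewrite !poweR_EFin -EFinM !lee_fin => xC.
  have xp : (x = (x `^ p^-1) `^ p)%R by rewrite -powRrM mulVf ?gt_eqF// powRr1// ltW.
  rewrite {1}xp; apply: le_powR; rewrite ?powR_ge0 ?(ltW p0)//.
  have -> : (p^-1 = 1 - q^-1)%R by rewrite -pq addrK.
  rewrite powRD; last by apply/implyP => _; rewrite gt_eqF.
  by rewrite powRr1 ?(ltW x0)// powRN ler_pdivrMr ?powR_gt0.
apply/Lnorm_le => //.
apply: (@fatou_le _ (fun N x => (hN N x)%:E `^ p)) main => //.
- by move=> N; apply: mfun_poweR; exact/mEFinP.
- nonneg.
- exact: mfun_poweR.
- nonneg.
apply: aeW => x.
have [i _ Ai] : (\bigcup_i A i) x by rewrite -AT.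
have Ain n : (i <= n)%N -> \1_(A n) x = 1%R :> R.
  by move=> /ndA/subsetPset iA; rewrite indicE mem_set//; exact: iA.
have [hx|hx] := eqVneq (h x) +oo.
  rewrite hx /= gt_eqF//; apply/cvgeyPge => K.
  near=> n; rewrite /hN Ain; last by near: n; exists i.
  rewrite hx min_r ?leey//= mulr1 lee_fin.
  apply: (@le_trans _ _ n%:R).
    by near: n; exact: nbhs_infty_ger.
  rewrite -{1}[n%:R]powRr1//; apply: ler_powR; last exact: ltW.
  by rewrite ler1n; near: n; exists 1%N.
have hfin : h x \is a fin_num by rewrite ge0_finE// lt_neqAle hx leey.
apply: (cvg_near_cst).
near=> n; rewrite /hN Ain; last by near: n; exists i.
rewrite mulr1 min_l ?fineK// -(fineK hfin) lee_fin.
near: n; exact: nbhs_infty_ger.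
Unshelve. all: by end_near.
Qed.

End LpDuality.

Ltac meas :=
  try assumption;
  lazymatch goal with
  | |- measurable_fun _ (fun _ => EFin _) => apply/mEFinP; meas
  | |- measurable_fun _ (fun _ => mule _ _) => apply: emfunM; meas
  | |- measurable_fun _ (fun _ => poweR _ _) => apply: mfun_poweR; meas
  | |- measurable_fun _ (fun _ => powR _ _) => apply: mfun_powR; meas
  | |- measurable_fun _ (fun _ => GRing.mul _ _) => apply: mfunM; meas
  | |- measurable_fun _ (fun _ => GRing.add _ _) => first [apply: mfunD | apply: mfunB]; meas
  | |- measurable_fun _ (fun _ => GRing.exp _ _) => apply: mfunX; meas
  | |- measurable_fun _ (fun _ => cabs _) => apply: cmeas_cabs; meas
  | |- measurable_fun _ (EFin \o _) => apply/mEFinP; meas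
  | |- _ => first [assumption | exact: mcst | exact: mindic | exact: mfst | exact: msnd]
  end.

(** * Symmetries and explicit integrals on the line *)

Section RealIntegrals.
Context (R : realType).
Local Notation leb := (@lebesgue_measure R).
Local Open Scope ereal_scope.

Lemma lebesgue_shift (a : R) (A : set R) : measurable A ->
  pushforward leb ((fun x : R => x + a)%R : mtypeR R -> mtypeR R) A = leb A.
Proof.
have ma : mfunT ((fun x : R => x + a)%R : mtypeR R -> mtypeR R).
  by apply: mfunD.
move=> mA; apply/esym.
pose m := pushforward leb ((fun x : R => x + a)%R : mtypeR R -> mtypeR R).
apply: (@lebesgue_measure_unique R m) => // _ [[u v]] _ <-.
rewrite /m /= /pushforward [X in _ = leb X](_ : _ = `](u - a)%R, (v - a)%R]%classic); last first.
  by apply/seteqP; split => x /=; rewrite !in_itv /= ltrBlDr lerBrDr.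
rewrite !lebesgue_measure_itv /= !lte_fin ltrD2r; case: ifPn => // _.
by rewrite -!EFinB; congr EFin; rewrite opprB addrA subrK.
Qed.

Lemma integral_lebesgue_shift (a : R) (f : R -> \bar R) : mfunT f ->
  (forall x, 0 <= f x) -> \int[leb]_x f (x + a)%R = \int[leb]_x f x.
Proof.
move=> mf f0.
have ma : mfunT ((fun x : R => x + a)%R : mtypeR R -> mtypeR R).
  by apply: mfunD.
transitivity (\int[pushforward leb ((fun x : R => x + a)%R : mtypeR R -> mtypeR R)]_x f x).
  by rewrite ge0_integral_pushforward//= => x _.
apply: eq_measure_integral => A mA _; exact: lebesgue_shift.
Qed.

Lemma integral_lebesgue_opp (f : R -> \bar R) : mfunT f ->
  (forall x, 0 <= f x) -> \int[leb]_x f (- x)%R = \int[leb]_x f x.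
Proof.
move=> mf f0.
transitivity (\int[pushforward leb (-%R : mtypeR R -> mtypeR R)]_x f x).
  by rewrite ge0_integral_pushforward//= => x _.
apply: eq_measure_integral => A mA _; exact: lebesgue_measureN.
Qed.

Lemma integral_normr (phi : R -> \bar R) : mfunT phi -> (forall x, 0 <= phi x) ->
  \int[leb]_x phi `|x|%R = \int[leb]_(x in `]0%R, +oo[) phi x + \int[leb]_(x in `]0%R, +oo[) phi x.
Proof.
move=> mphi phi0.
have mp : mfunT (fun x : R => phi `|x|%R) by apply: mcompT.
rewrite -(setvU [set x : R | 0 < x]%R) ge0_integral_setU//=; last 4 first.
- by apply: measurableC; rewrite -set_itvoy.
- by rewrite -set_itvoy.
- exact: mfunTS.
- by apply/disj_setPLR; exact: subset_refl.
congr (_ + _); last first.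
  rewrite set_itvoy; apply: eq_int => x; rewrite inE /= => x0.
  by rewrite gtr0_norm.
have -> : ~` [set x : R | 0 < x]%R = `]-oo, 0%R]%classic.
  by apply/seteqP; split => x /=; rewrite in_itv /= leNgt => /negP.
rewrite -(@integral_itv_bndo_bndc _ _ 0%R); last first.
  exact: mfunTS.
rewrite [RHS]integral_mkcond -integral_lebesgue_opp; last 2 first.
- by apply/(measurable_restrictT _ _).1 => //; exact: mfunTS.
- by move=> x; rewrite /patch; case: ifP.
rewrite integral_mkcond; apply: eq_int => x _; rewrite /patch.
rewrite !mem_setE !in_itv /= andbT oppr_gt0; case: ifPn => // x0.
by rewrite ltr0_norm.
Qed.

(** For $s<1$ the integrand is singular at 0, so the fundamental theorem of calculus is applied on
    $[a/(n+2),a]$ and these intervals exhaust the domain. The index $n+2$ keeps the left end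
    strictly below $a$. *)
Lemma integral_powR (s a : R) : (0 < s)%R -> (0 <= a)%R ->
  \int[leb]_(l in `]0%R, a]) (s * l `^ (s - 1))%:E = (a `^ s)%:E.
Proof.
move=> s0; rewrite le_eqVlt => /predU1P[<-|a0].
  by rewrite set_itvoc0 integral_set0 powR0// gt_eqF.
pose F n := `[(a / n.+2%:R)%R, a]%classic : set R.
have an0 n : (0 < a / n.+2%:R)%R by rewrite divr_gt0.
have ana n : (a / n.+2%:R < a)%R by rewrite ltr_pdivrMr// ltr_pMr// ltr1n.
have FU : \bigcup_n F n = `]0%R, a]%classic.
  apply/seteqP; split => [x [n _]|x]; rewrite /F /= !in_itv /= => /andP[h1 h2].
    by rewrite h2 (lt_le_trans _ h1).
  have [n xn] : exists n, (a / x < n%:R)%R.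
    by exists (Num.truncn (a / x)).+1; exact: truncnS_gt.
  exists n => //; rewrite /F /= in_itv /= h2 andbT ler_pdivrMr//.
  rewrite -ler_pdivrMl// mulrC (le_trans (ltW xn))// ler_nat.
  by rewrite -addn2 leq_addr.
have mf : mfunT (fun l : R => (s * l `^ (s - 1))%:E).
  by apply/mEFinP; apply: mfunM => //; exact: measurable_powR.
have := @ge0_nondecreasing_set_cvg_integral _ (mtypeR R) R F (fun l => (s * l `^ (s - 1))%:E) leb.
rewrite FU => h; apply: (cvg_unique _ (h _ _ _ _)) => //.
- move=> m n mn; apply/subsetPset => x; rewrite /F /= !in_itv /= => /andP[h1 ->].
  rewrite andbT; apply: le_trans h1; rewrite ler_pM2l// lef_pV2 ?posrE// ler_nat.
  by rewrite !ltnS.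
- by move=> n; exact: measurable_itv.
- by move=> n; exact: mfunTS.
- by move=> n x _; rewrite lee_fin mulr_ge0 ?powR_ge0// ltW.
have eqF n : \int[leb]_(x in F n) (s * x `^ (s - 1))%:E = (a `^ s - (a / n.+2%:R) `^ s)%:E.
  have df (x : R) : (0 < x)%R -> is_derive x 1%R (fun x => x `^ s)%R (s * x `^ (s - 1))%R.
    exact: is_derive1_powR.
  have pos x : x \in `[(a / n.+2%:R)%R, a] -> (0 < x)%R.
    by rewrite in_itv /= => /andP[+ _]; exact: lt_le_trans.
  have cf (c x : R) : (0 < x)%R -> {for x, continuous (fun x => x `^ c)%R}.
    move=> x0; apply: differentiable_continuous; apply/derivable1_diffP.
    by have [] := is_derive1_powR c x0.
  rewrite (@continuous_FTC2 _ _ (fun x => x `^ s)%R)//.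
  - apply: continuous_in_subspaceT => x; rewrite inE /= => /pos x0.
    by apply: cvgM; [exact: cvg_cst|exact: cf].
  - split.
    + move=> x xa; have x0 : (0 < x)%R by apply: pos; exact: subset_itv_oo_cc xa.
      by have [] := df _ x0.
    + by apply: cvg_at_right_filter; exact: cf.
    + by apply: cvg_at_left_filter; exact: cf.
  - move=> x xa; have x0 : (0 < x)%R by apply: pos; exact: subset_itv_oo_cc xa.
    by rewrite derive1E; have [_ ->] := df _ x0.
rewrite /= (_ : (fun n => _) = (fun n => (a `^ s - (a / n.+2%:R) `^ s)%:E)); last first.
  exact/funext.
apply: cvg_EFin; first by apply: nearW.
rewrite -[X in _ --> X]subr0; apply: cvgB; first exact: cvg_cst.
have /cvg_at_rightP := @powR_cvg0 R s s0; apply; split => //.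
rewrite -[X in _ --> X](mulr0 a); apply: cvgM; first exact: cvg_cst.
have := @cvg_harmonic R; rewrite -(@cvg_shiftS _ (harmonic : R^nat)).
by apply: cvg_trans; apply: near_eq_cvg; apply: nearW => n.
Qed.

Lemma integral_inv_sqr (r : R) : (0 < r)%R ->
  \int[leb]_(x in `[r, +oo[) (x ^- 2)%:E = (r^-1)%:E.
Proof.
move=> r0.
have df (x : R) : (0 < x)%R -> is_derive x 1%R (fun x : R => - x^-1)%R (x ^- 2)%R.
  move=> x0; have xn0 : x != 0%R by rewrite gt_eqF.
  have h := is_deriveV (f := id) xn0 (is_derive_id x 1%R).
  by apply: is_derive_eq; rewrite /GRing.scale /= mulr1 opprK.
have ci (x : R) : (0 < x)%R -> {for x, continuous (fun x : R => x ^- 2)%R}.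
  move=> x0; apply: cvgV; first by rewrite expf_neq0// gt_eqF.
  exact: exprn_continuous.
rewrite (@ge0_continuous_FTC2y _ _ (fun x : R => - x^-1)%R r 0%R).
- by rewrite sub0e -EFinN opprK.
- by move=> x _; rewrite invr_ge0 sqr_ge0.
- apply: continuous_in_subspaceT => x; rewrite inE /= in_itv /= andbT => rx.
  by apply: ci; exact: lt_le_trans rx.
- rewrite -oppr0; apply: cvgN.
  exact: (proj2 (@gtr0_cvgV0 R R (pinfty_nbhs R) _ id (nbhs_pinfty_gt (num_real 0%R))) cvg_id).
- by move=> x rx; have [] := df x (lt_trans r0 rx).
- apply: cvg_at_right_filter.
  suff : {for r, continuous (fun x : R => - x^-1)%R} by [].
  apply: differentiable_continuous; apply/derivable1_diffP.
  by have [] := df r r0.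
- move=> x; rewrite in_itv /= andbT => rx; rewrite derive1E.
  by have [_ ->] := df x (lt_trans r0 rx).
Qed.

End RealIntegrals.

(** * Weak-type interpolation and the Hardy-Littlewood-Sobolev inequality *)

Section LayerCake.
Context d (X : measurableType d) (R : realType) (mu : sfmeasure X R).
Local Notation leb := (@lebesgue_measure R).
Local Open Scope ereal_scope.

(** Tonelli on the region below the graph of [b]. The weight [w] and the level function [b] are kept
    apart because interpolation uses the formula twice: with $w=1$ for the output of the operator,
    and with a weight and a threshold both built from $f$ for its input. *)
Lemma layer_cake (w : X -> \bar R) (b : X -> R) (s : R) : (0 < s)%R ->
  mfunT w -> (forall x, 0 <= w x) ->
  mfunT b -> (forall x, 0 <= b x)%R ->
  \int[leb]_(l in `]0%R, +oo[) ((s * l `^ (s - 1))%:E *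
     \int[mu]_x (if (l < b x)%R then w x else 0)) =
  \int[mu]_x (w x * (b x `^ s)%:E).
Proof.
move=> s0 mw w0 mb b0.
pose c (l : R) : R := (s * l `^ (s - 1))%R.
have c0 l : (0 <= c l)%R by rewrite mulr_ge0 ?powR_ge0// ltW.
have mc : mfunT c by apply: mfunM => //; exact: measurable_powR.
pose G (z : mtypeR R * X) : \bar R :=
  (c z.1 * \1_(`]0%R, +oo[%classic : set R) z.1)%:E * (if (z.1 < b z.2)%R then w z.2 else 0).
have W0 (l : R) x : 0 <= if (l < b x)%R then w x else 0 by case: ifP.
have mG : mfunT G.
  apply: emfunM.
    apply/mEFinP; apply: mfunM.
      by apply: mcompT mc _.
    have mi : mfunT (\1_(`]0%R, +oo[%classic : set (mtypeR R)) : _ -> R).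
      meas.
    exact: (mcompT mi mfst).
  apply: mfun_ifT.
  - by apply: mfun_ltr => //; exact: mcompT mb _.
  - exact: mcompT mw _.
  - meas.
have G0 z : 0 <= G z by rewrite mule_ge0// lee_fin mulr_ge0.
have mW (l : R) : mfunT (fun x => if (l < b x)%R then w x else 0).
  apply: mfun_ifT => //; exact: mfun_ltr.
transitivity (\int[leb]_l \int[mu]_x G (l, x)).
  rewrite integral_mkcond; apply: eq_int => l _; rewrite /patch /G /=.
  rewrite indicE; case: ifP => _; last first.
    by rewrite mulr0; under eq_int do rewrite mul0e; rewrite integral0.
  by rewrite mulr1 integralZlT.
rewrite fubini_tonelli//; apply: eq_int => x _; rewrite /G /=.
transitivity (\int[leb]_(l in `]0%R, b x[) (w x * (c l)%:E)).
  rewrite [RHS]integral_mkcond; apply: eq_int => l _; rewrite /patch.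
  rewrite indicE !mem_setE !in_itv /= andbT; case: (0 < l)%R => /=; last by rewrite mulr0 mul0e.
  by rewrite mulr1; case: ifP => _; rewrite ?mule0// muleC.
rewrite ge0_integralZl//; last 2 first.
- by apply/mEFinP; exact: mfunTS.
- by move=> l _; rewrite lee_fin.
congr (_ * _); rewrite -integral_powR//; apply: integral_itv_bndo_bndc.
by apply/mEFinP; exact: mfunTS.
Qed.

End LayerCake.

Section Marcinkiewicz.
Context d1 d2 (X : measurableType d1) (Y : measurableType d2) (R : realType)
  (mu : sfmeasure X R) (nu : sfmeasure Y R).
Local Notation leb := (@lebesgue_measure R).
Local Open Scope ereal_scope.

Definition restr (E : set X) (f : X -> R[i]) (x : X) : R[i] := (((\1_E x : R)%:C)%C * f x)%R.

Lemma cabs_restr E f x : cabs (restr E f x) = (\1_E x * cabs (f x))%R.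
Proof. by rewrite cabsM cabs_real ger0_norm. Qed.

Lemma cintg_restr E f : measurable E -> cintegrable mu f -> cintegrable mu (restr E f).
Proof.
move=> mE If; have [mf _] := If.
apply: (cintg_le _ (cintg_cabs If)); first exact: cmeas_indic.
by move=> x; rewrite cabs_restr indicE; case: (_ \in _); rewrite ?mul1r ?mul0r ?cabs_ge0.
Qed.

(** Real interpolation between $L^1\to L^\infty$ and $L^2\to L^2$. At height $l$ the function is cut
    where $|f|^{r'-1}=2AN/l$: the large part has $L^1$ norm at most $l/(2A)$ and contributes at most
    $l/2$ pointwise, while the small part is handled by Chebyshev in $L^2$. Integrating the
    distribution bound in $l$ returns $\int|f|^2b^{r-2}$, a multiple of $\int|f|^{r'}$. *)
Theorem marcinkiewicz (S : (X -> R[i]) -> Y -> R) (A r r' N : R) (f : X -> R[i]) :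
  (2 < r)%R -> (r^-1 + r'^-1 = 1)%R -> (0 < A)%R -> (0 < N)%R ->
  (forall f, cintegrable mu f -> mfunT (S f)) ->
  (forall f y, 0 <= S f y)%R ->
  (forall f, cintegrable mu f -> forall y, (S f y)%:E <= A%:E * \int[mu]_x (cabs (f x))%:E) ->
  (forall f, cintegrable mu f ->
     \int[nu]_y (S f y ^+ 2)%:E <= \int[mu]_x (cabs (f x) ^+ 2)%:E) ->
  (forall f E, cintegrable mu f -> measurable E ->
     forall y, S f y <= S (restr E f) y + S (restr (~` E) f) y)%R ->
  cintegrable mu f -> \int[mu]_x (cabs (f x) `^ r')%:E <= N%:E ->
  \int[nu]_y (S f y `^ r)%:E <= (4 * r / (r - 2) * (2 * A * N) `^ (r - 2) * N)%:E.
Proof.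
move=> r2 rr' A0 N0 mS S0 S1 S2 Sadd If fN.
have r1 : (1 < r)%R by apply: lt_trans r2; rewrite ltr1n.
have [r'1 _ rr1] := conj_exp_gt1 r1 rr'.
have [mf _] := If; have mcf := cmeas_cabs mf.
have c0 x : (0 <= cabs (f x))%R by exact: cabs_ge0.
have AN0 : (0 < 2 * A * N)%R by rewrite !mulr_gt0.
(* Since $1-r'<0$, the condition $l<b(x)$ selects the small values of $f$. Where $f=0$ the
   convention for powers of 0 gives $b=0$, so such points fall on the other side, where they
   contribute nothing. *)
pose b x := (2 * A * N * cabs (f x) `^ (1 - r'))%R.
have mb : mfunT b by apply: mfunM => //; exact: mfun_powR.
have b0 x : (0 <= b x)%R by rewrite mulr_ge0 ?powR_ge0// ltW.
pose w x := (cabs (f x) ^+ 2)%:E.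
have mw : mfunT w by apply/mEFinP; exact: mfunX.
have w0 x : 0 <= w x by rewrite lee_fin sqr_ge0.
have step (l : R) : (0 < l)%R -> \int[nu]_y (if (l < S f y)%R then 1 else 0) <=
    (4 / l ^+ 2)%:E * \int[mu]_x (if (l < b x)%R then w x else 0).
  move=> l0; pose E := [set x | l < b x]%R.
  have mE : measurable E.
    rewrite /E -[X in measurable X]setTI.
    exact: (mfun_ltr (mcst l) mb).
  have If2 := cintg_restr mE If.
  have If1 := cintg_restr (measurableC mE) If.
  have f1 y : (S (restr (~` E) f) y <= l / 2)%R.
    rewrite -lee_fin; apply: le_trans (S1 _ If1 y) _.
    have -> : (l / 2)%R = (A * (l / (2 * A * N) * N))%R.
      by field; rewrite !gt_eqF.
    rewrite [leRHS]EFinM; apply: lee_wpmul2l; first by rewrite lee_fin ltW.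
    apply: (@le_trans _ _ (\int[mu]_x ((l / (2 * A * N))%:E * (cabs (f x) `^ r')%:E))).
      apply: le_integralT.
      - nonneg.
      - by apply/mEFinP/cmeas_cabs; have [] := If1.
      - meas.
      move=> x; rewrite -EFinM lee_fin cabs_restr indicE.
      have h0 : (0 <= l / (2 * A * N) * cabs (f x) `^ r')%R.
        by rewrite mulr_ge0 ?powR_ge0// divr_ge0// ltW.
      have [xE|xE] := boolP (x \in ~` E); last by rewrite mul0r.
      rewrite mul1r; have [->|fx0] := eqVneq (cabs (f x)) 0%R.
        by rewrite powR0 ?mulr0// gt_eqF// (lt_trans _ r'1).
      have fx : (0 < cabs (f x))%R by rewrite lt_neqAle eq_sym fx0 c0.
      have bl : (b x <= l)%R by move: xE; rewrite inE /E /= => /negP; rewrite -leNgt.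
      have {1}-> : cabs (f x) = (cabs (f x) `^ (1 - r') * cabs (f x) `^ r')%R.
        by rewrite -powRD ?fx0 ?implybT// subrK powRr1// ltW.
      apply: ler_wpM2r; first exact: powR_ge0.
      by rewrite ler_pdivlMr// mulrC.
    rewrite integralZlT//; last 3 first.
    - nonneg.
    - meas.
    - by rewrite divr_ge0// ltW.
    by rewrite [leRHS]EFinM; apply: lee_wpmul2l => //; rewrite lee_fin divr_ge0// ltW.
  have mS2 : mfunT (fun y => (S (restr E f) y ^+ 2)%:E).
    by apply/mEFinP/mfunX/mS.
  (* Chebyshev: where $Sf>l$ the image of the small part exceeds $l/2$, so four times its square
     over $l^2$ is at least 1. *)
  apply: (@le_trans _ _ ((4 / l ^+ 2)%:E * \int[nu]_y (S (restr E f) y ^+ 2)%:E)).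
    rewrite -integralZlT//; last 2 first.
    - nonneg.
    - by rewrite divr_ge0// ltW// exprn_gt0.
    apply: le_integralT.
    - by move=> y; case: ifP.
    - by apply: mfun_ifT => //; apply: mfun_ltr => //; exact: mS.
    - meas.
    move=> y; case: ifPn => [lS|_]; last first.
      by rewrite lee_fin mulr_ge0 ?sqr_ge0// divr_ge0// ltW// exprn_gt0.
    rewrite -EFinM lee_fin mulrAC ler_pdivlMr ?exprn_gt0// mul1r.
    have : (l < S (restr E f) y + l / 2)%R.
      by apply: lt_le_trans lS _; rewrite (le_trans (Sadd f E If mE y))// lerD2l.
    move: l0; clear; set s := S _ _; move=> l0 ls.
    have s0 : (l / 2 < s)%R by lra.
    nra.
  apply: lee_wpmul2l; first by rewrite lee_fin divr_ge0// ltW// exprn_gt0.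
  apply: le_trans (S2 _ If2) _; apply: le_of_eq.
  apply: eq_int => x _; rewrite cabs_restr indicE.
  case: ifPn => h; first by rewrite mem_set ?mul1r.
  by rewrite memNset ?mul0r ?expr0n// /E /=; exact/negP.
rewrite (_ : \int[nu]_y (S f y `^ r)%:E = \int[nu]_y (1 * (S f y `^ r)%:E)); last first.
  by apply: eq_int => y _; rewrite mul1e.
rewrite -layer_cake//; last 2 first.
- by rewrite (lt_trans _ r1).
- exact: mS.
have mW : mfunT (fun l : R => \int[mu]_x (if (l < b x)%R then w x else 0)).
  pose G (z : mtypeR R * X) : \bar R := if (z.1 < b z.2)%R then w z.2 else 0.
  apply: (@mfubiniF _ _ (mtypeR R) X R mu G).
    apply: mfun_ifT => //.
      by apply: mfun_ltr => //; exact: mcompT mb _.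
    exact: mcompT mw _.
  by move=> z; rewrite /G; case: ifP.
have mW' : mfunT (fun l : R => \int[nu]_y (if (l < S f y)%R then 1 else 0 : \bar R)).
  pose G (z : mtypeR R * Y) : \bar R := if (z.1 < S f z.2)%R then 1 else 0.
  apply: (@mfubiniF _ _ (mtypeR R) Y R nu G).
    apply: mfun_ifT => //.
    by apply: mfun_ltr => //; exact: (mcompT (mS _ If) msnd).
  by move=> z; rewrite /G; case: ifP.
have mpow (k : R) : mfunT (fun l : R => (k * l `^ (k - 1))%:E).
  by apply/mEFinP; apply: mfunM => //; exact: measurable_powR.
have r20 : (0 < r - 2)%R by rewrite subr_gt0.
apply: (@le_trans _ _ ((4 * r / (r - 2))%:E *
   \int[leb]_(l in `]0%R, +oo[) (((r - 2) * l `^ (r - 2 - 1))%:E *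
     \int[mu]_x (if (l < b x)%R then w x else 0)))).
  rewrite -ge0_integralZl//; last 3 first.
  - exact: (mfunTS (emfunM (mpow _) mW)).
  - move=> l _; rewrite mule_ge0//.
      by rewrite lee_fin mulr_ge0 ?powR_ge0// ltW.
    by apply: int_ge0 => x _; case: ifP.
  - by rewrite lee_fin divr_ge0 ?mulr_ge0 ?ltW// (lt_trans _ r1).
  apply: ge0_le_integral => //.
  - move=> l _; rewrite mule_ge0//.
      by rewrite lee_fin mulr_ge0 ?powR_ge0// ltW// (lt_trans _ r1).
    by apply: int_ge0 => y _; case: ifP.
  - exact: (mfunTS (emfunM (mpow _) mW')).
  - exact: (mfunTS (emfunM (mcst _) (emfunM (mpow _) mW))).
  move=> l /=; rewrite in_itv /= andbT => l0.
  have rl0 : (0 <= r * l `^ (r - 1))%R.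
    by rewrite mulr_ge0 ?powR_ge0// ltW// (lt_trans _ r1).
  apply: (@le_trans _ _ ((r * l `^ (r - 1))%:E * ((4 / l ^+ 2)%:E *
      \int[mu]_x (if (l < b x)%R then w x else 0)))).
    by apply: lee_wpmul2l; [rewrite lee_fin|exact: step].
  rewrite !muleA -!EFinM le_eqVlt; apply/orP; left; apply/eqP; congr (_%:E * _).
  have -> : (r - 1 = (r - 2 - 1) + 2%:R)%R by ring.
  rewrite powRD; last by rewrite (gt_eqF l0) /= implybT.
  rewrite powR_mulrn ?ltW//; field.
  by rewrite !gt_eqF.
rewrite layer_cake//.
rewrite -[in leRHS]mulrA [in leRHS]EFinM; apply: lee_wpmul2l.
  by rewrite lee_fin mulr_ge0// ?invr_ge0 ?mulr_ge0 ?(ltW r20)// ltW// (lt_trans _ r1).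
rewrite EFinM; apply: (@le_trans _ _ (\int[mu]_x (((2 * A * N) `^ (r - 2))%:E * (cabs (f x) `^ r')%:E))).
  apply: le_integralT.
  - nonneg.
  - meas.
  - meas.
  move=> x; rewrite /w -!EFinM lee_fin.
  have [fx0|fx0] := eqVneq (cabs (f x)) 0%R.
    by rewrite fx0 expr0n mul0r mulr_ge0 ?powR_ge0.
  rewrite /b powRM ?powR_ge0 ?(ltW AN0)// mulrCA; apply: ler_wpM2l; first exact: powR_ge0.
  rewrite -powRrM -powR_mulrn// -powRD ?fx0 ?implybT//.
  (* The exponents close up because $(r'-1)r=r'$. *)
  rewrite (_ : 2%:R + (1 - r') * (r - 2) = r')%R//.
  by have := rr1; lra.
rewrite integralZlT ?powR_ge0//.
- by apply: lee_wpmul2l => //; rewrite lee_fin powR_ge0.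
- nonneg.
- meas.
Qed.

End Marcinkiewicz.

(** * Hoelder and Minkowski inequalities with infinite values *)

Section HoelderMinkowski.
Context d (X : measurableType d) (R : realType).
Local Open Scope ereal_scope.

(** Real-valued truncations, through which statements about real functions reach functions that take
    the value +oo. *)
Definition etrunc (h : X -> \bar R) (n : nat) (x : X) : R := fine (mine (h x) n%:R%:E).

Lemma etruncE h n x : 0 <= h x -> (etrunc h n x)%:E = mine (h x) n%:R%:E.
Proof.
move=> h0; rewrite /etrunc fineK// ge0_finE; first by rewrite gt_min ltry orbT.
by rewrite le_min h0 lee_fin ler0n.
Qed.

Lemma meas_etrunc h n : mfunT h -> mfunT (etrunc h n).
Proof.
by move=> mh; apply: mcompT => //; exact: measurable_mine.
Qed.

Lemma etrunc_ge0 h n x : 0 <= h x -> (0 <= etrunc h n x)%R.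
Proof. by move=> h0; rewrite -lee_fin etruncE// le_min h0 lee_fin ler0n. Qed.

Lemma etrunc_le h n x : 0 <= h x -> (etrunc h n x)%:E <= h x.
Proof. by move=> h0; rewrite etruncE// ge_min lexx. Qed.

Lemma cvg_etrunc h x : 0 <= h x -> (fun n => (etrunc h n x)%:E) @ \oo --> h x.
Proof.
move=> h0; have [hx|hx] := eqVneq (h x) +oo.
  rewrite hx; apply/cvgeyPge => K; near=> n; rewrite etruncE// hx min_r ?leey// lee_fin.
  by near: n; exact: nbhs_infty_ger.
have hfin : h x \is a fin_num by rewrite ge0_finE// lt_neqAle hx leey.
apply: cvg_near_cst; near=> n; rewrite etruncE// min_l// -(fineK hfin) lee_fin.
by near: n; exact: nbhs_infty_ger.
Unshelve. all: by end_near.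
Qed.

Lemma etrunc_finE (h : X -> \bar R) n x : 0 <= h x -> (h x <= n%:R%:E) -> (etrunc h n x)%:E = h x.
Proof. by move=> h0 hn; rewrite etruncE// min_l. Qed.

Lemma le_Lnorm (mu : {measure set X -> \bar R}) (p : R) (f g : X -> \bar R) : (0 < p)%R ->
  mfunT f -> mfunT g ->
  (forall x, 0 <= f x) -> (forall x, f x <= g x) ->
  'N[mu]_p%:E[f] <= 'N[mu]_p%:E[g].
Proof.
move=> p0 mf mg f0 fg; have g0 x : 0 <= g x by exact: le_trans (fg x).
rewrite !Lnorm_ge0E//; apply: lee_poweR.
- by rewrite invr_ge0 ltW.
- by apply: int_ge0 => x _; exact: poweR_ge0.
apply: le_integralT => [x|||x]; first exact: poweR_ge0.
- meas.
- meas.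
- by apply: lee_poweR => //; exact: ltW.
Qed.

(** Extended values are reached from the truncations [etrunc] by Fatou, so that the inequality also
    covers functions equal to +oo on large sets, such as potentials not yet known to be finite. *)
Lemma ge0_hoelder (mu : {measure set X -> \bar R}) (p q : R) (f g : X -> \bar R) :
  (1 < p)%R -> (p^-1 + q^-1 = 1)%R ->
  mfunT f -> mfunT g ->
  (forall x, 0 <= f x) -> (forall x, 0 <= g x) ->
  \int[mu]_x (f x * g x) <= 'N[mu]_p%:E[f] * 'N[mu]_q%:E[g].
Proof.
move=> p1 pq mf mg f0 g0; have [q1 _ _] := conj_exp_gt1 p1 pq.
have p0 : (0 < p)%R by exact: lt_trans p1.
have q0 : (0 < q)%R by exact: lt_trans q1.
apply: (@fatou_le _ _ _ mu (fun n x => (etrunc f n x)%:E * (etrunc g n x)%:E)).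
- by move=> n; apply: emfunM; apply/mEFinP; exact: meas_etrunc.
- by move=> n x; rewrite mule_ge0// lee_fin etrunc_ge0.
- meas.
- by move=> x; rewrite mule_ge0.
- apply: aeW => x.
  (* Multiplication is continuous at the limit except for $0\cdot\infty$, so zeros of either factor
     are treated first; there the truncated products vanish. *)
  have [fx0|fx0] := eqVneq (f x) 0.
    rewrite fx0 mul0e; apply: cvg_near_cst; apply: nearW => n.
    by rewrite etruncE// fx0 min_l ?lee_fin// mul0e.
  have [gx0|gx0] := eqVneq (g x) 0.
    rewrite gx0 mule0; apply: cvg_near_cst; apply: nearW => n.
    by rewrite (etruncE n (g0 x)) gx0 min_l ?lee_fin// mule0.
  apply: cvgeM; [|exact: cvg_etrunc|exact: cvg_etrunc].
  by apply: neq0_mule_def; rewrite mule_eq0 negb_or fx0.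
move=> n.
have := @hoelder _ _ R mu (etrunc f n) (etrunc g n) p q
  (meas_etrunc _ mf) (meas_etrunc _ mg) p0 q0 pq.
rewrite Lnorm1 (_ : \int[mu]_x `|_| = \int[mu]_x ((etrunc f n x)%:E * (etrunc g n x)%:E)); last first.
  by apply: eq_int => x _; rewrite gee0_abs//= lee_fin mulr_ge0// etrunc_ge0.
move=> /le_trans; apply; apply: lee_pmul; try exact: Lnorm_ge0.
  apply: le_Lnorm => //; first by apply/mEFinP; exact: meas_etrunc.
    by move=> x; rewrite lee_fin etrunc_ge0.
  by move=> x; exact: etrunc_le.
apply: le_Lnorm => //; first by apply/mEFinP; exact: meas_etrunc.
  by move=> x; rewrite lee_fin etrunc_ge0.
by move=> x; exact: etrunc_le.
Qed.

End HoelderMinkowski.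

Section Minkowski.
Context d1 d2 (S : measurableType d1) (X : measurableType d2) (R : realType)
  (nu : sfmeasure S R) (mu : sfmeasure X R).
Local Open Scope ereal_scope.

Lemma meas_slice (G : S * X -> \bar R) : mfunT G ->
  forall s, mfunT (fun x => G (s, x)).
Proof.
by move=> mG s; apply: mcompT mG _; exact: mpair1.
Qed.

Lemma mLnorm_slice (p : R) (G : S * X -> \bar R) : mfunT G ->
  (forall z, 0 <= G z) -> mfunT (fun s => 'N[mu]_p%:E[(fun x => G (s, x))]).
Proof.
move=> mG G0.
under eq_fun do rewrite Lnorm_ge0E//.
apply: mfun_poweR.
apply: (@mfubiniF _ _ S X R mu (fun z => G z `^ p)).
  meas.
nonneg.
Qed.

(** By duality: pairing with [g], Tonelli, and Hoelder in each slice bound the pairing by the right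
    side times the norm of [g]. An infinite right side is set aside first, since [Lnorm_dual] takes
    a real constant. *)
Lemma minkowski_integral (p : R) (G : S * X -> \bar R) : (1 < p)%R ->
  mfunT G -> (forall z, 0 <= G z) ->
  'N[mu]_p%:E[(fun x => \int[nu]_s G (s, x))] <= \int[nu]_s 'N[mu]_p%:E[(fun x => G (s, x))].
Proof.
move=> p1 mG G0.
have mN := mLnorm_slice p mG G0.
set C := \int[nu]_s _.
have C0 : 0 <= C by apply: int_ge0 => s _; exact: Lnorm_ge0.
have [->|Coo] := eqVneq C +oo; first by rewrite leey.
have Cfin : C \is a fin_num by rewrite ge0_finE// lt_neqAle Coo leey.
pose q := (p / (p - 1))%R.
have p10 : (p - 1 != 0)%R by rewrite subr_eq0 gt_eqF.
have p0 : (p != 0)%R by rewrite gt_eqF// (lt_trans _ p1).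
have pq : (p^-1 + q^-1 = 1)%R by rewrite /q; field; rewrite p0 p10.
have mH : mfunT (fun x => \int[nu]_s G (s, x)).
  exact: (@mfubiniG _ _ S X R nu G).
rewrite -(fineK Cfin); apply: (@Lnorm_dual _ _ _ mu p q) => //.
- by move=> x; exact: int_ge0.
- exact: fine_ge0.
move=> g mg g0 _ _; rewrite fineK//.
have mGg : mfunT (fun z : S * X => G z * (g z.2)%:E).
  apply: emfunM => //; apply/mEFinP.
  exact: (mcompT mg msnd).
rewrite (_ : \int[mu]_x _ = \int[mu]_x \int[nu]_s (G (s, x) * (g x)%:E)); last first.
  apply: eq_int => x _; rewrite -ge0_integralZr//; last by rewrite lee_fin.
  by apply: mcompT mG _; exact: mpair2.
rewrite -(@fubini_tonelli _ _ _ _ _ nu mu (fun z => G z * (g z.2)%:E))//; last first.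
  by move=> z; rewrite mule_ge0// lee_fin.
rewrite /C -ge0_integralZr//; [|nonneg|exact: Lnorm_ge0].
apply: le_integralT.
- by move=> s; apply: int_ge0 => x _; rewrite mule_ge0// lee_fin.
- apply: (@mfubiniF _ _ S X R mu (fun z => G z * (g z.2)%:E)) => //.
  by move=> z; rewrite mule_ge0// lee_fin.
- meas.
move=> s; apply: ge0_hoelder => //.
- exact: meas_slice.
- meas.
Qed.

End Minkowski.

(** * Duality for the sum of two Lebesgue spaces *)

Section SumNormDuality.
Context (R : realType).
Local Notation leb := (@lebesgue_measure R).
Local Open Scope ereal_scope.

Lemma powR_le1 (x p : R) : (0 <= p -> 0 <= x -> x <= 1 -> x `^ p <= 1)%R.
Proof. by move=> p0 x0 /(le_powR p0 x0); rewrite powR1. Qed.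

Lemma meas_indicE (A : set R) : measurable A ->
  mfunT (fun t : R => (\1_A t)%:E : \bar R).
Proof. by move=> mA; apply/mEFinP; exact: mindic. Qed.

Lemma integral_indicE (A : set R) : measurable A -> \int[leb]_t (\1_A t)%:E = leb A.
Proof. by move=> mA; rewrite integral_indic// setIT. Qed.

Lemma indic_fun_ge0 (T : Type) (A : set T) (t : T) : (0 <= \1_A t :> R)%R.
Proof. by rewrite indicE. Qed.

Lemma Lnorm_scale (p : R) (k : R) (f : R -> \bar R) : (0 < p)%R -> (0 <= k)%R ->
  mfunT f -> (forall x, 0 <= f x) ->
  'N[leb]_p%:E[(fun x => k%:E * f x)] = k%:E * 'N[leb]_p%:E[f].
Proof.
move=> p0 k0 mf f0; rewrite !Lnorm_ge0E//; last by move=> x; rewrite mule_ge0// lee_fin.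
under eq_int do rewrite poweRM ?lee_fin// poweR_EFin.
rewrite integralZlT ?powR_ge0//; last 2 first.
- nonneg.
- meas.
rewrite poweRM ?lee_fin ?powR_ge0//; last by apply: int_ge0 => x _; exact: poweR_ge0.
by rewrite poweR_EFin -powRrM mulfV ?gt_eqF// powRr1.
Qed.

Lemma Lnorm_indic (p : R) (A : set R) : (0 < p)%R -> measurable A ->
  'N[leb]_p%:E[(fun x => (\1_A x)%:E)] = (leb A) `^ p^-1.
Proof.
move=> p0 mA; rewrite Lnorm_ge0E//; congr (_ `^ _).
transitivity (\int[leb]_x (\1_A x)%:E); last by rewrite integral_indic// setIT.
apply: eq_int => x _.
by rewrite poweR_EFin indicE; case: (_ \in _); rewrite ?powR1// powR0// gt_eqF.
Qed.

(** For $x>1$ a power of exponent below 1 is strictly smaller than $x$, so the half-sum of two of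
    them is too. *)
Lemma le1_of_half_powR (x c d : R) : (0 <= x -> c < 1 -> d < 1 ->
  x <= 2^-1 * (x `^ c + x `^ d) -> x <= 1)%R.
Proof.
move=> x0 c1 d1 h; rewrite leNgt; apply/negP => x1.
have H e : (e < 1 -> x `^ e < x)%R.
  move=> e1; have x0' : (0 < x)%R by exact: lt_trans x1.
  rewrite -{2}(powRr1 x0) /powR (gt_eqF x0') ltr_expR mul1r.
  by rewrite gtr_pMl// ln_gt0.
have := H _ c1; have := H _ d1; lra.
Qed.

(** Hoelder with exponent $p/q$ against the indicator of [E]; the measure of [E] being at most 1
    makes the constant 1. *)
Lemma Lnorm_le_of_support (p q : R) (F : R -> R) (E : set R) : (0 < q)%R -> (q < p)%R ->
  measurable E -> leb E <= 1 -> mfunT F -> (forall t, 0 <= F t)%R ->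
  (forall t, ~ E t -> F t = 0%R) ->
  'N[leb]_q%:E[EFin \o F] <= 'N[leb]_p%:E[EFin \o F].
Proof.
move=> q0 qp mE E1 mF F0 FE.
have p0 : (0 < p)%R by exact: lt_trans qp.
pose P := (p / q)%R; pose P' := (P / (P - 1))%R.
have P1 : (1 < P)%R by rewrite /P ltr_pdivlMr// mul1r.
have PP : (P^-1 + P'^-1 = 1)%R.
  rewrite /P'; field; rewrite ?subr_eq0 !gt_eqF//; exact: lt_trans P1.
have F0' t : 0 <= (EFin \o F) t by rewrite lee_fin.
have mFq : mfunT (fun t => ((F t) `^ q)%:E).
  meas.
have := @ge0_hoelder _ _ R leb P P' (fun t => ((F t) `^ q)%:E) (fun t => (\1_E t)%:E) P1 PP mFq.
have mi : mfunT (fun t : R => (\1_E t)%:E : \bar R).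
  exact: meas_indicE.
have [P'1 _ _] := conj_exp_gt1 P1 PP.
have P'0 : (0 < P')%R by exact: lt_trans P'1.
move=> /(_ mi (fun t => powR_ge0 _ _)).
have i0 t : 0 <= (\1_E t)%:E :> \bar R by rewrite lee_fin.
move=> /(_ i0); rewrite Lnorm_indic// => h.
have e1 : \int[leb]_t (((F t) `^ q)%:E * (\1_E t)%:E) = \int[leb]_t ((F t) `^ q)%:E.
  apply: eq_int => t _; rewrite indicE.
  have [tE|tE] := boolP (t \in E); first by rewrite mule1.
  by rewrite FE ?powR0 ?mul0e ?gt_eqF// => Et; move: tE; rewrite mem_set.
move: h; rewrite e1 => h.
rewrite !Lnorm_ge0E//.
have X0 : 0 <= \int[leb]_t ((F t) `^ q)%:E by apply: int_ge0 => t _; rewrite lee_fin powR_ge0.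
apply: (@le_trans _ _ (('N[leb]_P%:E[(fun t => ((F t) `^ q)%:E)]) `^ q^-1)).
  apply: lee_poweR => //; first by rewrite invr_ge0 ltW.
  apply: le_trans h _; rewrite -[leRHS]mule1; apply: lee_wpmul2l; first exact: Lnorm_ge0.
  have P'i : (0 <= P'^-1)%R by rewrite invr_ge0 ltW.
  have := @lee_poweR R (leb E) 1%:E P'^-1 P'i (measure_ge0 _ _) E1.
  by rewrite poweR_EFin powR1.
rewrite Lnorm_ge0E; last nonneg.
rewrite -poweRrM (_ : P^-1 * q^-1 = p^-1)%R; last by rewrite /P; field; rewrite !gt_eqF.
suff -> : \int[leb]_x ((F x `^ q)%:E `^ P) = \int[leb]_x ((EFin \o F) x `^ p) by [].
apply: eq_int => t _; rewrite !poweR_EFin -powRrM /P; congr ((_ `^ _)%:E).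
by rewrite mulrCA mulfV ?mulr1// gt_eqF.
Qed.

(* Normalized: the constant 1/2 makes the threshold g > 1 the right place to cut. *)
Lemma sum_norm_dual_half (a b a' b' : R) (g : R -> \bar R) :
  (1 < a)%R -> (a < b)%R -> (a^-1 + a'^-1 = 1)%R -> (b^-1 + b'^-1 = 1)%R ->
  mfunT g -> (forall t, 0 <= g t) ->
  (forall f : R -> R, mfunT f -> (forall t, 0 <= f t)%R ->
     (exists M, forall t, f t <= M)%R ->
     (exists2 A, measurable A /\ leb A < +oo & forall t, ~ A t -> f t = 0%R) ->
     \int[leb]_t (g t * (f t)%:E) <=
       (2^-1)%:E * ('N[leb]_a'%:E[EFin \o f] + 'N[leb]_b'%:E[EFin \o f])) ->
  'N[leb]_a%:E[(fun t => if 1 < g t then g t else 0)] <= 1 /\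
  'N[leb]_b%:E[(fun t => if 1 < g t then 0 else g t)] <= 1.
Proof.
move=> a1 ab aa' bb' mg g0 H.
have b1 : (1 < b)%R by exact: lt_trans ab.
have a0 : (0 < a)%R by exact: lt_trans a1.
have b0 : (0 < b)%R by exact: lt_trans b1.
have [a'1 _ a'a] := conj_exp_gt1 a1 aa'.
have [b'1 bb'b b'b] := conj_exp_gt1 b1 bb'.
have a'0 : (0 < a')%R by exact: lt_trans a'1.
have b'0 : (0 < b')%R by exact: lt_trans b'1.
have a'i : (a'^-1 < 1)%R by rewrite invf_lt1.
have b'i : (b'^-1 < 1)%R by rewrite invf_lt1.
have b'a' : (b' < a')%R.
  rewrite -ltf_pV2 ?posrE//.
  have : (b^-1 < a^-1)%R by rewrite ltf_pV2.
  by move: aa' bb'; lra.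
(* The part of $g$ above the level 1 goes to the smaller exponent [a], the part below it to [b]. *)
pose E := [set t : R | 1%:E < g t].
have mE : measurable E by rewrite -[E]setTI; exact: emeasurable_fun_o_infty.
rewrite (_ : (fun t => _) = (fun t => g t * (\1_E t)%:E)); last first.
  apply/funext => t; rewrite indicE; case: ifPn => h; first by rewrite mem_set ?mule1.
  by rewrite memNset ?mule0//; exact/negP.
rewrite (_ : (fun t => if _ then 0 else _) = (fun t => g t * (\1_(~` E) t)%:E)); last first.
  apply/funext => t; rewrite indicE; case: ifPn => h; first by rewrite memNset ?mule0//; exact.
  by rewrite mem_set ?mule1//; exact/negP.
pose I (N : nat) := [set` `[- N%:R, N%:R]%R] : set R.
have mI N : measurable (I N) by exact: measurable_itv.
have Ioo N : leb (I N) < +oo.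
  rewrite /I lebesgue_measure_itv /=; case: ifP => _; by rewrite ?ltry// -EFinD ltry.
have cvgI (t : R) : \forall N \near \oo, \1_(I N) t = 1%R :> R.
  near=> N; rewrite indicE mem_set// /I /= in_itv /= -ler_norml.
  by near: N; exact: nbhs_infty_ger.
(* Testing against the indicator of a bounded piece $A$ of [E], where $g>1$, gives
   $|A|\le\frac12(|A|^{1/a'}+|A|^{1/b'})$, which forces $|A|\le1$. The intersection with [I N] makes
   $|A|$ finite beforehand. *)
have E1 : leb E <= 1.
  have -> : leb E = \int[leb]_t (\1_E t)%:E by rewrite integral_indic// setIT.
  apply: (@fatou_le _ _ _ leb (fun N t => (\1_(E `&` I N) t)%:E)).
  - by move=> N; apply: meas_indicE; exact: (measurableI _ _ mE (mI N)).
  - nonneg.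
  - exact: meas_indicE.
  - nonneg.
  - apply: aeW => t; apply: cvg_near_cst; near=> N.
    rewrite indicI /=; have -> : \1_(I N) t = 1%R :> R by near: N; exact: cvgI.
    by rewrite mulr1.
  move=> N; set A := E `&` I N.
  have mA : measurable A by exact: measurableI.
  have Aoo : leb A < +oo.
    by apply: le_lt_trans (Ioo N); apply: le_measure; rewrite ?inE; [exact: mA|exact: mI|exact: subIsetr].
  have := H (\1_A : R -> R) (mindic mA) (indic_fun_ge0 A).
  have -> : \int[leb]_t (\1_A t)%:E = leb A by rewrite integral_indic// setIT.
  have h1 : exists M, forall t, (\1_A t <= M :> R)%R.
    by exists 1%R => t; rewrite indicE; case: (_ \in _).
  have h2 : exists2 A0, measurable A0 /\ leb A0 < +oo & forall t, ~ A0 t -> \1_A t = 0%R :> R.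
    by exists A => // t At; rewrite indicE memNset.
  move=> /(_ h1 h2); rewrite !Lnorm_indic// => h.
  have : leb A <= (2^-1)%:E * (leb A `^ a'^-1 + leb A `^ b'^-1).
    apply: le_trans h; rewrite (_ : leb A = \int[leb]_t (\1_A t)%:E); last first.
      by rewrite integral_indic// setIT.
    apply: le_integralT.
    - nonneg.
    - exact: meas_indicE.
    - by apply: emfunM => //; exact: meas_indicE.
    move=> t; rewrite indicE; have [tA|_] := boolP (t \in A); last by rewrite mule0.
    by rewrite mule1; move: tA; rewrite inE => -[+ _]; exact: ltW.
  have : 0 <= leb A by [].
  move: Aoo; case: (leb A) => // m _; rewrite !poweR_EFin -EFinD -EFinM !lee_fin.
  by move=> m0; exact: le1_of_half_powR.
split.
  apply: (@Lnorm_dual _ _ _ leb a a') => //.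
  - by apply: emfunM => //; exact: meas_indicE.
  - by move=> t; rewrite mule_ge0// lee_fin.
  move=> f mf f0 [M fM] [A [mA Aoo] Af]; rewrite mul1e.
  pose F t := (\1_E t * f t)%R.
  have mF : mfunT F by apply: mfunM => //; exact: mindic.
  have F0 t : (0 <= F t)%R by rewrite mulr_ge0.
  have Ff t : (F t <= f t)%R by rewrite /F indicE; case: (_ \in _); rewrite ?mul1r ?mul0r.
  have := H F mF F0.
  have h1 : exists M, forall t, (F t <= M)%R by exists M => t; exact: le_trans (fM t).
  have h2 : exists2 A0, measurable A0 /\ leb A0 < +oo & forall t, ~ A0 t -> F t = 0%R.
    by exists A => // t At; rewrite /F Af// mulr0.
  move=> /(_ h1 h2) h.
  rewrite (_ : \int[leb]_t _ = \int[leb]_t (g t * (F t)%:E)); last first.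
    by apply: eq_int => t _; rewrite /F EFinM muleA.
  apply: le_trans h _.
  have Fa : 'N[leb]_a'%:E[EFin \o F] <= 'N[leb]_a'%:E[EFin \o f].
    by apply: le_Lnorm => //; exact/mEFinP.
  (* As $b'<a'$ and [E] has measure at most 1, the $L^{b'}$ norm on [E] is below the $L^{a'}$ norm;
     the two halves then add up to a constant 1. *)
  have Fb : 'N[leb]_b'%:E[EFin \o F] <= 'N[leb]_a'%:E[EFin \o f].
    apply: le_trans Fa; apply: (@Lnorm_le_of_support _ _ _ E) => //.
    by move=> t Et; rewrite /F indicE memNset// mul0r.
  apply: (@le_trans _ _ ((2^-1)%:E * ('N[leb]_a'%:E[EFin \o f] + 'N[leb]_a'%:E[EFin \o f]))).
    by apply: lee_wpmul2l => //; exact: leeD.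
  rewrite -mule2n -mule_natl muleA -EFinM mulVf// mul1e//.
have mh : mfunT (fun t => g t * (\1_(~` E) t)%:E).
  by apply: emfunM => //; apply: meas_indicE; exact: measurableC.
have h0 t : 0 <= g t * (\1_(~` E) t)%:E by rewrite mule_ge0// lee_fin.
have hle1 t : g t * (\1_(~` E) t)%:E <= 1.
  rewrite indicE; have [tE|_] := boolP (t \in ~` E); last by rewrite mule0.
  by rewrite mule1; move: tE; rewrite inE /E /= => /negP; rewrite -leNgt.
apply/Lnorm_le => //; rewrite poweR_EFin powR1.
pose h t : R := fine (g t * (\1_(~` E) t)%:E).
have hE t : (h t)%:E = g t * (\1_(~` E) t)%:E.
  by rewrite fineK// ge0_finE// (le_lt_trans (hle1 t))// ltry.
have mhR : mfunT h by exact: mcompT.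
have h0R t : (0 <= h t)%R by exact: fine_ge0.
have h1R t : (h t <= 1)%R by rewrite -lee_fin hE.
under eq_int do rewrite -hE.
apply: (@fatou_le _ _ _ leb (fun N t => ((h t * \1_(I N) t) `^ b)%:E)).
- move=> N; apply/mEFinP; apply: mfun_powR; apply: mfunM => //.
  exact: (mindic (mI N)).
- nonneg.
- meas.
- nonneg.
- apply: aeW => t; apply: cvg_near_cst; near=> N.
  by have -> : \1_(I N) t = 1%R :> R by [near: N; exact: cvgI]; rewrite mulr1.
move=> N; pose k t := (h t * \1_(I N) t)%R.
have mk : mfunT k by apply: mfunM => //; exact: mindic.
have k0 t : (0 <= k t)%R by rewrite mulr_ge0.
have k1 t : (k t <= 1)%R by rewrite /k indicE; case: (_ \in _); rewrite ?mulr1 ?mulr0.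
have kg t : (k t)%:E <= g t.
  rewrite /k EFinM hE indicE [in leLHS]indicE; case: (_ \in _); case: (_ \in _);
  by rewrite ?mule1 ?mule0 ?mul0e.
(* Below the cut $k\le1$, so $f=k^{b-1}\le1$ and $\int f^{a'}\le\int f^{b'}=\int k^b$. The
   inequality used for the measure of [E] now applies to $\int k^b$ and bounds it by 1. *)
pose f t := (k t `^ (b - 1))%R.
have f0 t : (0 <= f t)%R by exact: powR_ge0.
have b10 : (0 <= b - 1)%R by rewrite subr_ge0 ltW.
have f1 t : (f t <= 1)%R by exact: powR_le1.
have mf : mfunT f by exact: mfun_powR.
have h2 : exists2 A0, measurable A0 /\ leb A0 < +oo & forall t, ~ A0 t -> f t = 0%R.
  exists (I N); first by split; [exact: mI|exact: Ioo].
  move=> t It; rewrite /f /k indicE memNset// mulr0 powR0//.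
  by rewrite subr_eq0 gt_eqF.
have := H f mf f0 (ex_intro _ 1%R f1) h2.
have X0 : 0 <= \int[leb]_t (k t `^ b)%:E by apply: int_ge0 => t _; rewrite lee_fin powR_ge0.
have Xoo : \int[leb]_t (k t `^ b)%:E < +oo.
  apply: le_lt_trans (Ioo N); rewrite (_ : leb (I N) = \int[leb]_t (\1_(I N) t)%:E); last first.
    exact: (esym (integral_indicE (mI N))).
  apply: le_integralT => [t|||t].
  - by rewrite lee_fin powR_ge0.
  - meas.
  - exact: meas_indicE.
  rewrite lee_fin /k indicE; case: (_ \in _); last by rewrite mulr0 powR0// gt_eqF.
  by rewrite mulr1; apply: powR_le1 => //; exact: ltW.
have fb : 'N[leb]_b'%:E[EFin \o f] = (\int[leb]_t (k t `^ b)%:E) `^ b'^-1.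
  rewrite Lnorm_ge0E; last nonneg.
  suff -> : \int[leb]_t ((EFin \o f) t `^ b') = \int[leb]_t (k t `^ b)%:E by [].
  by apply: eq_int => t _ /=; rewrite -powRrM bb'b.
have fa : 'N[leb]_a'%:E[EFin \o f] <= (\int[leb]_t (k t `^ b)%:E) `^ a'^-1.
  rewrite Lnorm_ge0E; last nonneg.
  apply: lee_poweR; first by rewrite invr_ge0 ltW.
    by apply: int_ge0 => t _; rewrite lee_fin powR_ge0.
  apply: le_integralT => [t|||t].
  - by rewrite lee_fin powR_ge0.
  - meas.
  - meas.
  rewrite /= lee_fin -[in leRHS]bb'b powRrM -/(f t).
  have [->|ft0] := eqVneq (f t) 0%R; first by rewrite !powR0// gt_eqF.
  apply: ger_powR; last exact: ltW.
  by rewrite lt_neqAle eq_sym ft0 f0 f1.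
rewrite fb => hX.
have : \int[leb]_t (k t `^ b)%:E <= (2^-1)%:E * ((\int[leb]_t (k t `^ b)%:E) `^ a'^-1 + (\int[leb]_t (k t `^ b)%:E) `^ b'^-1).
  apply: (@le_trans _ _ (\int[leb]_t (g t * (f t)%:E))).
    apply: le_integralT => [t|||t].
    - by rewrite lee_fin powR_ge0.
    - meas.
    - meas.
    by rewrite -(mulr_powRB1 (k0 t) b0) EFinM; apply: lee_wpmul2r; [rewrite lee_fin; exact: f0|exact: kg].
  by apply: le_trans hX _; apply: lee_wpmul2l => //; apply: leeD.
move: X0 Xoo; case: (\int[leb]_t _) => // m; rewrite !lee_fin => m0 _.
exact: le1_of_half_powR.
Unshelve. all: by end_near.
Qed.

End SumNormDuality.

Lemma meas_fun_elt d (T : measurableType d) (R : realType) (c : \bar R) (h : T -> \bar R) :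
  mfunT h -> mfunT (fun x => c < h x)%E.
Proof.
move=> mh; apply: (measurable_fun_bool true); rewrite setTI.
rewrite (_ : _ @^-1` _ = setT `&` [set x | (c < h x)%E]); last by rewrite setTI.
exact: emeasurable_fun_o_infty.
Qed.

Section HLS.
Context (R : realType) (q : R).
Hypothesis q2 : 2 < q.
Local Notation leb := (@lebesgue_measure R).
Local Notation al := (2 / q).
Local Notation p := (q / (q - 1)).
Local Open Scope ereal_scope.

Let q0 : (0 < q)%R. Proof. exact: lt_trans q2. Qed.
Let qn0 : (q != 0)%R. Proof. by rewrite gt_eqF. Qed.
Let q1 : (1 < q)%R. Proof. by apply: lt_trans q2; rewrite ltr1n. Qed.
Let q10 : (0 < q - 1)%R. Proof. by rewrite subr_gt0. Qed.
Let q1n0 : (q - 1 != 0)%R. Proof. by rewrite gt_eqF. Qed.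
Let al0 : (0 < al)%R. Proof. by rewrite divr_gt0. Qed.
Let al1 : (al < 1)%R. by rewrite ltr_pdivrMr// mul1r. Qed.
Let oal0 : (0 < 1 - al)%R. Proof. by rewrite subr_gt0. Qed.

(** The exponent is the one for which the potential maps $L^{q'}$ to $L^q$ on the line; away from 0
    the $q$-th power of the kernel is $|t|^{-2}$. *)
Definition rkernel (t : R) : R := `|t| `^ (- al).
Local Notation k := rkernel.

Lemma rkernel_ge0 t : (0 <= k t)%R. exact: powR_ge0. Qed.

Lemma mrkernel : mfunT k.
Proof. by apply: mfun_powR; exact: normr_measurable. Qed.

Lemma integral_riesz_near (r : R) : (0 < r)%R ->
  \int[leb]_s (if `|s| <= r then k s else 0)%:E = (2 * r `^ (1 - al) / (1 - al))%:E.
Proof.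
move=> r0.
pose phi (x : R) : \bar R := (if x <= r then x `^ (- al) else 0)%:E.
have mphi : mfunT phi.
  apply/mEFinP; apply: mfun_ifT.
  - exact: measurable_fun_ler.
  - exact: measurable_powR.
  - meas.
have phi0 x : 0 <= phi x by rewrite /phi lee_fin; case: ifP => // _; exact: powR_ge0.
rewrite (_ : \int[leb]_s _ = \int[leb]_s phi `|s|%R); last by [].
rewrite integral_normr//.
have -> : \int[leb]_(x in `]0%R, +oo[) phi x = (r `^ (1 - al) / (1 - al))%:E.
  have := @integral_powR R (1 - al) r oal0 (ltW r0).
  rewrite (_ : (fun l : R => _) = (fun l : R => (1 - al)%:E * (l `^ (- al))%:E)); last first.
    by apply/funext => l; rewrite -EFinM; congr ((_ * _ `^ _)%:E); ring.
  rewrite ge0_integralZl//; last 3 first.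
  - by apply/mEFinP; apply: mfunTS; exact: measurable_powR.
  - nonneg.
  - by rewrite lee_fin ltW.
  rewrite (_ : \int[leb]_(x in `]0%R, r]) (x `^ (- al))%:E = \int[leb]_(x in `]0%R, +oo[) phi x); last first.
    rewrite integral_mkcond [RHS]integral_mkcond; apply: eq_int => x _.
    rewrite /patch !mem_setE !in_itv /= andbT /phi.
    by case: (0 < x)%R => //=; case: ifP.
  move=> h; have -> : \int[leb]_(x in `]0%R, +oo[) phi x =
      ((1 - al)^-1)%:E * ((1 - al)%:E * \int[leb]_(x in `]0%R, +oo[) phi x).
    by rewrite muleA -EFinM mulVf ?mul1e// gt_eqF.
  by rewrite h -EFinM mulrC.
by rewrite -EFinD; congr EFin; ring.
Qed.

Lemma integral_riesz_far (r : R) : (0 < r)%R ->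
  \int[leb]_s ((if `|s| <= r then 0 else k s) `^ q)%:E = (2 / r)%:E.
Proof.
move=> r0.
pose phi (x : R) : \bar R := ((if x <= r then 0 else x `^ (- al)) `^ q)%:E.
have mphi : mfunT phi.
  apply/mEFinP; apply: mfun_powR; apply: mfun_ifT.
  - exact: measurable_fun_ler.
  - meas.
  - exact: measurable_powR.
have phi0 x : 0 <= phi x by rewrite /phi lee_fin powR_ge0.
rewrite (_ : \int[leb]_s _ = \int[leb]_s phi `|s|%R); last by [].
rewrite integral_normr//.
have -> : \int[leb]_(x in `]0%R, +oo[) phi x = (r^-1)%:E.
  rewrite -(integral_inv_sqr r0) -integral_itv_obnd_cbnd; last first.
    apply/mEFinP; apply: mfunTS.
    rewrite (_ : (fun x => _) = (fun x : R => `|x| `^ (- 2))%R).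
      by apply: mfun_powR; exact: normr_measurable.
    apply/funext => x; by rewrite powRN powR_mulrn// real_normK// num_real.
  rewrite integral_mkcond [RHS]integral_mkcond; apply: eq_int => x _.
  rewrite /patch !mem_setE !in_itv /= !andbT /phi.
  have [rx|xr] := ltP r x.
    rewrite (lt_trans r0 rx) -powRrM (_ : - al * q = - 2%:R)%R; last by field.
    by rewrite powRN powR_mulrn// ltW// (lt_trans r0).
  by case: ifP => // _; rewrite powR0.
by rewrite -EFinD; congr EFin; ring.
Qed.

Definition riesz (f : R -> R) (t : R) : \bar R := \int[leb]_s (k (t - s) * f s)%:E.

(** Chosen so that the kernel cut at the radius $2(4/l)^q$ has mass $K_0l^{2-q}$. *)
Let K0 : R := (2 * (2 * 4 `^ q) `^ (1 - al) / (1 - al))%R.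
Let K00 : (0 < K0)%R.
by rewrite divr_gt0// mulr_gt0// powR_gt0// mulr_gt0// powR_gt0. Qed.

(** The factor $2qK_0$ comes from integrating the distribution bound over the heights, the power of
    $4K_0$ from the threshold [b] in [hls_norm]. *)
Definition hls_cst : R := (2 * q * K0 * (4 * K0) `^ (q - 1)^-1)%R.

Lemma hls_cst_gt0 : (0 < hls_cst)%R.
Proof.
by rewrite /hls_cst; apply: mulr_gt0; [apply: mulr_gt0 => //; exact: mulr_gt0|apply: powR_gt0; exact: mulr_gt0].
Qed.

Let near (r : R) (f : R -> R) (t : R) : \bar R :=
  \int[leb]_s ((if `|t - s| <= r then k (t - s) else 0) * f s)%:E.

Let nk (r t : R) : R := (if `|t| <= r then k t else 0)%R.
Let mnk r : mfunT (nk r).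
apply: mfun_ifT => //.
- by apply: measurable_fun_ler => //; exact: normr_measurable.
- exact: mrkernel.
Qed.
Let nk0 r t : (0 <= nk r t)%R.
by rewrite /nk; case: ifP => // _; exact: rkernel_ge0. Qed.

Let fk (r t : R) : R := (if `|t| <= r then 0 else k t)%R.
Let mfk r : mfunT (fk r).
apply: mfun_ifT => //.
- by apply: measurable_fun_ler => //; exact: normr_measurable.
- exact: mrkernel.
Qed.
Let fk0 r t : (0 <= fk r t)%R.
by rewrite /fk; case: ifP => // _; exact: rkernel_ge0. Qed.

Let msub (t : R) : mfunT (fun s : R => (t - s)%R).
by apply: mfunB. Qed.

Let int_reflect (phi : R -> \bar R) t : mfunT phi -> (forall x, 0 <= phi x) ->
  \int[leb]_s phi (t - s)%R = \int[leb]_s phi s.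
move=> mphi phi0.
rewrite -(integral_lebesgue_opp mphi phi0).
rewrite -(@integral_lebesgue_shift _ (- t)%R (fun s => phi (- s)%R)).
- by apply: eq_int => s _; rewrite opprD opprK addrC.
- by apply: mcompT mphi _; exact: oppr_measurable.
- by move=> x.
Qed.

Let int_shift (phi : R -> \bar R) s : mfunT phi -> (forall x, 0 <= phi x) ->
  \int[leb]_t phi (t - s)%R = \int[leb]_t phi t.
by move=> mphi phi0; exact: (@integral_lebesgue_shift _ (- s)%R). Qed.

Let mconv (h f : R -> R) : mfunT h -> mfunT f ->
  mfunT (fun z : mtypeR R * mtypeR R => (h (z.1 - z.2) * f z.2)%:E).
move=> mh mf; apply/mEFinP; apply: mfunM.
  apply: mcompT mh _; apply: mfunB; [exact: mfst|exact: msnd].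
exact: mcompT mf msnd.
Qed.

Lemma meas_riesz (f : R -> R) : mfunT f -> (forall s, 0 <= f s)%R ->
  mfunT (riesz f).
Proof.
move=> mf f0; apply: (@mfubiniF _ _ (mtypeR R) (mtypeR R) R leb
  (fun z => (k (z.1 - z.2) * f z.2)%:E)).
- by apply: mconv => //; exact: mrkernel.
- by move=> z; rewrite lee_fin mulr_ge0// rkernel_ge0.
Qed.

Lemma riesz_ge0 (f : R -> R) t : (forall s, 0 <= f s)%R -> 0 <= riesz f t.
Proof.
by move=> f0; apply: int_ge0 => s _; rewrite lee_fin mulr_ge0// rkernel_ge0.
Qed.

Let conv_eq (h f : R -> R) : mfunT h -> (forall s, 0 <= h s)%R ->
  mfunT f -> (forall s, 0 <= f s)%R ->
  \int[leb]_t \int[leb]_s (h (t - s) * f s)%:E =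
  (\int[leb]_s (h s)%:E) * \int[leb]_s (f s)%:E.
move=> mh h0 mf f0.
rewrite (@fubini_tonelli _ _ (mtypeR R) (mtypeR R) R leb leb
  (fun z => (h (z.1 - z.2) * f z.2)%:E)) /=; last 2 first.
- exact: mconv.
- by move=> z; rewrite lee_fin mulr_ge0.
rewrite -ge0_integralZl//; last 3 first.
- meas.
- by move=> s _; rewrite lee_fin.
- by apply: int_ge0 => s _; rewrite lee_fin.
apply: eq_int => s _.
under eq_int do rewrite mulrC EFinM.
rewrite integralZlT//; last 2 first.
- by move=> t; rewrite lee_fin.
- by apply/mEFinP; apply: mcompT mh _; exact: mfunB.
rewrite muleC; congr (_ * _); apply: (int_shift (phi := EFin \o h)).
- meas.
- by move=> x; rewrite lee_fin.
Qed.

Let pq : (q^-1 + p^-1 = 1)%R. Proof. by field; rewrite qn0 q1n0. Qed.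

(** At height $l$ both the kernel and the function are cut. The far kernel contributes at most $l/4$
    by Hoelder, the near kernel applied to the values of $f$ below a threshold another $l/4$, and
    the rest is estimated in $L^1$. As the threshold moves with $l$, integrating over $l$ yields the
    strong bound at once, without interpolating between weak ones. *)
Let hls_norm (f : R -> R) : mfunT f -> (forall s, 0 <= f s)%R ->
  \int[leb]_s (f s `^ p)%:E <= 1 ->
  \int[leb]_t (riesz f t `^ q) <= hls_cst%:E.
move=> mf f0 f1.
have mK := meas_riesz mf f0.
have K_0 t := riesz_ge0 t f0.
have [p1 _ _] := conj_exp_gt1 q1 pq.
have p0 : (0 < p)%R by exact: lt_trans p1.
pose b s := ((4 * K0 * f s) `^ (q - 1)^-1)%R.
have mb : mfunT b by apply: mfun_powR; exact: mfunM.
have b0 s : (0 <= b s)%R by exact: powR_ge0.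
have K40 : (0 < 4 * K0)%R by rewrite mulr_gt0.
have bl l s : (0 < l)%R -> ~~ (l < b s)%R -> (f s <= l `^ (q - 1) / (4 * K0))%R.
  move=> l0; rewrite -leNgt => bsl; rewrite ler_pdivlMr// mulrC.
  have -> : (4 * K0 * f s = b s `^ (q - 1))%R.
    by rewrite /b -powRrM mulVf// powRr1// mulr_ge0// ltW.
  by apply: le_powR => //; exact: ltW.
pose W l := \int[leb]_s (if (l < b s)%R then (f s)%:E else 0).
have step l : (0 < l)%R -> \int[leb]_t (if (l%:E < riesz f t) then 1 else 0) <=
    (2 * K0 * l `^ (1 - q))%:E * W l.
  move=> l0.
  (* The far kernel has $\int k^q=2/r$; this radius makes its $L^q$ norm exactly $l/4$. *)
  pose r := (2 * (4 / l) `^ q)%R.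
  have l4 : (0 < 4 / l)%R by rewrite divr_gt0.
  have r0 : (0 < r)%R by rewrite mulr_gt0// powR_gt0.
  pose F s := if (l < b s)%R then f s else 0%R.
  have mF : mfunT F by apply: mfun_ifT => //; exact: mfun_ltr.
  have F0 s : (0 <= F s)%R by rewrite /F; case: ifP.
  (* An upper bound for $f$ where $b\le l$; multiplied by the near mass $K_0l^{2-q}$ it gives
     $l/4$. *)
  pose mu := (l `^ (q - 1) / (4 * K0))%R.
  have mu0 : (0 <= mu)%R by rewrite divr_ge0 ?powR_ge0// ltW.
  have K1E : (2 * r `^ (1 - al) / (1 - al) = K0 * l `^ (2 - q))%R.
    have -> : (r = (2 * 4 `^ q) * l^-1 `^ q)%R.
      by rewrite /r powRM ?invr_ge0 ?(ltW l0)// mulrA.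
    rewrite powRM ?powR_ge0 ?mulr_ge0 ?powR_ge0//.
    have -> : ((l^-1 `^ q) `^ (1 - al) = l `^ (2 - q))%R.
      by rewrite -(powR_inv1 (ltW l0)) -!powRrM; congr (_ `^ _)%R; field.
    by rewrite /K0; ring.
  have mn (h : R -> R) t : mfunT h -> mfunT (fun s : R => (nk r (t - s) * h s)%:E).
    move=> mh; apply/mEFinP; apply: mfunM => //.
    exact: mcompT (mnk r) (msub t).
  have far t : \int[leb]_s (fk r (t - s) * f s)%:E <= (l / 4)%:E.
    under eq_int do rewrite EFinM.
    have m1 : mfunT (fun s : R => (fk r (t - s))%:E).
      by apply/mEFinP; exact: mcompT (mfk r) (msub t).
    have := @ge0_hoelder _ _ R leb q p (fun s => (fk r (t - s))%:E) (EFin \o f) q1 pq m1.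
    move=> /(_ ((mEFinP _ _).2 mf)).
    have z1 s : 0 <= (fk r (t - s))%:E by rewrite lee_fin.
    have z2 s : 0 <= (EFin \o f) s by rewrite lee_fin.
    move=> /(_ z1 z2) /le_trans; apply.
    rewrite -[leRHS]mule1; apply: lee_pmul; try exact: Lnorm_ge0.
      rewrite Lnorm_ge0E// (@int_reflect (fun s => ((fk r s) `^ q)%:E) t); last 2 first.
      - by apply/mEFinP; apply: mfun_powR.
      - by move=> x; rewrite lee_fin powR_ge0.
      rewrite integral_riesz_far// poweR_EFin lee_fin /r invfM mulrA mulfV// mul1r.
      by rewrite -powRN -powRrM mulNr mulfV// powRN powRr1 ?(ltW l4)// invf_div.
    apply/Lnorm_le => //.
    by rewrite poweR_EFin powR1.
  have nearmu t : \int[leb]_s (nk r (t - s) * mu)%:E = (l / 4)%:E.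
    under eq_int do rewrite mulrC EFinM.
    rewrite integralZlT//; last 2 first.
    - by move=> s; rewrite lee_fin.
    - by apply/mEFinP; exact: mcompT (mnk r) (msub t).
    rewrite (@int_reflect (fun s => (nk r s)%:E) t); last 2 first.
    - by apply/mEFinP.
    - by move=> x; rewrite lee_fin.
    rewrite integral_riesz_near// K1E -EFinM /mu; congr EFin.
    have -> : (l `^ (q - 1) / (4 * K0) * (K0 * l `^ (2 - q)) = l `^ (q - 1) * l `^ (2 - q) / 4)%R.
      by move: K00; clearbody K0 => K00'; field; rewrite gt_eqF.
    rewrite -powRD ?(gt_eqF l0) ?implybT// (_ : q - 1 + (2 - q) = 1)%R; last by ring.
    by rewrite powRr1 ?(ltW l0).
  have Kle t : riesz f t <= (l / 4)%:E + ((l / 4)%:E + \int[leb]_s (nk r (t - s) * F s)%:E).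
    apply: (@le_trans _ _ (\int[leb]_s (fk r (t - s) * f s)%:E +
       (\int[leb]_s (nk r (t - s) * mu)%:E + \int[leb]_s (nk r (t - s) * F s)%:E))); last first.
      by apply: leeD; [exact: far|rewrite nearmu].
    rewrite -ge0_integralD//; last 4 first.
    - by move=> s _; rewrite lee_fin mulr_ge0.
    - exact: mn.
    - by move=> s _; rewrite lee_fin mulr_ge0.
    - exact: mn.
    have mfar : mfunT (fun s : R => (fk r (t - s) * f s)%:E).
      apply/mEFinP; apply: mfunM => //.
      exact: mcompT (mfk r) (msub t).
    rewrite -ge0_integralD//; last 3 first.
    - by move=> s _; rewrite lee_fin mulr_ge0.
    - by move=> s _; rewrite adde_ge0// lee_fin mulr_ge0.
    - by apply: emeasurable_funD; exact: mn.
    apply: le_integralT.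
    - by move=> s; rewrite lee_fin mulr_ge0// rkernel_ge0.
    - apply/mEFinP; apply: mfunM => //.
      exact: mcompT mrkernel (msub t).
    - by apply: emeasurable_funD => //; apply: emeasurable_funD; exact: mn.
    move=> s; rewrite -!EFinD lee_fin /fk /nk; case: ifPn => _; last first.
      by rewrite !mul0r !addr0.
    rewrite mul0r add0r -mulrDr; apply: ler_wpM2l; first exact: rkernel_ge0.
    rewrite /F; case: ifPn => h; first by rewrite lerDr.
    by rewrite addr0; exact: bl.
  have mcv : mfunT (fun t : R => \int[leb]_s (nk r (t - s) * F s)%:E).
    apply: (@mfubiniF _ _ (mtypeR R) (mtypeR R) R leb
      (fun z => (nk r (z.1 - z.2) * F z.2)%:E)); first exact: mconv.
    by move=> z; rewrite lee_fin mulr_ge0.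
  (* Where the potential exceeds $l$, the remaining piece exceeds $l/2$: Chebyshev in $L^1$. *)
  apply: (@le_trans _ _ ((2 / l)%:E * \int[leb]_t \int[leb]_s (nk r (t - s) * F s)%:E)).
    rewrite -integralZlT//; last 2 first.
    - by move=> t; apply: int_ge0 => s _; rewrite lee_fin mulr_ge0.
    - by rewrite divr_ge0// ltW.
    apply: le_integralT.
    - by move=> t; case: ifP.
    - by apply: mfun_ifT => //; exact: meas_fun_elt.
    - exact: emfunM.
    move=> t; have I0 : 0 <= \int[leb]_s (nk r (t - s) * F s)%:E.
      by apply: int_ge0 => s _; rewrite lee_fin mulr_ge0.
    case: ifPn => [h|_]; last by rewrite mule_ge0// lee_fin divr_ge0// ltW.
    have := lt_le_trans h (Kle t); move: I0; case: (\int[leb]_s _) => [m|_ _|//]; last first.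
      by rewrite gt0_muley ?leey// lte_fin divr_gt0.
    rewrite -EFinM -!EFinD !lee_fin lte_fin => m0 lm.
    rewrite mulrAC ler_pdivlMr// mul1r; lra.
  rewrite conv_eq// integral_riesz_near// K1E muleA -EFinM.
  rewrite (_ : 2 / l * (K0 * l `^ (2 - q)) = 2 * K0 * l `^ (1 - q))%R; last first.
    rewrite (_ : 2 - q = 1 + (1 - q))%R; last by ring.
    rewrite powRD ?(gt_eqF l0) ?implybT// powRr1 ?(ltW l0)//; field.
    by rewrite gt_eqF.
  rewrite /W /F; suff -> : \int[leb]_s (if (l < b s)%R then (f s)%:E else 0) =
    \int[leb]_s (if (l < b s)%R then f s else 0%R)%:E by [].
  by apply: eq_int => s _; case: ifP.
(* The potential may be infinite, whereas the layer-cake formula takes a real level function; hence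
   the truncations. *)
apply: (@fatou_le _ _ _ leb (fun n t => ((etrunc (riesz f) n t) `^ q)%:E)).
- move=> n; apply/mEFinP; apply: mfun_powR; exact: meas_etrunc.
- by move=> n t; rewrite lee_fin powR_ge0.
- exact: mfun_poweR.
- by move=> t; exact: poweR_ge0.
- apply: aeW => t.
  have [hx|hx] := eqVneq (riesz f t) +oo.
    rewrite hx /= gt_eqF//; apply/cvgeyPge => M; near=> n.
    have e : etrunc (riesz f) n t = n%:R by apply: EFin_inj; rewrite etruncE// hx min_r// leey.
    rewrite e lee_fin; apply: (@le_trans _ _ n%:R).
      by near: n; exact: nbhs_infty_ger.
    rewrite -{1}[n%:R]powRr1//; apply: ler_powR; last exact: ltW.
    by rewrite ler1n; near: n; exists 1%N.
  have hfin : riesz f t \is a fin_num by rewrite ge0_finE// lt_neqAle hx leey.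
  apply: cvg_near_cst; near=> n; rewrite -poweR_EFin etrunc_finE//.
  by rewrite -(fineK hfin) lee_fin; near: n; exact: nbhs_infty_ger.
move=> n; set g := etrunc _ n.
have mg : mfunT g by exact: meas_etrunc.
have g0 t : (0 <= g t)%R by exact: etrunc_ge0.
rewrite (_ : \int[leb]_t (g t `^ q)%:E = \int[leb]_t (1 * (g t `^ q)%:E)); last first.
  by apply: eq_int => t _; rewrite mul1e.
rewrite -layer_cake//.
have mW : mfunT W.
  pose G (z : mtypeR R * mtypeR R) : \bar R := if (z.1 < b z.2)%R then (f z.2)%:E else 0.
  apply: (@mfubiniF _ _ (mtypeR R) (mtypeR R) R leb G).
    apply: mfun_ifT => //.
      by apply: mfun_ltr; [exact: mfst|exact: (mcompT mb msnd)].
    by apply/mEFinP; exact: (mcompT mf msnd).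
  by move=> z; rewrite /G; case: ifP => // _; rewrite lee_fin.
have W0 l : 0 <= W l by apply: int_ge0 => s _; case: ifP => // _; rewrite lee_fin.
have mW' : mfunT (fun l : R => \int[leb]_t (if (l < g t)%R then 1 else 0 : \bar R)).
  pose G (z : mtypeR R * mtypeR R) : \bar R := if (z.1 < g z.2)%R then 1 else 0.
  apply: (@mfubiniF _ _ (mtypeR R) (mtypeR R) R leb G).
    apply: mfun_ifT => //.
    by apply: mfun_ltr; [exact: mfst|exact: (mcompT mg msnd)].
  by move=> z; rewrite /G; case: ifP.
have mpow (c : R) : mfunT (fun l : R => (c * l `^ (c - 1))%:E).
  by apply/mEFinP; apply: mfunM => //; exact: measurable_powR.
have mW1 : mfunT (fun l : R => (1 * l `^ (1 - 1))%:E * W l).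
  by apply: emfunM.
have qK0 : (0 <= 2 * q * K0)%R.
  by apply: mulr_ge0; [apply: mulr_ge0 => //; exact: ltW|exact: ltW].
apply: (@le_trans _ _ ((2 * q * K0)%:E * \int[leb]_(l in `]0%R, +oo[) ((1 * l `^ (1 - 1))%:E * W l))).
  rewrite -ge0_integralZl//; last 2 first.
  - exact: mfunTS.
  - by move=> l _; rewrite mule_ge0// lee_fin mulr_ge0 ?powR_ge0.
  apply: ge0_le_integral => //.
  - move=> l _; rewrite mule_ge0//; first by rewrite lee_fin mulr_ge0 ?powR_ge0// ltW.
    by apply: int_ge0 => t _; case: ifP.
  - exact: (mfunTS (emfunM (mpow _) mW')).
  - exact: (mfunTS (emfunM (mcst _) mW1)).
  move=> l /=; rewrite in_itv /= andbT => l0.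
  apply: (@le_trans _ _ ((q * l `^ (q - 1))%:E * ((2 * K0 * l `^ (1 - q))%:E * W l))).
    apply: lee_wpmul2l; first by rewrite lee_fin mulr_ge0 ?powR_ge0// ltW.
    apply: le_trans (step l l0); apply: le_integralT.
    - by move=> t; case: ifP.
    - by apply: mfun_ifT => //; exact: mfun_ltr.
    - by apply: mfun_ifT => //; exact: meas_fun_elt.
    move=> t; case: ifPn => [lg|_]; last by case: ifP.
    by rewrite ifT// (lt_le_trans _ (etrunc_le n (K_0 t))) ?lte_fin.
  rewrite !muleA -!EFinM; apply: lee_wpmul2r => //; rewrite lee_fin.
  rewrite subrr powRr0 !mulr1 mulrACA mulrC -!mulrA [(l `^ _ * _)%R]mulrCA.
  have e : (l `^ (1 - q) * l `^ (q - 1) = 1)%R.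
    rewrite -powRD ?(gt_eqF l0) ?implybT// (_ : 1 - q + (q - 1) = 0)%R ?powRr0//.
    by ring.
  rewrite mulrA e mul1r.
  by rewrite le_eqVlt; apply/orP; left; apply/eqP; ring.
rewrite layer_cake//; last first.
  exact/mEFinP.
rewrite /hls_cst [leRHS]EFinM; apply: lee_wpmul2l; first by rewrite lee_fin.
apply: (@le_trans _ _ (((4 * K0) `^ (q - 1)^-1)%:E * \int[leb]_s (f s `^ p)%:E)); last first.
  by rewrite -[leRHS]mule1; apply: lee_wpmul2l => //; rewrite lee_fin powR_ge0.
rewrite -integralZlT ?powR_ge0//; last 2 first.
- by move=> s; rewrite lee_fin powR_ge0.
- by apply/mEFinP; exact: mfun_powR.
apply: le_integralT.
- by move=> s; rewrite mule_ge0// lee_fin// powR_ge0.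
- apply: emfunM; apply/mEFinP => //; exact: mfun_powR.
- by apply/mEFinP; apply: mfunM => //; exact: mfun_powR.
move=> s; rewrite -!EFinM lee_fin powRr1// /b powRM ?(ltW K40)// mulrCA.
apply: ler_wpM2l; first exact: powR_ge0.
have [->|fs0] := eqVneq (f s) 0%R; first by rewrite mul0r powR_ge0.
rewrite -{1}(powRr1 (f0 s)) -powRD ?fs0 ?implybT//.
by rewrite (_ : 1 + (q - 1)^-1 = p)%R//; field.
Unshelve. all: by end_near.
Qed.

Lemma hls_bilinear (f g : R -> R) (M N : R) :
  mfunT f -> (forall s, 0 <= f s)%R ->
  mfunT g -> (forall s, 0 <= g s)%R ->
  'N[leb]_p%:E[EFin \o f] <= M%:E -> 'N[leb]_p%:E[EFin \o g] <= N%:E ->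
  \int[leb]_t (riesz f t * (g t)%:E) <= (hls_cst `^ q^-1 * M * N)%:E.
Proof.
move=> mf f0 mg g0 fM gN.
have [p1 _ _] := conj_exp_gt1 q1 pq.
have p0 : (0 < p)%R by exact: lt_trans p1.
have M0 : (0 <= M)%R by rewrite -lee_fin (le_trans _ fM)// Lnorm_ge0.
have N0 : (0 <= N)%R by rewrite -lee_fin (le_trans _ gN)// Lnorm_ge0.
have mK := meas_riesz mf f0.
suff KM : 'N[leb]_q%:E[riesz f] <= (hls_cst `^ q^-1 * M)%:E.
  have := @ge0_hoelder _ _ R leb q p (riesz f) (EFin \o g) q1 pq mK ((mEFinP _ _).2 mg).
  move=> /(_ (fun t => riesz_ge0 t f0) g0) /le_trans; apply.
  by rewrite [leRHS]EFinM; apply: lee_pmul => //; exact: Lnorm_ge0.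
(* Normalising by $M+e$ instead of $M$ covers the case $M=0$; [e] tends to 0 at the end. *)
have key e : (0 < e)%R -> 'N[leb]_q%:E[riesz f] <= (hls_cst `^ q^-1 * (M + e))%:E.
  move=> e0; have Me : (0 < M + e)%R by exact: ltr_wpDl.
  pose h s := ((M + e)^-1 * f s)%R.
  have mh : mfunT h by exact: mfunM.
  have h0 s : (0 <= h s)%R by rewrite mulr_ge0// invr_ge0 ltW.
  have hE : EFin \o h = (fun s => ((M + e)^-1)%:E * (EFin \o f) s).
    by apply/funext => s; rewrite /= EFinM.
  have h1 : \int[leb]_s (h s `^ p)%:E <= 1.
    have : 'N[leb]_p%:E[EFin \o h] <= 1%:E.
      rewrite hE Lnorm_scale//; last 2 first.
      - by rewrite invr_ge0 ltW.
      - meas.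
      apply: (@le_trans _ _ (((M + e)^-1)%:E * M%:E)).
        by apply: lee_wpmul2l => //; rewrite lee_fin invr_ge0 ltW.
      by rewrite -EFinM lee_fin mulrC ler_pdivrMr// mul1r lerDl ltW.
    by move/Lnorm_le; rewrite poweR_EFin powR1; apply.
  have fE : riesz f = (fun t => (M + e)%:E * riesz h t).
    apply/funext => t; rewrite /riesz -integralZlT; last 3 first.
    - by move=> s; rewrite lee_fin mulr_ge0// rkernel_ge0.
    - apply/mEFinP; apply: mfunM => //.
      exact: mcompT mrkernel (msub t).
    - exact: ltW.
    apply: eq_int => s _; rewrite -EFinM; congr EFin; rewrite /h.
    by field; rewrite gt_eqF.
  rewrite fE Lnorm_scale//; last 3 first.
  - exact: ltW.
  - exact: meas_riesz.
  - by move=> t; exact: riesz_ge0.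
  rewrite mulrC EFinM; apply: lee_wpmul2l; first by rewrite lee_fin ltW.
  apply/Lnorm_le => //; first by rewrite lee_fin powR_ge0.
    by move=> t; exact: riesz_ge0.
  rewrite poweR_EFin -powRrM mulVf// powRr1 ?(ltW hls_cst_gt0)//.
  exact: hls_norm.
apply/lee_addgt0Pr => e e0.
have c0 : (0 < hls_cst `^ q^-1)%R by rewrite powR_gt0// hls_cst_gt0.
have := key (e / hls_cst `^ q^-1)%R (divr_gt0 e0 c0).
by rewrite mulrDr [X in (_ + X)%R]mulrC divfK ?gt_eqF// EFinD.
Qed.

End HLS.

(** * Fubini for complex-valued integrals *)

Section ComplexFubini.
Context d1 d2 (X : measurableType d1) (Y : measurableType d2) (R : realType)
  (mu : sfmeasure X R) (nu : sfmeasure Y R).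

Lemma cabs_cint_le d (T : measurableType d) (m : {measure set T -> \bar R}) (f : T -> R[i]) :
  cmeasurable f -> ((cabs (cintegral m setT f))%:E <= \int[m]_x (cabs (f x))%:E)%E.
Proof.
move=> mf; have [->|foo] := eqVneq (\int[m]_x (cabs (f x))%:E)%E +oo%E; first by rewrite leey.
by apply: cabs_cintegral; split => //; rewrite lt_neqAle foo leey.
Qed.

(** Positive and negative parts have measurable integrals by Tonelli, and where the integral is not
    finite its conventional value still depends measurably on the parameter. Measurability of every
    parameter integral below rests on this. *)
Lemma meas_fine_integral (F : X * Y -> R) : mfunT F ->
  mfunT (fun x => \int[nu]_y F (x, y)).
Proof.
move=> mF; apply: mcompT => //.
under eq_fun do rewrite integralE.
have mFe : mfunT (EFin \o F) by meas.
pose P (z : X * Y) := maxe (F z)%:E 0%E; pose N (z : X * Y) := maxe (- (F z)%:E)%E 0%E.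
rewrite (_ : (fun x => _) = (fun x => \int[nu]_y P (x, y) - \int[nu]_y N (x, y))%E); last first.
  apply/funext => x; congr (_ - _)%E; apply: eq_int => y _.
    by rewrite funeposE.
  by rewrite funenegE.
apply: emeasurable_funB.
  apply: (@mfubiniF _ _ X Y R nu P).
    exact: measurable_maxe.
  by move=> z; rewrite /P le_max lexx orbT.
apply: (@mfubiniF _ _ X Y R nu N).
  by apply: measurable_maxe => //; exact: mcompT.
by move=> z; rewrite /N le_max lexx orbT.
Qed.

Lemma cmeas_int (F : X * Y -> R[i]) : cmeasurable F ->
  cmeasurable (fun x => cintegral nu setT (fun y => F (x, y))).
Proof.
move=> [mR mI]; split => /=.
  exact: (@meas_fine_integral (fun z => complex.Re (F z)) mR).
exact: (@meas_fine_integral (fun z => complex.Im (F z)) mI).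
Qed.

(** Slices are integrable only almost everywhere, so the real and the extended iterated integrals
    are compared almost everywhere. *)
Lemma Rintegral_prod (F : X * Y -> R) : (mu \x nu)%E.-integrable setT (EFin \o F) ->
  \int[(mu \x nu)%E]_z F z = \int[mu]_x \int[nu]_y F (x, y).
Proof.
move=> IF; rewrite /Rintegral -(integral12_prod_meas1 IF); congr fine.
have I1 := integrable_fubini_F IF.
apply: ae_eq_integral => //.
- exact: measurable_int I1.
- by apply/mEFinP; apply: meas_fine_integral; apply/mEFinP; exact: measurable_int IF.
- by apply: filterS (integrable_ae measurableT I1) => x /(_ I) xfin _; rewrite fineK.
Qed.

Lemma Rintegral_fubini (F : X * Y -> R) : (mu \x nu)%E.-integrable setT (EFin \o F) ->
  \int[mu]_x \int[nu]_y F (x, y) = \int[nu]_y \int[mu]_x F (x, y).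
Proof.
move=> IF; rewrite -Rintegral_prod// /Rintegral -(integral21_prod_meas1 IF); congr fine.
apply: ae_eq_integral => //.
- exact: (measurable_fubini_G IF).
- by apply/mEFinP; apply: mcompT => //; exact: (measurable_fubini_G IF).
- apply: filterS (ae_integrable2 IF) => y iy _; rewrite /fubini_G fineK//.
  exact: integrable_fin_num.
Qed.

Lemma cintegral_fubini (F : X * Y -> R[i]) : cmeasurable F ->
  (\int[mu]_x \int[nu]_y (cabs (F (x, y)))%:E < +oo)%E ->
  cintegral mu setT (fun x => cintegral nu setT (fun y => F (x, y))) =
  cintegral nu setT (fun y => cintegral mu setT (fun x => F (x, y))).
Proof.
move=> mF Foo.
have IF : cintegrable (mu \x nu)%E F.
  split => //; rewrite fubini_tonelli1//.
  - meas.
  - nonneg.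
rewrite /cintegral /=; congr Complex.
  exact: (@Rintegral_fubini (fun z => complex.Re (F z)) (cintg_Re IF)).
exact: (@Rintegral_fubini (fun z => complex.Im (F z)) (cintg_Im IF)).
Qed.

End ComplexFubini.

(** Writing $1/f=f\cdot(f^2)^{-1}$ moves the inversion to a power of a nonnegative function; at the
    zeros of $f$ both sides are 0. *)
Lemma meas_fun_inv (R : realType) d (T : measurableType d) (f : T -> R) :
  mfunT f -> mfunT (fun x => (f x)^-1).
Proof.
move=> mf; rewrite (_ : (fun x => _) = (fun x => f x * (f x ^+ 2) `^ (-1))).
  meas.
apply/funext => x; rewrite powR_inv1 ?sqr_ge0//.
have [->|fx] := eqVneq (f x) 0; first by rewrite invr0 mul0r.
by field.
Qed.

(** * Gaussian integrals on column vectors *)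

Section MeasurableMatrix.
Context (R : realType) d (S : measurableType d).

Definition mmx m n (f : S -> 'M[R]_(m, n)) := forall i j, mfunT (fun s => f s i j).

Lemma mmxP m n (f : S -> 'M[R]_(m, n)) : mfunT f <-> mmx f.
Proof.
split=> [mf i j|]; last exact: measurable_fun_mx.
exact: (mcompT (measurable_coord i j) mf).
Qed.

Lemma mmx_cst m n (A : 'M[R]_(m, n)) : mmx (fun _ => A).
Proof. by move=> i j; exact: mcst. Qed.

Lemma mmx_tr m n (f : S -> 'M[R]_(m, n)) : mmx f -> mmx (fun s => (f s)^T).
Proof. by move=> mf i j; under eq_fun do rewrite mxE; exact: mf. Qed.

Lemma mmxD m n (f g : S -> 'M[R]_(m, n)) : mmx f -> mmx g -> mmx (fun s => f s + g s).
Proof.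
move=> mf mg i j; under eq_fun do rewrite mxE.
by apply: mfunD; [exact: mf|exact: mg].
Qed.

Lemma mmxN m n (f : S -> 'M[R]_(m, n)) : mmx f -> mmx (fun s => - f s).
Proof. by move=> mf i j; under eq_fun do rewrite mxE; exact/mfunN/mf. Qed.

Lemma mmxB m n (f g : S -> 'M[R]_(m, n)) : mmx f -> mmx g -> mmx (fun s => f s - g s).
Proof. by move=> mf mg; apply: mmxD => //; exact: mmxN. Qed.

Lemma mmxM m n p (f : S -> 'M[R]_(m, n)) (g : S -> 'M[R]_(n, p)) : mmx f -> mmx g ->
  mmx (fun s => f s *m g s).
Proof.
move=> mf mg i j; under eq_fun do rewrite mxE.
apply: measurable_sum => k; apply: mfunM; [exact: mf|exact: mg].
Qed.

Lemma mmx_det n (f : S -> 'M[R]_n) : mmx f -> mfunT (fun s => \det (f s)).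
Proof.
move=> mf; rewrite /determinant; apply: measurable_sum => s.
apply: mfunM; first exact: mcst.
by apply: measurable_prod => i _; exact: mf.
Qed.

(** By Cramer's rule the entries of the inverse are rational in the entries of the matrix. *)
Lemma mmx_inv n (f : S -> 'M[R]_n) : mmx f -> (forall s, f s \in unitmx) ->
  mmx (fun s => invmx (f s)).
Proof.
move=> mf uf i j; rewrite /invmx; under eq_fun do rewrite uf mxE.
apply: mfunM.
  exact/meas_fun_inv/mmx_det.
under eq_fun do rewrite mxE; rewrite /cofactor; apply: mfunM => //.
by apply: mmx_det => k l; under eq_fun do rewrite !mxE; exact: mf.
Qed.

Lemma mmx_dotmul n (f g : S -> 'cV[R]_n) : mmx f -> mmx g ->
  mfunT (fun s => dotmul (f s) (g s)).
Proof. by move=> mf mg; rewrite /dotmul; apply: mmxM => //; exact: mmx_tr. Qed.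
End MeasurableMatrix.

Section LebesguecV.
Context (R : realType).
Local Notation leb := (@lebesgue_measure R).
Local Notation lebn := (lebesgue_cV R).
Local Notation vec n := 'cV[R]_n.

Lemma cons_cV0 n (a : R) (v : 'cV[R]_n) : cons_cV (a, v) ord0 ord0 = a.
Proof. by rewrite -[in RHS]/((a, v).1) -{2}(cons_cVK (a, v)). Qed.

Lemma cons_cVS n (a : R) (v : 'cV[R]_n) k : cons_cV (a, v) (lift ord0 k) ord0 = v k ord0.
Proof. by have := congr1 (fun p : R * 'cV[R]_n => p.2 k ord0) (cons_cVK (a, v)); rewrite /= mxE. Qed.

Lemma cons_cV_inj n (x : 'cV[R]_n.+1) : x = cons_cV (x ord0 ord0, \col_i x (lift ord0 i) ord0).
Proof.
apply/matrixP => i j; rewrite [j]ord1; case: (unliftP ord0 i) => [k ->|->].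
  by rewrite cons_cVS mxE.
by rewrite cons_cV0.
Qed.

Lemma cons_cVD n (a b : R) (v w : 'cV[R]_n) : cons_cV (a, v) + cons_cV (b, w) = cons_cV (a + b, v + w).
Proof.
apply/matrixP => i j; rewrite [j]ord1 mxE; case: (unliftP ord0 i) => [k ->|->].
  by rewrite !cons_cVS mxE.
by rewrite !cons_cV0.
Qed.

Lemma integral_cVS n (f : 'cV[R]_n.+1 -> \bar R) : mfunT f -> (forall x, 0 <= f x)%E ->
  (\int[lebn n.+1]_x f x = \int[leb]_a \int[lebn n]_v f (cons_cV (a, v)))%E.
Proof.
move=> mf f0.
transitivity (\int[pushforward (leb \x lebn n) (@cons_cV R n)]_x f x)%E; first by [].
rewrite ge0_integral_pushforward//=; last exact: measurable_cons_cV.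
rewrite fubini_tonelli1//.
by apply: mcompT mf _; exact: measurable_cons_cV.
Qed.

Lemma meas_cV_comp n (f : 'cV[R]_n.+1 -> \bar R) : mfunT f ->
  mfunT (fun z : mtypeR R * vec n => f (cons_cV z)).
Proof. by move=> mf; apply: mcompT mf _; exact: measurable_cons_cV. Qed.

Lemma mmx_id n : mmx (id : vec n -> 'cV[R]_n).
Proof. by move=> i j; exact: measurable_coord. Qed.

Lemma meas_shift_cV n (w : 'cV[R]_n) : mfunT (fun x : vec n => x + w : vec n).
Proof. by apply/mmxP; apply: mmxD; [exact: mmx_id|exact: mmx_cst]. Qed.

Lemma integral_cV_shift n (w : 'cV[R]_n) (f : 'cV[R]_n -> \bar R) :
  mfunT f -> (forall x, 0 <= f x)%E ->
  (\int[lebn n]_x f (x + w)%R = \int[lebn n]_x f x)%E.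
Proof.
elim: n w f => [|n IHn] w f mf f0.
  by apply: eq_int => x _; congr f; rewrite [LHS]flatmx0 [RHS]flatmx0.
have mfw : mfunT (fun x : vec n.+1 => f (x + w)).
  by apply: mcompT mf _; exact: meas_shift_cV.
rewrite (integral_cVS mfw (fun x => f0 _)) (integral_cVS mf f0) (cons_cV_inj w); set b := w _ _; set u := \col_i _.
transitivity (\int[leb]_a \int[lebn n]_v f (cons_cV (a + b, v)%R))%E.
  apply: eq_int => a _; under eq_int do rewrite cons_cVD.
  apply: (IHn u (fun v => f (cons_cV (a + b, v)))) => //.
  exact: (mcompT (meas_cV_comp mf) (mpair1 _)).
apply: (@integral_lebesgue_shift _ b (fun a => \int[lebn n]_v f (cons_cV (a, v)))%E).
  apply: (@mfubiniF _ _ (mtypeR R) _ R (lebn n) (fun z => f (cons_cV z)) (meas_cV_comp mf) (fun z => f0 _)).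
by move=> x; apply: int_ge0.
Qed.

(** Invariance for nonnegative functions passes to real ones through positive and negative parts,
    also where the integral is a conventional value. *)
Lemma Rintegral_invariant d (T : measurableType d) (m : {measure set T -> \bar R}) (phi : T -> T) :
  (forall f : T -> \bar R, mfunT f -> (forall x, 0 <= f x)%E ->
     (\int[m]_x f (phi x) = \int[m]_x f x)%E) ->
  forall f : T -> R, mfunT f -> \int[m]_x f (phi x) = \int[m]_x f x.
Proof.
move=> H f mf; rewrite /Rintegral; congr fine.
have mfe : mfunT (EFin \o f) by meas.
rewrite integralE [RHS]integralE; congr (_ - _)%E.
  pose P x := maxe (f x)%:E 0%E.
  rewrite (eq_int (fun x => P (phi x))); last by move=> x _; rewrite funeposE.
  rewrite [RHS](eq_int P); last by move=> x _; rewrite funeposE.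
  by apply: H => [|x]; [exact: measurable_maxe|rewrite /P le_max lexx orbT].
pose N x := maxe (- (f x)%:E)%E 0%E.
rewrite (eq_int (fun x => N (phi x))); last by move=> x _; rewrite funenegE.
rewrite [RHS](eq_int N); last by move=> x _; rewrite funenegE.
apply: H => [|x]; last by rewrite /N le_max lexx orbT.
by apply: measurable_maxe => //; exact: mcompT.
Qed.

Lemma cintegral_cV_shift n (w : 'cV[R]_n) (f : 'cV[R]_n -> R[i]) : cmeasurable f ->
  cintegral (lebn n) setT (fun x => f (x + w)) = cintegral (lebn n) setT f.
Proof.
move=> [mR mI]; rewrite /cintegral; congr Complex.
  exact: (@Rintegral_invariant _ _ (lebn n) (fun x : vec n => x + w) (@integral_cV_shift n w) (fun x => complex.Re (f x)) mR).
exact: (@Rintegral_invariant _ _ (lebn n) (fun x : vec n => x + w) (@integral_cV_shift n w) (fun x => complex.Im (f x)) mI).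
Qed.

Lemma dotmulE n (x y : 'cV[R]_n) : dotmul x y = \sum_i x i 0 * y i 0.
Proof. by rewrite /dotmul mxE; apply: eq_bigr => i _; rewrite mxE. Qed.

Lemma dotmulC n (x y : 'cV[R]_n) : dotmul x y = dotmul y x.
Proof. by rewrite !dotmulE; apply: eq_bigr => i _; rewrite mulrC. Qed.

Lemma dotmulDl n (x y z : 'cV[R]_n) : dotmul (x + y) z = dotmul x z + dotmul y z.
Proof. by rewrite /dotmul linearD mulmxDl mxE. Qed.

Lemma dotmulDr n (x y z : 'cV[R]_n) : dotmul z (x + y) = dotmul z x + dotmul z y.
Proof. by rewrite /dotmul mulmxDr mxE. Qed.

Lemma dotmulNl n (x z : 'cV[R]_n) : dotmul (- x) z = - dotmul x z.
Proof. by rewrite /dotmul linearN mulNmx mxE. Qed.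

Lemma dotmulNr n (x z : 'cV[R]_n) : dotmul z (- x) = - dotmul z x.
Proof. by rewrite /dotmul mulmxN mxE. Qed.

Lemma dotmulZl n k (x z : 'cV[R]_n) : dotmul (k *: x) z = k * dotmul x z.
Proof. by rewrite /dotmul linearZ -scalemxAl mxE. Qed.

Lemma dotmulZr n k (x z : 'cV[R]_n) : dotmul z (k *: x) = k * dotmul z x.
Proof. by rewrite /dotmul -scalemxAr mxE. Qed.

Lemma dotmul_mul n (A : 'M[R]_n) (x y : 'cV[R]_n) : dotmul (A *m x) y = dotmul x (A^T *m y).
Proof. by rewrite /dotmul trmx_mul mulmxA. Qed.

Lemma dotmul_ge0 n (x : 'cV[R]_n) : 0 <= dotmul x x.
Proof. by rewrite dotmulE sumr_ge0// => i _; rewrite -expr2 sqr_ge0. Qed.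

Lemma dotmul_eq0 n (x : 'cV[R]_n) : dotmul x x = 0 -> x = 0.
Proof.
move=> h; apply/matrixP => i j; rewrite [j]ord1 mxE; apply/eqP.
move: h; rewrite dotmulE => /eqP; rewrite psumr_eq0; last by move=> k _; rewrite -expr2 sqr_ge0.
by move/allP => /(_ i (mem_index_enum _)); rewrite mulf_eq0 orbb.
Qed.

Lemma dotmul_gt0 n (x : 'cV[R]_n) : x != 0 -> 0 < dotmul x x.
Proof.
move=> x0; rewrite lt_neqAle dotmul_ge0 andbT eq_sym.
by apply: contra x0 => /eqP/dotmul_eq0 ->.
Qed.

Lemma dotmul_cons n (a b : R) (v w : 'cV[R]_n) :
  dotmul (cons_cV (a, v)) (cons_cV (b, w)) = a * b + dotmul v w.
Proof.
rewrite !dotmulE big_ord_recl !cons_cV0; congr (_ + _).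
by apply: eq_bigr => i _; rewrite !cons_cVS.
Qed.

Lemma dotmul0l (x y : 'cV[R]_0) : dotmul x y = 0.
Proof. by rewrite dotmulE big_ord0. Qed.

End LebesguecV.

Section Gauss1.
Context (R : realType).
Local Notation leb := (@lebesgue_measure R).

Lemma meas_EFinR (f : R -> R) : mfunT f -> mfunT (EFin \o f).
Proof. by move=> mf; exact/mEFinP. Qed.

Lemma meas_gauss1 (a c : R) : mfunT (fun x : R => expR (- (a * (x + c) ^+ 2))).
Proof.
apply: mcompT => //.
by apply: mfunN; apply: mfunM => //; apply: mfunX; exact: mfunD.
Qed.

(** Total mass of the normal density with mean $-c$ and standard deviation $(2a)^{-1/2}$. *)
Lemma integral_gauss1 (a c : R) : 0 < a ->
  (\int[leb]_x (expR (- (a * (x + c) ^+ 2)))%:E = (Num.sqrt (pi / a))%:E)%E.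
Proof.
move=> a0; pose s : R := Num.sqrt (2 * a)^-1.
have s2 : s ^+ 2 = (2 * a)^-1 by rewrite sqr_sqrtr// invr_ge0 mulr_ge0// ltW.
have sn0 : s != 0 by rewrite gt_eqF// sqrtr_gt0 invr_gt0 mulr_gt0.
have := @integral_normal_pdf R (- c) s.
rewrite normal_pdfE// => h.
have p0 : 0 < normal_peak s by exact: normal_peak_gt0.
have pE : normal_peak s = (Num.sqrt (pi / a))^-1.
  by rewrite /normal_peak s2; congr (Num.sqrt _)^-1; rewrite -mulr_natr; field; rewrite gt_eqF.
transitivity ((normal_peak s)^-1%:E * \int[leb]_x ((normal_peak s)%:E * (expR (- (a * (x + c) ^+ 2)))%:E))%E.
  rewrite integralZlT ?(ltW p0)//.
    by rewrite muleA -EFinM mulVf ?mul1e// gt_eqF.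
  exact: (meas_EFinR (meas_gauss1 _ _)).
rewrite (_ : (\int[leb]_x _ = 1)%E); first by rewrite mule1 pE invrK.
rewrite -[RHS]h; apply: eq_int => x _; rewrite -EFinM; congr ((_ * expR _)%:E).
by rewrite opprK s2 -mulr_natr; field; rewrite gt_eqF.
Qed.

Lemma integral_gauss0 (a : R) : 0 < a ->
  (\int[leb]_x (expR (- (a * x ^+ 2)))%:E = (Num.sqrt (pi / a))%:E)%E.
Proof. by move=> a0; rewrite -(integral_gauss1 0 a0); under [RHS]eq_int do rewrite addr0. Qed.

Lemma integrable_gauss1 (a : R) : 0 < a -> leb.-integrable setT (EFin \o (fun x => expR (- (a * x ^+ 2)))).
Proof.
move=> a0; apply/integrableP; split.
  apply/mEFinP; apply: mcompT => //.
  by apply: mfunN; apply: mfunM => //; apply: mfunX.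
have := integral_gauss1 0 a0; under eq_int do rewrite addr0.
move=> h; rewrite (_ : (\int[leb]_x _ = (Num.sqrt (pi / a))%:E)%E) ?ltry// -h.
by apply: eq_int => x _; rewrite gee0_abs//= lee_fin expR_ge0.
Qed.

(** Integration by parts on the line: exhausting by symmetric intervals, only the difference of [F]
    at opposite integers has to vanish in the limit. *)
Lemma Rintegral_derive0 (F f : R -> R) : continuous f ->
  (forall x : R, is_derive x (1 : R) F (f x)) -> leb.-integrable setT (EFin \o f) ->
  (fun N : nat => F N%:R - F (- N%:R)) @ \oo --> (0 : R) ->
  \int[leb]_x f x = 0.
Proof.
move=> cf dF If F0.
have mf : mfunT f by exact: continuous_measurable_fun.
pose I (N : nat) : set R := [set` `[- N%:R, N%:R]].
have mI N : measurable (I N) by exact: measurable_itv.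
pose g (N : nat) (x : R) : \bar R := (f x * \1_(I N) x)%:E.
have mg N : mfunT (g N).
  by apply/mEFinP; apply: mfunM => //; exact: (mindic (mI N)).
have cg : {ae leb, forall x : mtypeR R, setT x -> (g ^~ x) @ \oo --> (EFin \o f) x}.
  apply: aeW => x _; apply: cvg_near_cst; near=> N.
  rewrite /g /= indicE mem_set ?mulr1// /I /= in_itv /= -ler_norml.
  by near: N; exact: nbhs_infty_ger.
have bg : {ae leb, forall (x : R) (N : nat), setT x -> (`|g N x| <= `|(f x)%:E|)%E}.
  apply: aeW => x N _; rewrite /g indicE; case: (_ \in _); first by rewrite mulr1.
  by rewrite mulr0 abse0.
have IAf : leb.-integrable setT (fun x => `|(f x)%:E|)%E.
  exact: (integrable_abse If).
have mfe : mfunT (EFin \o f) by meas.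
have [_ _ h] := @dominated_convergence _ (mtypeR R) R leb setT measurableT g (EFin \o f) _ mg mfe cg IAf bg.
have e N : (\int[leb]_x g N x = (F N%:R - F (- N%:R))%:E)%E.
  have -> : (\int[leb]_x g N x = \int[leb]_(x in I N) (f x)%:E)%E.
    rewrite [RHS]integral_mkcond; apply: eq_int => x _; rewrite /g /patch indicE.
    by case: ifP => _; rewrite ?mulr1 ?mulr0.
  rewrite /I; case: N => [|N].
    by rewrite oppr0 subrr set_itv1 integral_set1.
  rewrite (@continuous_FTC2 _ f F) ?EFinB//.
  - by rewrite -subr_gt0 opprK addr_gt0.
  - exact: continuous_subspaceT.
  - have dc x : {for x, continuous F}.
      by apply: differentiable_continuous; apply/derivable1_diffP; have [] := dF x.
    split=> [x _||]; first by have [] := dF x.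
      by apply: cvg_at_right_filter; exact: dc.
    by apply: cvg_at_left_filter; exact: dc.
  - by move=> x _; rewrite derive1E; have [_ ->] := dF x.
have h' : (fun N => (F N%:R - F (- N%:R))%:E) @ \oo --> (\int[leb]_x (f x)%:E)%E.
  by move: h; rewrite (_ : [sequence _]_n = (fun N => (F N%:R - F (- N%:R))%:E))//; apply/funext => N; rewrite /= e.
have h0 : (fun N => (F N%:R - F (- N%:R))%:E) @ \oo --> (0%:E : \bar R).
  by apply: cvg_EFin => //; exact: nearW.
by rewrite /Rintegral (cvg_unique _ h' h0).
Unshelve. all: by end_near.
Qed.

(** Half of the Gaussian absorbs the factor [|x|]: $|x|\le(1+2/a)e^{ax^2/2}$. *)
Lemma integrable_x_gauss1 (a : R) : 0 < a ->
  leb.-integrable setT (EFin \o (fun x => `|x| * expR (- (a * x ^+ 2)))).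
Proof.
move=> a0; have a20 : 0 < a / 2 by rewrite divr_gt0.
have := @integrable_EFinZ R _ _ leb (1 + 2 / a) _ (integrable_gauss1 a20).
apply: le_integrable => //.
  have := meas_gauss1 a 0; under eq_fun do rewrite addr0.
  by move=> mg; exact: (meas_EFinR (mfunM (@normr_measurable R setT) mg)).
move=> x _ /=; rewrite lee_fin (ger0_norm (mulr_ge0 (normr_ge0 _) (expR_ge0 _))).
have c0 : 0 <= 1 + 2 / a by rewrite addr_ge0// divr_ge0// ltW.
rewrite (ger0_norm (mulr_ge0 c0 (expR_ge0 _))).
have -> : - (a * x ^+ 2) = - (a / 2 * x ^+ 2) - (a / 2 * x ^+ 2) by field.
rewrite expRD mulrA; apply: ler_wpM2r; first exact: expR_ge0.
rewrite expRN ler_pdivrMr ?expR_gt0//.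
apply: (@le_trans _ _ ((1 + 2 / a) * (1 + a / 2 * x ^+ 2))); last first.
  by apply: ler_wpM2l => //; exact: expR_ge1Dx.
have : `|x| <= 1 + x ^+ 2.
  rewrite -(real_normK (num_real x)); have := normr_ge0 x; nra.
move=> /le_trans; apply.
have -> : (1 + 2 / a) * (1 + a / 2 * x ^+ 2) = 1 + x ^+ 2 + (2 / a + a / 2 * x ^+ 2).
  by field; rewrite gt_eqF.
rewrite lerDl; apply: addr_ge0; first by rewrite divr_ge0// ltW.
by apply: mulr_ge0; [exact: ltW|exact: sqr_ge0].
Qed.

(** As a function of the frequency the integral $H$ solves $H'=-\frac z{2a}H$, so $H(z)e^{z^2/(4a)}$
    is constant. The derivative is taken under the integral sign and the equation comes from an
    integration by parts. *)
Lemma Rintegral_cos_gauss (a xi : R) : 0 < a ->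
  \int[leb]_x (cos (xi * x) * expR (- (a * x ^+ 2))) =
  Num.sqrt (pi / a) * expR (- (xi ^+ 2 / (4 * a))).
Proof.
move=> a0.
pose e x := expR (- (a * x ^+ 2)) : R.
have de (x : R) : is_derive x (1 : R) e (- (2 * a * x) * e x).
  rewrite /e; apply: is_derive_eq; rewrite !scaler1 /GRing.scale /=; ring.
pose H z := \int[leb]_x (cos (z * x) * e x).
have ce : continuous e.
  by move=> x; apply: differentiable_continuous; apply/derivable1_diffP; have [] := de x.
have me : mfunT e by exact: continuous_measurable_fun.
have mc z : mfunT (fun x : R => cos (z * x)).
  by apply: mcompT; [apply: continuous_measurable_fun; exact: continuous_cos|exact: mfunM].
have ms z : mfunT (fun x : R => sin (z * x)).
  by apply: mcompT; [apply: continuous_measurable_fun; exact: continuous_sin|exact: mfunM].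
have e0 x : 0 <= e x by exact: expR_ge0.
have Ic z : leb.-integrable setT (EFin \o (fun x => cos (z * x) * e x)).
  apply: le_integrable (integrable_gauss1 a0) => //.
    exact: (meas_EFinR (mfunM (mc z) me)).
  move=> x _ /=; rewrite lee_fin normrM ler_piMl//.
  by rewrite ler_norml cos_geN1 cos_le1.
have Is z : leb.-integrable setT (EFin \o (fun x => x * sin (z * x) * e x)).
  apply: le_integrable (integrable_x_gauss1 a0) => //.
    exact: (meas_EFinR (mfunM (mfunM (@measurable_id _ R setT) (ms z)) me)).
  move=> x _ /=; rewrite lee_fin !normrM normr_id ler_wpM2r// ler_piMr//.
  by rewrite ler_norml sin_geN1 sin_le1.
have key z : \int[leb]_x (x * sin (z * x) * e x) = z / (2 * a) * H z.
  (* The derivative of $\sin(zx)e^{-ax^2}$ has integral 0; its two terms are the two sides of the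
     identity. *)
  pose F x := sin (z * x) * e x.
  pose f x := z * (cos (z * x) * e x) + - (2 * a) * (x * sin (z * x) * e x).
  have dF (x : R) : is_derive x (1 : R) F (f x).
    have h1 : is_derive x (1 : R) (fun x : R => sin (z * x)) (z * cos (z * x)).
      by apply: is_derive_eq; rewrite !scaler1 /GRing.scale /= mulrC.
    rewrite /F; apply: is_derive_eq; rewrite /f /GRing.scale /=; ring.
  have cf : continuous f.
    have cc : continuous (fun x : R => z * x) by move=> x; exact: mulrl_continuous.
    move=> x; apply: cvgD.
      apply: cvgM; first exact: cvg_cst.
      by apply: cvgM; [apply: continuous_comp; [exact: cc|exact: continuous_cos]|exact: ce].
    apply: cvgM; first exact: cvg_cst.
    apply: cvgM; last exact: ce.
    by apply: cvgM; [exact: cvg_id|apply: continuous_comp; [exact: cc|exact: continuous_sin]].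
  have If : leb.-integrable setT (EFin \o f).
    have := integrableD measurableT (integrable_EFinZ z (Ic z)) (integrable_EFinZ (- (2 * a)) (Is z)).
    by apply: eq_integrable => //= x _; rewrite /f EFinD.
  have F0 : (fun N : nat => F N%:R - F (- N%:R)) @ \oo --> (0 : R).
    (* With this $m$ one has $m(N+1)\le1+aN^2\le e^{aN^2}$, so the boundary terms are below a
       multiple of $1/(N+1)$. *)
    pose m := Num.min 1 a; have m0 : 0 < m by rewrite lt_min ltr01.
    have eN (N : nat) : e N%:R <= m^-1 * harmonic N.
      rewrite /e /harmonic /= expRN -invfM lef_pV2 ?posrE ?expR_gt0 ?mulr_gt0//.
      apply: le_trans (expR_ge1Dx _); rewrite -natr1 mulrDr mulr1 addrC lerD//.
        by rewrite ge_min lexx.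
      apply: (@le_trans _ _ (a * N%:R)).
        by apply: ler_wpM2r => //; rewrite ge_min lexx orbT.
      by apply: ler_wpM2l; [exact: ltW|rewrite -natrX ler_nat; case: N => // N; rewrite leq_pmulr].
    have FN (N : nat) : `|F N%:R - F (- N%:R)| <= 2 * m^-1 * harmonic N.
      have FE x : `|F x| <= e x.
        by rewrite /F normrM (ger0_norm (e0 x)) ler_piMl// ler_norml sin_geN1 sin_le1.
      have eo : e (- N%:R) = e N%:R by rewrite /e sqrrN.
      have := ler_normB (F N%:R) (F (- N%:R)); have := FE N%:R; have := FE (- N%:R).
      rewrite eo; have := eN N; lra.
    have h0 : (fun N => 2 * m^-1 * harmonic N) @ \oo --> (0 : R).
      rewrite -(mulr0 (2 * m^-1)); apply: cvgM; [exact: cvg_cst|exact: cvg_harmonic].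
    apply/norm_cvg0P; apply: (squeeze_cvgr _ (cvg_cst 0) h0).
    by apply: nearW => N; rewrite normr_ge0 FN.
  have := Rintegral_derive0 cf dF If F0.
  rewrite /f RintegralD//; [|exact: integrable_EFinZ|exact: integrable_EFinZ].
  rewrite !RintegralZl// -/(H z) => h.
  apply: (mulfI (_ : 2 * a != 0)); first by rewrite gt_eqF// mulr_gt0.
  have -> : 2 * a * (z / (2 * a) * H z) = z * H z by field; rewrite gt_eqF.
  move: h; set J := Rintegral _ _ _; lra.
have dH z : is_derive z (1 : R) H (- (z / (2 * a)) * H z).
  have dp (y x : R) : is_derive y (1 : R) (fun y : R => cos (y * x) * e x) (- (x * sin (y * x) * e x)).
    apply: is_derive_eq; rewrite !scaler1 /GRing.scale /=; ring.
  have pE y x : partial1of2 (fun y x => cos (y * x) * e x) y x = - (x * sin (y * x) * e x).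
    by rewrite /partial1of2 derive1E; have [_ ->] := dp y x.
  have zin : `](z - 1), (z + 1)[%classic z by rewrite /= in_itv /= ltrBlDr ltrDl ltr01.
  have := @cvg_differentiation_under_integral R _ _ leb (fun y x => cos (y * x) * e x) setT measurableT
    z (z - 1) (z + 1) zin (fun y _ => Ic y).
  have dd y x : `](z - 1), (z + 1)[%classic y -> setT x -> derivable (fun y : R => cos (y * x) * e x) y 1.
    by move=> _ _; have [] := dp y x.
  have bd y x : `](z - 1), (z + 1)[%classic y -> setT x ->
      `|partial1of2 (fun y x => cos (y * x) * e x) y x| <= `|x| * e x.
    move=> _ _; rewrite pE normrN !normrM (ger0_norm (e0 x)) ler_wpM2r// ler_piMr//.
    by rewrite ler_norml sin_geN1 sin_le1.
  move=> /(_ dd (fun x => `|x| * e x) (fun x => mulr_ge0 (normr_ge0 _) (e0 x)) (integrable_x_gauss1 a0) bd) h.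
  have L : \int[leb]_y partial1of2 (fun y x => cos (y * x) * e x) z y = - (z / (2 * a)) * H z.
    under eq_Rintegral do rewrite pE -mulN1r.
    by rewrite RintegralZl// key mulN1r mulNr.
  rewrite L in h.
  have h' : (fun h => h^-1 *: ((H \o shift z) (h *: (1 : R)) - H z)) @ 0^' --> - (z / (2 * a)) * H z.
    rewrite (_ : (fun h => _) = (fun h => h^-1 *: (H (h + z) - H z)))//.
    by apply/funext => k /=; rewrite /GRing.scale /= mulr1.
  apply: DeriveDef; first by apply/cvg_ex; eexists; exact: h'.
  exact: cvg_lim h'.
have cst : forall z, H z * expR (z ^+ 2 / (4 * a)) = H 0 * expR (0 ^+ 2 / (4 * a)).
  move=> z; apply: (@is_derive_0_is_cst _ (fun z => H z * expR (z ^+ 2 / (4 * a)))) => x.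
  have := dH x => dHx.
  apply: is_derive_eq; rewrite !scaler1 /GRing.scale /=; field; by rewrite gt_eqF.
have H0 : H 0 = Num.sqrt (pi / a).
  rewrite /H /Rintegral; under eq_int do rewrite mul0r cos0 mul1r /e.
  by rewrite integral_gauss0.
have := cst xi; rewrite expr0n mul0r expR0 mulr1 H0 => h.
by rewrite expRN -[LHS]/(H xi) -h mulfK// gt_eqF// expR_gt0.
Unshelve. all: by end_near.
Qed.

End Gauss1.

Section GaussN.
Context (R : realType).
Local Notation leb := (@lebesgue_measure R).
Local Notation lebn := (lebesgue_cV R).

(** Completion of the square in the first coordinate: [c] is the rest of the first column divided by
    the pivot and [S] is the Schur complement. It lets Gaussian integrals be computed one coordinate
    at a time. *)
Lemma schur_form n (A : 'M[R]_n.+1) : Defs.symmetric A -> A ord0 ord0 != 0 ->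
  exists (c : 'cV[R]_n) (S : 'M[R]_n), [/\ Defs.symmetric S, \det A = A ord0 ord0 * \det S &
    forall t v, dotmul (A *m cons_cV (t, v)) (cons_cV (t, v)) =
      A ord0 ord0 * (t + dotmul c v) ^+ 2 + dotmul (S *m v) v].
Proof.
move=> symA a0; set a := A ord0 ord0 in a0 *.
pose A' : 'M[R]_(1 + n) := A.
pose b : 'cV[R]_n := dlsubmx A'.
have o0 : lshift n (0 : 'I_1) = ord0 :> 'I_n.+1 by apply/val_inj.
have ulE : ulsubmx A' = a%:M.
  by apply/matrixP => i j; rewrite (ord1 i) (ord1 j); rewrite !mxE mulr1n o0.
have urE : ursubmx A' = b^T by rewrite /b /A' trmx_dlsub symA.
have drE : (drsubmx A')^T = drsubmx A' by rewrite trmx_drsub symA.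
have AE : A' = block_mx a%:M b^T b (drsubmx A').
  by rewrite -[LHS](submxK A') ulE urE.
pose S := drsubmx A' - a^-1 *: (b *m b^T).
exists (a^-1 *: b), S; split.
- by rewrite /Defs.symmetric /S linearB linearZ /= drE trmx_mul trmxK.
- have -> : A = block_mx 1%:M 0 (a^-1 *: b) 1%:M *m block_mx a%:M b^T 0 S.
    rewrite mulmx_block !mul1mx !mul0mx !addr0 [LHS]AE; congr (@block_mx R 1 n 1 n _ _ _ _).
      by rewrite mul_mx_scalar scalerA mulfV ?scale1r.
    by rewrite /S -scalemxAl addrC subrK.
  transitivity (\det (block_mx 1%:M 0 (a^-1 *: b) 1%:M : 'M[R]_(1 + n)) *
      \det (block_mx a%:M b^T 0 S : 'M[R]_(1 + n))); first exact: (@det_mulmx R (1 + n)).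
  by rewrite (@det_lblock R 1 n) (@det_ublock R 1 n) !det1 !mul1r det_scalar1.
- move=> t v; rewrite /cons_cV /=.
  have -> : A *m col_mx (const_mx t : 'cV_1) v =
      col_mx (const_mx (a * t + dotmul b v) : 'cV_1) (t *: b + drsubmx A' *m v).
    have AEm (u : 'cV[R]_(1 + n)) : A *m u = block_mx a%:M b^T b (drsubmx A') *m u by rewrite -AE.
    rewrite AEm mul_block_col; congr (@col_mx R 1 n 1 _ _).
      apply/matrixP => i j; rewrite (ord1 i) (ord1 j); rewrite !mxE /dotmul mxE; congr (_ + _).
      by rewrite big_ord1 !mxE mulr1n.
    congr (_ + _); apply/matrixP => i j; rewrite [j]ord1 !mxE big_ord1 !mxE mulrC.
    by [].
  have dc (x y : 'cV[R]_1) (u w : 'cV[R]_n) : dotmul (col_mx x u) (col_mx y w) = dotmul x y + dotmul u w.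
    by rewrite /dotmul tr_col_mx mul_row_col mxE.
  rewrite dc [dotmul (const_mx _) _]dotmulE big_ord1 !mxE dotmulDl !dotmulZl /S mulmxBl dotmulDl dotmulNl.
  rewrite -scalemxAl dotmulZl -mulmxA.
  have -> : b *m (b^T *m v) = dotmul b v *: b.
    by rewrite /dotmul -mul_mx_scalar -mx11_scalar.
  by rewrite dotmulZl; field.
Qed.

Lemma pos_def_schur n (A : 'M[R]_n.+1) c S : pos_def A ->
  (forall t v, dotmul (A *m cons_cV (t, v)) (cons_cV (t, v)) =
      A ord0 ord0 * (t + dotmul c v) ^+ 2 + dotmul (S *m v) v) -> pos_def S.
Proof.
move=> pdA h v v0; have := pdA (cons_cV (- dotmul c v, v)).
rewrite h addNr expr0n mulr0 add0r; apply; apply: contra v0 => /eqP e.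
apply/eqP/matrixP => i j; rewrite [j]ord1.
by rewrite -(cons_cVS (- dotmul c v) v) e !mxE.
Qed.

Lemma pos_def_entry00 n (A : 'M[R]_n.+1) : pos_def A -> 0 < A ord0 ord0.
Proof.
move=> pdA; have := pdA (delta_mx ord0 ord0); rewrite -colE dotmulE.
rewrite (bigD1 ord0)//= big1 ?addr0; last first.
  by move=> i i0; rewrite !mxE (negbTE i0) mulr0.
rewrite !mxE eqxx mulr1; apply; apply/eqP => /matrixP/(_ ord0 ord0); rewrite !mxE eqxx.
exact/eqP/oner_neq0.
Qed.

Lemma meas_quad n (A : 'M[R]_n) :
  mfunT (fun x : 'cV[R]_n => dotmul (A *m x) x).
Proof. by apply: mmx_dotmul; [apply: mmxM; [exact: mmx_cst|exact: mmx_id]|exact: mmx_id]. Qed.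

(** Induction on the dimension: the integral over the first coordinate is a shifted Gaussian equal
    to $\sqrt{\pi/a}$ whatever the others are, and what remains is the form of the Schur
    complement. *)
Lemma integral_gauss_pd n (A : 'M[R]_n) : Defs.symmetric A -> pos_def A ->
  0 < \det A /\ (\int[lebn n]_x (expR (- dotmul (A *m x) x))%:E =
    (Num.sqrt pi ^+ n / Num.sqrt (\det A))%:E)%E.
Proof.
elim: n A => [|n IHn] A symA pdA.
  rewrite det_mx00 ltr01 expr0 sqrtr1 invr1 mulr1; split => //.
  under eq_int do rewrite dotmul0l oppr0 expR0.
  by rewrite integral_cst//= /lebesgue_cV/= diracE mem_set// mule1.
have a0 := pos_def_entry00 pdA; set a := A ord0 ord0 in a0.
have an0 : A ord0 ord0 != 0 by rewrite gt_eqF.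
have [c [S [symS detA h]]] := schur_form symA an0.
have [dS IS] := IHn S symS (pos_def_schur pdA h).
have dA : 0 < \det A by rewrite detA mulr_gt0.
split => //.
have mq k (B : 'M[R]_k) : mfunT (fun x : 'cV[R]_k => (expR (- dotmul (B *m x) x))%:E).
  by apply/mEFinP; apply: mcompT => //; apply: mfunN; exact: meas_quad.
have q0 k (B : 'M[R]_k) (x : 'cV[R]_k) : (0 <= (expR (- dotmul (B *m x) x))%:E)%E.
  by rewrite lee_fin expR_ge0.
rewrite (integral_cVS (mq _ A) (q0 _ A)).
rewrite (@fubini_tonelli _ _ (mtypeR R) _ R leb (lebn n)
  (fun z => (expR (- dotmul (A *m cons_cV z) (cons_cV z)))%:E)); last 2 first.
- exact: (meas_cV_comp (mq _ A)).
- by move=> z.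
transitivity (\int[lebn n]_v ((Num.sqrt (pi / a))%:E * (expR (- dotmul (S *m v) v))%:E))%E.
  apply: eq_int => v _.
  under eq_int do rewrite h opprD expRD mulrC EFinM.
  rewrite integralZlT ?expR_ge0//; last first.
    exact: (meas_EFinR (meas_gauss1 _ _)).
  by rewrite integral_gauss1// muleC.
rewrite integralZlT ?sqrtr_ge0//; last exact: mq.
rewrite IS -EFinM; congr EFin.
have -> : Num.sqrt (pi / a) = Num.sqrt pi / Num.sqrt a.
  by rewrite sqrtrM ?pi_ge0// sqrtrV// ltW.
have -> : Num.sqrt (\det A) = Num.sqrt a * Num.sqrt (\det S).
  by rewrite detA -/a sqrtrM// ltW.
have sa : Num.sqrt a != 0 by rewrite gt_eqF// sqrtr_gt0.
have sS : Num.sqrt (\det S) != 0 by rewrite gt_eqF// sqrtr_gt0.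
by rewrite exprS; field; rewrite sa sS.
Qed.

(** Read off from Gaussian integrals: a larger form has a smaller integral, and this integral is
    $\pi^{n/2}/\sqrt{\det}$. Spectral theory does not enter. *)
Lemma det_pos_def_le n (A B : 'M[R]_n) : Defs.symmetric A -> pos_def A -> Defs.symmetric B -> pos_def B ->
  (forall x, dotmul (A *m x) x <= dotmul (B *m x) x) -> \det A <= \det B.
Proof.
move=> sA pA sB pB AB.
have [dA IA] := integral_gauss_pd sA pA; have [dB IB] := integral_gauss_pd sB pB.
have mq (C : 'M[R]_n) : mfunT (fun x : 'cV[R]_n => (expR (- dotmul (C *m x) x))%:E).
  by apply/mEFinP; apply: mcompT => //; apply: mfunN; exact: meas_quad.
have : (\int[lebn n]_x (expR (- dotmul (B *m x) x))%:E <= \int[lebn n]_x (expR (- dotmul (A *m x) x))%:E)%E.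
  apply: le_integralT; [|exact: (mq B)|exact: (mq A)|].
    nonneg.
  by move=> x; rewrite lee_fin ler_expR lerN2.
rewrite IA IB lee_fin ler_pM2l ?exprn_gt0 ?sqrtr_gt0 ?pi_gt0//.
by rewrite lef_pV2 ?posrE ?sqrtr_gt0// ler_sqrt// ltW.
Qed.

End GaussN.

Section FourierGauss.
Context (R : realType).
Local Notation leb := (@lebesgue_measure R).
Local Notation lebn := (lebesgue_cV R).
Local Notation vec n := 'cV[R]_n.

Lemma Rintegral_cVS n (g : 'cV[R]_n.+1 -> R) : (lebn n.+1).-integrable setT (EFin \o g) ->
  \int[lebn n.+1]_x g x = \int[leb]_a \int[lebn n]_v g (cons_cV (a, v)).
Proof.
move=> Ig; have mg := measurable_int _ Ig.
have Ic : (leb \x lebn n)%E.-integrable setT (EFin \o (fun z => g (cons_cV z))).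
  apply/integrableP; split; first exact: (meas_cV_comp mg).
  have /integrableP[_] := Ig; apply: le_lt_trans.
  have ma : mfunT (abse \o (EFin \o g)) by exact: mcompT.
  rewrite (integral_cVS ma (fun x => abse_ge0 _)) fubini_tonelli1//.
  exact: (meas_cV_comp ma).
rewrite -(Rintegral_prod Ic) /Rintegral; congr fine.
transitivity (\int[pushforward (leb \x lebn n) (@cons_cV R n)]_x (g x)%:E)%E; first by [].
rewrite (integral_pushforward (@measurable_cons_cV R n) mg)//.
Qed.

Lemma cintegral_cVS n (f : 'cV[R]_n.+1 -> R[i]) : cintegrable (lebn n.+1) f ->
  cintegral (lebn n.+1) setT f =
  cintegral leb setT (fun a => cintegral (lebn n) setT (fun v => f (cons_cV (a, v)))).
Proof.
move=> If; rewrite /cintegral /=; congr Complex.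
  exact: (Rintegral_cVS (cintg_Re If)).
exact: (Rintegral_cVS (cintg_Im If)).
Qed.

Lemma integral_gauss_mul n (M : 'M[R]_n) (c : R) : 0 < c -> \det M != 0 ->
  (\int[lebn n]_x (expR (- (c * dotmul (M *m x) (M *m x))))%:E =
   (Num.sqrt pi ^+ n / (Num.sqrt c ^+ n * `|\det M|))%:E)%E.
Proof.
move=> c0 dM; pose A := c *: (M^T *m M).
have AE x : dotmul (A *m x) x = c * dotmul (M *m x) (M *m x).
  by rewrite /A -scalemxAl dotmulZl -mulmxA dotmul_mul trmxK.
have sA : Defs.symmetric A by rewrite /Defs.symmetric /A linearZ /= trmx_mul trmxK.
have pA : pos_def A.
  move=> x x0; rewrite AE mulr_gt0//; apply: dotmul_gt0; apply: contra x0 => /eqP Mx.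
  have uM : M \in unitmx by rewrite unitmxE unitfE.
  by rewrite -(mulKmx uM x) Mx mulmx0.
have [dA IA] := integral_gauss_pd sA pA.
have -> : (\int[lebn n]_x (expR (- (c * dotmul (M *m x) (M *m x))))%:E =
  \int[lebn n]_x (expR (- dotmul (A *m x) x))%:E)%E.
  by apply: eq_int => x _; rewrite AE.
rewrite IA; congr (_ / _)%:E; rewrite /A detZ det_mulmx det_tr -expr2.
rewrite sqrtrM ?exprn_ge0 ?(ltW c0)// sqrtr_sqr; congr (_ * _).
elim: (n) => [|k IHk]; first by rewrite !expr0 sqrtr1.
by rewrite !exprS sqrtrM ?(ltW c0)// IHk.
Qed.

Lemma mEFin_cV n (f : vec n -> R) :
  mfunT f -> mfunT (EFin \o f).
Proof. by move=> mf; exact/mEFinP. Qed.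

Definition gaussn n (e : R) (x : 'cV[R]_n) : R := expR (- (e * dotmul x x)).

Lemma gaussn_ge0 n e (x : 'cV[R]_n) : 0 <= gaussn e x.
Proof. exact: expR_ge0. Qed.

Lemma gaussn_le1 n e (x : 'cV[R]_n) : 0 <= e -> gaussn e x <= 1.
Proof. by move=> e0; rewrite /gaussn -expR0 ler_expR oppr_le0 mulr_ge0// dotmul_ge0. Qed.

Lemma meas_gaussn n e : mfunT (@gaussn n e : vec n -> R).
Proof.
apply: mcompT => //; apply: mfunN; apply: mfunM => //.
by apply: mmx_dotmul; exact: mmx_id.
Qed.

Lemma integral_gaussn n e : 0 < e ->
  (\int[lebn n]_x (gaussn e x)%:E = (Num.sqrt (pi / e) ^+ n)%:E)%E.
Proof.
move=> e0; have := @integral_gauss_mul n 1%:M e e0; rewrite det1 oner_neq0 => /(_ isT).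
rewrite normr1 mulr1 -expr_div_n.
rewrite (_ : Num.sqrt (pi / e) = Num.sqrt pi / Num.sqrt e); last by rewrite sqrtrM ?pi_ge0// sqrtrV// ltW.
by move=> <-; apply: eq_int => x _; rewrite mul1mx.
Qed.

Lemma cmeas_gaussn n e : cmeasurable (fun x : vec n => ((gaussn e x)%:C)%C).
Proof. by apply: cmeas_real; exact: meas_gaussn. Qed.

Lemma integrable_gaussn n e : 0 < e -> (lebn n).-integrable setT (EFin \o (@gaussn n e)).
Proof.
move=> e0; apply/integrableP; split; first exact: (mEFin_cV (@meas_gaussn n e)).
under eq_int do rewrite gee0_abs ?lee_fin ?gaussn_ge0//.
by rewrite integral_gaussn// ltry.
Qed.

Lemma cintg_expi_gaussn n e (theta : 'cV[R]_n -> R) : 0 < e ->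
  mfunT (theta : vec n -> R) ->
  cintegrable (lebn n) (fun x => expi (theta x) * ((gaussn e x)%:C)%C).
Proof.
move=> e0 mt; apply: (cintg_le _ (integrable_gaussn n e0)).
  by apply: cmeasM; [exact: cmeas_expi|exact: cmeas_gaussn].
by move=> x; rewrite cabsM cabs_expi cabs_real mul1r ger0_norm// gaussn_ge0.
Qed.

Lemma meas_dotmull n (w : 'cV[R]_n) : mfunT (fun x : vec n => dotmul x w).
Proof. by apply: mmx_dotmul; [exact: mmx_id|exact: mmx_cst]. Qed.

Lemma cintegral_gauss1_ft (e b : R) : 0 < e ->
  cintegral leb setT (fun a : R => expi (a * b) * ((expR (- (e * a ^+ 2)))%:C)%C) =
  ((Num.sqrt (pi / e) * expR (- (b ^+ 2 / (4 * e))))%:C)%C.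
Proof.
move=> e0; rewrite /cintegral; apply: complexE => /=.
  rewrite -Rintegral_cos_gauss//; apply: eq_Rintegral => a _.
  by rewrite /= mulr0 subr0 [b * a]mulrC.
pose g (a : R) := sin (a * b) * expR (- (e * a ^+ 2)).
have mg : mfunT g.
  apply: mfunM; last by have := meas_gauss1 e (0 : R); under eq_fun do rewrite addr0.
  by apply: mcompT; [apply: continuous_measurable_fun; exact: continuous_sin|exact: mfunM].
have Ig : leb.-integrable setT (EFin \o g).
  apply: le_integrable (integrable_gauss1 e0) => //; first exact: (meas_EFinR mg).
  move=> x _ /=; rewrite lee_fin normrM ler_piMl//.
  by rewrite ler_norml sin_geN1 sin_le1.
rewrite (_ : Rintegral _ _ _ = \int[leb]_a g a); last first.
  by apply: eq_Rintegral => a _; rewrite /= mulr0 add0r.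
have h : \int[leb]_a g (- a) = \int[leb]_a g a.
  exact: (@Rintegral_invariant R _ _ leb (-%R) (@integral_lebesgue_opp R) g mg).
have : \int[leb]_a g (- a) = - \int[leb]_a g a.
  rewrite -mulN1r -RintegralZl//; apply: eq_Rintegral => a _.
  by rewrite /g mulNr sinN sqrrN mulN1r mulNr.
rewrite h; set J := Rintegral _ _ _; lra.
Qed.

(** Phase and Gaussian both factor over the coordinates, so the one-dimensional transform is
    iterated. *)
Lemma cintegral_gaussn_ft n (e : R) (w : 'cV[R]_n) : 0 < e ->
  cintegral (lebn n) setT (fun x => expi (dotmul x w) * ((gaussn e x)%:C)%C) =
  ((Num.sqrt (pi / e) ^+ n * expR (- (dotmul w w / (4 * e))))%:C)%C.
Proof.
move=> e0; elim: n w => [|n IHn] w.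
  rewrite expr0 dotmul0l mul0r oppr0 expR0 mul1r.
  rewrite (@eq_cintegral _ _ _ _ _ (fun=> 1)); last first.
    by move=> x; rewrite /gaussn !dotmul0l expi0 mulr0 oppr0 expR0 mulr1.
  have L (c : R) : \int[lebn 0]_x c = c.
    have d1 : lebn 0 setT = 1%E by rewrite /lebesgue_cV /= diracT.
    by rewrite Rintegral_cst// (_ : fine _ = 1) ?mulr1//; exact: (congr1 fine d1).
  by rewrite /cintegral !L.
rewrite cintegral_cVS; last by apply: cintg_expi_gaussn => //; exact: meas_dotmull.
rewrite (cons_cV_inj w); set b := w _ _; set u := \col_i _.
have E a v : expi (dotmul (cons_cV (a, v)) (cons_cV (b, u))) * ((gaussn e (cons_cV (a, v)))%:C)%C =
    (expi (a * b) * ((expR (- (e * a ^+ 2)))%:C)%C) * (expi (dotmul v u) * ((gaussn e v)%:C)%C).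
  rewrite /gaussn !dotmul_cons expiD mulrDr opprD expRD expr2 rmorphM /=; ring.
transitivity (cintegral leb setT (fun a => ((Num.sqrt (pi / e) ^+ n * expR (- (dotmul u u / (4 * e))))%:C)%C *
    (expi (a * b) * ((expR (- (e * a ^+ 2)))%:C)%C))).
  apply: eq_cintegral => a; rewrite mulrC -IHn -cintegralZ.
    by apply: eq_cintegral => v; rewrite E.
  by apply: cintg_expi_gaussn => //; exact: meas_dotmull.
rewrite cintegralZ; last first.
  apply: (cintg_le _ (integrable_gauss1 e0)).
    apply: cmeasM; first by apply: cmeas_expi; exact: mfunM.
    apply: cmeas_real.
    by have := meas_gauss1 e (0 : R); under eq_fun do rewrite addr0.
  by move=> x; rewrite cabsM cabs_expi cabs_real mul1r ger0_norm// expR_ge0.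
rewrite cintegral_gauss1_ft// -rmorphM /= dotmul_cons; congr ((_%:C)%C).
rewrite (_ : - ((b * b + _) / _) = - (b ^+ 2 / (4 * e)) + - (dotmul u u / (4 * e))).
  have aux (X E1 E2 : R) : X ^+ n * E1 * (X * E2) = X ^+ n.+1 * (E2 * E1) by rewrite exprS; ring.
  by rewrite expRD; exact: aux.
by rewrite -opprD -mulrDl.
Qed.

End FourierGauss.

(** * The TT* expansion and oscillatory integrals *)

Section TTStar.
Context d1 d2 (X : measurableType d1) (Z : measurableType d2) (R : realType)
  (mu : sfmeasure X R) (nu : sfmeasure Z R).

Lemma cintg_mulb d (T : measurableType d) (m : {measure set T -> \bar R})
    (h f : T -> R[i]) (c : R) : cmeasurable h -> (forall x, cabs (h x) <= c) ->
  cintegrable m f -> cintegrable m (fun x => h x * f x).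
Proof.
move=> mh hc If; have [mf _] := If.
have := integrableZl measurableT c (cintg_cabs If).
move=> /(cintg_le (cmeasM mh mf)); apply => x.
by rewrite cabsM ler_wpM2r ?cabs_ge0.
Qed.

Lemma integral_product_lty (F : Z * X -> R) (a : Z -> R) (b : X -> R) :
  mfunT F -> (forall z, 0 <= F z) ->
  nu.-integrable setT (EFin \o a) -> mu.-integrable setT (EFin \o b) ->
  (forall z, 0 <= a z) -> (forall x, 0 <= b x) ->
  (forall z x, F (z, x) <= a z * b x) ->
  (\int[nu]_z \int[mu]_x (F (z, x))%:E < +oo)%E.
Proof.
move=> mF F0 /integrableP[ma aoo] /integrableP[mb boo] a0 b0 Fab.
have nE (T : Type) (h : T -> R) x : 0 <= h x -> `|(EFin \o h) x|%E = (h x)%:E.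
  by move=> h0; rewrite /= ger0_norm.
have bfin : (\int[mu]_x (b x)%:E)%E \is a fin_num.
  rewrite ge0_finE; last by apply: int_ge0 => x _; rewrite lee_fin.
  by apply: le_lt_trans boo; rewrite le_eqVlt; apply/orP; left; apply/eqP/eq_int => x _; rewrite nE.
pose c := fine (\int[mu]_x (b x)%:E)%E.
have c0 : 0 <= c by rewrite fine_ge0// int_ge0// => x _; rewrite lee_fin.
have mFe : mfunT (fun z => (F z)%:E) by meas.
apply: (@le_lt_trans _ _ (\int[nu]_z (c%:E * (a z)%:E))%E); last first.
  rewrite integralZlT// ?lte_mul_pinfty ?lee_fin//.
  by apply: le_lt_trans aoo; rewrite le_eqVlt; apply/orP; left; apply/eqP/eq_int => x _; rewrite nE.
apply: le_integralT.
- by move=> z; apply: int_ge0 => x _; rewrite lee_fin.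
- by apply: (@mfubiniF _ _ Z X R mu (fun z => (F z)%:E)) => // z; rewrite lee_fin.
- meas.
move=> z; rewrite muleC /c fineK// -integralZlT//.
apply: le_integralT.
- by move=> x; rewrite lee_fin.
- exact: (meas_slice mFe).
- meas.
- by move=> x; rewrite -EFinM lee_fin.
Qed.

(** Two applications of Fubini open the square $g\bar g$ and move the [z] integral innermost. A
    weighted $L^2$ norm of an oscillatory transform thus becomes a form in $f$ whose kernel can be
    computed. *)
Lemma cintegral_ttstar (e : X * Z -> R[i]) (f : X -> R[i]) (w : Z -> R[i]) :
  cmeasurable e -> (forall z, cabs (e z) <= 1) -> cintegrable mu f -> cintegrable nu w ->
  let g z := cintegral mu setT (fun x => e (x, z) * f x) in
  cintegral nu setT (fun z => w z * (g z * conjc (g z))) =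
  cintegral mu setT (fun x => f x * cintegral mu setT (fun y => conjc (f y) *
    cintegral nu setT (fun z => w z * (e (x, z) * conjc (e (y, z)))))).
Proof.
move=> me e1 If Iw g; have [mf _] := If; have [mw _] := Iw.
have mex (x : X) : cmeasurable (fun z => e (x, z)) by exact: cmeas_comp me _.
have mez (z : Z) : cmeasurable (fun x => e (x, z)) by exact: cmeas_comp me _.
have mes : cmeasurable (fun p : Z * X => e (p.2, p.1)).
  by apply: cmeas_comp me _; exact: mfun_pair.
have mf2 : cmeasurable (fun p : Z * X => f p.2) by exact: cmeas_comp mf _.
have mw1 : cmeasurable (fun p : Z * X => w p.1) by exact: cmeas_comp mw _.
have mg : cmeasurable g.
  by apply: (@cmeas_int _ _ Z X R mu (fun p : Z * X => e (p.2, p.1) * f p.2)); exact: cmeasM.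
have Ief z : cintegrable mu (fun x => e (x, z) * f x).
  exact: (cintg_mulb (mez z) (fun x => e1 (x, z)) If).
pose A := fine (\int[mu]_x (cabs (f x))%:E)%E.
have gA z : cabs (g z) <= A.
  rewrite -lee_fin /A fineK; last first.
    have [_ foo] := If; rewrite ge0_finE//.
    by apply: int_ge0 => x _; rewrite lee_fin cabs_ge0.
  apply: (le_trans (cabs_cintegral (Ief z))); apply: le_integralT.
  - nonneg.
  - by apply/mEFinP/cmeas_cabs; exact: (Ief z).1.
  - meas.
  - by move=> x; rewrite lee_fin cabsM ler_piMl ?cabs_ge0.
have A0 : 0 <= A.
  by apply: fine_ge0; apply: int_ge0 => x _; rewrite lee_fin cabs_ge0.
have mgJ : cmeasurable (fun p : Z * X => conjc (g p.1)).
  by apply: (cmeas_comp (cmeasJ mg)); exact: mfst.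
transitivity (cintegral nu setT (fun z => cintegral mu setT (fun x =>
    (w z * conjc (g z)) * (e (x, z) * f x)))).
  by apply: eq_cintegral => z; rewrite cintegralZ// -/(g z) mulrAC mulrA.
have Ic := cintg_cabs If; have Icw := cintg_cabs Iw.
rewrite (@cintegral_fubini _ _ _ _ _ nu mu (fun p : Z * X => (w p.1 * conjc (g p.1)) * (e (p.2, p.1) * f p.2))); last 2 first.
  by apply: cmeasM; apply: cmeasM.
  apply: (@integral_product_lty (fun p => cabs ((w p.1 * conjc (g p.1)) * (e (p.2, p.1) * f p.2)))
     (fun z => A * cabs (w z)) (fun x => cabs (f x))) => //.
  - by apply: cmeas_cabs; apply: cmeasM; apply: cmeasM.
  - nonneg.
  - exact: (integrableZl measurableT A Icw).
  - nonneg.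
  - nonneg.
  - move=> z x; rewrite !cabsM cabsJ; apply: ler_pM; rewrite ?mulr_ge0 ?cabs_ge0//=.
      by rewrite mulrC; apply: ler_wpM2r; [exact: cabs_ge0|exact: gA].
    by rewrite ler_piMl ?cabs_ge0.
apply: eq_cintegral => x.
transitivity (f x * cintegral nu setT (fun z => (e (x, z) * conjc (g z)) * w z)).
  rewrite -cintegralZ; first by apply: eq_cintegral => z; ring.
  apply: (@cintg_mulb _ _ _ _ _ A) => //.
    by apply: cmeasM => //; exact: cmeasJ.
  move=> z; rewrite cabsM cabsJ -[leRHS]mul1r; apply: ler_pM => //; exact: cabs_ge0.
congr (_ * _).
transitivity (cintegral nu setT (fun z => cintegral mu setT (fun y => (w z * e (x, z)) * conjc (e (y, z) * f y)))).
  apply: eq_cintegral => z; rewrite cintegralZ; last first.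
    by apply: (cintg_le _ (cintg_cabs (Ief z))) => [|y]; [exact/cmeasJ/(Ief z).1|rewrite cabsJ].
  by rewrite cintegralJ// -/(g z); ring.
have mex1 : cmeasurable (fun p : Z * X => e (x, p.1)).
  by apply: (cmeas_comp (mex x)); exact: mfst.
have mG : cmeasurable (fun p : Z * X => (w p.1 * e (x, p.1)) * conjc (e (p.2, p.1) * f p.2)).
  by apply: cmeasM; [exact: cmeasM|apply: cmeasJ; exact: cmeasM].
rewrite (cintegral_fubini (F := fun p : Z * X => (w p.1 * e (x, p.1)) * conjc (e (p.2, p.1) * f p.2))) //; last first.
  apply: (@integral_product_lty (fun p => cabs ((w p.1 * e (x, p.1)) * conjc (e (p.2, p.1) * f p.2)))
     (fun z => cabs (w z)) (fun x => cabs (f x))) => //.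
  - meas.
  - nonneg.
  - nonneg.
  - nonneg.
  - move=> z y; rewrite !cabsM cabsJ cabsM; apply: ler_pM; rewrite ?mulr_ge0 ?cabs_ge0//=.
      by rewrite ler_piMr ?cabs_ge0.
    by rewrite ler_piMl ?cabs_ge0.
apply: eq_cintegral => y; rewrite -cintegralZ; last first.
  rewrite (_ : (fun z => _) = (fun z => (e (x, z) * conjc (e (y, z))) * w z)); last by apply/funext => z; ring.
  apply: (@cintg_mulb _ _ _ _ _ 1) => //.
    by apply: cmeasM => //; exact: cmeasJ.
  move=> z; rewrite cabsM cabsJ -[leRHS]mul1r; apply: ler_pM => //; exact: cabs_ge0.
by apply: eq_cintegral => z; rewrite rmorphM /=; ring.
Qed.

Lemma cintegral_ReE (h : Z -> R) : cintegral nu setT (fun z => ((h z)%:C)%C) = ((\int[nu]_z h z)%:C)%C.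
Proof.
rewrite /cintegral /=; congr Complex.
by rewrite /Rintegral integral0.
Qed.

End TTStar.

(** Schur's test, from $ab\le\frac12(a^2+b^2)$: each half is integrated first in the variable that
    does not carry the square. *)
Lemma integral_schur d (X : measurableType d) (R : realType)
    (mu : sfmeasure X R) (k : X * X -> R) (a : X -> R) (K : R) :
  0 <= K -> mfunT k -> (forall z, 0 <= k z) ->
  mfunT a -> (forall x, 0 <= a x) ->
  (forall x, \int[mu]_y (k (x, y))%:E <= K%:E)%E ->
  (forall y, \int[mu]_x (k (x, y))%:E <= K%:E)%E ->
  (\int[mu]_x \int[mu]_y (a x * (a y * k (x, y))%R)%:E <= K%:E * \int[mu]_x (a x ^+ 2)%:E)%E.
Proof.
move=> K0 mk k0 ma a0 kx ky.
have ma1 : mfunT (fun z : X * X => a z.1) by exact: mcompT ma mfst.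
have ma2 : mfunT (fun z : X * X => a z.2) by exact: mcompT ma msnd.
pose F1 (z : X * X) := (2^-1 * (a z.1 ^+ 2 * k z))%:E.
pose F2 (z : X * X) := (2^-1 * (a z.2 ^+ 2 * k z))%:E.
have mF1 : mfunT F1.
  by apply/mEFinP; apply: mfunM => //; apply: mfunM => //; exact: mfunX.
have mF2 : mfunT F2.
  by apply/mEFinP; apply: mfunM => //; apply: mfunM => //; exact: mfunX.
have F10 z : (0 <= F1 z)%E by rewrite lee_fin mulr_ge0// mulr_ge0// sqr_ge0.
have F20 z : (0 <= F2 z)%E by rewrite lee_fin mulr_ge0// mulr_ge0// sqr_ge0.
have mas : mfunT (fun x => (a x ^+ 2)%:E).
  by apply/mEFinP; exact: mfunX.
have key (G : X -> X -> R) (c : R) : 0 <= c -> mfunT (fun z : X * X => G z.1 z.2) ->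
  (forall x y, 0 <= G x y) -> (forall x, \int[mu]_y (G x y)%:E <= K%:E)%E ->
  (\int[mu]_x \int[mu]_y (c * (a x ^+ 2 * G x y))%:E <= (c * K)%:E * \int[mu]_x (a x ^+ 2)%:E)%E.
  move=> c0 mG G0 GE.
  rewrite -integralZlT ?mulr_ge0//; last by move=> x; rewrite lee_fin sqr_ge0.
  apply: le_integralT.
  - by move=> x; apply: int_ge0 => y _; rewrite lee_fin mulr_ge0// mulr_ge0// sqr_ge0.
  - apply: (@mfubiniF _ _ X X R mu (fun z => (c * (a z.1 ^+ 2 * G z.1 z.2))%:E)).
      by apply/mEFinP; apply: mfunM => //; apply: mfunM => //; exact: mfunX.
    by move=> z; rewrite lee_fin mulr_ge0// mulr_ge0// sqr_ge0.
  - by apply: emfunM => //; exact: mcst.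
  move=> x; have mGx : mfunT (G x) by exact: (mcompT mG (mpair1 x)).
  have -> : (\int[mu]_y (c * (a x ^+ 2 * G x y))%:E = (c * a x ^+ 2)%:E * \int[mu]_y (G x y)%:E)%E.
    rewrite -integralZlT ?mulr_ge0 ?sqr_ge0//.
    - by apply: eq_int => y _; rewrite -EFinM mulrA.
    - by move=> y; rewrite lee_fin.
    - exact/mEFinP.
  rewrite -[leRHS]EFinM mulrAC [leRHS]EFinM; apply: lee_wpmul2l => //.
  by rewrite lee_fin mulr_ge0 ?sqr_ge0.
apply: (@le_trans _ _ (\int[mu]_x \int[mu]_y F1 (x, y) + \int[mu]_x \int[mu]_y F2 (x, y))%E).
  have m1 : mfunT (fun x => \int[mu]_y F1 (x, y))%E.
    exact: (@mfubiniF _ _ X X R mu F1).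
  have m2 : mfunT (fun x => \int[mu]_y F2 (x, y))%E.
    exact: (@mfubiniF _ _ X X R mu F2).
  rewrite -ge0_integralD//; [|by move=> x _; apply: int_ge0|by move=> x _; apply: int_ge0].
  apply: le_integralT.
  - by move=> x; apply: int_ge0 => y _; rewrite lee_fin mulr_ge0// mulr_ge0.
  - apply: (@mfubiniF _ _ X X R mu (fun z => (a z.1 * (a z.2 * k z))%:E)).
      by apply/mEFinP; apply: mfunM => //; exact: mfunM.
    by move=> z; rewrite lee_fin mulr_ge0// mulr_ge0.
  - exact: emeasurable_funD.
  move=> x; rewrite -ge0_integralD//; [|exact: (meas_slice mF1)|exact: (meas_slice mF2)].
  apply: le_integralT.
  - by move=> y; rewrite lee_fin mulr_ge0// mulr_ge0.
  - apply/mEFinP; apply: mfunM => //; apply: mfunM => //.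
    exact: (mcompT mk (mpair1 x)).
  - by apply: emeasurable_funD; [exact: (meas_slice mF1)|exact: (meas_slice mF2)].
  move=> y; rewrite /F1 /F2 /= -EFinD lee_fin mulrA.
  have -> : 2^-1 * (a x ^+ 2 * k (x, y)) + 2^-1 * (a y ^+ 2 * k (x, y)) =
    2^-1 * (a x ^+ 2 + a y ^+ 2) * k (x, y) by ring.
  by apply: ler_wpM2r => //; have := sqr_ge0 (a x - a y); nra.
have -> : (\int[mu]_x \int[mu]_y F2 (x, y) = \int[mu]_y \int[mu]_x F2 (x, y))%E.
  exact: fubini_tonelli.
have ki0 : (0 <= \int[mu]_x (a x ^+ 2)%:E)%E by apply: int_ge0 => x _; rewrite lee_fin sqr_ge0.
have -> : (K%:E = (2^-1 * K)%:E + (2^-1 * K)%:E)%E by rewrite -EFinD; congr EFin; field.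
rewrite ge0_muleDl ?lee_fin ?mulr_ge0//; apply: leeD.
  by apply: (key (fun x y => k (x, y))) => //; under eq_fun do rewrite -surjective_pairing.
apply: (key (fun y x => k (x, y))) => //.
by apply: mcompT mk _; exact: mfun_pair.
Qed.

Section Oscillatory.
Context (R : realType) (n : nat).
Local Notation leb := (@lebesgue_measure R).
Local Notation lebn := (lebesgue_cV R n).
Local Notation vec := 'cV[R]_n.

Lemma meas_sub_cV : mfunT (fun z : vec * vec => z.1 - z.2 : vec).
Proof.
apply/mmxP; apply: mmxB.
  by move=> i j; exact: (mcompT (measurable_coord i j) mfst).
by move=> i j; exact: (mcompT (measurable_coord i j) msnd).
Qed.

Lemma integral_schur_conv (k a : 'cV[R]_n -> R) (K : R) :
  mfunT (k : vec -> R) -> (forall x, 0 <= k x) ->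
  mfunT (a : vec -> R) -> (forall x, 0 <= a x) -> (forall x, k (- x) = k x) ->
  (\int[lebn]_x (k x)%:E = K%:E)%E ->
  (\int[lebn]_x \int[lebn]_y (a x * (a y * k (x - y)%R))%:E <=
    K%:E * \int[lebn]_x (a x ^+ 2)%:E)%E.
Proof.
move=> mk k0 ma a0 ke kK.
have mke : mfunT (fun x : vec => (k x)%:E) by exact: mEFin_cV.
have ky (y : 'cV[R]_n) : (\int[lebn]_x (k (x - y))%:E = K%:E)%E.
  by rewrite -kK -(@integral_cV_shift R n (- y) (fun y => (k y)%:E))// => x; rewrite lee_fin.
have kx (x : 'cV[R]_n) : (\int[lebn]_y (k (x - y))%:E = K%:E)%E.
  by rewrite -(ky x); apply: eq_int => y _; rewrite -opprB ke.
have mk2 : mfunT (fun z : vec * vec => k (z.1 - z.2)) by exact: mcompT mk meas_sub_cV.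
have K0 : 0 <= K by rewrite -lee_fin -kK; apply: int_ge0 => x _; rewrite lee_fin.
apply: (@integral_schur _ _ R lebn (fun z => k (z.1 - z.2)) a K K0 mk2) => // [x|y].
  by rewrite kx.
by rewrite ky.
Qed.

(** Takes the place of Plancherel for the phase $Mx\cdot z$. A weight $e^{-\varepsilon|z|^2}$ makes
    the square expandable; the resulting kernel is a Gaussian in $x-y$ whose mass $(2\pi)^n/|\det
    M|$ does not depend on $\varepsilon$, so Schur's test gives a uniform bound and Fatou removes
    the weight. *)
Theorem bessel (M : 'M[R]_n) (f : 'cV[R]_n -> R[i]) : \det M != 0 -> cintegrable lebn f ->
  (\int[lebn]_z (cabs (cintegral lebn setT (fun x => expi (dotmul (M *m x) z) * f x)) ^+ 2)%:E <=
   ((2 * pi) ^+ n / `|\det M|)%:E * \int[lebn]_x (cabs (f x) ^+ 2)%:E)%E.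
Proof.
move=> dM If; have [mf _] := If.
set g := fun z => cintegral lebn setT (fun x => expi (dotmul (M *m x) z) * f x).
have mz1 : mmx (fun z : vec * vec => z.1).
  by move=> i j; exact: (mcompT (measurable_coord i j) mfst).
have mz2 : mmx (fun z : vec * vec => z.2).
  by move=> i j; exact: (mcompT (measurable_coord i j) msnd).
pose e (z : vec * vec) : R[i] := expi (dotmul (M *m z.1) z.2).
have me : cmeasurable e.
  by apply: cmeas_expi; apply: mmx_dotmul => //; apply: mmxM => //; exact: mmx_cst.
have mg : cmeasurable (g : vec -> R[i]).
  apply: (@cmeas_int _ _ vec vec R lebn (fun z => expi (dotmul (M *m z.2) z.1) * f z.2)).
  apply: cmeasM; last by apply: cmeas_comp mf _; exact: msnd.
  by apply: cmeas_expi; apply: mmx_dotmul => //; apply: mmxM => //; exact: mmx_cst.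
have bound (eps : R) : 0 < eps ->
    (\int[lebn]_z (gaussn eps z * cabs (g z) ^+ 2)%:E <=
     ((2 * pi) ^+ n / `|\det M|)%:E * \int[lebn]_x (cabs (f x) ^+ 2)%:E)%E.
  move=> eps0.
  pose w (z : vec) : R[i] := ((gaussn eps z)%:C)%C.
  have Iw : cintegrable lebn w.
    apply: (cintg_le _ (integrable_gaussn n eps0)); first exact: cmeas_gaussn.
    by move=> x; rewrite /w cabs_real ger0_norm ?gaussn_ge0.
  have := @cintegral_ttstar _ _ vec vec R lebn lebn e f w me _ If Iw.
  have e1 z : cabs (e z) <= 1 by rewrite cabs_expi.
  move=> /(_ e1); cbv zeta => TT.
  pose k (u : vec) := Num.sqrt (pi / eps) ^+ n * expR (- (dotmul (M *m u) (M *m u) / (4 * eps))).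
  have kE (x y : vec) : cintegral lebn setT (fun z => w z * (e (x, z) * conjc (e (y, z)))) = ((k (x - y))%:C)%C.
    rewrite /k -(@cintegral_gaussn_ft R n eps (M *m (x - y)) eps0); apply: eq_cintegral => z.
    change (w z * (expi (dotmul (M *m x) z) * conjc (expi (dotmul (M *m y) z))) = expi (dotmul z (M *m (x - y))) * w z).
    by rewrite -expiN -expiD mulrC dotmulC [dotmul (M *m y) z]dotmulC -dotmulNr -dotmulDr mulmxBr.
  have k0 u : 0 <= k u by rewrite mulr_ge0 ?exprn_ge0 ?sqrtr_ge0 ?expR_ge0.
  have mk : mfunT k.
    apply: mfunM => //; apply: mcompT => //; apply: mfunN.
    apply: mfunM => //; apply: mmx_dotmul; apply: mmxM; try exact: mmx_id; exact: mmx_cst.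
  have kn u : k (- u) = k u by rewrite /k mulmxN dotmulNl dotmulNr opprK.
  (* The factor $(\pi/\varepsilon)^{n/2}$ of the Fourier transform meets
     $(4\pi\varepsilon)^{n/2}/|\det M|$ from the integration, and $\varepsilon$ cancels. *)
  have ki : (\int[lebn]_x (k x)%:E = ((2 * pi) ^+ n / `|\det M|)%:E)%E.
    rewrite /k; transitivity (\int[lebn]_x ((Num.sqrt (pi / eps) ^+ n)%:E *
       (expR (- ((4 * eps)^-1 * dotmul (M *m x) (M *m x))))%:E))%E.
      by apply: eq_int => x _; rewrite -EFinM [dotmul _ _ / _]mulrC.
    rewrite integralZlT ?exprn_ge0 ?sqrtr_ge0//; last first.
      apply: mEFin_cV; apply: mcompT => //; apply: mfunN.
      apply: mfunM => //; apply: mmx_dotmul; apply: mmxM; try exact: mmx_id; exact: mmx_cst.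
    have e40 : 0 < 4 * eps by rewrite mulr_gt0.
    rewrite integral_gauss_mul ?invr_gt0// -EFinM; congr EFin.
    rewrite invfM mulrA mulrA; congr (_ / _); rewrite -!exprMn -expr_div_n; congr (_ ^+ _).
    rewrite sqrtrM ?pi_ge0// sqrtrV ?(ltW eps0)// sqrtrV ?(ltW e40)// invrK sqrtrM//.
    rewrite (_ : 4 = 2 ^+ 2 :> R); last by rewrite -natrX.
    rewrite sqrtr_sqr ger0_norm//.
    have sp : Num.sqrt pi * Num.sqrt pi = pi :> R by rewrite -expr2 sqr_sqrtr ?pi_ge0.
    have se : Num.sqrt eps != 0 by rewrite gt_eqF// sqrtr_gt0.
    by rewrite -[in RHS]sp; field.
  pose a (x : vec) := cabs (f x).
  have ma : mfunT a by exact: cmeas_cabs.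
  have mga : mfunT (fun z : vec => gaussn eps z * cabs (g z) ^+ 2).
    by apply: mfunM; [exact: meas_gaussn|apply: mfunX; exact: cmeas_cabs].
  have E : ((\int[lebn]_z (gaussn eps z * cabs (g z) ^+ 2))%:C)%C =
    cintegral lebn setT (fun x => f x * cintegral lebn setT (fun y => conjc (f y) * ((k (x - y))%:C)%C)).
    rewrite -cintegral_ReE (_ : (fun x => f x * _) = (fun x => f x * cintegral lebn setT (fun y => conjc (f y) *
      cintegral lebn setT (fun z => w z * (e (x, z) * conjc (e (y, z))))))).
      rewrite -TT; apply: eq_cintegral => z; rewrite /w mulcJ rmorphM//.
    apply/funext => x; congr (_ * _); apply: eq_cintegral => y; by rewrite kE.
  (* Integrability identifies the extended integral with the real one that occurs in [E]; it holds
     because [g] is bounded by the $L^1$ norm of $f$. *)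
  have Ig : lebn.-integrable setT (fun z => (gaussn eps z * cabs (g z) ^+ 2)%:E).
    have [_ foo] := If.
    pose A := fine (\int[lebn]_x (cabs (f x))%:E)%E.
    apply: le_integrable (integrableZl measurableT (A ^+ 2) (integrable_gaussn n eps0)) => //.
      exact: mEFin_cV.
    move=> z _; rewrite /= lee_fin ger0_norm; last by rewrite mulr_ge0 ?gaussn_ge0 ?sqr_ge0.
    rewrite mulrC ger0_norm; last by rewrite mulr_ge0 ?gaussn_ge0 ?sqr_ge0.
    apply: ler_wpM2r; first exact: gaussn_ge0.
    rewrite ler_pXn2r ?nnegrE ?cabs_ge0//; last by apply: fine_ge0; apply: int_ge0 => x _; rewrite lee_fin cabs_ge0.
    rewrite -lee_fin /A fineK; last first.
      by rewrite ge0_finE//; apply: int_ge0 => x _; rewrite lee_fin cabs_ge0.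
    have mez : cmeasurable (fun x : vec => expi (dotmul (M *m x) z)).
      by apply: cmeas_expi; apply: mmx_dotmul; [apply: mmxM; [exact: mmx_cst|exact: mmx_id]|exact: mmx_cst].
    apply: (le_trans (cabs_cint_le _ _)); first exact: cmeasM.
    by apply: le_of_eq; apply: eq_int => x _; rewrite cabsM cabs_expi mul1r.
  rewrite -[leLHS]fineK; last exact: integrable_fin_num.
  have -> : fine (\int[lebn]_z (gaussn eps z * cabs (g z) ^+ 2)%:E)%E =
      cabs ((\int[lebn]_z (gaussn eps z * cabs (g z) ^+ 2))%:C)%C.
    rewrite cabs_real ger0_norm//; apply: Rintegral_ge0 => z _; by rewrite mulr_ge0 ?gaussn_ge0 ?sqr_ge0.
  rewrite E.
  have mkxy : mfunT (fun z : vec * vec => k (z.1 - z.2)) by exact: mcompT mk meas_sub_cV.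
  have mfk : cmeasurable (fun z : vec * vec => conjc (f z.2) * ((k (z.1 - z.2))%:C)%C).
    apply: cmeasM; last exact: cmeas_real.
    by apply: cmeasJ; apply: cmeas_comp mf _; exact: msnd.
  have mI := @cmeas_int _ _ vec vec R lebn _ mfk.
  apply: (le_trans (cabs_cint_le _ _)); first by apply: cmeasM => //; exact: mI.
  apply: (le_trans _ (integral_schur_conv mk k0 ma (fun x => cabs_ge0 _) kn ki)).
  have mF : mfunT (fun z : vec * vec => (a z.1 * (a z.2 * k (z.1 - z.2)))%:E).
    apply/mEFinP; apply: mfunM; first exact: mcompT ma mfst.
    by apply: mfunM => //; exact: mcompT ma msnd.
  apply: le_integralT.
  - nonneg.
  - by apply: mEFin_cV; apply: cmeas_cabs; apply: cmeasM => //; exact: mI.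
  - apply: (@mfubiniF _ _ vec vec R lebn _ mF).
    by move=> z; rewrite lee_fin mulr_ge0 ?cabs_ge0 ?mulr_ge0 ?cabs_ge0.
  move=> x; rewrite cabsM EFinM.
  have -> : (\int[lebn]_y (a x * (a y * k (x - y)))%:E = (a x)%:E * \int[lebn]_y (a y * k (x - y))%:E)%E.
    rewrite -integralZlT ?cabs_ge0//; first by move=> y; rewrite lee_fin mulr_ge0 ?cabs_ge0.
    apply: mEFin_cV; apply: mfunM => //.
    exact: (mcompT mkxy (mpair1 x)).
  apply: lee_wpmul2l; first by rewrite lee_fin cabs_ge0.
  have mfkx : cmeasurable (fun y : vec => conjc (f y) * ((k (x - y))%:C)%C).
    exact: (cmeas_comp mfk (mpair1 x)).
  apply: (le_trans (cabs_cint_le _ mfkx)).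
  apply: le_of_eq; apply: eq_int => y _.
  by rewrite cabsM cabsJ cabs_real ger0_norm.
apply: (@fatou_le _ vec R lebn (fun m z => (gaussn m.+1%:R^-1 z * cabs (g z) ^+ 2)%:E)).
- move=> m; apply: mEFin_cV; apply: mfunM; first exact: meas_gaussn.
  meas.
- by move=> m z; rewrite lee_fin mulr_ge0 ?gaussn_ge0 ?sqr_ge0.
- by apply: mEFin_cV; apply: mfunX; exact: cmeas_cabs.
- nonneg.
- apply: aeW => z; apply: cvg_EFin; first by apply: nearW.
  rewrite -[X in _ --> X]mul1r; apply: cvgMl.
  rewrite -[X in _ --> X](_ : expR (- (0 * dotmul z z)) = 1); last by rewrite mul0r oppr0 expR0.
  have h0 : - (m.+1%:R^-1 * dotmul z z) @[m --> \oo] --> - (0 * dotmul z z).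
    by apply: cvgN; apply: cvgMl; exact: cvg_harmonic.
  exact: (cvg_comp _ _ h0 (@continuous_expR R _)).
- by move=> m; apply: bound; rewrite invr_gt0.
Qed.

(** Differencing instead of diagonalising $A$: in $|I|^2$ the substitution $y'=y+w$ leaves a phase
    linear in $y$, so the inner integral is the Fourier transform of a Gaussian and is bounded by a
    Gaussian in $Aw$. The integral of that bound over $w$ is $\pi^n/|\det A|$ for every
    $\varepsilon$. *)
Theorem fresnel_bound (A : 'M[R]_n) (b : 'cV[R]_n) (eps : R) : Defs.symmetric A -> \det A != 0 -> 0 < eps ->
  cabs (cintegral lebn setT (fun y => expi (dotmul (A *m y) y + dotmul b y) * ((gaussn eps y)%:C)%C)) <=
  Num.sqrt pi ^+ n / Num.sqrt `|\det A|.
Proof.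
move=> sA dA eps0.
pose h (y : vec) : R[i] := expi (dotmul (A *m y) y + dotmul b y) * ((gaussn eps y)%:C)%C.
set I := cintegral _ _ _.
have mth : mfunT (fun y : vec => dotmul (A *m y) y + dotmul b y).
  apply: mfunD; apply: mmx_dotmul; [|exact: mmx_id|exact: mmx_cst|exact: mmx_id].
  by apply: mmxM; [exact: mmx_cst|exact: mmx_id].
have Ih : cintegrable lebn h by exact: cintg_expi_gaussn.
have [mh _] := Ih.
have mhJ : cmeasurable (fun y => conjc (h y)) by exact: cmeasJ.
have ch y : cabs (h y) = gaussn eps y by rewrite cabsM cabs_expi mul1r cabs_real ger0_norm ?gaussn_ge0.
have mz1 : mfunT (fun z : vec * vec => z.1) by meas.
have mz2 : mfunT (fun z : vec * vec => z.2) by meas.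
have madd : mfunT (fun z : vec * vec => z.1 + z.2 : vec).
  by apply/mmxP; apply: mmxD; exact/mmxP.
have mH : cmeasurable (fun z : vec * vec => h z.1 * conjc (h (z.1 + z.2))).
  by apply: cmeasM; [exact: cmeas_comp mh mz1|exact: cmeas_comp mhJ madd].
have mHJ (y : vec) : cmeasurable (fun w => conjc (h (y + w))).
  exact: (cmeas_comp mhJ (mcompT madd (mpair1 y))).
have shiftJ (y : vec) : cintegral lebn setT (fun w => conjc (h (y + w))) = conjc I.
  transitivity (cintegral lebn setT (fun w => conjc (h (w + y)))).
    by apply: eq_cintegral => w; rewrite addrC.
  exact: etrans (@cintegral_cV_shift R n y (fun w => conjc (h w)) mhJ) (cintegralJ Ih).
have gi : (\int[lebn]_x (cabs (h x))%:E = (Num.sqrt (pi / eps) ^+ n)%:E)%E.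
  by rewrite -(integral_gaussn n eps0); apply: eq_int => x _; rewrite ch.
have gis (y : vec) : (\int[lebn]_w (cabs (h (y + w)))%:E = (Num.sqrt (pi / eps) ^+ n)%:E)%E.
  transitivity (\int[lebn]_w (cabs (h (w + y)))%:E)%E.
    by apply: eq_int => w _; rewrite addrC.
  rewrite -gi; apply: (@integral_cV_shift R n y (fun x => (cabs (h x))%:E)).
    by apply: mEFin_cV; exact: cmeas_cabs.
  nonneg.
have IJ (y : vec) : cintegrable lebn (fun w => conjc (h (y + w))).
  split => //; rewrite (_ : integral _ _ _ = (Num.sqrt (pi / eps) ^+ n)%:E) ?ltry//.
  by rewrite -(gis y); apply: eq_int => w _; rewrite cabsJ.
have sq : I * conjc I = cintegral lebn setT (fun w => cintegral lebn setT (fun y => h y * conjc (h (y + w)))).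
  rewrite -(cintegral_fubini mH); last first.
    apply: (@le_lt_trans _ _ (\int[lebn]_x ((Num.sqrt (pi / eps) ^+ n)%:E * (cabs (h x))%:E))%E).
      apply: le_integralT.
      - by move=> x; apply: int_ge0 => y _; rewrite lee_fin cabs_ge0.
      - apply: (@mfubiniF _ _ _ _ R lebn (fun z => (cabs (h z.1 * conjc (h (z.1 + z.2))))%:E)).
          meas.
        nonneg.
      - apply: emfunM; first exact: mcst.
        by apply: mEFin_cV; exact: cmeas_cabs.
      move=> x; rewrite -(gis x) muleC -integralZlT ?cabs_ge0//.
      - apply: le_of_eq; apply: eq_int => w _.
        by rewrite cabsM cabsJ EFinM.
      - nonneg.
      - apply: mEFin_cV; apply: cmeas_cabs.
        exact: (cmeas_comp mh (mcompT madd (mpair1 x))).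
    rewrite integralZlT ?exprn_ge0 ?sqrtr_ge0//.
    - by rewrite gi -EFinM ltry.
    - nonneg.
    - by apply: mEFin_cV; exact: cmeas_cabs.
  rewrite mulrC -cintegralZ//; apply: eq_cintegral => y.
  by rewrite mulrC -(shiftJ y) -cintegralZ.
have e20 : 0 < 2 * eps by rewrite mulr_gt0.
have inner (w : vec) : cabs (cintegral lebn setT (fun y => h y * conjc (h (y + w)))) <=
    Num.sqrt (pi / (2 * eps)) ^+ n * expR (- ((2 * eps)^-1 * dotmul (A *m w) (A *m w))).
  (* Midpoint of the two arguments: $|y|^2+|y+w|^2=2|y+w/2|^2+\frac12|w|^2$ explains the rate
     [2 * eps] and the Gaussian factor in [c]. *)
  pose m0 : vec := - (2^-1 *: w).
  pose c : R[i] := expi (- (dotmul (A *m w) w + dotmul b w)) * ((expR (- (eps / 2 * dotmul w w)))%:C)%C.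
  pose H (m : vec) : R[i] := c * expi (dotmul w (A *m w)) *
     (expi (dotmul m (- 2 *: (A *m w))) * ((gaussn (2 * eps) m)%:C)%C).
  have IH : cintegrable lebn (fun m => expi (dotmul m (- 2 *: (A *m w))) * ((gaussn (2 * eps) m)%:C)%C).
    by apply: cintg_expi_gaussn => //; exact: meas_dotmull.
  have hH (y : vec) : h y * conjc (h (y + w)) = H (y - m0).
    have dA2 : dotmul (A *m w) y = dotmul (A *m y) w by rewrite dotmul_mul (sA : A^T = A) dotmulC.
    have hJ (t g : R) : conjc (expi t * (g%:C)%C) = expi (- t) * (g%:C)%C.
      by rewrite expiN; apply: complexE => /=; ring.
    rewrite {2}/h hJ /h /H /c mulrACA -expiD -rmorphM.
    have -> : expi (- (dotmul (A *m w) w + dotmul b w)) * ((expR (- (eps / 2 * dotmul w w)))%:C)%C *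
        expi (dotmul w (A *m w)) * (expi (dotmul (y - m0) (- 2 *: (A *m w))) * ((gaussn (2 * eps) (y - m0))%:C)%C) =
      expi (- (dotmul (A *m w) w + dotmul b w) + dotmul w (A *m w) + dotmul (y - m0) (- 2 *: (A *m w))) *
      ((expR (- (eps / 2 * dotmul w w)) * gaussn (2 * eps) (y - m0))%:C)%C.
      by rewrite !expiD rmorphM; ring.
    congr (expi _ * _).
      rewrite /m0 opprK !(mulmxDr, dotmulDl, dotmulDr, dotmulZl, dotmulZr) -?dA2 [dotmul y (A *m w)]dotmulC dA2 [dotmul w (A *m w)]dotmulC.
      by field.
    congr ((_%:C)%C); rewrite /gaussn -!expRD; congr expR.
    rewrite /m0 opprK !(dotmulDl, dotmulDr, dotmulZl, dotmulZr) [dotmul w y]dotmulC.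
    by field.
  have mHm : cmeasurable H by apply: cmeasM; [exact: cmeas_cst|exact: IH.1].
  rewrite (eq_cintegral _ hH) (@cintegral_cV_shift R n (- m0) H mHm) /H cintegralZ//.
  rewrite cintegral_gaussn_ft// !cabsM !cabs_expi mul1r mulr1 !cabs_real.
  rewrite ger0_norm ?expR_ge0// ger0_norm; last by rewrite mulr_ge0 ?expR_ge0 ?exprn_ge0 ?sqrtr_ge0.
  (* The factor $e^{-\varepsilon|w|^2/2}\le1$ is dropped. *)
  rewrite -[leRHS]mul1r ler_pM ?expR_ge0 ?mulr_ge0 ?expR_ge0 ?exprn_ge0 ?sqrtr_ge0//.
    by rewrite -expR0 ler_expR oppr_le0 mulr_ge0 ?dotmul_ge0 ?divr_ge0 ?(ltW eps0).
  rewrite le_eqVlt; apply/orP; left; apply/eqP; congr (_ * expR (- _)).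
  by rewrite dotmulZl dotmulZr; field; rewrite gt_eqF.
have I2 : cabs I ^+ 2 <= pi ^+ n / `|\det A|.
  have -> : cabs I ^+ 2 = cabs (I * conjc I) by rewrite cabsM cabsJ expr2.
  rewrite sq -lee_fin.
  have mHs : cmeasurable (fun z : vec * vec => h z.2 * conjc (h (z.2 + z.1))).
    have maddC : mfunT (fun z : vec * vec => z.2 + z.1 : vec).
      by apply/mmxP; apply: mmxD; exact/mmxP.
    by apply: cmeasM; [exact: cmeas_comp mh mz2|exact: cmeas_comp mhJ maddC].
  have mC := @cmeas_int _ _ _ _ R lebn _ mHs.
  apply: (le_trans (cabs_cint_le lebn mC)).
  have mE : mfunT (fun w : vec => (expR (- ((2 * eps)^-1 * dotmul (A *m w) (A *m w))))%:E).
    apply: mEFin_cV; apply: mcompT => //; apply: mfunN.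
    by apply: mfunM => //; apply: mmx_dotmul; apply: mmxM; try exact: mmx_id; exact: mmx_cst.
  apply: (@le_trans _ _ (\int[lebn]_w ((Num.sqrt (pi / (2 * eps)) ^+ n)%:E *
     (expR (- ((2 * eps)^-1 * dotmul (A *m w) (A *m w))))%:E))%E).
    apply: le_integralT.
    - nonneg.
    - by apply: mEFin_cV; exact: cmeas_cabs.
    - meas.
    - by move=> w; rewrite -EFinM lee_fin; exact: inner.
  rewrite integralZlT ?exprn_ge0 ?sqrtr_ge0//.
  rewrite integral_gauss_mul ?invr_gt0// -EFinM lee_fin le_eqVlt; apply/orP; left; apply/eqP.
  have := e20; move: (2 * eps) => e2 e2_gt0.
  rewrite invfM mulrA mulrA; congr (_ / _); rewrite -exprMn -expr_div_n; congr (_ ^+ _).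
  rewrite sqrtrM ?pi_ge0// sqrtrV ?(ltW e2_gt0)//.
  have sp : Num.sqrt pi * Num.sqrt pi = pi :> R by rewrite -expr2 sqr_sqrtr ?pi_ge0.
  have se : Num.sqrt e2 != 0 by rewrite gt_eqF// sqrtr_gt0.
  by rewrite -[in RHS]sp; field.
have dA0 : 0 < Num.sqrt `|\det A| by rewrite sqrtr_gt0 normr_gt0.
rewrite -(@ler_pXn2r _ 2) ?nnegrE ?cabs_ge0 ?divr_ge0 ?exprn_ge0 ?sqrtr_ge0//.
have -> : (Num.sqrt pi ^+ n / Num.sqrt `|\det A|) ^+ 2 = pi ^+ n / `|\det A| by rewrite expr_div_n exprAC !sqr_sqrtr ?pi_ge0.
exact: I2.
Qed.

End Oscillatory.

(* Delayed because [fingroup] overrides the [inE] of [classical_sets]. *)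
From mathcomp Require Import fingroup perm.

(** * Matrix exponential and Gramian *)

Section MatrixExponential.
Context (R : realType).

Definition mder m n (F F' : R -> 'M[R]_(m, n)) :=
  forall t i j, is_derive t (1 : R) (fun t => F t i j : R) (F' t i j).

Lemma mder_cst m n (A : 'M[R]_(m, n)) : mder (fun=> A) (fun=> 0).
Proof. by move=> t i j; rewrite mxE; exact: is_derive_cst. Qed.

Lemma mder_eq m n (F F' G' : R -> 'M[R]_(m, n)) : mder F F' -> F' =1 G' -> mder F G'.
Proof. by move=> dF FG t i j; rewrite -FG. Qed.

Lemma mder_comp m n (F F' : R -> 'M[R]_(m, n)) (g : R -> R) (a : R) : mder F F' ->
  (forall t, is_derive t (1 : R) g a) -> mder (fun t => F (g t)) (fun t => a *: F' (g t)).
Proof.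
move=> dF dg t i j; rewrite mxE mulrC.
exact: (@is_derive1_comp R (fun t => F t i j) g t _ _ (dF (g t) i j) (dg t)).
Qed.

Lemma mderM m n p (F F' : R -> 'M[R]_(m, n)) (G G' : R -> 'M[R]_(n, p)) :
  mder F F' -> mder G G' -> mder (fun t => F t *m G t) (fun t => F' t *m G t + F t *m G' t).
Proof.
move=> dF dG t i j.
have -> : (fun t => (F t *m G t) i j) = \sum_(k < n) (fun t => F t i k * G t k j).
  by apply/funext => u; rewrite mxE fct_sumE.
have -> : (F' t *m G t + F t *m G' t) i j = \sum_(k < n) (F t i k * G' t k j + G t k j * F' t i k).
  by rewrite !mxE -big_split /=; apply: eq_bigr => k _; rewrite addrC [G _ _ _ * _]mulrC.
apply: is_derive_sum => k.
exact: (is_deriveM (dF t i k) (dG t k j)).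
Qed.

Lemma mder0_eq m n (F : R -> 'M[R]_(m, n)) s t : mder F (fun=> 0) -> F s = F t.
Proof.
move=> dF; apply/matrixP => i j; apply: (@is_derive_0_is_cst R (fun t => F t i j)) => u.
by have := dF u i j; rewrite mxE.
Qed.

Lemma is_derive_addr (a t : R) : is_derive t (1 : R) (fun x : R => x + a) 1.
Proof. by have := is_deriveD (is_derive_id t 1) (is_derive_cst a t 1); rewrite addr0. Qed.

Lemma is_derive_opp (t : R) : is_derive t (1 : R) (fun x : R => - x) (- 1).
Proof. exact: (is_deriveN (is_derive_id t 1)). Qed.

Lemma continuous_is_derive (f f' : R -> R) : (forall t, is_derive t (1 : R) f (f' t)) -> continuous f.
Proof.
move=> df t; apply: differentiable_continuous; apply/derivable1_diffP.
by have [] := df t.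
Qed.

Lemma cvg_sum_seq (I : Type) (s : seq I) (h : I -> R^nat) (l : I -> R) :
  (forall i, h i @ \oo --> l i) -> (fun k => \sum_(i <- s) h i k) @ \oo --> \sum_(i <- s) l i.
Proof.
move=> hl; elim: s => [|i s IHs].
  by rewrite big_nil; under eq_fun do rewrite big_nil; exact: cvg_cst.
by rewrite big_cons; under eq_fun do rewrite big_cons; exact: cvgD.
Qed.

Lemma is_derive_sum_seq (I : Type) (s : seq I) (t : R) (h : I -> R -> R) (d : I -> R) :
  (forall i, is_derive t (1 : R) (h i) (d i)) ->
  is_derive t (1 : R) (fun u => \sum_(i <- s) h i u) (\sum_(i <- s) d i).
Proof.
move=> dh; elim: s => [|i s IHs].
  rewrite big_nil (_ : (fun u => _) = cst 0); first exact: is_derive_cst.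
  by apply/funext => u; rewrite big_nil.
rewrite big_cons (_ : (fun u => _) = (fun u => h i u + \sum_(j <- s) h j u)).
  exact: is_deriveD.
by apply/funext => u; rewrite big_cons.
Qed.

Lemma cvg_mx m n (u : nat -> 'M[R]_(m, n)) (l : 'M[R]_(m, n)) :
  (forall i j, u k i j @[k --> \oo] --> l i j) -> u @ \oo --> l.
Proof.
move=> h; apply/cvg_ballP => e e0.
have : \forall k \near \oo, forall i j, ball (l i j) e (u k i j).
  apply: filter_forall => i; apply: filter_forall => j.
  by have /cvg_ballP/(_ _ e0) := h i j.
by apply: filterS => k hk; split.
Qed.

Section fixed.
Context (n : nat) (B : 'M[R]_n).

Let b : R := 1 + \sum_i \sum_j `|B i j|.

Let b0 : 0 <= b.
by rewrite addr_ge0// sumr_ge0// => i _; rewrite sumr_ge0. Qed.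

Let expmx_bound k i j : `|(B ^+ k) i j| <= b ^+ k.
elim: k i j => [|k IHk] i j.
  by rewrite !expr0 mxE; case: eqP => _; rewrite ?normr1 ?normr0.
rewrite !exprS mxE; apply: le_trans (ler_norm_sum _ _ _) _.
apply: (@le_trans _ _ (\sum_l `|B i l| * b ^+ k)).
  by apply: ler_sum => l _; rewrite normrM; apply: ler_wpM2l => //; exact: IHk.
rewrite -mulr_suml; apply: ler_wpM2r; first exact: exprn_ge0.
rewrite /b [X in _ <= 1 + X](bigD1 i)//= addrCA lerDl addr_ge0// sumr_ge0// => l _.
by rewrite sumr_ge0.
Qed.

(** Taylor coefficients of an entry of $Ae^{tB}C$. The outer factors are carried along so that
    differentiation term by term, which replaces [A] by [A *m B], stays in the same family. *)
Let ec (A C : 'M[R]_n) i j : R^nat := fun k => (A *m B ^+ k *m C) i j / k`!%:R.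

Let ecE A C i j k : ec A C i j k = \sum_l \sum_m A i l * C m j * ec 1%:M 1%:M l m k.
rewrite /ec !mxE mulr_suml exchange_big /=; apply: eq_bigr => m _.
rewrite mxE !mulr_suml; apply: eq_bigr => l _.
rewrite mulmx1 mul1mx; ring.
Qed.

Let cvg_ec1 l m (x : R) : cvgn (pseries (ec 1%:M 1%:M l m) x).
apply: normed_cvg; apply: series_le_cvg (is_cvg_series_exp_coeff (b * `|x|)) => k.
- exact: normr_ge0.
- by rewrite /exp_coeff divr_ge0// exprn_ge0// mulr_ge0.
rewrite /exp_coeff /ec /= mulmx1 mul1mx !normrM normfV normr_nat normrX exprMn.
by rewrite mulrAC ler_wpM2r// ler_wpM2r// exprn_ge0.
Qed.

Let E (t : R) : 'M[R]_n := \matrix_(i, j) limn (pseries (ec 1%:M 1%:M i j) t).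

Let cvg_ec (A C : 'M[R]_n) i j (x : R) :
  pseries (ec A C i j) x @ \oo --> ((A *m E x *m C) i j : R).
have -> : (A *m E x *m C) i j = \sum_l \sum_m A i l * C m j * E x l m.
  rewrite !mxE exchange_big /=; apply: eq_bigr => m _.
  by rewrite mxE mulr_suml; apply: eq_bigr => l _; ring.
have -> : pseries (ec A C i j) x =
    (fun N => \sum_l \sum_m A i l * C m j * pseries (ec 1%:M 1%:M l m) x N).
  apply/funext => N; rewrite /pseries /series /=.
  under eq_bigr do rewrite ecE mulr_suml.
  rewrite exchange_big /=; apply: eq_bigr => l _.
  under eq_bigr do rewrite mulr_suml.
  rewrite exchange_big /=; apply: eq_bigr => m _.
  by rewrite mulr_sumr; apply: eq_bigr => k _; rewrite mulrA.
apply: cvg_sum_seq => l; apply: cvg_sum_seq => m; apply: cvgMr.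
by rewrite mxE; exact: cvg_ec1.
Qed.

Let is_cvg_ec (A C : 'M[R]_n) i j (x : R) : cvgn (pseries (ec A C i j) x).
by apply/cvg_ex; exists ((A *m E x *m C) i j : R); exact: cvg_ec. Qed.

Let ec_lim (A C : 'M[R]_n) i j (x : R) : limn (pseries (ec A C i j) x) = (A *m E x *m C) i j.
by apply: cvg_lim; [exact: Rhausdorff|exact: cvg_ec]. Qed.

Let E_derive (A C : 'M[R]_n) : mder (fun t => A *m E t *m C) (fun t => A *m (B *m E t) *m C).
move=> t i j.
have dE A' : pseries_diffs (ec A' C i j) = ec (A' *m B) C i j.
  apply/funext => k; rewrite /pseries_diffs /ec exprS -mulmxA factS natrM.
  rewrite -[B * _]/(B *m _) !mulmxA; field.
  by rewrite pnatr_eq0 -lt0n fact_gt0 /= gt_eqF// ltr_wpDr.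
(* Differentiating inside the radius of convergence asks for convergence of the series and of its
   first two derived series; by [dE] all three are instances of [ec]. *)
have := @pseries_snd_diffs R (ec A C i j) (`|t| + 1) t (@is_cvg_ec _ _ _ _ _).
rewrite !dE => /(_ (@is_cvg_ec _ _ _ _ _) (@is_cvg_ec _ _ _ _ _)).
have t1 : `|t| < `| `|t| + 1| by rewrite (ger0_norm (addr_ge0 (normr_ge0 t) ler01)) ltrDl.
move=> /(_ t1).
rewrite ec_lim mulmxA => h; congr (is_derive _ _ _ _): h.
by apply/funext => u; rewrite ec_lim.
Qed.

Let exprZmx t k : (t *: B) ^+ k = t ^+ k *: B ^+ k.
elim: k => [|k IHk]; first by rewrite !expr0 scale1r.
rewrite !exprS IHk -[t *: B * _]/((t *: B) *m (t ^+ k *: B ^+ k)) -scalemxAl -scalemxAr scalerA.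
by [].
Qed.

Lemma expmx_seriesE t : expmx (t *: B) = E t.
Proof.
apply: cvg_lim; first exact: norm_hausdorff.
apply: cvg_mx => i j; rewrite mxE.
rewrite (_ : (fun k => _) = pseries (ec 1%:M 1%:M i j) t); first exact: cvg_ec1.
apply/funext => N; rewrite /series /pseries /series /= summxE; apply: eq_bigr => k _.
by rewrite exprZmx !mxE /ec mul1mx mulmx1; ring.
Qed.

Lemma expmx0 : expmx (0 *: B) = 1%:M.
Proof.
rewrite expmx_seriesE; apply/matrixP => i j; rewrite mxE; apply: cvg_lim => //.
apply: cvg_near_cst; exists 1%N => //= N N1.
rewrite /pseries /series /=; case: N N1 => // N _.
rewrite big_nat_recl//= big1 ?addr0; last by move=> k _; rewrite exprS mul0r mulr0.
by rewrite /ec !expr0 fact0 mulr1 divr1 mul1mx mulmx1.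
Qed.

Lemma expmx_mder : mder (fun t => expmx (t *: B)) (fun t => B *m expmx (t *: B)).
Proof.
move=> t i j; have := E_derive 1%:M 1%:M t i j; rewrite mul1mx mulmx1 -expmx_seriesE.
move=> h; congr (is_derive _ _ _ _): h; apply/funext => u.
by rewrite mul1mx mulmx1 expmx_seriesE.
Qed.

Lemma expmxC t : B *m expmx (t *: B) = expmx (t *: B) *m B.
Proof.
rewrite expmx_seriesE; apply/matrixP => i j.
have := ec_lim B 1%:M i j t; have := ec_lim 1%:M B i j t.
rewrite mul1mx mulmx1 => <- <-; congr (limn (pseries _ _)); apply/funext => k.
by rewrite /ec mulmx1 mul1mx -[_ *m B]/(_ * B) -[B *m _]/(B * _) -exprS -exprSr.
Qed.

(** The product has zero derivative in $t$. Inverse and group law both follow from this constancy,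
    without multiplying series. *)
Lemma expmxND t s : expmx ((- t) *: B) *m expmx ((t + s) *: B) = expmx (s *: B).
Proof.
pose G t := expmx ((- t) *: B) *m expmx ((t + s) *: B).
have dG : mder G (fun=> 0).
  have d1 := mder_comp expmx_mder is_derive_opp.
  have d2 := mder_comp expmx_mder (is_derive_addr s).
  apply: (mder_eq (mderM d1 d2)) => u.
  by rewrite scale1r scaleN1r mulNmx expmxC mulmxA addNr.
by have := mder0_eq t 0 dG; rewrite /G oppr0 add0r expmx0 mul1mx.
Qed.

Lemma expmxVK t : expmx ((- t) *: B) *m expmx (t *: B) = 1%:M.
Proof. by have := expmxND t 0; rewrite addr0 expmx0. Qed.

Lemma expmxD t s : expmx ((t + s) *: B) = expmx (t *: B) *m expmx (s *: B).
Proof.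
rewrite -(expmxND t s) mulmxA; have := expmxVK (- t); rewrite opprK => ->.
by rewrite mul1mx.
Qed.

Lemma expmx_continuous i j : continuous (fun t : R => expmx (t *: B) i j).
Proof. by apply: continuous_is_derive => t; exact: expmx_mder. Qed.

(** Leibniz rule along a list: the derivative of a product with factors [h] and derivatives [h']. *)
Fixpoint dprod (h h' : 'I_n -> R) (s : seq 'I_n) : R :=
  if s is i :: s' then h i * dprod h h' s' + (\prod_(k <- s') h k) * h' i else 0.

Let is_derive_prod (t : R) (h : 'I_n -> R -> R) (h' : 'I_n -> R) (s : seq 'I_n) :
  (forall i, is_derive t (1 : R) (h i) (h' i)) ->
  is_derive t (1 : R) (fun u => \prod_(i <- s) h i u) (dprod (h ^~ t) h' s).
move=> dh; elim: s => [|i s IHs] /=.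
  have -> : (fun u => \prod_(i <- [::]) h i u) = cst 1 by apply/funext => u; rewrite big_nil.
  exact: is_derive_cst.
have -> : (fun u => \prod_(k <- i :: s) h k u) = (fun u => h i u * \prod_(k <- s) h k u).
  by apply/funext => u; rewrite big_cons.
exact: (is_deriveM (dh i) IHs).
Qed.

(** Each term of the Leibniz rule omits a single factor, so two vanishing factors kill every
    term. *)
Let dprod_eq0 (h h' : 'I_n -> R) s : (1 < count (fun i => h i == 0%R) s)%N -> dprod h h' s = 0.
elim: s => //= i s IHs; have [hi|hi] := eqVneq (h i) 0; rewrite ?hi ?mul0r ?add0r.
  rewrite ltnS -has_count => /hasP[k ks /eqP hk].
  by rewrite (big_rem k)//= hk !mul0r.
rewrite add0n => c; rewrite IHs// mulr0 add0r.
have /hasP[k ks /eqP hk] : has (fun i => h i == 0) s by rewrite has_count (ltn_trans _ c).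
by rewrite (big_rem k)//= hk !mul0r.
Qed.

Let dprod_1 (h h' : 'I_n -> R) s : (forall i, h i = 1) -> dprod h h' s = \sum_(i <- s) h' i.
move=> h1; elim: s => [|i s IHs] /=; first by rewrite big_nil.
by rewrite IHs h1 [\prod_(_ <- _) _]big1// !mul1r big_cons addrC.
Qed.

(** At $t=0$ the matrix is the identity, and a permutation other than the identity moves at least
    two points, hence has two vanishing factors. Only the identity permutation contributes, with the
    trace. *)
Let det_derive0 : is_derive (0 : R) (1 : R) (fun t => \det (expmx (t *: B))) (\tr B).
have -> : (fun t => \det (expmx (t *: B))) =
    (fun t => \sum_(s : 'S_n) (-1) ^+ s * \prod_i expmx (t *: B) i (s i)) by [].
have d (s : 'S_n) : is_derive (0 : R) (1 : R) (fun t => (-1) ^+ s * \prod_i expmx (t *: B) i (s i))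
    (if s == 1%g then \tr B else 0).
  have dh i : is_derive (0 : R) (1 : R) (fun t : R => expmx (t *: B) i (s i)) (B i (s i)).
    by have := expmx_mder 0 i (s i); rewrite expmx0 mulmx1.
  have := is_derive_prod (index_enum 'I_n) dh.
  rewrite (_ : dprod _ _ _ = if s == 1%g then \tr B else 0).
    move=> h; have := is_deriveM (is_derive_cst ((-1) ^+ s : R) (0 : R) 1) h.
    congr is_derive; rewrite scaler0 addr0 /GRing.scale /=.
    by case: eqP => [->|_]; rewrite ?odd_perm1 ?expr0 ?mul1r ?mulr0.
  have [->|s1] := eqVneq s 1%g.
    rewrite dprod_1; last by move=> i; rewrite expmx0 perm1 mxE eqxx.
    by rewrite /mxtrace; apply: eq_bigr => i _; rewrite perm1.
  have [i si] : exists i, s i != i.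
    apply/existsP; rewrite -negb_forall; apply: contra s1 => /forallP si.
    by apply/eqP/permP => i; rewrite perm1; apply/eqP.
  apply: dprod_eq0; rewrite -size_filter.
  apply: (@leq_trans (size [:: i; s i])) => //.
  apply: uniq_leq_size; first by rewrite /= inE eq_sym si.
  move=> k; rewrite !inE mem_filter mem_index_enum andbT expmx0 mxE => /orP[]/eqP->.
    by rewrite [i == _]eq_sym (negbTE si).
  by rewrite [s i == _]eq_sym (inj_eq perm_inj) (negbTE si).
have -> : \tr B = \sum_(s : 'S_n) (if s == 1%g then \tr B else 0).
  by rewrite -big_mkcond big_pred1_eq.
exact: is_derive_sum_seq.
Qed.

(** Multiplicativity transports the derivative at 0 to every time, giving $d'=d\operatorname{tr}B$;
    then $d(t)e^{-t\operatorname{tr}B}$ is constant. *)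
Lemma det_expmx t : \det (expmx (t *: B)) = expR (t * \tr B).
Proof.
pose d t := \det (expmx (t *: B)).
have dd u : is_derive u (1 : R) d (d u * \tr B).
  have h1 : is_derive u (1 : R) (fun x : R => x + - u) 1 by exact: is_derive_addr.
  have h0 : is_derive (u + - u) (1 : R) d (\tr B) by rewrite subrr; exact: det_derive0.
  have := is_deriveM (is_derive_cst (d u) u 1) (@is_derive1_comp R d _ u _ _ h0 h1).
  rewrite scaler0 addr0 mulr1 => h; congr (is_derive _ _ _ _): h.
  apply/funext => v; change (d u * d (v - u) = d v).
  by rewrite /d -det_mulmx -expmxD addrC subrK.
pose g t := d t * expR (- t * \tr B).
have dg u : is_derive u (1 : R) g 0.
  have h1 : is_derive u (1 : R) (fun x : R => - x * \tr B) (- \tr B).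
    have := is_deriveM (is_derive_opp u) (is_derive_cst (\tr B) u 1).
    by rewrite scaler0 add0r /GRing.scale /= mulrN1.
  have := is_deriveM (dd u) (@is_derive1_comp R expR _ u _ _ (is_derive_expR _) h1).
  congr is_derive; rewrite /GRing.scale /=; ring.
have := is_derive_0_is_cst t 0 dg; rewrite /g /d expmx0 det1 oppr0 !mul0r expR0 mulr1 mulNr expRN.
by move/divr1_eq.
Qed.

Lemma expmx_unit t : expmx (t *: B) \in unitmx.
Proof. by rewrite unitmxE unitfE det_expmx gt_eqF// expR_gt0. Qed.

End fixed.

Lemma expmx_tr n (B : 'M[R]_n) t : expmx (t *: B^T) = (expmx (t *: B))^T.
Proof.
pose G t := expmx ((- t) *: B^T) *m (expmx (t *: B))^T.
have dT : mder (fun t => (expmx (t *: B))^T) (fun t => (B *m expmx (t *: B))^T).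
  move=> u i j; rewrite mxE; have := expmx_mder B u j i.
  by congr is_derive; apply/funext => v; rewrite mxE.
have dG : mder G (fun=> 0).
  apply: (mder_eq (mderM (mder_comp (expmx_mder B^T) is_derive_opp) dT)) => u.
  by rewrite (expmxC B) trmx_mul mulmxA scaleN1r mulNmx (expmxC B^T) addNr.
have := mder0_eq t 0 dG; rewrite {2}/G oppr0 !expmx0 trmx1 mulmx1 /G => h.
by rewrite -[RHS]mul1mx -(expmxVK B^T (- t)) opprK -mulmxA h mulmx1.
Qed.

End MatrixExponential.

Section LinearRintegral.
Context d (T : measurableType d) (R : realType) (mu : {measure set T -> \bar R}).

Lemma Rintegral_sum_seq (I : Type) (s : seq I) (D : set T) (h : I -> T -> R) : measurable D ->
  (forall i, mu.-integrable D (EFin \o h i)) ->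
  mu.-integrable D (EFin \o (fun x => \sum_(i <- s) h i x)) /\
  \int[mu]_(x in D) \sum_(i <- s) h i x = \sum_(i <- s) \int[mu]_(x in D) h i x.
Proof.
move=> mD Ih; elim: s => [|i s [IH1 IH2]].
  rewrite big_nil; have -> : (fun x : T => \sum_(i <- [::]) h i x) = cst 0.
    by apply/funext => x; rewrite big_nil.
  by split; [exact: integrable0|rewrite /Rintegral integral0].
rewrite big_cons; have -> : (fun x : T => \sum_(j <- i :: s) h j x) = (fun x => h i x + \sum_(j <- s) h j x).
  by apply/funext => x; rewrite big_cons.
split; last by rewrite RintegralD// IH2.
by apply: eq_integrable (integrableD mD (Ih i) IH1).
Qed.

Lemma Rintegral_mx m n p q (D : set T) (A : 'M[R]_(m, n)) (F : T -> 'M[R]_(n, p)) (C : 'M[R]_(p, q)) i j :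
  measurable D -> (forall i j, mu.-integrable D (EFin \o (fun s => F s i j))) ->
  \int[mu]_(s in D) (A *m F s *m C) i j =
  (A *m (\matrix_(i, j) \int[mu]_(s in D) F s i j) *m C) i j.
Proof.
move=> mD IF.
have E (G : 'M[R]_(n, p)) : (A *m G *m C) i j = \sum_l \sum_k A i l * C k j * G l k.
  rewrite !mxE exchange_big /=; apply: eq_bigr => k _.
  by rewrite mxE mulr_suml; apply: eq_bigr => l _; ring.
rewrite E; under eq_Rintegral do rewrite E.
have IZ l k : mu.-integrable D (EFin \o (fun s => A i l * C k j * F s l k)).
  by apply: eq_integrable (integrableZl mD (A i l * C k j) (IF l k)).
have h l := Rintegral_sum_seq (index_enum 'I_p) mD (IZ l).
rewrite (Rintegral_sum_seq (index_enum 'I_n) mD (fun l => (h l).1)).2.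
apply: eq_bigr => l _; rewrite (h l).2; apply: eq_bigr => k _.
by rewrite mxE RintegralZl.
Qed.

End LinearRintegral.

(** * Cocycles, the signed Gramian and the corrected volume *)

Section MatrixCocycle.
Context (R : realType) (n : nat).

Lemma det_oppmx (A : 'M[R]_n) : `|\det (- A)| = `|\det A|.
Proof. by rewrite -scaleN1r detZ normrM normrX normrN1 expr1n mul1r. Qed.

Lemma det_congruence (A X : 'M[R]_n) : `|\det (- (A *m X *m A^T))| = `|\det A| ^+ 2 * `|\det X|.
Proof. by rewrite det_oppmx !det_mulmx det_tr !normrM; ring. Qed.

Lemma invmx_sub (X Y : 'M[R]_n) : X \in unitmx -> Y \in unitmx ->
  invmx X - invmx Y = invmx X *m (Y - X) *m invmx Y.
Proof. by move=> uX uY; rewrite mulmxBr mulmxBl mulVmx// mul1mx mulmxK. Qed.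

Lemma det_invmx_sub (X Y Z A : 'M[R]_n) : X \in unitmx -> Y \in unitmx ->
  Y - X = - (A *m Z *m A^T) ->
  `|\det (invmx X - invmx Y)| = `|\det A| ^+ 2 * `|\det Z| / (`|\det X| * `|\det Y|).
Proof.
move=> uX uY h; rewrite invmx_sub// det_mulmx det_mulmx h !normrM det_congruence !det_inv !normfV invfM.
by ring.
Qed.

(** Solving the identity for another of its three terms gives two moves on pairs of times,
    $(u,v)\mapsto(u+v,-v)$ and $(u,v)\mapsto(-u,u+v)$, that preserve its validity. Every pair is
    reached by such moves from a nonnegative one. *)
Lemma cocycle_extension (E g : R -> 'M[R]_n) :
  (forall s t, E (s + t) = E s *m E t) -> E 0 = 1%:M -> g 0 = 0 ->
  (forall s t, 0 <= s -> 0 <= t -> g (s + t) = g s + E s *m g t *m (E s)^T) ->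
  let sg t := if 0 <= t then g t else - (E t *m g (- t) *m (E t)^T) in
  forall s t, sg (s + t) = sg s + E s *m sg t *m (E s)^T.
Proof.
move=> ED E0 g0 gD sg s t.
have EV u (A : 'M[R]_n) : E (- u) *m (E u *m A *m (E u)^T) *m (E (- u))^T = A.
  by rewrite !mulmxA -ED addNr E0 mul1mx -mulmxA -trmx_mul -ED addNr E0 trmx1 mulmx1.
have EM u v (A : 'M[R]_n) : E u *m (E v *m A *m (E v)^T) *m (E u)^T = E (u + v) *m A *m (E (u + v))^T.
  by rewrite ED trmx_mul !mulmxA.
have sgN u : sg (- u) = - (E (- u) *m sg u *m (E (- u))^T).
  rewrite /sg; have [u0|u0|<-] := ltgtP 0 u.
  - by rewrite leNgt oppr_lt0 u0 /= opprK.
  - by rewrite oppr_ge0 (ltW u0) mulmxN mulNmx opprK EV.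
  - by rewrite oppr0 lexx g0 mulmx0 mul0mx oppr0.
pose C s t := sg (s + t) = sg s + E s *m sg t *m (E s)^T.
have C1 u v : C u v -> C (u + v) (- v).
  by rewrite /C addrK => ->; rewrite sgN mulmxN mulNmx EM addrK addrK.
have C2 u v : C u v -> C (- u) (u + v).
  by rewrite /C addKr => ->; rewrite mulmxDr mulmxDl sgN EV addKr.
have Cp u v : 0 <= u -> 0 <= v -> C u v.
  by move=> u0 v0; rewrite /C /sg u0 v0 addr_ge0// gD.
rewrite -/(C s t).
have [s0|/ltW s0] := leP 0 s; have [t0|/ltW t0] := leP 0 t.
- exact: Cp.
- have [st|/ltW st] := leP 0 (s + t).
    have /C1 : C (s + t) (- t) by apply: Cp => //; rewrite oppr_ge0.
    by rewrite addrK opprK.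
  have /C2/C1 : C (- (s + t)) s by apply: Cp => //; rewrite oppr_ge0.
  by congr C; ring.
- have [st|/ltW st] := leP 0 (s + t).
    have /C2 : C (- s) (s + t) by apply: Cp => //; rewrite oppr_ge0.
    by rewrite opprK addKr.
  have /C1/C2 : C t (- (s + t)) by apply: Cp => //; rewrite oppr_ge0.
  by congr C; ring.
- have /C1/C2/C1 : C (- t) (- s) by apply: Cp; rewrite oppr_ge0.
  by congr C; ring.
Qed.

(** If the form vanishes at $x$, its nonnegativity along the lines $x+uy$ forces $Gx\cdot y=0$ for
    all $y$, and invertibility then gives $x=0$. *)
Lemma psd_pos_def (G : 'M[R]_n) : Defs.symmetric G -> psd G -> G \in unitmx -> pos_def G.
Proof.
move=> sG pG uG x x0; rewrite lt_neqAle pG andbT eq_sym; apply/negP => /eqP gx.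
have Gy y : dotmul (G *m x) y = 0.
  have h (u : R) : 0 <= 2 * u * dotmul (G *m x) y + u ^+ 2 * dotmul (G *m y) y.
    have := pG (x + u *: y); rewrite mulmxDr -scalemxAr !(dotmulDl, dotmulDr, dotmulZl, dotmulZr) gx.
    rewrite [dotmul (G *m y) x]dotmul_mul (sG : G^T = _) [dotmul y _]dotmulC.
    set a := dotmul _ y; set c := dotmul _ y.
    have -> : 0 + u * a + u * (a + u * c) = 2 * u * a + u ^+ 2 * c by ring.
    by [].
  move: h; have := pG y; set a := dotmul _ y; set c := dotmul (G *m x) y => a0 h.
  (* Close to the minimiser in $u$; the denominator $a+1$ replaces $a$, which may vanish. *)
  have := h (- c / (a + 1)); have a1 : 0 < a + 1 by rewrite ltr_wpDl.
  have -> : 2 * (- c / (a + 1)) * c + (- c / (a + 1)) ^+ 2 * a = - (c ^+ 2 * ((a + 2) / (a + 1) ^+ 2)).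
    by field; rewrite gt_eqF.
  rewrite oppr_ge0 pmulr_lle0 ?divr_gt0 ?exprn_gt0 ?ltr_wpDl//.
  by move=> c2; apply/eqP; rewrite -sqrf_eq0 eq_le c2 sqr_ge0.
have /dotmul_eq0 gx0 := Gy (G *m x).
by move: x0; rewrite -(mulKmx uG x) gx0 mulmx0 eqxx.
Qed.

Lemma pos_def_congruence (A X : 'M[R]_n) : A \in unitmx -> pos_def X -> pos_def (A *m X *m A^T).
Proof.
move=> uA pX x x0; rewrite -!mulmxA dotmul_mul; apply: pX.
apply: contra x0 => /eqP h.
have uAT : A^T \in unitmx by rewrite unitmx_tr.
by rewrite -(mulKmx uAT x) h mulmx0.
Qed.

End MatrixCocycle.

Section Gramian.
Context (R : realType).
Local Notation leb := (@lebesgue_measure R).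

Context (n : nat) (Q B : 'M[R]_n).
Hypothesis sQ : Defs.symmetric Q.
Hypothesis pQ : psd Q.
Local Notation E t := (expmx (t *: B)).
Local Notation gram := (gramian Q B).

Let N (s : R) : 'M[R]_n := E s *m Q *m (E s)^T.

Let N_continuous i j : continuous (fun s => N s i j).
have dT : mder (fun t => (E t)^T) (fun t => (B *m E t)^T).
  move=> u k l; rewrite mxE; have := expmx_mder B u l k.
  by congr is_derive; apply/funext => v; rewrite mxE.
by apply: continuous_is_derive => t; apply: mderM (mderM (expmx_mder B) (mder_cst Q)) dT t i j.
Qed.

Let N_integrable i j a b : leb.-integrable `[a, b] (EFin \o (fun s => N s i j)).
apply: continuous_compact_integrable; first exact: segment_compact.
exact/continuous_subspaceT/N_continuous.
Qed.

Let gramE t : gram t = \matrix_(i, j) \int[leb]_(s in `[0, t]) N s i j.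
apply/matrixP => i j; rewrite !mxE; apply: eq_Rintegral => s _.
by rewrite expmx_tr.
Qed.

Lemma gramian_sym t : Defs.symmetric (gram t).
Proof.
rewrite /Defs.symmetric gramE; apply/matrixP => i j; rewrite !mxE; apply: eq_Rintegral => s _.
rewrite -[in RHS](_ : (N s)^T = N s) ?mxE//.
by rewrite /N !trmx_mul trmxK (sQ : Q^T = Q) mulmxA.
Qed.

Lemma gramian_psd t : psd (gram t).
Proof.
move=> x; rewrite dotmulC /dotmul gramE mulmxA.
rewrite (_ : _ 0 0 = \int[leb]_(s in `[0, t]) (x^T *m N s *m x) 0 0); last first.
  by apply/esym; exact: (@Rintegral_mx _ (mtypeR R) R leb 1 n n 1 _ x^T N x 0 0 (measurable_itv _) (fun i j => N_integrable i j 0 t)).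
apply: Rintegral_ge0 => s _; rewrite /N.
have := pQ ((E s)^T *m x); rewrite dotmulC /dotmul trmx_mul trmxK.
by rewrite !mulmxA.
Qed.

(** The interval is split at $s$ and the second piece shifted back, using that the integrand at
    $u+s$ is its value at $u$ conjugated by $e^{sB}$. *)
Lemma gramianD s t : 0 <= s -> 0 <= t -> gram (s + t) = gram s + E s *m gram t *m (E s)^T.
Proof.
move=> s0 t0; apply/matrixP => i j; rewrite !gramE.
have NE u : N (u + s) = E s *m N u *m (E s)^T.
  by rewrite /N addrC expmxD trmx_mul !mulmxA.
have S := Rintegral_itvB (N_integrable i j 0 (s + t)) (x := s).
have -> : (\matrix_(i, j) \int[leb]_(u in `[0, s + t]) N u i j) i j =
    \int[leb]_(u in `[0, s]) N u i j + \int[leb]_(u in `]s, s + t]) N u i j.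
  by rewrite mxE -S ?bnd_simp ?lerDl//; ring.
rewrite [RHS]mxE mxE; congr (_ + _).
transitivity (\int[leb]_(u in `[0, t]) (E s *m N u *m (E s)^T) i j); last first.
  exact: (@Rintegral_mx _ (mtypeR R) R leb n n n n _ (E s) N (E s)^T i j (measurable_itv _) (fun i j => N_integrable i j 0 t)).
rewrite Rintegral_itv_obnd_cbnd; last first.
  apply: integrableS (N_integrable i j s (s + t)) => //.
  by apply: subset_itv; rewrite bnd_simp.
rewrite Rintegral_mkcond [RHS]Rintegral_mkcond.
pose g := (fun u => N u i j) \_ `[s, s + t].
have mN k l : mfunT (fun u : R => N u k l) by apply: continuous_measurable_fun; exact: N_continuous.
have mg : mfunT g.
  by apply/(measurable_restrictT _ _).1 => //; exact: mfunTS.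
apply: etrans (esym (@Rintegral_invariant R _ _ leb (fun x : R => x + s) (@integral_lebesgue_shift R s) g mg)) _.
apply: eq_Rintegral => u _; rewrite /g !patchE NE.
by rewrite !mem_setE !in_itv /= -{1}(add0r s) [s + t]addrC !lerD2r.
Qed.

Lemma mmx_expmx : mmx (fun t : R => E t).
Proof. by move=> i j; apply: continuous_measurable_fun; exact: expmx_continuous. Qed.

Lemma mmx_gramian : mmx (fun t : R => gram t).
Proof.
move=> i j.
have mN : mfunT (fun u : R => N u i j) by apply: continuous_measurable_fun; exact: N_continuous.
pose F (z : R * R) := if (0 <= z.2) && (z.2 <= z.1) then N z.2 i j else 0.
have mF : mfunT F.
  apply: mfun_ifT => //.
    apply: measurable_and; apply: measurable_fun_ler => //; exact: mfst.
  by apply: mcompT mN _; exact: msnd.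
have := @meas_fine_integral _ _ _ _ R leb F mF; congr measurable_fun.
apply/funext => t; rewrite gramE mxE [RHS]Rintegral_mkcond; apply: eq_Rintegral => u _.
by rewrite patchE mem_setE in_itv.
Qed.

(** The oriented integral $\int_0^te^{sB}Qe^{sB^\star}ds$ for times of both signs. *)
Definition sgramian t : 'M[R]_n := if 0 <= t then gram t else - (E t *m gram (- t) *m (E t)^T).
Local Notation sg := sgramian.

Lemma sgramianD s t : sg (s + t) = sg s + E s *m sg t *m (E s)^T.
Proof.
apply: (cocycle_extension (E := fun t => E t) (g := fun t => gram t)).
- exact: expmxD.
- exact: expmx0.
- by rewrite gramE; apply/matrixP => i j; rewrite !mxE set_itv1 Rintegral_set1.
- exact: gramianD.
Qed.

Lemma sgramian_sym t : Defs.symmetric (sg t).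
Proof.
rewrite /Defs.symmetric /sg; case: ifP => _; first exact: gramian_sym.
by rewrite linearN /= !trmx_mul trmxK (gramian_sym (- t) : (gram (- t))^T = _) mulmxA.
Qed.

Lemma mmx_sgramian : mmx (fun t : R => sg t).
Proof.
have mo : mfunT (fun t : R => - t) by exact: mfunN.
have m1 : mmx (fun t : R => - (E t *m gram (- t) *m (E t)^T)).
  apply: mmxN; apply: mmxM; last by apply: mmx_tr; exact: mmx_expmx.
  by apply: mmxM; [exact: mmx_expmx|move=> i j; exact: (mcompT (mmx_gramian i j) mo)].
move=> i j; rewrite (_ : (fun t => _) = (fun t => if 0 <= t then gram t i j else (- (E t *m gram (- t) *m (E t)^T)) i j)).
  by apply: mfun_ifT; [exact: measurable_fun_ler|exact: mmx_gramian|exact: m1].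
by apply/funext => t; rewrite /sg; case: ifP.
Qed.

(** The value at 0 is a placeholder that keeps the matrix invertible at every time, so that phases
    and amplitudes are measurable on the whole line. *)
Definition qmx t : 'M[R]_n := if t == 0 then 1%:M else sg t.
(** The exponential makes the function even in time. The kernel of $e^{t\operatorname{tr}B/2}U(t)$
    has modulus $(4\pi)^{-n/2}$ times the inverse square root of this quantity. *)
Definition vol t : R := `|\det (qmx t)| * expR (- (t * \tr B)).

Hypothesis V0 : forall t : R, 0 < t -> 0 < volume Q B t.

Lemma qmx_pos t : 0 < t -> qmx t = gram t.
Proof. by move=> t0; rewrite /qmx gt_eqF// /sg (ltW t0). Qed.

Lemma qmx_neg t : 0 < t -> qmx (- t) = - (E (- t) *m gram t *m (E (- t))^T).
Proof. by move=> t0; rewrite /qmx oppr_eq0 gt_eqF// /sg leNgt oppr_lt0 t0 opprK. Qed.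

Lemma det_qmx t : \det (qmx t) != 0.
Proof.
have [t0|t0|<-] := ltgtP 0 t; last by rewrite /qmx eqxx det1 oner_neq0.
  by rewrite qmx_pos// gt_eqF//; exact: V0.
rewrite -(opprK t) qmx_neg ?oppr_gt0// -normr_eq0 det_congruence opprK mulf_neq0//.
  by rewrite expf_neq0// normr_eq0 det_expmx gt_eqF ?expR_gt0.
by rewrite normr_eq0 gt_eqF//; apply: V0; rewrite oppr_gt0.
Qed.

Lemma qmx_unit t : qmx t \in unitmx.
Proof. by rewrite unitmxE unitfE det_qmx. Qed.

Lemma vol_gt0 t : 0 < vol t.
Proof. by rewrite mulr_gt0 ?expR_gt0// normr_gt0 det_qmx. Qed.

Lemma vol_pos t : 0 < t -> vol t = volume Q B t * expR (- (t * \tr B)).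
Proof. by move=> t0; rewrite /vol qmx_pos// ger0_norm//; exact/ltW/V0. Qed.

(** Passing from $t$ to $-t$ conjugates the Gramian by $e^{-tB}$ and so multiplies the determinant
    by $e^{-2t\operatorname{tr}B}$, exactly the change of the exponential factor. *)
Lemma volN t : vol (- t) = vol t.
Proof.
wlog t0 : t / 0 < t.
  move=> h; have [t0|t0|<-] := ltgtP 0 t; [exact: h| |by rewrite oppr0].
  by have := h (- t); rewrite oppr_gt0 opprK => ->.
rewrite [RHS]vol_pos// /vol qmx_neg// det_congruence det_expmx [X in _ * X * _]ger0_norm; last exact/ltW/V0.
rewrite ger0_norm ?expR_ge0// /volume mulrC [X in _ * X]mulrC mulrCA; congr (_ * _).
by rewrite expr2 -!expRD; congr expR; ring.
Qed.

(** The cocycle identity gives $q(s)-q(t)=-e^{sB}q(t-s)e^{sB^\star}$. This is the determinant of the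
    phase left over in the kernel of TT*, where it leaves a size depending on $t-s$ alone. *)
Lemma det_invqmx_sub s t : s != 0 -> t != 0 -> t != s ->
  `|\det (invmx (qmx t) - invmx (qmx s))| = vol (t - s) / (vol t * vol s).
Proof.
move=> s0 t0 ts.
have h : qmx s - qmx t = - (E s *m qmx (t - s) *m (E s)^T).
  rewrite /qmx (negbTE s0) (negbTE t0) subr_eq0 (negbTE ts).
  have := sgramianD s (t - s); rewrite addrC subrK => ->.
  by rewrite opprD addrA subrr add0r.
rewrite (det_invmx_sub (qmx_unit t) (qmx_unit s) h) det_expmx.
rewrite /vol [`|expR _|]ger0_norm ?expR_ge0//.
have ar (a b c es et : R) : a != 0 -> b != 0 -> es != 0 -> et != 0 ->
    es ^+ 2 * c / (a * b) = c * (et^-1 * es) / ((a * et^-1) * (b * es^-1)).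
  by move=> a0 b0 es0 et0; field; rewrite a0 b0 es0 et0.
have -> : expR (- ((t - s) * \tr B)) = (expR (t * \tr B))^-1 * expR (s * \tr B).
  by rewrite -expRN -expRD; congr expR; ring.
rewrite (expRN (t * _)) (expRN (s * _)).
by apply: ar; rewrite ?normr_eq0 ?det_qmx// gt_eqF ?expR_gt0.
Qed.

Lemma gramian_pos_def t : 0 < t -> pos_def (gram t).
Proof.
move=> t0; apply: psd_pos_def; [exact: gramian_sym|exact: gramian_psd|].
by rewrite -qmx_pos// qmx_unit.
Qed.

(** For $\operatorname{tr}B\le0$ the exponential factor is at least 1. For $a=\operatorname{tr}B>0$
    it costs a constant when $t\le1$; when $t>1$ the Gramian dominates
    $e^{(t-1)B}Q(1)e^{(t-1)B^\star}$, so $V(t)\ge V(1)e^{2(t-1)a}$ and [vol] grows exponentially,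
    faster than $t^{D_\infty}$. *)
Lemma vol_ge (D : nat) (Dinf gamma : R) : 0 < Dinf -> 0 < gamma ->
  (forall t : R, 0 < t -> gamma * Num.min (t ^+ D) (t `^ Dinf) <= volume Q B t) ->
  exists2 g : R, 0 < g & forall t, 0 < t -> g * Num.min (t ^+ D) (t `^ Dinf) <= vol t.
Proof.
move=> Dinf0 gamma0 hV; pose a := \tr B.
have m0 (t : R) : 0 < t -> 0 <= Num.min (t ^+ D) (t `^ Dinf).
  by move=> t0; rewrite le_min exprn_ge0 ?powR_ge0// ltW.
have [a0|a0] := leP a 0.
  exists gamma => // t t0; rewrite vol_pos//; apply: le_trans (hV t t0) _.
  by rewrite ler_peMr ?(ltW (V0 t0))// -expR0 ler_expR oppr_ge0 mulr_ge0_le0// ltW.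
pose c := V0 ltr01.
(* The constant in $t^{D_\infty}\le k\,e^{ta}$, which is $x\le e^x$ at $x=ta/D_\infty$ raised to the
   power $D_\infty$. *)
pose k := (Dinf / a) `^ Dinf.
have k0 : 0 < k by rewrite powR_gt0// divr_gt0.
(* Solves $V(1)e^{2(t-1)a}e^{-ta}=g_2\,k\,e^{ta}$. *)
pose g2 := volume Q B 1 * expR (- (2 * a)) / k.
have g20 : 0 < g2 by rewrite divr_gt0// mulr_gt0 ?expR_gt0.
exists (Num.min (gamma * expR (- a)) g2); first by rewrite lt_min g20 mulr_gt0 ?expR_gt0.
move=> t t0; have [t1|t1] := leP t 1.
  apply: (@le_trans _ _ (gamma * expR (- a) * Num.min (t ^+ D) (t `^ Dinf))).
    by apply: ler_wpM2r; [exact: m0|rewrite ge_min lexx].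
  rewrite vol_pos// mulrAC; apply: ler_pM; rewrite ?expR_ge0 ?mulr_ge0 ?m0 ?(ltW gamma0)//.
    exact: hV.
  by rewrite ler_expR lerN2 -[leRHS]mul1r ler_wpM2r// ltW.
apply: (@le_trans _ _ (g2 * t `^ Dinf)).
  by apply: ler_pM; rewrite ?m0// ?ge_min ?lexx ?orbT// le_min (ltW g20) mulr_ge0 ?(ltW gamma0) ?expR_ge0.
have tk : t `^ Dinf <= k * expR (t * a).
  have aD : 0 < a / Dinf by rewrite divr_gt0.
  have h : t * (a / Dinf) <= expR (t * (a / Dinf)).
    by apply: le_trans (expR_ge1Dx _); rewrite lerDr.
  have -> : t = (Dinf / a) * (t * (a / Dinf)) by field; rewrite !gt_eqF.
  have A1 : 0 <= Dinf / a by rewrite divr_ge0// ltW.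
  have A2 : 0 <= t * (a / Dinf) by rewrite mulr_ge0// ltW.
  rewrite powRM//.
  rewrite /k; apply: ler_wpM2l; first exact: powR_ge0.
  have -> : Dinf / a * (t * (a / Dinf)) * a = t * (a / Dinf) * Dinf by field; rewrite !gt_eqF.
  rewrite expRM; apply: le_powR => //; exact: ltW.
have V1 : volume Q B 1 * expR (2 * ((t - 1) * a)) <= volume Q B t.
  have t10 : 0 < t - 1 by rewrite subr_gt0.
  have pB : pos_def (E (t - 1) *m gram 1 *m (E (t - 1))^T).
    by apply: pos_def_congruence; [exact: expmx_unit|exact: gramian_pos_def].
  have sB : Defs.symmetric (E (t - 1) *m gram 1 *m (E (t - 1))^T).
    by rewrite /Defs.symmetric !trmx_mul trmxK (gramian_sym 1 : (gram 1)^T = _) mulmxA.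
  have -> : volume Q B 1 * expR (2 * ((t - 1) * a)) = \det (E (t - 1) *m gram 1 *m (E (t - 1))^T).
    rewrite (_ : 2 * ((t - 1) * a) = (t - 1) * a + (t - 1) * a); last by ring.
    by rewrite expRD !det_mulmx det_tr det_expmx -/a /volume; ring.
  apply: det_pos_def_le => //; [exact: gramian_sym|exact: gramian_pos_def|].
  move=> x; have := @gramianD (t - 1) 1 (ltW t10) ler01; rewrite subrK => ->.
  by rewrite mulmxDl dotmulDl lerDr gramian_psd.
rewrite vol_pos//; apply: (@le_trans _ _ (volume Q B 1 * expR (2 * ((t - 1) * a)) * expR (- (t * a)))); last first.
  by apply: ler_wpM2r; rewrite ?expR_ge0.
have -> : volume Q B 1 * expR (2 * ((t - 1) * a)) * expR (- (t * a)) = g2 * (k * expR (t * a)).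
  have -> : expR (2 * ((t - 1) * a)) = expR (- (2 * a)) * expR (t * a) * expR (t * a).
    by rewrite -!expRD; congr expR; ring.
  rewrite (expRN (t * a)) /g2; have et : expR (t * a) != 0 by rewrite gt_eqF ?expR_gt0.
  by field; rewrite et gt_eqF.
by apply: ler_wpM2l; first exact: ltW.
Qed.

End Gramian.

(** * Density of Schwartz functions *)

Section SchwartzIntegrable.
Context (R : realType) (n : nat).
Local Notation leb := (@lebesgue_measure R).
Local Notation vec := 'cV[R]_n.

Lemma le_coord_norm (x : vec) i : `|x i 0| <= `|x|.
Proof.
have -> : `|x| = mx_norm x by [].
rewrite mx_normrE; exact: (le_bigmax _ (fun i : 'I_n * 'I_1 => `|x i.1 i.2|) (i, ord0)).
Qed.

Lemma meas_floor_eq (k : nat) (z : int) i :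
  measurable [set x : vec | Num.floor (k.+1%:R * x i 0) = z].
Proof.
have mf : mfunT (fun x : vec => k.+1%:R * x i 0).
  by apply: mfunM => //; exact: (measurable_coord i 0).
rewrite (_ : [set x | _] = (fun x : vec => k.+1%:R * x i 0) @^-1` `[z%:~R, (z + 1)%:~R[).
  by rewrite -[X in measurable X]setTI; apply: mf => //; exact: measurable_itv.
apply/seteqP; split => x /=; rewrite in_itv /=.
  by move=> <-; rewrite ge_floor lt_succ_floor.
by move=> /floor_def.
Qed.

(** The sigma-algebra is generated by the coordinates. Rounding them down to multiples of $1/(k+1)$
    gives functions constant on countably many measurable cells, which converge to $f$ by
    continuity. *)
Lemma meas_continuous_cV (f : vec -> R) : continuous f -> mfunT f.
Proof.
move=> cf; pose Z (k : nat) (x : vec) : 'cV[int]_n := \col_i Num.floor (k.+1%:R * x i 0).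
pose h (k : nat) (z : 'cV[int]_n) : vec := \col_i ((z i 0)%:~R / k.+1%:R).
apply: (@measurable_fun_cvg _ _ R setT (fun k x => f (h k (Z k x)))).
  move=> k _ Y mY; rewrite setTI.
  have -> : (fun x => f (h k (Z k x))) @^-1` Y =
      \bigcup_z (if `[< Y (f (h k z)) >] then [set x | Z k x = z] else set0).
    apply/seteqP; split => x /= => [Yx|[z _]].
      by exists (Z k x) => //; rewrite asboolT.
    by case: asboolP => // Yz ->.
  apply: countable_bigcupT_measurable; first exact: countableP.
  move=> z; case: asboolP => // _.
  rewrite (_ : [set x | _] = \bigcap_(i in [set: 'I_n]) [set x : vec | Num.floor (k.+1%:R * x i 0) = z i 0]).
    by apply: fin_bigcap_measurable => // i _; exact: meas_floor_eq.
  apply/seteqP; split => x /= => [<- i _|xz]; first by rewrite mxE.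
  by apply/matrixP => i j; rewrite (ord1 j) mxE xz.
move=> x _; apply: continuous_cvg; first exact: cf.
apply: cvg_mx => i j; rewrite (ord1 j).
under eq_fun do rewrite /h /Z !mxE.
have -> : (fun k : nat => (Num.floor (k.+1%:R * x i 0))%:~R / k.+1%:R) =
    (fun k => x i 0 - (x i 0 - (Num.floor (k.+1%:R * x i 0))%:~R / k.+1%:R)).
  by apply/funext => k; ring.
rewrite -[X in nbhs X](subr0 (x i 0)); apply: cvgB; first exact: cvg_cst.
apply: (@squeeze_cvgr _ _ _ _ (fun=> 0) (fun k => k.+1%:R^-1)).
- apply: nearW => k; have k0 : 0 < k.+1%:R :> R by [].
  rewrite subr_ge0 ler_pdivrMr// mulrC ge_floor /= -(ler_pM2r k0) mulrBl mulfVK ?gt_eqF// mulVf ?gt_eqF//.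
  by have := lt_succ_floor (x i 0 * k.+1%:R); rewrite intrD; lra.
- exact: cvg_cst.
- exact: cvg_harmonic.
Qed.
End SchwartzIntegrable.

Section Decay.
Context (R : realType).
Local Notation leb := (@lebesgue_measure R).
Local Notation lebn := (lebesgue_cV R).

(** An integrable majorant of Schwartz functions, in product form so that its integral factors over
    the coordinates. *)
Definition decay n (x : 'cV[R]_n) : R := \prod_i (1 + x i 0 ^+ 2)^-1.

Lemma decay_ge0 n (x : 'cV[R]_n) : 0 <= decay x.
Proof. by apply: prodr_ge0 => i _; rewrite invr_ge0 addr_ge0 ?sqr_ge0. Qed.

Lemma meas_decay n : mfunT (@decay n).
Proof.
apply: measurable_prod => i _; apply: meas_fun_inv; apply: mfunD => //.
by apply: mfunX; exact: (measurable_coord i 0).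
Qed.

Lemma integral_cauchy_lty : (\int[leb]_a ((1 + a ^+ 2)^-1)%:E < +oo)%E.
Proof.
have m : mfunT (fun x : R => ((1 + x ^+ 2)^-1)%:E).
  apply: meas_EFinR; apply: meas_fun_inv; apply: mfunD => //.
have := @integral_normr R _ m (fun x => _).
have -> : (\int[leb]_x ((1 + `|x| ^+ 2)^-1)%:E = \int[leb]_a ((1 + a ^+ 2)^-1)%:E)%E.
  by apply: eq_int => x _; rewrite real_normK ?num_real.
move=> ->; last by move=> x; rewrite lee_fin invr_ge0 addr_ge0 ?sqr_ge0.
have h : (\int[leb]_(x in `]0%R, +oo[) ((1 + x ^+ 2)^-1)%:E < +oo)%E.
  apply: (@le_lt_trans _ _ (\int[leb]_(x in `[0%R, +oo[) (oneDsqr x)^-1%:E)%E).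
    apply: ge0_subset_integral => //.
    - exact: mfunTS.
    - by move=> x _; rewrite lee_fin invr_ge0 addr_ge0 ?sqr_ge0.
    - by apply: subset_itvr; rewrite bnd_simp.
  by rewrite integral0y_oneDsqr ltry.
by rewrite lte_add_pinfty.
Qed.

Lemma integral_decay_lty n : (\int[lebn n]_x (decay x)%:E < +oo)%E.
Proof.
elim: n => [|n IHn].
  rewrite (eq_int (fun=> 1%E)); last by move=> x _; rewrite /decay big_ord0.
  by rewrite integral_cst//= /lebesgue_cV /= diracT mule1 ltry.
have d0 k (x : 'cV[R]_k) : (0 <= (decay x)%:E)%E by rewrite lee_fin decay_ge0.
have md k : mfunT (fun x : 'cV[R]_k => (decay x)%:E).
  by apply: mEFin_cV; exact: meas_decay.
rewrite (integral_cVS (md _) (@d0 _)).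
have dE a (v : 'cV[R]_n) : decay (cons_cV (a, v)) = (1 + a ^+ 2)^-1 * decay v.
  rewrite /decay big_ord_recl cons_cV0; congr (_ * _); apply: eq_bigr => i _.
  by rewrite cons_cVS.
pose I := fine (\int[lebn n]_x (decay x)%:E)%E.
have IE : (\int[lebn n]_x (decay x)%:E = I%:E)%E.
  by rewrite fineK// ge0_finE//; exact: int_ge0.
have c0 (a : R) : 0 <= (1 + a ^+ 2)^-1 by rewrite invr_ge0 addr_ge0 ?sqr_ge0.
have -> : (\int[leb]_a \int[lebn n]_v (decay (cons_cV (a, v)))%:E =
    \int[leb]_a (I%:E * ((1 + a ^+ 2)^-1)%:E))%E.
  apply: eq_int => a _; rewrite -IE muleC -integralZlT//.
    by apply: eq_int => v _; rewrite dE EFinM.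
  exact: md.
rewrite integralZlT.
- by rewrite lte_mul_pinfty ?lee_fin ?fine_ge0 ?int_ge0 ?integral_cauchy_lty.
- by move=> x; rewrite lee_fin.
- apply: meas_EFinR; apply: meas_fun_inv; apply: mfunD => //.
- by apply: fine_ge0; exact: int_ge0.
Qed.

(** Since $\prod_i(1+x_i^2)\le2^n(1+|x|^{2n})$, the Schwartz bounds of orders 0 and $2n$ on the
    function itself suffice. *)
Lemma rschwartz_decay n (f : 'cV[R]_n -> R) : rschwartz f ->
  exists2 C, 0 <= C & forall x, `|f x| <= C * decay x.
Proof.
move=> /(_ [::])[_ /= df]; have [M0 h0] := df 0%N; have [Mn hn] := df (2 * n)%N.
have M00 : 0 <= M0 by apply: le_trans (h0 0); rewrite expr0 mul1r.
have Mn0 : 0 <= Mn by apply: le_trans (hn 0); rewrite mulr_ge0// exprn_ge0.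
exists (2 ^+ n * (M0 + Mn)) => [|x]; first by rewrite mulr_ge0 ?exprn_ge0 ?addr_ge0.
have d0 : 0 < \prod_i (1 + x i 0 ^+ 2) by apply: prodr_gt0 => i _; rewrite ltr_pwDl ?sqr_ge0.
rewrite /decay prodfV ler_pdivlMr//.
have y0 : 0 <= `|x| ^+ 2 by rewrite sqr_ge0.
have hp : \prod_i (1 + x i 0 ^+ 2) <= 2 ^+ n * (1 + `|x| ^+ (2 * n)).
  apply: (@le_trans _ _ ((1 + `|x| ^+ 2) ^+ n)).
    rewrite -[X in _ <= _ ^+ X]card_ord -prodr_const; apply: ler_prod => i _.
    rewrite addr_ge0 ?sqr_ge0//= lerD2l -[x i 0 ^+ 2]real_normK ?num_real//.
    by rewrite ler_pXn2r ?nnegrE//; exact: le_coord_norm.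
  rewrite exprM; move: (`|x| ^+ 2) y0 => y y0.
  have [y1|y1] := leP y 1.
    apply: (@le_trans _ _ (2 ^+ n)); last by rewrite ler_peMr ?exprn_ge0// lerDl exprn_ge0.
    by apply: lerXn2r; rewrite ?nnegrE ?addr_ge0//; lra.
  apply: (@le_trans _ _ ((2 * y) ^+ n)).
    by apply: lerXn2r; rewrite ?nnegrE ?addr_ge0 ?mulr_ge0//; lra.
  by rewrite exprMn; apply: ler_wpM2l; rewrite ?exprn_ge0// lerDr.
apply: (le_trans (ler_wpM2l (normr_ge0 _) hp)).
rewrite mulrCA; apply: ler_wpM2l; first by rewrite exprn_ge0.
rewrite mulrDr mulr1; apply: lerD; first by have := h0 x; rewrite expr0 mul1r.
by rewrite mulrC; exact: hn.
Qed.

Lemma rschwartz_measurable n (f : 'cV[R]_n -> R) : rschwartz f -> mfunT f.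
Proof.
move=> /(_ [::])[df _]; apply: meas_continuous_cV => x.
exact: differentiable_continuous.
Qed.

Lemma schwartz_cintegrable n (f : 'cV[R]_n -> R[i]) : schwartz f -> cintegrable (lebn n) f.
Proof.
move=> [sR sI].
have mf : cmeasurable f by split; exact: rschwartz_measurable.
have [C1 C10 h1] := rschwartz_decay sR; have [C2 C20 h2] := rschwartz_decay sI.
have Id : (lebn n).-integrable setT (EFin \o @decay n).
  apply/integrableP; split; first by apply: mEFin_cV; exact: meas_decay.
  under eq_int do rewrite gee0_abs ?lee_fin ?decay_ge0//.
  exact: integral_decay_lty.
apply: (cintg_le mf (integrable_EFinZ (C1 + C2) Id)) => x.
by apply: le_trans (cabs_ReIm _) _; rewrite mulrDl; exact: lerD.
Qed.

End Decay.

Section SchwartzLinear.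
Context (R : realType) (n : nat).
Local Notation vec := 'cV[R]_n.

Lemma partialsD (f g : vec -> R) s : rschwartz f -> rschwartz g ->
  partials s (fun x => f x + g x) = (fun x => partials s f x + partials s g x).
Proof.
move=> sf sg; elim: s => [//|i s IHs] /=; rewrite IHs; apply/funext => x.
apply: deriveD; apply: diff_derivable; [exact: (sf s).1|exact: (sg s).1].
Qed.

Lemma rschwartzD (f g : vec -> R) : rschwartz f -> rschwartz g -> rschwartz (fun x => f x + g x).
Proof.
move=> sf sg s; rewrite partialsD//; split=> [x|k].
  by apply: differentiableD; [exact: (sf s).1|exact: (sg s).1].
have [M hM] := (sf s).2 k; have [N hN] := (sg s).2 k; exists (M + N) => x.
apply: le_trans (ler_wpM2l (exprn_ge0 k (normr_ge0 x)) (ler_normD _ _)) _.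
by rewrite mulrDr; exact: lerD.
Qed.

Lemma partialsZ (a : R) (f : vec -> R) s : rschwartz f ->
  partials s (fun x => a * f x) = (fun x => a * partials s f x).
Proof.
move=> sf; elim: s => [//|i s IHs] /=; rewrite IHs; apply/funext => x.
by apply: deriveZ; apply: diff_derivable; exact: (sf s).1.
Qed.

Lemma rschwartzZ (a : R) (f : vec -> R) : rschwartz f -> rschwartz (fun x => a * f x).
Proof.
move=> sf s; rewrite partialsZ//; split=> [x|k].
  by apply: differentiableZ; exact: (sf s).1.
have [M hM] := (sf s).2 k; exists (`|a| * M) => x.
by rewrite normrM mulrCA; apply: ler_wpM2l.
Qed.

Lemma schwartzD (f g : vec -> R[i]) : schwartz f -> schwartz g -> schwartz (fun x => f x + g x).
Proof.
move=> [fR fI] [gR gI]; split.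
  by rewrite (_ : (fun x => _) = (fun x => complex.Re (f x) + complex.Re (g x))); [exact: rschwartzD|apply/funext => x; rewrite ReD].
by rewrite (_ : (fun x => _) = (fun x => complex.Im (f x) + complex.Im (g x))); [exact: rschwartzD|apply/funext => x; rewrite ImD].
Qed.

Lemma schwartzZ (a : R[i]) (f : vec -> R[i]) : schwartz f -> schwartz (fun x => a * f x).
Proof.
move=> [fR fI]; split.
  rewrite (_ : (fun x => _) = (fun x => complex.Re a * complex.Re (f x) + (- complex.Im a) * complex.Im (f x))).
    by apply: rschwartzD; exact: rschwartzZ.
  by apply/funext => x; rewrite ReM mulNr.
rewrite (_ : (fun x => _) = (fun x => complex.Re a * complex.Im (f x) + complex.Im a * complex.Re (f x))).
  by apply: rschwartzD; exact: rschwartzZ.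
by apply/funext => x; rewrite ImM.
Qed.

Lemma schwartz_real (f : vec -> R) : rschwartz f -> schwartz (fun x => ((f x)%:C)%C).
Proof.
move=> sf; split => //=; rewrite (_ : (fun x => _) = (fun x => 0 * f x)); first exact: rschwartzZ.
by apply/funext => x; rewrite mul0r.
Qed.
End SchwartzLinear.

Section Sigmoid.
Context (R : realType).

(** The logistic function. Its derivative is a polynomial in itself, which gives smooth approximate
    indicators with explicit derivatives of every order, without compactly supported cut-offs. *)
Definition sig (y : R) : R := (1 + expR (- y))^-1.

Let den0 (y : R) : 0 < 1 + expR (- y).
by rewrite ltr_wpDl// expR_gt0. Qed.

Lemma sig_gt0 y : 0 < sig y. Proof. by rewrite invr_gt0. Qed.

Lemma sigN y : sig (- y) = 1 - sig y.
Proof.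
rewrite /sig opprK expRN; have := expR_gt0 y; move: (expR y) => e e0.
have e1 : 0 < 1 + e by rewrite addr_gt0.
by field; rewrite !gt_eqF// addrC.
Qed.

Lemma sig_lt1 y : sig y < 1.
Proof. by rewrite -subr_gt0 -sigN sig_gt0. Qed.

Lemma sig_le_expR y : sig y <= expR y.
Proof.
rewrite -[leRHS]invrK -expRN lef_pV2 ?posrE ?den0 ?expR_gt0//.
by rewrite lerDr.
Qed.

Lemma ler_sig x y : x <= y -> sig x <= sig y.
Proof. by move=> xy; rewrite lef_pV2 ?posrE ?den0// lerD2l ler_expR lerN2. Qed.

Lemma is_derive_sig (y : R) : is_derive y (1 : R) sig (sig y * (1 - sig y)).
Proof.
have h := @is_derive1_comp R expR -%R y _ _ (is_derive_expR _) (is_derive_opp y).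
have := @is_deriveV R (fun y => 1 + expR (- y)) y _ 1 (lt0r_neq0 (den0 y)) (is_deriveD (is_derive_cst (1 : R) y 1) h).
congr (is_derive _ _ _ _); rewrite add0r mulrN1 /GRing.scale /= -sigN /sig opprK expRN.
have := expR_gt0 y; move: (expR y) => e e0.
have e1 : 0 < 1 + e by rewrite addr_gt0.
by field; rewrite !gt_eqF// addrC.
Qed.

(** Uniform in the slope: this is the majorant for dominated convergence to a step. *)
Lemma sig_dominated (l z : R) : 1 <= l -> sig (l * z) <= 2 * sig z.
Proof.
move=> l1; have [z0|z0] := leP 0 z.
  have : sig 0 <= sig z by exact: ler_sig.
  have -> : sig 0 = 2^-1 by rewrite /sig oppr0 expR0.
  by have := sig_lt1 (l * z); lra.
apply: (@le_trans _ _ (sig z)); last by have := sig_gt0 z; lra.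
by apply: ler_sig; nra.
Qed.

(** The slope $(k+1)^2$ beats the shift $k+1$ away from $a$, and the shift decides the value at
    $y=a$, so that the limit is the indicator of the strict inequality. *)
Lemma cvg_sig_step (a y : R) :
  sig (k.+1%:R ^+ 2 * (y - a) - k.+1%:R) @[k --> \oo] --> ((if a < y then 1 else 0) : R).
Proof.
have small (z : R) : 0 < z -> sig (- z) <= z^-1.
  move=> z0; apply: le_trans (sig_le_expR _) _; rewrite expRN lef_pV2 ?posrE ?expR_gt0//.
  by have := expR_ge1Dx z; lra.
case: ltP => [ay|ya].
  have -> : (fun k : nat => sig (k.+1%:R ^+ 2 * (y - a) - k.+1%:R)) =
     (fun k : nat => 1 - sig (- (k.+1%:R ^+ 2 * (y - a) - k.+1%:R))).
    by apply/funext => k; rewrite sigN subKr.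
  suff h : sig (- (k.+1%:R ^+ 2 * (y - a) - k.+1%:R)) @[k --> \oo] --> (0 : R).
    have H : (1 - sig (- (k.+1%:R ^+ 2 * (y - a) - k.+1%:R))) @[k --> \oo] --> (1 - 0 : R).
      exact: cvgB (cvg_cst _) h.
    by rewrite subr0 in H.
  apply: (@squeeze_cvgr _ _ _ _ (fun=> 0) (fun k => k.+1%:R^-1)); [|exact: cvg_cst|exact: cvg_harmonic].
  have d0 : 0 < y - a by rewrite subr_gt0.
  near=> k; have k0 : 0 < k.+1%:R :> R by [].
  rewrite (ltW (sig_gt0 _)) /=.
  have kd : 2 <= k.+1%:R * (y - a).
    rewrite -ler_pdivrMr//; near: k; have := nbhs_infty_ger (2 / (y - a)).
    by apply: filterS => k /= h; apply: le_trans h _; rewrite ler_nat.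
  have kz : k.+1%:R <= k.+1%:R ^+ 2 * (y - a) - k.+1%:R by rewrite expr2; nra.
  apply: le_trans (small _ (lt_le_trans k0 kz)) _.
  by rewrite lef_pV2 ?posrE// (lt_le_trans k0 kz).
apply: (@squeeze_cvgr _ _ _ _ (fun=> 0) (fun k => k.+1%:R^-1)); [|exact: cvg_cst|exact: cvg_harmonic].
apply: nearW => k; rewrite (ltW (sig_gt0 _)) /=; apply: le_trans (small _ _) => //.
apply: ler_sig; have := sqr_ge0 (k.+1%:R : R); have : y - a <= 0 by rewrite subr_le0.
by move: (k.+1%:R ^+ 2) => u; nra.
Unshelve. all: by end_near. Qed.

Lemma pow_le_expR (l : R) k : 0 < l ->
  exists2 M, 0 <= M & forall y, 0 <= y -> y ^+ k <= M * expR (l * y).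
Proof.
move=> l0; case: k => [|k].
  by exists 1 => // z z0; rewrite expr0 mul1r -expR0 ler_expR mulr_ge0// ltW.
exists ((k.+1%:R / l) ^+ k.+1) => [|z z0]; first by rewrite exprn_ge0// divr_ge0// ltW.
have -> : l * z = k.+1%:R * (l * z / k.+1%:R) by rewrite mulrCA mulfV ?mulr1.
rewrite expRM_natl -exprMn; apply: lerXn2r.
- by rewrite nnegrE.
- by rewrite nnegrE mulr_ge0 ?expR_ge0// divr_ge0// ltW.
have := expR_ge1Dx (l * z / k.+1%:R) => h.
apply: (@le_trans _ _ (k.+1%:R / l * (l * z / k.+1%:R))).
  by rewrite (_ : _ * _ = z)//; field; rewrite ?gt_eqF//= ltr_wpDr.
apply: ler_wpM2l; first by rewrite divr_ge0// ltW.
by apply: le_trans h; rewrite lerDr.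
Qed.

(** A rising edge times a falling edge, exponentially small at both ends for [0 < l]. *)
Definition bump1 (l b c y : R) := sig (l * y + b) * sig (- l * y + c).

Lemma bump1_ge0 l b c y : 0 <= bump1 l b c y.
Proof. by rewrite mulr_ge0// ltW// sig_gt0. Qed.

Lemma bump1_le1 l b c y : bump1 l b c y <= 1.
Proof. by rewrite mulr_ile1 ?(ltW (sig_gt0 _)) ?(ltW (sig_lt1 _)). Qed.

Lemma bump1_decay l b c : 0 < l -> forall y, bump1 l b c y <= expR (`|b| + `|c|) * expR (- (l * `|y|)).
Proof.
move=> l0 y; rewrite -expRD.
have h1 : bump1 l b c y <= sig (l * y + b) by rewrite ler_piMr ?(ltW (sig_gt0 _)) ?(ltW (sig_lt1 _)).
have h2 : bump1 l b c y <= sig (- l * y + c) by rewrite ler_piMl ?(ltW (sig_gt0 _)) ?(ltW (sig_lt1 _)).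
have := ler_norm b; have := ler_norm c; have := normr_ge0 b; have := normr_ge0 c => c0 b0 cc bb.
have [y0|y0] := leP 0 y.
  apply: le_trans h2 (le_trans (sig_le_expR _) _); rewrite ler_expR mulNr (ger0_norm y0); lra.
by apply: le_trans h1 (le_trans (sig_le_expR _) _); rewrite ler_expR (ltr0_norm y0) mulrN opprK; lra.
Qed.

End Sigmoid.

Section Bump.
Context (R : realType) (n : nat).
Local Notation vec := 'cV[R]_n.

(** An algebra of bounded functions stable under partial derivatives; every derivative of a bump is
    one of its elements times the bump itself. *)
Inductive salg : (vec -> R) -> Prop :=
| salg_cst c : salg (fun=> c)
| salg_sig i l b : salg (fun x => sig (l * x i 0 + b))
| salgD f g : salg f -> salg g -> salg (fun x => f x + g x)
| salgM f g : salg f -> salg g -> salg (fun x => f x * g x).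

Lemma derive_coord (x v : vec) i : is_derive x v (fun y : vec => y i 0 : R) (v i 0).
Proof.
apply: DeriveDef; first exact/diff_derivable/differentiable_coord.
apply: cvg_lim => //; apply: cvg_near_cst; near=> h.
rewrite /= !mxE addrK /GRing.scale /= mulKf//.
by near: h; exact: nbhs_dnbhs_neq.
Unshelve. all: by end_near. Qed.

Let dsig (x : vec) i l b j : is_derive x (delta_mx j 0 : vec) (fun x : vec => sig (l * x i 0 + b))
  ((if i == j then l else 0) * (sig (l * x i 0 + b) * (1 - sig (l * x i 0 + b)))).
pose L (x : vec) : R := l * x i 0 + b.
have dL : is_derive x (delta_mx j 0 : vec) L (if i == j then l else 0).
  have := is_deriveD (is_deriveZ l (derive_coord x (delta_mx j 0) i)) (is_derive_cst b x (delta_mx j 0 : vec)).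
  congr is_derive; rewrite addr0 mxE eqxx andbT /GRing.scale /=.
  by case: eqP => _; rewrite ?mulr1 ?mulr0.
have diffL : differentiable L x.
  apply: differentiableD; last exact: differentiable_cst.
  by apply: differentiableZ; exact: differentiable_coord.
have dS : derivable (@sig R) (L x) (1 : R) by case: (is_derive_sig (L x)).
have diffS : differentiable (@sig R) (L x) by apply/derivable1_diffP.
apply: DeriveDef; first by apply: diff_derivable; exact: differentiable_comp.
rewrite deriveE; last exact: differentiable_comp.
rewrite diff_comp//= -(deriveE _ diffL) (@derive_val _ _ _ _ _ _ _ dL) deriv1E//.
by rewrite derive1E (@derive_val _ _ _ _ _ _ _ (is_derive_sig (L x))).
Qed.

Lemma salg_differentiable f : salg f -> forall x, differentiable f x.
Proof.
elim=> [c|i l b|g h _ IHg _ IHh|g h _ IHg _ IHh] x.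
- exact: differentiable_cst.
- apply: (@differentiable_comp _ _ _ _ (fun x : vec => l * x i 0 + b) (@sig R)).
    apply: differentiableD; last exact: differentiable_cst.
    by apply: differentiableZ; exact: differentiable_coord.
  by apply/derivable1_diffP; case: (is_derive_sig (l * x i 0 + b)).
- exact: differentiableD.
- exact: differentiableM.
Qed.

Lemma salg_bounded f : salg f -> exists M, forall x, `|f x| <= M.
Proof.
elim=> [c|i l b|g h _ [M hM] _ [N hN]|g h _ [M hM] _ [N hN]].
- by exists `|c|.
- by exists 1 => x; rewrite ger0_norm ltW// ?sig_gt0 ?sig_lt1.
- by exists (M + N) => x; apply: le_trans (ler_normD _ _) _; exact: lerD.
- by exists (M * N) => x; rewrite normrM ler_pM.
Qed.

Lemma salg_derive f : salg f -> forall j, exists2 g, salg g & forall x, 'D_(delta_mx j 0) f x = g x.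
Proof.
elim=> [c|i l b|g h Ag IHg Ah IHh|g h Ag IHg Ah IHh] j.
- by exists (fun=> 0); [exact: salg_cst|move=> x; exact: derive_cst].
- exists (fun x => (if i == j then l else 0) * (sig (l * x i 0 + b) * (1 + (-1) * sig (l * x i 0 + b)))).
    apply: salgM; [exact: salg_cst|apply: salgM; [exact: salg_sig|apply: salgD]]; first exact: salg_cst.
    by apply: salgM; [exact: salg_cst|exact: salg_sig].
  by move=> x; rewrite mulN1r (@derive_val _ _ _ _ _ _ _ (dsig x i l b j)).
- have [dg Adg gE] := IHg j; have [dh Adh hE] := IHh j.
  exists (fun x => dg x + dh x) => [|x]; first exact: salgD.
  by rewrite -gE -hE; apply: deriveD; apply: diff_derivable; exact: salg_differentiable.
- have [dg Adg gE] := IHg j; have [dh Adh hE] := IHh j.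
  exists (fun x => g x * dh x + h x * dg x) => [|x]; first by apply: salgD; apply: salgM.
  by rewrite -gE -hE; apply: deriveM; apply: diff_derivable; exact: salg_differentiable.
Qed.

Definition bumps (s : seq 'I_n) (l : R) (b c : 'I_n -> R) (x : vec) : R :=
  \prod_(i <- s) bump1 l (b i) (c i) (x i 0).

Let salg_bump1 i l b c : salg (fun x => bump1 l b c (x i 0)).
by apply: salgM; exact: salg_sig. Qed.

Lemma salg_bumps s l b c : salg (bumps s l b c).
Proof.
elim: s => [|i s IHs].
  by rewrite (_ : bumps _ _ _ _ = fun=> 1); [exact: salg_cst|apply/funext => x; rewrite /bumps big_nil].
rewrite (_ : bumps _ _ _ _ = fun x => bump1 l (b i) (c i) (x i 0) * bumps s l b c x).
  by apply: salgM.
by apply/funext => x; rewrite /bumps big_cons.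
Qed.

(** Logarithmic derivative of a product: each edge contributes
    $\mathrm{sig}'/\mathrm{sig}=1-\mathrm{sig}$ times its slope. *)
Lemma bumps_derive s l b c j : exists2 a, salg a &
  forall x, 'D_(delta_mx j 0) (bumps s l b c) x = a x * bumps s l b c x.
Proof.
elim: s => [|i s [a Aa aE]].
  exists (fun=> 0) => [|x]; first exact: salg_cst.
  rewrite (_ : bumps _ _ _ _ = fun=> 1); last by apply/funext => z; rewrite /bumps big_nil.
  by rewrite derive_cst mul0r.
pose li := if i == j then l else 0.
exists (fun x : vec => (li * (1 + (-1) * sig (l * x i 0 + b i)) + (- li) * (1 + (-1) * sig (- l * x i 0 + c i))) + a x).
  apply: salgD => //; apply: salgD; (apply: salgM; first exact: salg_cst);
    (apply: salgD; first exact: salg_cst); (apply: salgM; first exact: salg_cst); exact: salg_sig.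
move=> x.
have E : bumps (i :: s) l b c = (fun x => sig (l * x i 0 + b i) * sig (- l * x i 0 + c i) * bumps s l b c x).
  by apply/funext => z; rewrite /bumps big_cons.
have d1 := is_deriveM (dsig x i l (b i) j) (dsig x i (- l) (c i) j).
have d2 : is_derive x (delta_mx j 0 : vec) (bumps s l b c) (a x * bumps s l b c x).
  apply: DeriveDef; last exact: aE.
  exact/diff_derivable/salg_differentiable/salg_bumps.
rewrite E (@derive_val _ _ _ _ _ _ _ (is_deriveM d1 d2)) /li /GRing.scale /= mulrfctE.
by case: eqP => _; ring.
Qed.

Lemma bumps_ge0 s l b c x : 0 <= bumps s l b c x.
Proof. by apply: prodr_ge0 => i _; exact: bump1_ge0. Qed.

Lemma bumps_le1 s l b c x : bumps s l b c x <= 1.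
Proof. by apply: prodr_ile1 => i _; rewrite bump1_ge0 bump1_le1. Qed.

Local Notation bump := (bumps (index_enum 'I_n)).

(** The coordinate that attains the maximum norm already decays exponentially, and the other factors
    are at most 1. *)
Lemma bump_decay l b c k : 0 < l -> exists M, forall x, `|x| ^+ k * bump l b c x <= M.
Proof.
move=> l0; have [P P0 hP] := pow_le_expR k l0.
pose C i := P * expR (`|b i| + `|c i|).
have C0 i : 0 <= C i by rewrite mulr_ge0 ?expR_ge0.
exists (1 + \sum_i C i) => x.
have [x0|/mx_norm_neq0[[i j] /= xE]] := eqVneq (mx_norm x) 0.
  apply: (@le_trans _ _ 1); last by rewrite lerDl sumr_ge0.
  have -> : `|x| = 0 by exact: x0.
  by rewrite expr0n; case: k {hP} => [|k]; rewrite ?mul1r ?bumps_le1// mul0r.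
have -> : `|x| = `|x i 0| by rewrite -[LHS]/(mx_norm x) xE (ord1 j).
apply: (@le_trans _ _ (C i)); last first.
  by rewrite (bigD1 i)//= addrCA lerDl addr_ge0// sumr_ge0.
apply: (@le_trans _ _ (`|x i 0| ^+ k * bump1 l (b i) (c i) (x i 0))).
  apply: ler_wpM2l; first by rewrite exprn_ge0.
  rewrite /bumps (bigD1 i)//= ler_piMr ?bump1_ge0//.
  by apply: prodr_ile1 => m _; rewrite bump1_ge0 bump1_le1.
apply: (@le_trans _ _ ((P * expR (l * `|x i 0|)) * (expR (`|b i| + `|c i|) * expR (- (l * `|x i 0|))))).
  by apply: ler_pM; rewrite ?exprn_ge0 ?bump1_ge0 ?hP//; exact: bump1_decay.
by rewrite expRN mulrACA mulfV ?mulr1// gt_eqF// expR_gt0.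
Qed.

Lemma rschwartz_bump l b c : 0 < l -> rschwartz (bump l b c).
Proof.
move=> l0 s.
suff [a Aa ->] : exists2 a, salg a & partials s (bump l b c) = (fun x => a x * bump l b c x).
  split=> [x|k].
    by apply: salg_differentiable; apply: salgM => //; exact: salg_bumps.
  have [M hM] := salg_bounded Aa; have [N hN] := bump_decay b c k l0.
  exists (M * N) => x; rewrite normrM (ger0_norm (bumps_ge0 _ _ _ _ _)) mulrCA.
  by apply: ler_pM; rewrite ?mulr_ge0 ?exprn_ge0 ?bumps_ge0.
elim: s => [|j s [a Aa IHs]] /=.
  by exists (fun=> 1); [exact: salg_cst|apply/funext => x; rewrite mul1r].
have [a' Aa' aE] := salg_derive Aa j; have [d Ad dE] := bumps_derive (index_enum 'I_n) l b c j.
exists (fun x => a x * d x + a' x); first by apply: salgD => //; exact: salgM.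
rewrite IHs; apply/funext => x.
have -> : 'D_(delta_mx j 0) (fun x => a x * bump l b c x) x = a x * (d x * bump l b c x) + bump l b c x * a' x.
  rewrite -dE -aE; apply: deriveM; apply: diff_derivable; apply: salg_differentiable => //.
  exact: salg_bumps.
ring.
Qed.
End Bump.

(** * Norms of complex functions and approximation in Lp *)

Section LpNorm.
Context d (T : measurableType d) (R : realType) (mu : {measure set T -> \bar R}).

Lemma Lp_norm_ge0 (p : R) (f : T -> R[i]) : (0 <= Lp_norm mu p%:E f)%E.
Proof. exact: Lnorm_ge0. Qed.

Lemma Lp_normD (p : R) (f g : T -> R[i]) : 1 <= p -> cmeasurable f -> cmeasurable g ->
  (Lp_norm mu p%:E (fun x => f x + g x)%R <= Lp_norm mu p%:E f + Lp_norm mu p%:E g)%E.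
Proof.
move=> p1 mf mg; have p0 : 0 < p by apply: lt_le_trans p1.
have mcf := cmeas_cabs mf; have mcg := cmeas_cabs mg.
apply: le_trans (minkowski_EFin mu mcf mcg p1).
apply: le_Lnorm => //.
- by apply/mEFinP; apply: cmeas_cabs; exact: cmeasD.
- by apply/mEFinP; exact: mfunD.
- nonneg.
- by move=> x /=; rewrite lee_fin cabsD.
Qed.

Lemma Lp_normZ (p : R) (c : R[i]) (f : T -> R[i]) : 0 < p -> cmeasurable f ->
  (Lp_norm mu p%:E (fun x => c * f x)%R = (cabs c)%:E * Lp_norm mu p%:E f)%E.
Proof.
move=> p0 mf; rewrite /Lp_norm !Lnorm_ge0E; last 2 first.
- nonneg.
- nonneg.
have -> : (\int[mu]_x ((cabs (c * f x))%:E `^ p) = ((cabs c) `^ p)%:E * \int[mu]_x ((cabs (f x))%:E `^ p))%E.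
  rewrite -integralZlT ?powR_ge0//.
  - by apply: eq_int => x _; rewrite cabsM !poweR_EFin powRM ?cabs_ge0.
  - nonneg.
  - meas.
rewrite poweRM ?lee_fin ?powR_ge0 ?int_ge0//; last nonneg.
by rewrite -poweR_EFin poweRKV ?lee_fin ?cabs_ge0 ?gt_eqF.
Qed.

Lemma ae_eq_Lp_norm (p : R) (f g : T -> R[i]) : 0 < p -> cmeasurable f -> cmeasurable g ->
  {ae mu, forall x, f x = g x} -> Lp_norm mu p%:E f = Lp_norm mu p%:E g.
Proof.
move=> p0 mf mg fg; rewrite /Lp_norm !Lnorm_ge0E; last 2 first.
- nonneg.
- nonneg.
apply: (congr1 (fun z => z `^ p^-1)%E); apply: ge0_ae_eq_integral => //.
- meas.
- meas.
- nonneg.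
- nonneg.
- by apply: filterS fg => x -> _.
Qed.

Lemma Lp_norm_lty (p : R) (f : T -> R[i]) : 0 < p ->
  (Lp_norm mu p%:E f < +oo)%E <-> (\int[mu]_x (cabs (f x) `^ p)%:E < +oo)%E.
Proof.
move=> p0; rewrite /Lp_norm Lnorm_ge0E; last nonneg.
have -> : (\int[mu]_x ((cabs (f x))%:E `^ p) = \int[mu]_x (cabs (f x) `^ p)%:E)%E.
  by apply: eq_int => x _; rewrite poweR_EFin.
have i0 : (0 <= \int[mu]_x (cabs (f x) `^ p)%:E)%E.
  by apply: int_ge0 => x _; rewrite lee_fin powR_ge0.
split; last by move=> h; rewrite poweR_lty.
move=> h; have := poweR_lty p h.
by rewrite poweRVK// gt_eqF.
Qed.

Lemma cvg_powR_0 (u : R^nat) (p : R) : 0 < p -> (forall k, 0 <= u k) ->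
  u @ \oo --> 0 -> (fun k => u k `^ p) @ \oo --> (0 : R).
Proof.
move=> p0 u0 cu; apply/cvgrPdist_lt => e e0.
have ep : 0 < e `^ p^-1 by rewrite powR_gt0.
near=> k; rewrite sub0r normrN ger0_norm ?powR_ge0//.
have : u k < e `^ p^-1.
  near: k; have := cu => /cvgrPdist_lt/(_ _ ep); apply: filterS => k.
  by rewrite sub0r normrN ger0_norm.
move=> lt; have <- : (e `^ p^-1) `^ p = e by rewrite -powRrM mulVf ?gt_eqF// powRr1// ltW.
by apply: gt0_ltr_powR; rewrite ?nnegrE// ltW.
Unshelve. all: by end_near. Qed.

Lemma Lp_dominated_cvg (p : R) (f_ : nat -> T -> R[i]) (f : T -> R[i]) (h : T -> R) :
  0 < p -> (forall k, cmeasurable (f_ k)) -> cmeasurable f ->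
  (forall x, cabs (f_ k x - f x) @[k --> \oo] --> 0) ->
  (forall k x, cabs (f_ k x - f x) <= h x) -> mfunT h ->
  (\int[mu]_x (h x `^ p)%:E < +oo)%E ->
  forall eps : R, 0 < eps -> \forall k \near \oo, (Lp_norm mu p%:E (f_ k \- f)%R < eps%:E)%E.
Proof.
move=> p0 mf_ mf cf fh mh hoo eps eps0.
have mfd k : cmeasurable (f_ k \- f)%R by exact: cmeasB.
have h0 x : 0 <= h x by apply: le_trans (fh 0%N x); exact: cabs_ge0.
pose F k x := (cabs ((f_ k \- f)%R x) `^ p)%:E.
have mF k : mfunT (F k).
  by apply/mEFinP; apply: mfun_powR; exact: cmeas_cabs.
have Ih : mu.-integrable setT (fun x => (h x `^ p)%:E).
  apply/integrableP; split; first by apply/mEFinP; exact: mfun_powR.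
  by under eq_int do rewrite gee0_abs ?lee_fin ?powR_ge0//.
have cF : {ae mu, forall x, setT x -> F k x @[k --> \oo] --> (cst 0%E : T -> \bar R) x}.
  apply: aeW => x _; apply: cvg_EFin; first exact: nearW.
  by apply: (@cvg_powR_0 (fun k => cabs ((f_ k \- f)%R x)) p p0 _ (cf x)) => k; exact: cabs_ge0.
have bF : {ae mu, forall x k, setT x -> (`|F k x| <= (h x `^ p)%:E)%E}.
  apply: aeW => x k _; rewrite /F gee0_abs ?lee_fin ?powR_ge0// le_powR ?cabs_ge0 ?(ltW p0)//.
  exact: fh.
have [_ _] := dominated_convergence measurableT mF (mcst _) cF Ih bF.
rewrite integral0 => cI.
have e2 : 0 < (eps / 2) `^ p by rewrite powR_gt0// divr_gt0.
have := cI; move/fine_cvgP => [finF /cvgrPdist_lt/(_ _ e2)] cfin.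
near=> k.
apply: (@le_lt_trans _ _ (eps / 2)%:E); last by rewrite lte_fin ltr_pdivrMr// ltr_pMr// ltr1n.
rewrite /Lp_norm; apply/Lnorm_le => //.
- by rewrite lee_fin divr_ge0// ltW.
- nonneg.
have : (\int[mu]_x F k x \is a fin_num)%E by near: k.
move=> kfin; rewrite poweR_EFin.
have -> : (\int[mu]_x ((cabs ((f_ k \- f)%R x))%:E `^ p) = \int[mu]_x F k x)%E.
  by apply: eq_int => x _; rewrite poweR_EFin.
rewrite -(fineK kfin) lee_fin ltW//.
have : `|0 - fine (\int[mu]_x F k x)| < (eps / 2) `^ p by near: k.
by rewrite sub0r normrN; apply: le_lt_trans; rewrite ler_norm.
Unshelve. all: by end_near. Qed.

End LpNorm.

Import HBNNSimple.

Section Density.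
Context (R : realType) (n : nat) (p : R).
Hypothesis p1 : 1 <= p.
Local Notation vec := 'cV[R]_n.
Local Notation lebn := (lebesgue_cV R n).
Local Notation Np := (Lp_norm lebn p%:E).

Let p0 : 0 < p. Proof. exact: lt_le_trans p1. Qed.

(** The closure of the Schwartz functions for the $L^p$ distance is taken inside all measurable
    functions, which lightens its stability properties: no norm has to be shown finite along the
    way. *)
Definition schwartz_limit (f : vec -> R[i]) := cmeasurable f /\
  forall eps : R, 0 < eps -> exists psi, schwartz psi /\ (Np (f \- psi)%R < eps%:E)%E.
Local Notation lim := schwartz_limit.

Let cmS (psi : vec -> R[i]) : schwartz psi -> cmeasurable psi.
by case/schwartz_cintegrable. Qed.

Let limS (psi : vec -> R[i]) : schwartz psi -> lim psi.
move=> s; split=> [|eps e0]; first exact: cmS.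
exists psi; split=> //; rewrite /Lp_norm (_ : (fun x => _) = cst 0%E).
  by rewrite Lnorm0// gt_eqF.
by apply/funext => x /=; rewrite subrr cabs0.
Qed.

Let lim_lim (f : vec -> R[i]) : cmeasurable f ->
  (forall eps : R, 0 < eps -> exists g, lim g /\ (Np (f \- g)%R < eps%:E)%E) -> lim f.
move=> mf h; split=> // eps e0.
have e2 : 0 < eps / 2 by rewrite divr_gt0.
have [g [[mg /(_ _ e2)[psi [sp gp]]] fg]] := h _ e2.
exists psi; split => //.
have -> : (f \- psi)%R = (fun x => (f \- g)%R x + (g \- psi)%R x).
  by apply/funext => x /=; rewrite addrA subrK.
apply: le_lt_trans (Lp_normD _ p1 _ _) _; [exact: cmeasB|apply: cmeasB => //; exact: cmS|].
rewrite (_ : eps = eps / 2 + eps / 2); last by field.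
by rewrite EFinD; apply: lteD.
Qed.

Let limD (f g : vec -> R[i]) : lim f -> lim g -> lim (fun x => f x + g x).
move=> [mf hf] [mg hg]; split=> [|eps e0]; first exact: cmeasD.
have e2 : 0 < eps / 2 by rewrite divr_gt0.
have [a [sa fa]] := hf _ e2; have [b [sb gb]] := hg _ e2.
exists (fun x => a x + b x); split; first exact: schwartzD.
rewrite (_ : _ \- _ = fun x => (f \- a)%R x + (g \- b)%R x); last first.
  by apply/funext => x /=; rewrite opprD addrACA.
apply: le_lt_trans (Lp_normD _ p1 _ _) _.
- by apply: cmeasB => //; exact: cmS.
- by apply: cmeasB => //; exact: cmS.
rewrite (_ : eps = eps / 2 + eps / 2); last by field.
by rewrite EFinD; apply: lteD.
Qed.

Let limZ (c : R[i]) (f : vec -> R[i]) : lim f -> lim (fun x => c * f x).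
move=> [mf hf]; split=> [|eps e0]; first by apply: cmeasM => //; exact: cmeas_cst.
have c1 : 0 < cabs c + 1 by rewrite ltr_wpDl ?cabs_ge0.
have e2 : 0 < eps / (cabs c + 1) by rewrite divr_gt0.
have [a [sa fa]] := hf _ e2.
exists (fun x => c * a x); split; first exact: schwartzZ.
rewrite (_ : _ \- _ = fun x => c * (f \- a)%R x); last by apply/funext => x /=; rewrite mulrBr.
rewrite Lp_normZ//; last by apply: cmeasB => //; exact: cmS.
apply: (@le_lt_trans _ _ ((cabs c)%:E * (eps / (cabs c + 1))%:E)%E).
  by apply: lee_wpmul2l; [rewrite lee_fin cabs_ge0|exact: ltW].
by rewrite -EFinM lte_fin mulrCA -[ltRHS]mulr1 ltr_pM2l// ltr_pdivrMr// mul1r ltrDl.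
Qed.

Let lim_sum (I : Type) (s : seq I) (f : I -> vec -> R[i]) : (forall i, lim (f i)) ->
  lim (fun x => \sum_(i <- s) f i x).
move=> hf; elim: s => [|i s IHs].
  rewrite (_ : (fun x => _) = (fun x => ((0 * bumps (index_enum 'I_n) 1 (fun=> 0) (fun=> 0) x)%:C)%C)).
    by apply: limS; apply: schwartz_real; apply: rschwartzZ; exact: rschwartz_bump.
  by apply/funext => x; rewrite big_nil mul0r.
rewrite (_ : (fun x => _) = (fun x => f i x + \sum_(j <- s) f j x)); first exact: limD.
by apply/funext => x; rewrite big_cons.
Qed.

Let lim_dct (f_ : nat -> vec -> R[i]) (f : vec -> R[i]) (h : vec -> R) :
  (forall k, lim (f_ k)) -> cmeasurable f ->
  (forall x, cabs (f_ k x - f x) @[k --> \oo] --> 0) ->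
  (forall k x, cabs (f_ k x - f x) <= h x) -> mfunT h ->
  (\int[lebn]_x (h x `^ p)%:E < +oo)%E -> lim f.
move=> lf mf cf fh mh hoo; apply: lim_lim => // eps e0.
have [k _ hk] := Lp_dominated_cvg p0 (fun k => (lf k).1) mf cf fh mh hoo e0.
exists (f_ k); split => //; have := hk k (leqnn k); congr (_ < _)%E.
by congr (Lnorm _ _ _); apply/funext => x /=; rewrite cabs_distC.
Qed.

Definition box (a b : 'I_n -> R) : set vec := [set x | forall i, a i < x i 0 <= b i].

Lemma meas_box a b : measurable (box a b).
Proof.
rewrite (_ : box a b = \bigcap_(i in [set: 'I_n]) ((fun x : vec => x i 0) @^-1` `]a i, b i])).
  apply: fin_bigcap_measurable => // i _; rewrite -[X in measurable X]setTI.
  by apply: (measurable_coord i 0) => //; exact: measurable_itv.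
by apply/seteqP; split => x h i; [move=> _|]; have := h i; rewrite /= in_itv //; apply.
Qed.

Let cind (E : set vec) : vec -> R[i] := fun x => ((\1_E x : R)%:C)%C.

Let cm_cind E : measurable E -> cmeasurable (cind E).
by move=> mE; apply: cmeas_real; exact: mindic. Qed.

Let cvg_prod_seq (I : Type) (s : seq I) (u : I -> R^nat) (l : I -> R) :
  (forall i, u i @ \oo --> l i) -> (fun k => \prod_(i <- s) u i k) @ \oo --> \prod_(i <- s) l i.
move=> ul; elim: s => [|i s IHs].
  by rewrite big_nil; under eq_fun do rewrite big_nil; exact: cvg_cst.
by rewrite big_cons; under eq_fun do rewrite big_cons; exact: cvgM.
Qed.

Let cvg_cabs_real (u : R^nat) (l : R) : u @ \oo --> l ->
  cabs (((u k)%:C)%C - (l%:C)%C) @[k --> \oo] --> (0 : R).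
move=> ul; apply/cvgrPdist_lt => e e0; have := ul => /cvgrPdist_lt/(_ _ e0); apply: filterS => k.
by rewrite sub0r normrN -rmorphB cabs_real normr_id distrC.
Qed.

Let half_sig (y : R) : 0 <= y -> 1 <= 2 * sig y.
move=> y0; have : sig 0 <= sig y by exact: ler_sig.
have -> : sig 0 = 2^-1 :> R by rewrite /sig oppr0 expR0.
by lra.
Qed.

(** Products of steep logistic edges converge to the indicator of the half-open box, and one
    function [h] dominates all of them. *)
Let lim_box a b : lim (cind (box a b)).
pose l (k : nat) : R := k.+1%:R ^+ 2.
pose be k i := - (l k * a i) - k.+1%:R; pose ga k i := l k * b i + k.+1%:R.
pose f k := bumps (index_enum 'I_n) (l k) (be k) (ga k).
(* Edges of slope 1 with a factor 2 for each of the $2n$ of them, by [sig_dominated]. The upper edge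
   is moved by 1 because the shift $k+1$ is at most the slope $(k+1)^2$. *)
pose h (x : vec) : R := 4 ^+ n * bumps (index_enum 'I_n) 1 (fun i => - a i) (fun i => b i + 1) x.
have l1 k : 1 <= l k by rewrite /l -natrX ler1n expn_gt0.
have h0 x : 0 <= h x by rewrite mulr_ge0 ?exprn_ge0 ?bumps_ge0.
have hprod x : h x = \prod_i ((2 * sig (x i 0 - a i)) * (2 * sig (b i + 1 - x i 0))).
  rewrite /h /bumps -[X in 4 ^+ X]card_ord -prodr_const -big_split /=; apply: eq_bigr => i _.
  by rewrite /bump1 mul1r mulN1r [- _ + _]addrC; ring.
have fh k x : f k x <= h x.
  rewrite hprod; apply: ler_prod => i _; rewrite bump1_ge0 /=; apply: ler_pM; rewrite ?(ltW (sig_gt0 _))//.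
    apply: (@le_trans _ _ (sig (l k * (x i 0 - a i)))).
      by apply: ler_sig; rewrite /be mulrBr addrA lerBlDr lerDl.
    exact: sig_dominated.
  apply: (@le_trans _ _ (sig (l k * (b i + 1 - x i 0)))).
    apply: ler_sig; rewrite /ga !(mulrBr, mulrDr) mulr1 mulNr addrC lerD2r lerD2l.
    by rewrite /l expr2 ler_peMr// ler1n.
  exact: sig_dominated.
have f0 k x : 0 <= f k x by exact: bumps_ge0.
have ih x : \1_(box a b) x <= h x.
  rewrite indicE; case: (boolP (x \in box a b)) => // /set_mem xb.
  rewrite hprod (_ : true%:R = \prod_(i < n) (1 : R)); last by rewrite big1_eq.
  apply: ler_prod => i _; rewrite ler01 /=; have /andP[ax bx] := xb i.
  rewrite -[leLHS]mulr1; apply: ler_pM => //; apply: half_sig; first by rewrite subr_ge0 ltW.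
  by rewrite subr_ge0 (le_trans bx)// lerDl.
apply: (lim_dct (f_ := fun k x => ((f k x)%:C)%C) (h := h)).
- by move=> k; apply: limS; apply: schwartz_real; apply: rschwartz_bump; exact: lt_le_trans (l1 k).
- by apply: cm_cind; exact: meas_box.
- move=> x; suff c : f k x @[k --> \oo] --> (\1_(box a b) x : R).
    exact: cvg_cabs_real.
  have -> : \1_(box a b) x = \prod_(i <- index_enum 'I_n) ((if a i < x i 0 then 1 else 0) * (1 - (if b i < x i 0 then 1 else 0))) :> R.
    rewrite indicE; case: (boolP (x \in box a b)) => [/set_mem xb|/negP xb].
      rewrite big1// => i _; have /andP[-> bx] := xb i.
      by rewrite ltNge bx /= subr0 mulr1.
    have [i hi] : exists i, ~ (a i < x i 0 <= b i).
      by apply: contrapT => nh; apply: xb; apply/mem_set => i; apply: contrapT => hi; apply: nh; exists i.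
    rewrite (bigD1 i)//=; move: hi; rewrite leNgt; case: ltP => _; case: ltP => _ //= _; rewrite ?subrr ?mulr0 ?mul0r//.
  apply: cvg_prod_seq => i; apply: cvgM.
    have := @cvg_sig_step R (a i) (x i 0); apply: cvg_trans; apply: near_eq_cvg; apply: nearW => k.
    by rewrite /be -/(l k); congr sig; ring.
  have E k : sig (- l k * x i 0 + ga k i) = 1 - sig (k.+1%:R ^+ 2 * (x i 0 - b i) - k.+1%:R).
    by rewrite -/(l k) -sigN /ga; congr sig; ring.
  by under eq_fun do rewrite E; apply: cvgB; [exact: cvg_cst|exact: cvg_sig_step].
- move=> k x; rewrite -rmorphB cabs_real ler_norml.
  have := f0 k x; have := fh k x; have := ih x; have := @indic_fun_ge0 R _ (box a b) x; lra.
- by apply: rschwartz_measurable; apply: rschwartzZ; exact: rschwartz_bump.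
- have /schwartz_cintegrable[_] : schwartz (fun x => ((h x)%:C)%C).
    by apply: schwartz_real; apply: rschwartzZ; exact: rschwartz_bump.
  pose c : R := (4 ^+ n) `^ (p - 1).
  have mh : mfunT h by apply: rschwartz_measurable; apply: rschwartzZ; exact: rschwartz_bump.
  have hb x : h x <= 4 ^+ n by rewrite ler_piMr ?exprn_ge0// bumps_le1.
  move=> hoo; apply: (@le_lt_trans _ _ (\int[lebn]_x (c%:E * (cabs ((h x)%:C)%C)%:E))%E).
    apply: le_integralT.
    - nonneg.
    - by apply: mEFin_cV; exact: mfun_powR.
    - apply: emfunM; first exact: mcst.
      by apply: mEFin_cV; apply: cmeas_cabs; exact: cmeas_real.
    move=> x; rewrite -EFinM lee_fin cabs_real ger0_norm//.
    have [->|hx] := eqVneq (h x) 0; first by rewrite powR0 ?gt_eqF// mulr0.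
    have hx0 : 0 < h x by rewrite lt_neqAle eq_sym hx h0.
    rewrite -{2}(powRr1 (ltW hx0)) -{1}(subrK 1 p) powRD; last by rewrite (gt_eqF hx0) implybT.
    apply: ler_wpM2r; first exact: powR_ge0.
    by apply: le_powR; rewrite ?subr_ge0.
  rewrite integralZlT ?powR_ge0//.
  - by rewrite lte_mul_pinfty ?lee_fin ?powR_ge0.
  - nonneg.
  - by apply: mEFin_cV; apply: cmeas_cabs; exact: cmeas_real.
Qed.

Let boxI (a b a' b' : 'I_n -> R) : box a b `&` box a' b' =
  box (fun i => Num.max (a i) (a' i)) (fun i => Num.min (b i) (b' i)).
apply/seteqP; split => x /=.
  by move=> [h h'] i; rewrite gt_max le_min; have /andP[-> ->] := h i; have /andP[-> ->] := h' i.
by move=> h; split => i; have := h i; rewrite gt_max le_min => /andP[/andP[h1 h2] /andP[h3 h4]]; apply/andP.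
Qed.

Let boxes : set (set vec) := [set E | exists a b, E = box a b].
Let Om (N : nat) : set vec := box (fun=> - N%:R) (fun=> N%:R).

Let Om_homo N M : (N <= M)%N -> Om N `<=` Om M.
move=> NM x h i; have /andP[h1 h2] := h i; have nm : N%:R <= M%:R :> R by rewrite ler_nat.
by apply/andP; split; lra.
Qed.

Let Om_near (x : vec) : \forall N \near \oo, Om N x.
have := nbhs_infty_ger (`|x| + 1); apply: filterS => N /= hN i.
have := le_coord_norm x i; rewrite ler_norml => /andP[h1 h2]; apply/andP; split; lra.
Qed.

Let meas_boxes : (measure_matrix_display _).-measurable = <<s boxes >> :> set (set vec).
apply/seteqP; split; last first.
  by apply: smallest_sub; [exact: sigma_algebra_measurable|move=> _ [a [b ->]]; exact: meas_box].
apply: smallest_sub; first exact: smallest_sigma_algebra.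
move=> _ [i [j [Y [mY ->]]]].
pose f : g_sigma_algebraType boxes -> mtypeR R := fun x : vec => x i j.
suff mf : mfunT f by have := mf measurableT Y mY; rewrite setTI.
apply: (@measurability _ _ _ (mtypeR R) _ f (R.-ocitv).-measurable) => //.
move=> _ [_ [[c d] _ <-] <-]; rewrite setTI.
have -> : f @^-1` `]c, d] = \bigcup_N box (fun k => if k == i then c else - N%:R) (fun k => if k == i then d else N%:R).
  apply/seteqP; split => x /=; rewrite in_itv /f (ord1 j) /=.
    move=> cd; have [N _ hN] := Om_near x; exists N => // k.
    by case: eqP => [->//|_]; exact: (hN N (leqnn _) k).
  by move=> [N _ /(_ i)]; rewrite eqxx.
apply: bigcupT_measurable => N; apply: sub_sigma_algebra.
by eexists; eexists.
Qed.

Let finite_box a b : (\int[lebn]_x ((\1_(box a b) x : R) `^ p)%:E < +oo)%E.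
have -> : (\int[lebn]_x ((\1_(box a b) x : R) `^ p)%:E = lebn (box a b))%E.
  have -> : lebn (box a b) = (\int[lebn]_x (\1_(box a b) x)%:E)%E.
    by rewrite integral_indic ?setIT//; exact: meas_box.
  apply: eq_int => x _; rewrite indicE; case: (x \in _); first by rewrite powR1.
  by rewrite powR0 ?gt_eqF.
have -> : (lebn (box a b) = \prod_(i < n) @lebesgue_measure R `]a i, b i])%E.
  have -> : box a b = [set v : vec | forall i, `]a i, b i]%classic (v i ord0)].
    by apply/seteqP; split => x h i; have := h i; rewrite /= in_itv.
  by apply: lebesgue_cV_box => i; exact: measurable_itv.
suff : (\prod_(i < n) @lebesgue_measure R `]a i, b i])%E \is a fin_num by rewrite ltey_eq => ->.
elim/big_ind : _ => [//|x y xoo yoo|i _]; first by rewrite fin_numM.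
by rewrite lebesgue_measure_itv; case: ifP => _; rewrite // fin_numB.
Qed.

(** Dynkin's theorem on the intersection-stable family of boxes. Intersecting with the bounded set
    [Om N] provides the majorant for countable unions and makes complements relative to a box. *)
Let lim_set N E : measurable E -> lim (cind (E `&` Om N)).
rewrite [in X in X -> _]meas_boxes; move: E.
have mO := @meas_box (fun=> - N%:R) (fun=> N%:R) : measurable (Om N).
apply: (dynkin_induction (G := boxes)).
- exact: meas_boxes.
- by move=> _ _ [a [b ->]] [a' [b' ->]]; rewrite boxI; eexists; eexists.
- by rewrite setTI; exact: lim_box.
- by move=> _ [a [b ->]]; rewrite /Om boxI; exact: lim_box.
- move=> E mE lE; rewrite (_ : cind _ = (fun x => cind (Om N) x + (-1) * cind (E `&` Om N) x)).
    by apply: limD; [exact: lim_box|exact: limZ].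
  apply/funext => x; rewrite /cind !indicE !in_setI in_setC.
  by case: (x \in E); case: (x \in Om N); apply: complexE => /=; ring.
move=> F mF tF lF.
pose U k := [set x : vec | exists2 i, (i < k)%N & F i x].
have mU k : measurable (U k).
  rewrite (_ : U k = \bigcup_(i in [set i | (i < k)%N]) F i); first exact: bigcup_measurable.
  by apply/seteqP; split => x [i ik Fx]; exists i.
have lU k : lim (cind (U k `&` Om N)).
  elim: k => [|k IHk].
    rewrite (_ : cind _ = (fun x => 0 * cind (F 0%N `&` Om N) x)); first exact: limZ.
    apply/funext => x; rewrite mul0r /cind indicE (_ : x \in _ = false)//.
    by apply/negP => /set_mem[[]].
  rewrite (_ : cind _ = (fun x => cind (U k `&` Om N) x + cind (F k `&` Om N) x)); first exact: limD.
  apply/funext => x; rewrite /cind !indicE !in_setI.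
  have -> : x \in U k.+1 = (x \in U k) || (x \in F k).
    apply/idP/idP => [/set_mem|/orP[|] /set_mem].
    - case=> i; rewrite ltnS leq_eqVlt => /orP[/eqP->|ik] Fi; apply/orP; [right|left]; apply/mem_set => //.
      by exists i.
    - by case=> i ik Fi; apply/mem_set; exists i => //; exact: ltnW.
    - by move=> Fk; apply/mem_set; exists k.
  have : ~~ ((x \in U k) && (x \in F k)).
    apply/negP => /andP[/set_mem + /set_mem Fk] => -[i ik Fi].
    have ik' : i = k by apply: tF => //; exists x.
    by rewrite ik' ltnn in ik.
  by case: (x \in U k); case: (x \in F k) => //= _; case: (x \in Om N); apply: complexE => /=; ring.
apply: (lim_dct (f_ := fun k => cind (U k `&` Om N)) (h := fun x => \1_(Om N) x)) => //.
- by apply: cm_cind; apply: measurableI => //; exact: bigcupT_measurable.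
- move=> x; apply: cvg_near_cst.
  have [[m _ Fm]|nF] := pselect ((\bigcup_k F k) x).
    near=> k; rewrite /cind !indicE !in_setI.
    have -> : x \in U k by apply/mem_set; exists m => //; near: k; exists m.+1.
    by rewrite (mem_set (ex_intro2 _ _ m I Fm)) subrr cabs0.
  apply: nearW => k; rewrite /cind !indicE !in_setI.
  rewrite (_ : x \in \bigcup_k F k = false); last by apply/negP => /set_mem.
  rewrite (_ : x \in U k = false) ?subrr ?cabs0//.
  by apply/negP => /set_mem[i _ Fi]; apply: nF; exists i.
- move=> k x; rewrite /cind -rmorphB cabs_real !indicE !in_setI.
  case: (x \in U k); case: (x \in \bigcup_k F k); case: (x \in Om N);
    rewrite /= ?subrr ?subr0 ?sub0r ?normrN ?normr0 ?normr1//.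
- meas.
- exact: finite_box.
Unshelve. all: by end_near. Qed.

(** Simple functions from below, cut to growing boxes, are finite combinations of the indicators of
    [lim_set], and $f$ itself is the majorant. *)
Let lim_nn (f : vec -> R) : mfunT f -> (forall x, 0 <= f x) ->
  (\int[lebn]_x (f x `^ p)%:E < +oo)%E -> lim (fun x => ((f x)%:C)%C).
move=> mf f0 foo; have mfe : mfunT (EFin \o f) by exact: mEFin_cV.
have fe0 x : setT x -> (0 <= (EFin \o f) x)%E by move=> _; rewrite lee_fin.
pose g k := nnsfun_approx measurableT mfe k.
have gf k x : g k x <= f x by rewrite -lee_fin /g nnsfun_approxE; exact: le_approx.
have cg x : g k x @[k --> \oo] --> f x.
  by have := cvg_nnsfun_approx measurableT mfe fe0 (x := x) I; move/fine_cvgP => [].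
apply: (lim_dct (f_ := fun k x => ((g k x)%:C)%C * cind (Om k) x) (h := f)) => //.
- move=> k; rewrite (_ : (fun x => _) = (fun x => \sum_(y <- finmap.enum_fset (fset_set (range (g k))))
    (y%:C)%C * cind (g k @^-1` [set y] `&` Om k) x)).
    apply: lim_sum => y; apply: limZ; apply: lim_set.
    by rewrite -[X in measurable X]setTI; exact: measurable_funP.
  apply/funext => x; rewrite {1}(fimfunE (g k) x) fsbig_finite//= rmorph_sum mulr_suml.
  apply: eq_bigr => y _; rewrite rmorphM -mulrA; congr (_ * _).
  by rewrite /cind -rmorphM; congr (_%:C)%C; rewrite indicI.
- move=> x; have := cvg_cabs_real (cg x).
  apply: cvg_trans; apply: near_eq_cvg; near=> k.
  have Ok : Om k x by near: k; exact: Om_near.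
  by rewrite /cind indicE mem_set// mulr1.
- move=> k x; rewrite /cind -rmorphM -rmorphB cabs_real ler_norml indicE.
  have := gf k x; have := f0 x; have : 0 <= g k x by [].
  by case: (x \in Om k); rewrite /= ?mulr1 ?mulr0; lra.
Unshelve. all: by end_near. Qed.

Theorem schwartz_dense (f : vec -> R[i]) : in_Lp lebn p%:E f ->
  forall eps : R, 0 < eps -> exists psi, schwartz psi /\ (Np (f \- psi)%R < eps%:E)%E.
Proof.
move=> [mf /Lp_norm_lty-/(_ p0) foo].
have part (g : vec -> R) : mfunT g -> (forall x, `|g x| <= cabs (f x)) ->
    lim (fun x => ((g x)%:C)%C).
  move=> mg gf.
  have fin (h : vec -> R) : mfunT h -> (forall x, 0 <= h x <= cabs (f x)) ->
      (\int[lebn]_x (h x `^ p)%:E < +oo)%E.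
    move=> mh hf; apply: le_lt_trans foo; apply: le_integralT.
    - nonneg.
    - by apply: mEFin_cV; exact: mfun_powR.
    - by apply: mEFin_cV; apply: mfun_powR; exact: cmeas_cabs.
    - by move=> x; have /andP[h0 h1] := hf x; rewrite lee_fin le_powR// ltW.
  have P : lim (fun x => ((Num.max (g x) 0)%:C)%C).
    apply: lim_nn; first exact: measurable_maxr.
      by move=> x; rewrite le_max lexx orbT.
    apply: fin; first exact: measurable_maxr.
    move=> x; rewrite le_max lexx orbT /=; apply: le_trans (gf x).
    by rewrite ge_max ler_norm normr_ge0.
  have N : lim (fun x => ((Num.max (- g x) 0)%:C)%C).
    have mng : mfunT (fun x => - g x) by exact: mfunN.
    apply: lim_nn; first exact: measurable_maxr.
      by move=> x; rewrite le_max lexx orbT.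
    apply: fin; first exact: measurable_maxr.
    move=> x; rewrite le_max lexx orbT /=; apply: le_trans (gf x).
    by rewrite ge_max -normrN ler_norm normr_ge0.
  rewrite (_ : (fun x => _) = (fun x => ((Num.max (g x) 0)%:C)%C + (-1) * ((Num.max (- g x) 0)%:C)%C)).
    by apply: limD => //; exact: limZ.
  apply/funext => x; apply: complexE => /=; last by ring.
  by rewrite !maxEle oppr_le0; case: (leP (g x) 0) => h1; case: (leP 0 (g x)) => h2; lra.
have [mR mI] := mf.
have lR := part _ mR (fun x => abs_Re (f x)).
have lI := part _ mI (fun x => abs_Im (f x)).
suff [_] : lim f by [].
rewrite (_ : f = (fun x => ((complex.Re (f x))%:C)%C + (Complex 0 1) * ((complex.Im (f x))%:C)%C)).
  by apply: limD => //; exact: limZ.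
by apply/funext => x; apply: complexE => /=; ring.
Qed.

End Density.

(** * Dispersive estimates *)

Section Interpolation.
Context d1 d2 (X : measurableType d1) (Y : measurableType d2) (R : realType)
  (mu : sfmeasure X R) (nu : sfmeasure Y R).

(** The constant of [marcinkiewicz] after an $r$-th root, with the powers of [A] and of the norm
    split off. *)
Definition interp_cst (r : R) : R := (4 * r / (r - 2) * 2 `^ (r - 2)) `^ r^-1.

(** Applying [marcinkiewicz] with $N$ the $r'$-th power of the norm makes the bound homogeneous of
    degree one. An infinite norm is trivial, and a vanishing one is approached by small positive
    values of $N$. *)
Lemma Lp_interpolation (T : (X -> R[i]) -> Y -> R[i]) (A r r' : R) (f : X -> R[i]) :
  2 < r -> r^-1 + r'^-1 = 1 -> 0 < A ->
  (forall f, cintegrable mu f -> cmeasurable (T f)) ->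
  (forall f, cintegrable mu f -> forall y,
     ((cabs (T f y))%:E <= A%:E * \int[mu]_x (cabs (f x))%:E)%E) ->
  (forall f, cintegrable mu f ->
     (\int[nu]_y (cabs (T f y) ^+ 2)%:E <= \int[mu]_x (cabs (f x) ^+ 2)%:E)%E) ->
  (forall f E, cintegrable mu f -> measurable E ->
     forall y, T f y = T (restr E f) y + T (restr (~` E) f) y) ->
  cintegrable mu f ->
  (Lp_norm nu r%:E (T f) <= (interp_cst r * A `^ (1 - 2 / r))%:E * Lp_norm mu r'%:E f)%E.
Proof.
move=> r2 rr' A0 mT T1 T2 Tadd If.
have r1 : 1 < r by apply: lt_trans r2; rewrite ltr1n.
have r0 : 0 < r by exact: lt_trans r1.
have [r'1 _ _] := conj_exp_gt1 r1 rr'.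
have r'0 : 0 < r' by exact: lt_trans r'1.
have c0 : 0 < interp_cst r.
  by rewrite powR_gt0// mulr_gt0 ?powR_gt0// divr_gt0 ?mulr_gt0 ?subr_gt0.
have cA : 0 < interp_cst r * A `^ (1 - 2 / r) by apply: mulr_gt0 => //; exact: powR_gt0.
have [foo|] := eqVneq (\int[mu]_x (cabs (f x) `^ r')%:E)%E +oo%E.
  suff -> : Lp_norm mu r'%:E f = +oo%E by rewrite gt0_muley ?leey ?lte_fin.
  apply/eqP; move: foo; apply: contra_eqT; rewrite -ltey => /Lp_norm_lty -/(_ r'0).
  by rewrite ltey.
rewrite -ltey => foo.
pose N := fine (\int[mu]_x (cabs (f x) `^ r')%:E)%E.
have I0 : (0 <= \int[mu]_x (cabs (f x) `^ r')%:E)%E.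
  by apply: int_ge0 => x _; rewrite lee_fin powR_ge0.
have NE : (\int[mu]_x (cabs (f x) `^ r')%:E = N%:E)%E by rewrite fineK// ge0_finE.
have N0 : 0 <= N by rewrite fine_ge0.
have key (M : R) : 0 < M -> N <= M ->
    (Lp_norm nu r%:E (T f) <= (interp_cst r * A `^ (1 - 2 / r) * M `^ r'^-1)%:E)%E.
  move=> M0 NM.
  have := @marcinkiewicz _ _ X Y R mu nu (fun f y => cabs (T f y)) A r r' M f r2 rr' A0 M0.
  move=> H; have {}H : (\int[nu]_y (cabs (T f y) `^ r)%:E <= (4 * r / (r - 2) * (2 * A * M) `^ (r - 2) * M)%:E)%E.
    apply: H => //.
    - by move=> g Ig; apply: cmeas_cabs; exact: mT.
    - nonneg.
    - by move=> g E Ig mE y; rewrite (Tadd g E Ig mE y); exact: cabsD.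
    - by rewrite NE lee_fin.
  apply/Lnorm_le => //; first by rewrite lee_fin mulr_ge0 ?powR_ge0// ltW.
    nonneg.
  have -> : (\int[nu]_x ((cabs (T f x))%:E `^ r) = \int[nu]_y (cabs (T f y) `^ r)%:E)%E.
    by apply: eq_int => y _; rewrite poweR_EFin.
  apply: le_trans H _; rewrite poweR_EFin lee_fin le_eqVlt; apply/orP; left; apply/eqP.
  have c4 : 0 <= 4 * r / (r - 2) * 2 `^ (r - 2).
    by rewrite mulr_ge0 ?powR_ge0// divr_ge0 ?mulr_ge0 ?subr_ge0 ?(ltW r0) ?(ltW r2).
  have -> : (interp_cst r * A `^ (1 - 2 / r) * M `^ r'^-1) `^ r =
      interp_cst r `^ r * (A `^ (1 - 2 / r)) `^ r * (M `^ r'^-1) `^ r.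
    rewrite powRM ?powR_ge0//; last by rewrite mulr_ge0 ?powR_ge0// ltW.
    by rewrite powRM ?powR_ge0// ltW.
  rewrite /interp_cst.
  rewrite -!powRrM mulVf ?gt_eqF// powRr1//.
  have -> : (1 - 2 / r) * r = r - 2 by field; rewrite gt_eqF.
  have -> : r'^-1 * r = (r - 2) + 1.
    have -> : r'^-1 = 1 - r^-1 by rewrite -rr'; ring.
    by field; rewrite gt_eqF.
  rewrite (@powRD _ M) ?(gt_eqF M0) ?implybT// (powRr1 (ltW M0)).
  by rewrite powRM ?mulr_ge0 ?(ltW A0) ?(ltW M0)// powRM ?(ltW A0)//; ring.
have LE : Lp_norm mu r'%:E f = (N `^ r'^-1)%:E.
  rewrite /Lp_norm Lnorm_ge0E; last nonneg.
  have -> : (\int[mu]_x ((cabs (f x))%:E `^ r') = N%:E)%E.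
    by rewrite -NE; apply: eq_int => x _; rewrite poweR_EFin.
  by rewrite poweR_EFin.
rewrite LE -EFinM; have [N00|N00] := eqVneq N 0; last by apply: key => //; rewrite lt_neqAle eq_sym N00.
rewrite N00 powR0 ?invr_eq0 ?gt_eqF// mulr0; apply/lee_addgt0Pr => e e0; rewrite add0e.
pose c := interp_cst r * A `^ (1 - 2 / r); have ec : 0 < e / c by rewrite divr_gt0.
have := key ((e / c) `^ r'); rewrite powR_gt0// N00 powR_ge0 => /(_ isT isT).
by rewrite -powRrM mulfV ?gt_eqF// powRr1 ?(ltW ec)// -/c mulrCA mulfV ?mulr1 ?gt_eqF.
Qed.

End Interpolation.

Section PhaseAlgebra.
Context (R : realType) (n : nat).

Lemma symmetric_subZ (a : R) (X Y : 'M[R]_n) : Defs.symmetric X -> Defs.symmetric Y ->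
  Defs.symmetric (a *: X - a *: Y).
Proof.
move=> sX sY; rewrite /Defs.symmetric linearB /= !linearZ /=.
by rewrite (sX : X^T = X) (sY : Y^T = Y).
Qed.

Lemma quad_phase_sub (X Y M N : 'M[R]_n) (x x' y : 'cV[R]_n) (c c' : R) :
  (dotmul (X *m y) y + (dotmul (M *m y) x + c)) - (dotmul (Y *m y) y + (dotmul (N *m y) x' + c')) =
  (c - c') + (dotmul ((X - Y) *m y) y + dotmul (M^T *m x - N^T *m x') y).
Proof.
rewrite mulmxBl !(dotmulDl, dotmulNl) [dotmul (M *m y) x]dotmul_mul [dotmul (N *m y) x']dotmul_mul.
by rewrite [dotmul y (M^T *m x)]dotmulC [dotmul y (N^T *m x')]dotmulC; ring.
Qed.

End PhaseAlgebra.

Section Propagator.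
Context (R : realType) (n : nat) (Q B : 'M[R]_n).
Hypothesis sQ : Defs.symmetric Q.
Hypothesis pQ : psd Q.
Hypothesis V0 : forall t : R, 0 < t -> 0 < volume Q B t.
Local Notation vec := 'cV[R]_n.
Local Notation lebn := (lebesgue_cV R n).
Local Notation E t := (expmx (t *: B)).

Definition pmx t : 'M[R]_n := invmx (qmx Q B t).
Local Notation P := pmx.
Definition phase (t : R) (x y : vec) : R :=
  4^-1 * dotmul (P t *m (y - E t *m x)) (y - E t *m x).
Definition amp (t : R) : R := (4 * pi) `^ (- (n%:R / 2)) / Num.sqrt (vol Q B t).
Local Notation A := amp.
(** For $t\neq0$ this is $e^{t\operatorname{tr}B/2}U(t)$ up to a unimodular constant, in one formula
    for both signs of time. *)
Definition prop (t : R) (f : vec -> R[i]) (x : vec) : R[i] :=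
  ((A t)%:C)%C * cintegral lebn setT (fun y => expi (phase t x y) * f y).

Lemma amp_gt0 t : 0 < A t.
Proof. by rewrite divr_gt0 ?powR_gt0 ?mulr_gt0 ?pi_gt0// sqrtr_gt0; exact: vol_gt0. Qed.

Lemma pmx_sym t : Defs.symmetric (P t).
Proof.
rewrite /Defs.symmetric /P trmx_inv; congr invmx.
rewrite /qmx; case: eqP => _; first exact: trmx1.
exact: (sgramian_sym B sQ).
Qed.

Let phaseE t x y : phase t x y = dotmul ((4^-1 *: P t) *m y) y +
  (dotmul (- 2^-1 *: ((E t)^T *m P t) *m y) x + 4^-1 * dotmul (P t *m (E t *m x)) (E t *m x)).
rewrite /phase -!scalemxAl !dotmulZl -mulmxA [dotmul ((E t)^T *m _) x]dotmul_mul trmxK.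
rewrite mulmxBr !(dotmulDl, dotmulDr, dotmulNl, dotmulNr).
rewrite [dotmul (P t *m (E t *m x)) y]dotmul_mul (pmx_sym t : (P t)^T = _) [dotmul (E t *m x) (P t *m y)]dotmulC.
by field.
Qed.

(** The chirps in $y$ alone and in $x$ alone are unimodular and disappear from the two norms; what
    is left is the bilinear phase of [bessel]. *)
Lemma osc_L2 (th1 th2 : vec -> R) (M : 'M[R]_n) (f : vec -> R[i]) : \det M != 0 ->
  mfunT th1 -> cintegrable lebn f ->
  (\int[lebn]_x (cabs (cintegral lebn setT (fun y => expi (th1 y + (dotmul (M *m y) x + th2 x)) * f y)) ^+ 2)%:E <=
   ((2 * pi) ^+ n / `|\det M|)%:E * \int[lebn]_y (cabs (f y) ^+ 2)%:E)%E.
Proof.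
move=> dM mth If; have [mf _] := If.
have me : cmeasurable (fun y => expi (th1 y)) by exact: cmeas_expi.
have Ig : cintegrable lebn (fun y => expi (th1 y) * f y).
  by apply: (cintg_mulb me (c := 1)) => // y; rewrite cabs_expi.
have := bessel dM Ig.
have -> : (\int[lebn]_x (cabs (expi (th1 x) * f x) ^+ 2)%:E = \int[lebn]_y (cabs (f y) ^+ 2)%:E)%E.
  by apply: eq_int => y _; rewrite cabsM cabs_expi mul1r.
apply: le_trans; apply: le_of_eq; apply: eq_int => x _.
congr ((_ ^+ 2)%:E).
have mx : cmeasurable (fun y : vec => expi (dotmul (M *m y) x)).
  by apply: cmeas_expi; apply: mmx_dotmul; [apply: mmxM; [exact: mmx_cst|exact: mmx_id]|exact: mmx_cst].
have Ih : cintegrable lebn (fun y => expi (dotmul (M *m y) x) * (expi (th1 y) * f y)).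
  by apply: (cintg_mulb mx (c := 1)) => // y; rewrite cabs_expi.
rewrite -[RHS]mul1r -{1}(cabs_expi (th2 x)) -cabsM -cintegralZ//; congr cabs.
by apply: eq_cintegral => y; rewrite !expiD; ring.
Qed.

Let Mmx t := - 2^-1 *: ((E t)^T *m P t).

Let det_Mmx t : `|\det (Mmx t)| = (2 ^+ n * vol Q B t)^-1.
rewrite /Mmx detZ det_mulmx det_tr det_expmx /P det_inv !normrM normrX normrN normfV ger0_norm//.
rewrite (ger0_norm (ler0n R 2)) normfV /vol expRN exprVn.
have dq : `|\det (qmx Q B t)| != 0 by rewrite normr_eq0 det_qmx.
have e0 : expR (t * \tr B) != 0 by rewrite gt_eqF ?expR_gt0.
by field; rewrite ?dq ?e0 ?expf_neq0.
Qed.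

Let det_Mmx_neq0 t : \det (Mmx t) != 0.
by rewrite -normr_eq0 det_Mmx invr_neq0// mulf_neq0 ?gt_eqF ?vol_gt0. Qed.

(** The squared amplitude times the constant of [bessel] for the coupling matrix [Mmx] is 1, so the
    normalised propagator contracts $L^2$. *)
Lemma amp_sqr t : A t ^+ 2 * ((2 * pi) ^+ n * (2 ^+ n * vol Q B t)) = 1.
Proof.
have v0 := vol_gt0 V0 t; have pi4 : 0 < 4 * pi :> R by rewrite mulr_gt0 ?pi_gt0.
rewrite /A expr_div_n sqr_sqrtr ?(ltW v0)//.
have -> : ((4 * pi) `^ (- (n%:R / 2))) ^+ 2 = ((4 * pi) ^+ n)^-1 :> R.
  rewrite -powR_mulrn ?powR_ge0// -powRrM -powR_mulrn ?(ltW pi4)// -powRN; congr powR.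
  by field.
have -> : (2 * pi) ^+ n * (2 ^+ n * vol Q B t) = (4 * pi) ^+ n * vol Q B t.
  by rewrite mulrA -exprMn; congr (_ ^+ _ * _); ring.
have p4 : (4 * pi) ^+ n != 0 :> R by rewrite gt_eqF// exprn_gt0.
by field; rewrite p4 gt_eqF.
Qed.

Lemma cmeas_prop_integrand t x f : cmeasurable f -> cmeasurable (fun y => expi (phase t x y) * f y).
Proof.
move=> mf; apply: cmeasM => //; apply: cmeas_expi; apply: mfunM => //.
have mb : mmx (fun y : vec => y - E t *m x) by apply: mmxB; [exact: mmx_id|exact: mmx_cst].
by apply: mmx_dotmul => //; apply: mmxM => //; exact: mmx_cst.
Qed.

Lemma prop_sup t f x : cintegrable lebn f ->
  ((cabs (prop t f x))%:E <= (A t)%:E * \int[lebn]_y (cabs (f y))%:E)%E.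
Proof.
move=> [mf _]; rewrite cabsM cabs_real ger0_norm ?(ltW (amp_gt0 t))// EFinM.
apply: lee_wpmul2l; first by rewrite lee_fin ltW ?amp_gt0.
apply: le_trans (cabs_cint_le _ _) _; first exact: cmeas_prop_integrand.
by apply: le_of_eq; apply: eq_int => y _; rewrite cabsM cabs_expi mul1r.
Qed.

Let mS t : mfunT (fun y : vec => dotmul ((4^-1 *: P t) *m y) y).
by apply: mmx_dotmul; [apply: mmxM; [exact: mmx_cst|exact: mmx_id]|exact: mmx_id]. Qed.

Lemma prop_L2 t f : cintegrable lebn f ->
  (\int[lebn]_x (cabs (prop t f x) ^+ 2)%:E <= \int[lebn]_y (cabs (f y) ^+ 2)%:E)%E.
Proof.
move=> If.
have := osc_L2 (fun x => 4^-1 * dotmul (P t *m (E t *m x)) (E t *m x)) (det_Mmx_neq0 t) (mS t) If.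
set I := (\int[lebn]_x _)%E => h.
have a0 : 0 < A t ^+ 2 by rewrite exprn_gt0 ?amp_gt0.
have -> : (\int[lebn]_x (cabs (prop t f x) ^+ 2)%:E = (A t ^+ 2)%:E * I)%E.
  rewrite /I -integralZlT ?(ltW a0)//.
  - apply: eq_int => x _; rewrite cabsM exprMn cabs_real ger0_norm ?(ltW (amp_gt0 t))// EFinM.
    congr (_ * (cabs _ ^+ 2)%:E)%E; apply: eq_cintegral => y; by rewrite phaseE.
  - nonneg.
  apply: mEFin_cV; apply: mfunX; apply: cmeas_cabs.
  apply: (@cmeas_int _ _ _ _ R lebn (fun z : vec * vec => expi (dotmul (4^-1 *: P t *m z.2) z.2 +
     (dotmul (Mmx t *m z.2) z.1 + 4^-1 * dotmul (P t *m (E t *m z.1)) (E t *m z.1))) * f z.2)).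
  have m1 : mmx (fun z : vec * vec => z.1) by apply/mmxP; exact: mfst.
  have m2 : mmx (fun z : vec * vec => z.2) by apply/mmxP; exact: msnd.
  apply: cmeasM; last by apply: cmeas_comp If.1 _; exact: msnd.
  apply: cmeas_expi; apply: mfunD; first exact: (mcompT (mS t) msnd).
  apply: mfunD; first by apply: mmx_dotmul => //; apply: mmxM => //; exact: mmx_cst.
  apply: mfunM => //; apply: mmx_dotmul; last by apply: mmxM => //; exact: mmx_cst.
  by apply: mmxM; [exact: mmx_cst|apply: mmxM => //; exact: mmx_cst].
apply: (@le_trans _ _ ((A t ^+ 2)%:E * (((2 * pi) ^+ n / `|\det (Mmx t)|)%:E * \int[lebn]_y (cabs (f y) ^+ 2)%:E))%E).
  by apply: lee_wpmul2l => //; rewrite lee_fin ltW.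
by rewrite muleA -EFinM det_Mmx invrK amp_sqr mul1e.
Qed.

(** Joint measurability in time and both space variables reduces to the entries of the matrices; the
    inverse causes no trouble because [qmx] is invertible at every time. *)
Lemma meas_phase : mfunT
  (fun z : (mtypeR R * vec) * vec => phase z.1.1 z.1.2 z.2).
Proof.
have mt : mfunT (fun z : (mtypeR R * vec) * vec => z.1.1).
  by apply: mcompT; [exact: mfst|exact: mfst].
have mx : mmx (fun z : (mtypeR R * vec) * vec => z.1.2).
  by apply/mmxP; apply: mcompT; [exact: msnd|exact: mfst].
have my : mmx (fun z : (mtypeR R * vec) * vec => z.2).
  by apply/mmxP; exact: msnd.
have mE : mmx (fun z : (mtypeR R * vec) * vec => E z.1.1).
  by move=> i j; exact: (mcompT (mmx_expmx B i j) mt).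
have mq : mmx (fun t : R => qmx Q B t).
  move=> i j; rewrite (_ : (fun t => _) = (fun t => if t == 0 then (1%:M : 'M[R]_n) i j else sgramian Q B t i j)).
    apply: mfun_ifT; [|exact: mcst|exact: mmx_sgramian].
    exact: measurable_fun_eqr.
  by apply/funext => t; rewrite /qmx; case: ifP.
have mP : mmx (fun z : (mtypeR R * vec) * vec => P z.1.1).
  apply: mmx_inv => [i j|z]; first exact: (mcompT (mq i j) mt).
  exact: qmx_unit.
have mb : mmx (fun z : (mtypeR R * vec) * vec => z.2 - E z.1.1 *m z.1.2).
  by apply: mmxB => //; apply: mmxM.
by apply: mfunM => //; apply: mmx_dotmul => //; exact: mmxM.
Qed.

Lemma meas_vol : mfunT (fun t : R => vol Q B t).
Proof.
have mq : mmx (fun t : R => qmx Q B t).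
  move=> i j; rewrite (_ : (fun t => _) = (fun t => if t == 0 then (1%:M : 'M[R]_n) i j else sgramian Q B t i j)).
    apply: mfun_ifT; [|exact: mcst|exact: mmx_sgramian].
    exact: measurable_fun_eqr.
  by apply/funext => t; rewrite /qmx; case: ifP.
apply: mfunM; first by apply: mcompT => //; exact: mmx_det.
by apply: mcompT => //; apply: mfunN; exact: mfunM.
Qed.

Lemma meas_amp : mfunT A.
Proof.
apply: mfunM => //; apply: meas_fun_inv.
rewrite (_ : (fun t => _) = (fun t => vol Q B t `^ 2^-1)).
  by apply: mfun_powR; exact: meas_vol.
by apply/funext => t; rewrite powR12_sqrt// ltW// vol_gt0.
Qed.

Lemma cmeas_prop t f : cmeasurable f -> cmeasurable (prop t f).
Proof.
move=> mf; apply: cmeasM; first exact: cmeas_cst.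
apply: (@cmeas_int _ _ _ _ R lebn (fun z : vec * vec => expi (phase t z.1 z.2) * f z.2)).
apply: cmeasM; last by apply: cmeas_comp mf _; exact: msnd.
apply: cmeas_expi.
have m1 : mmx (fun z : vec * vec => z.1) by apply/mmxP; exact: mfst.
have m2 : mmx (fun z : vec * vec => z.2) by apply/mmxP; exact: msnd.
have mb : mmx (fun z : vec * vec => z.2 - E t *m z.1).
  by apply: mmxB => //; apply: mmxM => //; exact: mmx_cst.
by apply: mfunM => //; apply: mmx_dotmul => //; apply: mmxM => //; exact: mmx_cst.
Qed.

Lemma restrD (F : set vec) (f : vec -> R[i]) y : f y = restr F f y + restr (~` F) f y.
Proof.
by rewrite /restr !indicE in_setC; case: (f y) => a b; case: (y \in F); apply: complexE => /=; ring.
Qed.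

Lemma cintegral_restrD (g f : vec -> R[i]) (F : set vec) : cmeasurable g -> (forall y, cabs (g y) <= 1) ->
  cintegrable lebn f -> measurable F ->
  cintegral lebn setT (fun y => g y * f y) =
  cintegral lebn setT (fun y => g y * restr F f y) + cintegral lebn setT (fun y => g y * restr (~` F) f y).
Proof.
move=> mg g1 If mF; rewrite -cintegralD.
- by apply: eq_cintegral => y; rewrite -mulrDr -restrD.
- by apply: cintg_mulb g1 _ => //; exact: cintg_restr.
- by apply: cintg_mulb g1 _ => //; apply: cintg_restr => //; exact: measurableC.
Qed.

Lemma prop_Lr (r r' : R) t f : 2 < r -> r^-1 + r'^-1 = 1 -> cintegrable lebn f ->
  (Lp_norm lebn r%:E (prop t f) <= (interp_cst r * A t `^ (1 - 2 / r))%:E * Lp_norm lebn r'%:E f)%E.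
Proof.
move=> r2 rr' If; apply: (Lp_interpolation (T := prop t)) => //.
- exact: amp_gt0.
- by move=> g [mg _]; exact: cmeas_prop.
- by move=> g Ig x; exact: prop_sup.
- by move=> g Ig; exact: prop_L2.
move=> g F Ig mF x; rewrite /prop -mulrDr; congr (_ * _).
apply: cintegral_restrD => //; last by move=> y; rewrite cabs_expi.
have := @cmeas_prop_integrand t x (fun=> 1) (cmeas_cst _ _).
by under eq_fun do rewrite mulr1.
Qed.

Section TTStarKernel.
Variables (t s eps : R).
Hypotheses (t0 : t != 0) (s0 : s != 0) (ts : t != s) (eps0 : 0 < eps).

Let w (y : vec) : R[i] := ((gaussn eps y)%:C)%C.
(** Kernel of [prop t] composed with multiplication by a Gaussian and with the adjoint of [prop s].
    The Gaussian makes the integral over the intermediate variable absolutely convergent. *)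
Let K (x x' : vec) : R[i] := ((A t * A s)%:C)%C *
  cintegral lebn setT (fun y => w y * (expi (phase t x y) * conjc (expi (phase s x' y)))).
Definition ttstar_op (h : vec -> R[i]) (x : vec) : R[i] := cintegral lebn setT (fun x' => K x x' * h x').

Let S := 4^-1 *: P t - 4^-1 *: P s.

(** The two chirps leave a Fresnel integral with matrix $S=\frac14(P_t-P_s)$, whose determinant is
    given by [det_invqmx_sub]. The volumes at $t$ and $s$ cancel against the amplitudes, and the
    constants combine to exactly [A (t - s)], whatever [eps] is. *)
Let kernel_bound x x' : cabs (K x x') <= A (t - s).
have dS : `|\det S| = (4 ^+ n)^-1 * (vol Q B (t - s) / (vol Q B t * vol Q B s)).
  by rewrite /S -scalerBr detZ normrM (det_invqmx_sub V0 s0 t0 ts) ger0_norm ?exprn_ge0// exprVn.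
have vt := vol_gt0 V0 t; have vs := vol_gt0 V0 s; have vts := vol_gt0 V0 (t - s).
have dS0 : 0 < `|\det S| by rewrite dS mulr_gt0 ?invr_gt0 ?exprn_gt0// divr_gt0// mulr_gt0.
have sS : Defs.symmetric S.
  by apply: symmetric_subZ; exact: pmx_sym.
pose b := (Mmx t)^T *m x - (Mmx s)^T *m x'.
pose c := 4^-1 * dotmul (P t *m (E t *m x)) (E t *m x) - 4^-1 * dotmul (P s *m (E s *m x')) (E s *m x').
have -> : K x x' = ((A t * A s)%:C)%C * (expi c *
    cintegral lebn setT (fun y => expi (dotmul (S *m y) y + dotmul b y) * ((gaussn eps y)%:C)%C)).
  congr (_ * _); rewrite -cintegralZ; last first.
    apply: cintg_expi_gaussn => //; apply: mfunD; apply: mmx_dotmul; [|exact: mmx_id|exact: mmx_cst|exact: mmx_id].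
    by apply: mmxM; [exact: mmx_cst|exact: mmx_id].
  have pd y : phase t x y - phase s x' y = c + (dotmul (S *m y) y + dotmul b y).
    by rewrite !phaseE; exact: quad_phase_sub.
  by apply: eq_cintegral => y; rewrite -expiN -expiD pd [X in _ * X]expiD; exact: (etrans (mulrC _ _) (esym (mulrA _ _ _))).
rewrite !cabsM cabs_expi mul1r cabs_real ger0_norm; last by rewrite mulr_ge0 ?(ltW (amp_gt0 _)).
have det0 : \det S != 0 by rewrite -normr_gt0.
apply: (le_trans (ler_wpM2l _ (fresnel_bound b sS det0 eps0))).
  by rewrite mulr_ge0 ?(ltW (amp_gt0 _)).
rewrite le_eqVlt; apply/orP; left; apply/eqP; rewrite dS /A.
have s4 : Num.sqrt (4 ^+ n) = 2 ^+ n :> R.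
  have -> : 4 = 2 * 2 :> R by ring.
  by rewrite exprMn -expr2 sqrtr_sqr ger0_norm ?exprn_ge0.
have -> : Num.sqrt ((4 ^+ n)^-1 * (vol Q B (t - s) / (vol Q B t * vol Q B s))) =
    (2 ^+ n)^-1 * (Num.sqrt (vol Q B (t - s)) / (Num.sqrt (vol Q B t) * Num.sqrt (vol Q B s))).
  move: (vol Q B t) (vol Q B s) (vol Q B (t - s)) vt vs vts => v1 v2 v3 v10 v20 v30.
  rewrite (@sqrtrM _ (4 ^+ n)^-1) ?invr_ge0 ?exprn_ge0// (@sqrtrV _ (4 ^+ n)) ?exprn_ge0// s4; congr (_ * _).
  rewrite (@sqrtrM _ v3) ?(ltW v30)// (@sqrtrV _ (v1 * v2)) ?mulr_ge0 ?(ltW v10) ?(ltW v20)//.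
  by rewrite (@sqrtrM _ v1) ?(ltW v10).
have pi4 : 0 < 4 * pi :> R by rewrite mulr_gt0 ?pi_gt0.
have -> : (4 * pi) `^ (- (n%:R / 2)) = ((2 * Num.sqrt pi) ^+ n)^-1 :> R.
  rewrite powRN; congr (_^-1); rewrite [n%:R / 2]mulrC powRrM powR12_sqrt ?(ltW pi4)// powR_mulrn ?sqrtr_ge0//.
  rewrite sqrtrM//; congr ((_ * _) ^+ _).
  have -> : 4 = 2 ^+ 2 :> R by ring.
  by rewrite sqrtr_sqr ger0_norm.
have p0 : Num.sqrt pi != 0 :> R by rewrite gt_eqF// sqrtr_gt0 pi_gt0.
have n1 : Num.sqrt (vol Q B t) != 0 by rewrite gt_eqF// sqrtr_gt0.
have n2 : Num.sqrt (vol Q B s) != 0 by rewrite gt_eqF// sqrtr_gt0.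
have n3 : Num.sqrt (vol Q B (t - s)) != 0 by rewrite gt_eqF// sqrtr_gt0.
have n4 : 2 ^+ n != 0 :> R by rewrite expf_neq0.
have n5 : Num.sqrt pi ^+ n != 0 :> R by rewrite expf_neq0.
rewrite exprMn.
move: (Num.sqrt (vol Q B t)) (Num.sqrt (vol Q B s)) (Num.sqrt (vol Q B (t - s))) (2 ^+ n) (Num.sqrt pi ^+ n) n1 n2 n3 n4 n5.
by move=> a1 a2 a3 a4 a5 *; field; do ?[apply/andP; split].
Qed.

Let me z : mfunT (fun y : vec => phase t z y).
apply: mfunM => //.
have mb : mmx (fun y : vec => y - E t *m z) by apply: mmxB; [exact: mmx_id|exact: mmx_cst].
by apply: mmx_dotmul => //; apply: mmxM => //; exact: mmx_cst.
Qed.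

Let mphase2 a : mfunT (fun z : vec * vec => phase a z.1 z.2).
have m1 : mmx (fun z : vec * vec => z.1) by apply/mmxP; exact: mfst.
have m2 : mmx (fun z : vec * vec => z.2) by apply/mmxP; exact: msnd.
have mb : mmx (fun z : vec * vec => z.2 - E a *m z.1).
  by apply: mmxB => //; apply: mmxM => //; exact: mmx_cst.
by apply: mfunM => //; apply: mmx_dotmul => //; apply: mmxM => //; exact: mmx_cst.
Qed.

Let mphase1 a y : mfunT (fun x : vec => phase a x y).
have mb : mmx (fun x : vec => y - E a *m x).
  by apply: mmxB; [exact: mmx_cst|apply: mmxM; [exact: mmx_cst|exact: mmx_id]].
by apply: mfunM => //; apply: mmx_dotmul => //; apply: mmxM => //; exact: mmx_cst.
Qed.

Let mK : cmeasurable (fun z : vec * vec => K z.1 z.2).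
apply: cmeasM; first exact: cmeas_cst.
apply: (@cmeas_int _ _ _ _ R lebn (fun z : (vec * vec) * vec =>
  w z.2 * (expi (phase t z.1.1 z.2) * conjc (expi (phase s z.1.2 z.2))))).
have m2 : mfunT (fun z : (vec * vec) * vec => z.2) by meas.
have m11 : mfunT (fun z : (vec * vec) * vec => (z.1.1, z.2)).
  by apply/mfun_pair => //; apply: mcompT; [exact: mfst|exact: mfst].
have m12 : mfunT (fun z : (vec * vec) * vec => (z.1.2, z.2)).
  by apply/mfun_pair => //; apply: mcompT; [exact: msnd|exact: mfst].
apply: cmeasM; first by apply: cmeas_real; apply: mcompT m2; exact: meas_gaussn.
apply: cmeasM; first by apply: cmeas_expi; exact: (mcompT (mphase2 t) m11).
by apply: cmeasJ; apply: cmeas_expi; exact: (mcompT (mphase2 s) m12).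
Qed.

Lemma cmeas_ttstar_op h : cmeasurable h -> cmeasurable (ttstar_op h).
Proof.
move=> mh; apply: (@cmeas_int _ _ _ _ R lebn (fun z : vec * vec => K z.1 z.2 * h z.2)).
by apply: cmeasM; [exact: mK|apply: cmeas_comp mh _; exact: msnd].
Qed.

Let mK1 x : cmeasurable (fun x' => K x x').
exact: (cmeas_comp mK (@mpair1 _ _ vec vec x)). Qed.

Let ttstar_op_sup h x : cintegrable lebn h ->
  ((cabs (ttstar_op h x))%:E <= (A (t - s))%:E * \int[lebn]_y (cabs (h y))%:E)%E.
move=> Ih; have [mh _] := Ih.
have mKh : cmeasurable (fun x' => K x x' * h x') by exact: (cmeasM (mK1 x) mh).
apply: (le_trans (cabs_cint_le _ mKh)); rewrite -integralZlT ?(ltW (amp_gt0 _))//.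
- apply: le_integralT.
  + nonneg.
  + by apply: mEFin_cV; exact: (cmeas_cabs mKh).
  + apply: (@mEFin_cV _ _ (fun x0 => A (t - s) * cabs (h x0))).
    meas.
  + by move=> y; rewrite -EFinM lee_fin cabsM ler_wpM2r ?cabs_ge0// kernel_bound.
- nonneg.
- by apply: mEFin_cV; exact: cmeas_cabs.
Qed.

Let adj (h : vec -> R[i]) (y : vec) : R[i] :=
  ((A s)%:C)%C * cintegral lebn setT (fun x' => conjc (expi (phase s x' y)) * h x').

Let adj_sup h y : cintegrable lebn h ->
  ((cabs (adj h y))%:E <= (A s)%:E * \int[lebn]_y (cabs (h y))%:E)%E.
move=> [mh _]; rewrite cabsM cabs_real ger0_norm ?(ltW (amp_gt0 s))// EFinM.
apply: lee_wpmul2l; first by rewrite lee_fin ltW ?amp_gt0.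
apply: le_trans (cabs_cint_le _ _) _.
  by apply: cmeasM => //; apply: cmeasJ; apply: cmeas_expi; exact: mphase1.
by apply: le_of_eq; apply: eq_int => x _; rewrite cabsM cabsJ cabs_expi mul1r.
Qed.

Let madj h : cmeasurable h -> cmeasurable (adj h).
move=> mh; apply: cmeasM; first exact: cmeas_cst.
apply: (@cmeas_int _ _ _ _ R lebn (fun z : vec * vec => conjc (expi (phase s z.2 z.1)) * h z.2)).
apply: cmeasM; last by apply: cmeas_comp mh _; exact: msnd.
apply: cmeasJ; apply: cmeas_expi.
have ms : mfunT (fun z : vec * vec => (z.2, z.1)).
  by apply/mfun_pair; [exact: msnd|exact: mfst].
exact: (mcompT (mphase2 s) ms).
Qed.

(** The same mechanism as for [prop], with the two space variables exchanged and the coupling matrix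
    transposed and negated. *)
Let adj_L2 h : cintegrable lebn h ->
  (\int[lebn]_y (cabs (adj h y) ^+ 2)%:E <= \int[lebn]_y (cabs (h y) ^+ 2)%:E)%E.
move=> Ih; pose M := - (Mmx s)^T.
have dMM : `|\det M| = `|\det (Mmx s)| by rewrite /M -scaleN1r detZ det_tr normrM normrX normrN1 expr1n mul1r.
have dM : \det M != 0 by rewrite -normr_gt0 dMM normr_gt0 det_Mmx_neq0.
pose th x := - (4^-1 * dotmul (P s *m (E s *m x)) (E s *m x)).
have mth : mfunT th.
  apply: mfunN; apply: mfunM => //.
  have mx : mmx (fun x : vec => E s *m x) by apply: mmxM; [exact: mmx_cst|exact: mmx_id].
  by apply: mmx_dotmul => //; apply: mmxM => //; exact: mmx_cst.
have := osc_L2 (fun y => - dotmul ((4^-1 *: P s) *m y) y) dM mth Ih.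
set I := (\int[lebn]_x _)%E => hI.
have a0 : 0 < A s ^+ 2 by rewrite exprn_gt0 ?amp_gt0.
have E1 y : cabs (adj h y) = A s * cabs (cintegral lebn setT (fun x => expi (th x + (dotmul (M *m x) y + - dotmul ((4^-1 *: P s) *m y) y)) * h x)).
  rewrite cabsM cabs_real ger0_norm ?(ltW (amp_gt0 s))//; congr (_ * cabs _).
  apply: eq_cintegral => x; congr (_ * _); rewrite -expiN; congr expi.
  rewrite phaseE /th /M mulNmx dotmulNl [dotmul (Mmx s *m y) x]dotmul_mul [dotmul y ((Mmx s)^T *m x)]dotmulC.
  ring.
have -> : (\int[lebn]_x (cabs (adj h x) ^+ 2)%:E = (A s ^+ 2)%:E * I)%E.
  rewrite /I -integralZlT ?(ltW a0)//.
  - by apply: eq_int => x _; rewrite E1 exprMn EFinM.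
  - nonneg.
  apply: mEFin_cV; apply: mfunX.
  rewrite (_ : (fun x => _) = (fun x => (A s)^-1 * cabs (adj h x))).
    by apply: mfunM => //; apply: cmeas_cabs; apply: madj; exact: Ih.1.
  by apply/funext => x; rewrite E1 mulrA mulVf ?mul1r// gt_eqF ?amp_gt0.
apply: (@le_trans _ _ ((A s ^+ 2)%:E * (((2 * pi) ^+ n / `|\det M|)%:E * \int[lebn]_y (cabs (h y) ^+ 2)%:E))%E).
  by apply: lee_wpmul2l => //; rewrite lee_fin ltW.
by rewrite muleA -EFinM dMM det_Mmx invrK amp_sqr mul1e.
Qed.

Let Iw : cintegrable lebn w.
have := @cintg_expi_gaussn R n eps (fun=> 0) eps0 (mcst _).
by under eq_fun do rewrite expi0 mul1r.
Qed.

Let wadj h : cintegrable lebn h -> cintegrable lebn (fun y => w y * adj h y).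
move=> Ih; have [mh fh] := Ih.
pose N := fine (\int[lebn]_y (cabs (h y))%:E)%E.
have NE : (\int[lebn]_y (cabs (h y))%:E = N%:E)%E.
  by rewrite fineK// ge0_finE// int_ge0// => y _; rewrite lee_fin cabs_ge0.
rewrite (_ : (fun y => w y * adj h y) = (fun y => adj h y * w y)); last first.
  by apply/funext => y; rewrite mulrC.
apply: (@cintg_mulb R _ _ lebn (adj h) w (A s * N) (madj mh) _ Iw).
by move=> y; have := adj_sup y Ih; rewrite NE -EFinM lee_fin.
Qed.

(** The sup bound is seen on the kernel, the $L^2$ bound on this factorisation: two contractions
    around multiplication by a function between 0 and 1. *)
Let ttstar_opE h x : cintegrable lebn h ->
  ttstar_op h x = prop t (fun y => w y * adj h y) x.
move=> Ih; have [mh fh] := Ih.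
pose k := A t * A s; have k0 : 0 <= k by rewrite mulr_ge0 ?(ltW (amp_gt0 _)).
pose F (z : vec * vec) := ((k)%:C)%C * (expi (phase t x z.1) * (w z.1 * (conjc (expi (phase s z.2 z.1)) * h z.2))).
have mF : cmeasurable F.
  apply: cmeasM; first exact: cmeas_cst.
  apply: cmeasM.
    by apply: cmeas_expi; exact: (mcompT (me x) mfst).
  apply: cmeasM.
    by apply: cmeas_comp Iw.1 _; exact: mfst.
  apply: cmeasM; last by apply: cmeas_comp mh _; exact: msnd.
  apply: cmeasJ; apply: cmeas_expi.
  have ms : mfunT (fun z : vec * vec => (z.2, z.1)).
    by apply/mfun_pair; [exact: msnd|exact: mfst].
  exact: (mcompT (mphase2 s) ms).
have mhx y : cmeasurable (fun x' => conjc (expi (phase s x' y)) * h x').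
  by apply: cmeasM => //; apply: cmeasJ; apply: cmeas_expi; exact: mphase1.
have Ihx y : cintegrable lebn (fun x' => conjc (expi (phase s x' y)) * h x').
  apply: (@cintg_mulb R _ _ lebn _ h 1) => //.
    by apply: cmeasJ; apply: cmeas_expi; exact: mphase1.
  by move=> x'; rewrite cabsJ cabs_expi.
have Foo : (\int[lebn]_y \int[lebn]_x' (cabs (F (y, x')))%:E < +oo)%E.
  have -> : (\int[lebn]_y \int[lebn]_x' (cabs (F (y, x')))%:E =
      \int[lebn]_y ((k%:E * \int[lebn]_x' (cabs (h x'))%:E) * (cabs (w y))%:E))%E.
    apply: eq_int => y _; rewrite muleC muleA -integralZlT ?(mulr_ge0 (cabs_ge0 _) k0)//.
    - apply: eq_int => x' _; rewrite -EFinM /F !cabsM cabsJ !cabs_expi cabs_real.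
      by rewrite ger0_norm // !mul1r mulrA [k * _]mulrC.
    - by move=> x'; rewrite lee_fin cabs_ge0.
    - by apply: mEFin_cV; exact: cmeas_cabs.
  pose N := fine (\int[lebn]_y (cabs (h y))%:E)%E.
  have N0 : 0 <= N by rewrite fine_ge0// int_ge0// => y _; rewrite lee_fin cabs_ge0.
  have -> : (\int[lebn]_y (cabs (h y))%:E = N%:E)%E.
    by rewrite fineK// ge0_finE// int_ge0// => y _; rewrite lee_fin cabs_ge0.
  rewrite -EFinM integralZlT ?(mulr_ge0 k0 N0)//.
  - by apply: lte_mul_pinfty; rewrite ?lee_fin ?(mulr_ge0 k0 N0)//; exact: Iw.2.
  - by move=> x'; rewrite lee_fin cabs_ge0.
  - by apply: mEFin_cV; apply: cmeas_cabs; exact: Iw.1.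
have := cintegral_fubini mF Foo => fub.
have L : prop t (fun y => w y * adj h y) x = cintegral lebn setT (fun y => cintegral lebn setT (fun x' => F (y, x'))).
  have Iwa : cintegrable lebn (fun y => expi (phase t x y) * (w y * adj h y)).
    apply: (@cintg_mulb R _ _ lebn _ _ 1 _ _ (wadj Ih)); first by apply: cmeas_expi; exact: me.
    by move=> y; rewrite cabs_expi.
  rewrite /prop -(@cintegralZ R _ _ lebn ((A t)%:C)%C _ Iwa); apply: eq_cintegral => y.
  have -> : cintegral lebn setT (fun x' => F (y, x')) = ((k%:C)%C * (expi (phase t x y) * w y)) *
      cintegral lebn setT (fun x' => conjc (expi (phase s x' y)) * h x').
    rewrite -(@cintegralZ R _ _ lebn ((k%:C)%C * (expi (phase t x y) * w y)) _ (Ihx y)).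
    apply: eq_cintegral => x'; rewrite /F.
    by move: (expi _) (conjc _) => a b; rewrite !mulrA.
  have kE : (k%:C)%C = ((A t)%:C)%C * ((A s)%:C)%C by exact: rmorphM.
  rewrite /adj kE; move: (cintegral _ _ _) (expi _) (w y) (((A s)%:C)%C) (((A t)%:C)%C) => a b d k1 k2.
  by ring.
rewrite L fub; apply: eq_cintegral => x'; rewrite /K.
have Ie : cintegrable lebn (fun y => w y * (expi (phase t x y) * conjc (expi (phase s x' y)))).
  have mee : cmeasurable (fun y => expi (phase t x y) * conjc (expi (phase s x' y))).
    by apply: cmeasM; [|apply: cmeasJ]; apply: cmeas_expi; [exact: me|apply: mcompT (mphase2 s) (mpair1 x')].
  rewrite (_ : (fun y => w y * _) = (fun y => (expi (phase t x y) * conjc (expi (phase s x' y))) * w y)); last first.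
    by apply/funext => y; rewrite mulrC.
  apply: (@cintg_mulb R _ _ lebn _ w 1 mee _ Iw) => y.
  by rewrite cabsM cabsJ !cabs_expi mul1r.
have -> : cintegral lebn setT (fun y => F (y, x')) = ((k%:C)%C * h x') *
    cintegral lebn setT (fun y => w y * (expi (phase t x y) * conjc (expi (phase s x' y)))).
  rewrite -(@cintegralZ R _ _ lebn ((k%:C)%C * h x') _ Ie).
  apply: eq_cintegral => y.
  have -> : F (y, x') = (k%:C)%C * (expi (phase t x y) * (w y * (conjc (expi (phase s x' y)) * h x'))) by [].
  move: (expi _) (conjc _) (w y) (h x') ((k%:C)%C) => a b c d k'.
  by rewrite -!mulrA; congr (_ * _); rewrite mulrCA [RHS]mulrC -!mulrA; congr (_ * (_ * _)); rewrite mulrC.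
by move: (cintegral _ _ _) (h x') ((k%:C)%C) => a b d; rewrite -!mulrA [a * b]mulrC.
Qed.

Let ttstar_op_L2 h : cintegrable lebn h ->
  (\int[lebn]_x (cabs (ttstar_op h x) ^+ 2)%:E <= \int[lebn]_y (cabs (h y) ^+ 2)%:E)%E.
move=> Ih; under eq_int do rewrite ttstar_opE//.
apply: le_trans (prop_L2 t (wadj Ih)) _; apply: le_trans _ (adj_L2 Ih).
apply: le_integralT.
- nonneg.
- by apply: mEFin_cV; apply: mfunX; apply: cmeas_cabs; exact: (wadj Ih).1.
- by apply: mEFin_cV; apply: mfunX; apply: cmeas_cabs; exact: (madj Ih.1).
move=> y; rewrite lee_fin cabsM ler_pXn2r ?nnegrE ?mulr_ge0 ?cabs_ge0// ler_piMl ?cabs_ge0//.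
by rewrite cabs_real ger0_norm ?gaussn_ge0 ?gaussn_le1 ?(ltW eps0).
Qed.

Lemma ttstar_op_Lr (r r' : R) h : 2 < r -> r^-1 + r'^-1 = 1 -> cintegrable lebn h ->
  (Lp_norm lebn r%:E (ttstar_op h) <=
   (interp_cst r * A (t - s) `^ (1 - 2 / r))%:E * Lp_norm lebn r'%:E h)%E.
Proof.
move=> r2 rr' Ih; apply: (Lp_interpolation (T := ttstar_op)) => //.
- exact: amp_gt0.
- by move=> g [mg _]; exact: cmeas_ttstar_op.
- by move=> g Ig x; exact: ttstar_op_sup.
move=> g F Ig mF x.
have KI g' : cintegrable lebn g' -> cintegrable lebn (fun x' => K x x' * g' x').
  by move=> I'; apply: (@cintg_mulb R _ _ lebn _ g' (A (t - s)) (mK1 x) _ I') => x'; exact: kernel_bound.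
rewrite /ttstar_op -cintegralD.
- by apply: eq_cintegral => y; rewrite -mulrDr -restrD.
- by apply: KI; exact: cintg_restr.
- by apply: KI; apply: cintg_restr => //; exact: measurableC.
Qed.

End TTStarKernel.
End Propagator.

Section Auxiliary.
Context d1 d2 (X : measurableType d1) (Y : measurableType d2) (R : realType)
  (mu : sfmeasure X R) (nu : sfmeasure Y R).

Lemma cintegral_prod (F : X * Y -> R[i]) : cintegrable (mu \x nu)%E F ->
  cintegral (mu \x nu)%E setT F = cintegral mu setT (fun x => cintegral nu setT (fun y => F (x, y))).
Proof.
move=> IF; rewrite /cintegral; congr Complex.
  exact: (@Rintegral_prod _ _ X Y R mu nu (fun z => complex.Re (F z)) (cintg_Re IF)).
exact: (@Rintegral_prod _ _ X Y R mu nu (fun z => complex.Im (F z)) (cintg_Im IF)).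
Qed.

Lemma cvg_Lnorm_indic (r : R) (f : X -> \bar R) (G : nat -> set X) : 0 < r ->
  mfunT f -> (forall x, 0 <= f x)%E -> (forall k, measurable (G k)) ->
  {homo G : n m / (n <= m)%N >-> n `<=` m} -> (forall x, exists k, G k x) ->
  ('N[mu]_r%:E[(fun x => f x * (\1_(G k) x)%:E)] @[k --> \oo] --> 'N[mu]_r%:E[f])%E.
Proof.
move=> r0 mf f0 mG nG exG.
pose g k x := (f x * (\1_(G k) x)%:E)%E.
have mg k : mfunT (g k).
  by apply: emfunM => //; apply/mEFinP; exact: mindic.
have g0 k x : (0 <= g k x)%E by rewrite mule_ge0// lee_fin indic_fun_ge0.
have gg k m x : (k <= m)%N -> (g k x <= g m x)%E.
  move=> km; apply: lee_wpmul2l => //; rewrite lee_fin !indicE ler_nat.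
  by case: (boolP (x \in G k)) => // /set_mem /(nG _ _ km) /mem_set ->.
have ndN : {homo (fun k => 'N[mu]_r%:E[g k]%E) : n m / (n <= m)%N >-> (n <= m)%E}.
  by move=> k m km; apply: le_Lnorm => // x; exact: gg.
have cv := ereal_nondecreasing_cvgn ndN.
suff E : ereal_sup (range (fun k => 'N[mu]_r%:E[g k]%E)) = 'N[mu]_r%:E[f]%E by rewrite E in cv.
apply/eqP; rewrite eq_le; apply/andP; split.
  apply: ge_ereal_sup => _ [k _ <-]; apply: le_Lnorm => // x.
  by rewrite /g indicE; case: (x \in G k); rewrite ?mule1// mule0.
set L := ereal_sup _; have L0 : (0 <= L)%E.
  by apply: le_trans (ereal_sup_ubound _) => /=; [|exists 0%N => //]; exact: Lnorm_ge0.
apply/Lnorm_le => //.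
apply: (@fatou_le _ _ _ mu (fun k x => g k x `^ r)%E) => //.
- by move=> k; exact: mfun_poweR.
- nonneg.
- meas.
- nonneg.
- apply/aeW => x; have [k0 Gk] := exG x; apply: cvg_near_cst; exists k0 => // k /= k0k.
  by rewrite /g indicE mem_set ?mule1//; exact: nG Gk.
- move=> k; apply/Lnorm_le => //; exact: ereal_sup_ubound.
Qed.

End Auxiliary.

Section ProductSigmaFinite.
Context d1 d2 (X : measurableType d1) (Y : measurableType d2) (R : realType)
  (mu : sfmeasure X R) (nu : sfmeasure Y R).

Lemma product_measure1_sigma_finite : sigma_finite setT (mu \x nu)%E.
Proof.
have /sigma_finiteP[F [TF ndF Foo]] := sigma_finiteT mu.
have /sigma_finiteP[G [TG ndG Goo]] := sigma_finiteT nu.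
exists (fun k => F k `*` G k).
  apply/esym/seteqP; split => // v _.
  have : setT v.1 by [].
  have : setT v.2 by [].
  rewrite TF TG => -[j _ Gj] [i _ Fi].
  exists (maxn i j) => //; split.
    by move: Fi; exact/subsetPset/ndF/leq_maxl.
  by move: Gj; exact/subsetPset/ndG/leq_maxr.
move=> k; have [mF Fk] := Foo k; have [mG Gk] := Goo k; split; first exact: measurableX.
by rewrite product_measure1E// lte_mul_pinfty// ge0_finE.
Qed.

(** The product measure under a name of its own, so that it carries a sigma-finiteness instance and
    space-time can serve as a single base space. *)
Definition prod_sf : set (X * Y) -> \bar R := (mu \x nu)%E.

HB.instance Definition _ := isMeasure.Build _ _ _ prod_sf
  (measure0 (mu \x nu)%E) (measure_ge0 (mu \x nu)%E) (@measure_semi_sigma_additive _ _ _ (mu \x nu)%E).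

HB.instance Definition _ := @Measure_isSigmaFinite.Build _ _ _ prod_sf product_measure1_sigma_finite.

Lemma integral_prod_sf (f : X * Y -> \bar R) : mfunT f -> (forall z, 0 <= f z)%E ->
  (\int[prod_sf]_z f z = \int[mu]_x \int[nu]_y f (x, y))%E.
Proof. by move=> mf f0; rewrite /prod_sf fubini_tonelli1. Qed.

Lemma cintegral_prod_sf (F : X * Y -> R[i]) : cintegrable prod_sf F ->
  cintegral prod_sf setT F = cintegral mu setT (fun x => cintegral nu setT (fun y => F (x, y))).
Proof. exact: cintegral_prod. Qed.

End ProductSigmaFinite.

(** * Homogeneous estimate *)

Section MixedTTStar.
Context d1 d2 d3 (S : measurableType d1) (X : measurableType d2) (Y : measurableType d3)
  (R : realType) (nu : sfmeasure S R)
  (mu : sfmeasure X R) (rho : sfmeasure Y R).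
Variables (e : (S * X) * Y -> R[i]) (A : S -> R) (wh : Y -> R) (kk : S * S -> R) (r r' : R).
Hypotheses (me : cmeasurable e) (e1 : forall z, cabs (e z) <= 1).
Hypotheses (mA : mfunT A) (A0 : forall t, 0 <= A t).
Hypotheses (mw : mfunT wh) (w0 : forall y, 0 <= wh y).
Hypothesis w2 : (\int[rho]_y (wh y ^+ 2)%:E < +oo)%E.
Hypotheses (mkk : mfunT kk) (kk0 : forall z, 0 <= kk z).
Hypotheses (r2 : 2 < r) (rr' : r^-1 + r'^-1 = 1).

Local Notation numu := (prod_sf nu mu).

Let r1 : 1 < r. Proof. by apply: lt_trans r2; rewrite ltr1n. Qed.
Let r0 : 0 < r. Proof. exact: lt_trans r1. Qed.
Let r'1 : 1 < r'. Proof. by have [] := conj_exp_gt1 r1 rr'. Qed.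
Let r'0 : 0 < r'. exact: lt_trans r'1. Qed.

Let w (y : Y) : R[i] := ((wh y ^+ 2)%:C)%C.
Let J (z z' : S * X) : R[i] := cintegral rho setT (fun y => w y * (e (z, y) * conjc (e (z', y)))).

(** The slice of TT* between the times [s] and [t], with weight [wh ^+ 2] in the middle; for the
    propagator it is [ttstar_op]. *)
Definition ts_op (t s : S) (h : X -> R[i]) (x : X) : R[i] := cintegral mu setT (fun x' =>
  ((A t * A s)%:C)%C * cintegral rho setT (fun y =>
     ((wh y ^+ 2)%:C)%C * (e ((t, x), y) * conjc (e ((s, x'), y)))) * h x').

Hypothesis Tbd : forall t, {ae nu, forall s, forall h, cintegrable mu h ->
  (Lp_norm mu r%:E (ts_op t s h) <= (kk (t, s))%:E * Lp_norm mu r'%:E h)%E}.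

Let Iw : cintegrable rho w.
split; first by apply: cmeas_real; exact: mfunX.
by under eq_int => y _ do rewrite cabs_real ger0_norm ?sqr_ge0//.
Qed.

Let W := fine (\int[rho]_y (wh y ^+ 2)%:E)%E.
Let WE : (\int[rho]_y (wh y ^+ 2)%:E = W%:E)%E.
by rewrite /W fineK// ge0_finE// int_ge0// => y _; rewrite lee_fin sqr_ge0. Qed.
Let W0 : 0 <= W.
by rewrite fine_ge0// int_ge0// => y _; rewrite lee_fin sqr_ge0. Qed.

Let mJ : cmeasurable (fun z : (S * X) * (S * X) => J z.1 z.2).
apply: (@cmeas_int _ _ _ _ R rho (fun z : ((S * X) * (S * X)) * Y =>
  w z.2 * (e (z.1.1, z.2) * conjc (e (z.1.2, z.2))))).
have m2 : mfunT (fun z : ((S * X) * (S * X)) * Y => z.2) by meas.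
have m11 : mfunT (fun z : ((S * X) * (S * X)) * Y => (z.1.1, z.2)).
  by apply/mfun_pair => //; apply: mcompT; [exact: mfst|exact: mfst].
have m12 : mfunT (fun z : ((S * X) * (S * X)) * Y => (z.1.2, z.2)).
  by apply/mfun_pair => //; apply: mcompT; [exact: msnd|exact: mfst].
apply: cmeasM; first exact: cmeas_comp Iw.1 m2.
by apply: cmeasM; [exact: cmeas_comp me m11|apply: cmeasJ; exact: cmeas_comp me m12].
Qed.

Let cabsJW z z' : cabs (J z z') <= W.
have mf : cmeasurable (fun y => w y * (e (z, y) * conjc (e (z', y)))).
  have mz a : cmeasurable (fun y => e (a, y)) by exact: cmeas_comp me (mpair1 a).
  by apply: cmeasM; [exact: Iw.1|apply: cmeasM; [|apply: cmeasJ]].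
rewrite -lee_fin; apply: (le_trans (cabs_cint_le rho mf)); rewrite -WE.
apply: le_integralT.
- nonneg.
- meas.
- meas.
move=> y; rewrite lee_fin !cabsM cabsJ cabs_real ger0_norm ?sqr_ge0//.
by rewrite ler_piMr ?sqr_ge0// -[leRHS]mulr1 ler_pM ?cabs_ge0.
Qed.

Section TestFunction.
Variables (h : S * X -> R[i]) (f : S -> R) (Om : set X) (c : R).
Hypotheses (mh : cmeasurable h) (mf : mfunT f) (f0 : forall t, 0 <= f t).
Hypothesis hf : forall t, (Lp_norm mu r'%:E (fun x => h (t, x)) <= (f t)%:E)%E.
Hypotheses (mOm : measurable Om) (Omoo : (mu Om < +oo)%E).
Hypothesis hOm : forall z, ~ Om z.2 -> h z = 0.
Hypothesis (IAf : (\int[nu]_t (A t * f t)%:E < +oo)%E).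
Hypothesis c0 : 0 <= c.
Hypothesis fkf : (\int[nu]_t \int[nu]_s (f t * kk (t, s) * f s)%:E <= (c ^+ 2)%:E)%E.

Let cO : R := fine (mu Om) `^ r^-1.
Let cO0 : 0 <= cO. Proof. exact: powR_ge0. Qed.

Let mht t : cmeasurable (fun x => h (t, x)).
exact: cmeas_comp mh (mpair1 t). Qed.

(** Hoelder on a support of finite measure turns the $L^{r'}$ bound into integrability, which all
    uses of Fubini below rest on. *)
Let L1 t : (\int[mu]_x (cabs (h (t, x)))%:E <= (f t * cO)%:E)%E.
have r'r : r'^-1 + r^-1 = 1 by rewrite addrC.
have mt : mfunT (fun x => (cabs (h (t, x)))%:E).
  by apply/mEFinP; exact: cmeas_cabs.
have mO : mfunT (fun x => (\1_Om x : R)%:E).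
  meas.
have := @ge0_hoelder _ X R mu r' r _ _ r'1 r'r mt mO.
have -> : (\int[mu]_x ((cabs (h (t, x)))%:E * (\1_Om x)%:E) = \int[mu]_x (cabs (h (t, x)))%:E)%E.
  apply: eq_int => x _; rewrite indicE; have [/set_mem Ox|xO] := boolP (x \in Om).
    by rewrite mule1.
  by rewrite mule0 hOm ?cabs0// => Ox; move: xO; rewrite mem_set.
have -> : ('N[mu]_r%:E[(fun x => (\1_Om x : R)%:E)] = cO%:E)%E.
  rewrite Lnorm_ge0E; last by move=> x; rewrite lee_fin indic_fun_ge0.
  have -> : (\int[mu]_x ((\1_Om x : R)%:E `^ r) = mu Om)%E.
    transitivity (\int[mu]_x (\1_Om x : R)%:E)%E; last by rewrite integral_indic// setIT.
    apply: eq_int => x _.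
    by rewrite poweR_EFin indicE; case: (x \in Om); rewrite ?powR1// powR0// gt_eqF.
  by rewrite -(@fineK _ (mu Om)) ?ge0_finE// poweR_EFin.
move=> H; apply: (le_trans (H _ _)).
- nonneg.
- by move=> x; rewrite lee_fin indic_fun_ge0.
by rewrite EFinM; apply: lee_wpmul2r; [rewrite lee_fin|exact: hf].
Qed.

Let Iht t : cintegrable mu (fun x => h (t, x)).
by split => //; apply: le_lt_trans (L1 t) (ltry _). Qed.

Let F (z : S * X) : R[i] := ((A z.1)%:C)%C * h z.

Let mF : cmeasurable F.
by apply: cmeasM => //; apply: cmeas_real; apply: mcompT => //; exact: mfst.
Qed.

Let cabsF z : cabs (F z) = A z.1 * cabs (h z).
by rewrite cabsM cabs_real ger0_norm. Qed.

Let IF : cintegrable numu F.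
split => //; rewrite integral_prod_sf//; last 2 first.
- meas.
- nonneg.
apply: (@le_lt_trans _ _ (\int[nu]_t (cO%:E * (A t * f t)%:E))%E); last first.
  rewrite integralZlT//; last 2 first.
  - by move=> t; rewrite lee_fin mulr_ge0.
  - meas.
  by apply: lte_mul_pinfty; rewrite ?lee_fin.
apply: le_integralT.
- by move=> t; apply: int_ge0 => x _; rewrite lee_fin cabs_ge0.
- apply: (@mfubiniF _ _ S X R mu (fun z => (cabs (F z))%:E)).
    meas.
  nonneg.
- meas.
move=> t; rewrite /fubini_F.
have -> : (\int[mu]_x (cabs (F (t, x)))%:E = \int[mu]_x ((A t)%:E * (cabs (h (t, x)))%:E))%E.
  by apply: eq_int => x _; rewrite cabsF EFinM.
rewrite integralZlT//; last 2 first.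
- nonneg.
- by apply/mEFinP; exact: cmeas_cabs.
rewrite -EFinM mulrC -mulrA EFinM; apply: lee_wpmul2l; first by rewrite lee_fin.
exact: L1.
Qed.

Let g (y : Y) : R[i] := cintegral numu setT (fun z => e (z, y) * F z).

Let Phi (z : S * X) : R[i] := cintegral numu setT (fun z' => conjc (F z') * J z z').

Let IPhi z : cintegrable numu (fun z' => conjc (F z') * J z z').
rewrite (_ : (fun z' => _) = (fun z' => J z z' * conjc (F z'))); last by apply/funext => z'; rewrite mulrC.
apply: (@cintg_mulb R _ _ _ _ _ W) => //.
  exact: cmeas_comp mJ (mpair1 z).
split; first exact: cmeasJ.
by under eq_int => z' _ do rewrite cabsJ; exact: IF.2.
Qed.

Let mPhi0 : cmeasurable Phi.
have H : cmeasurable (fun q : (S * X) * (S * X) => conjc (F q.2) * J q.1 q.2).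
  by apply: cmeasM => //; apply: cmeasJ; apply: cmeas_comp mF _; exact: msnd.
exact: (@cmeas_int _ _ (S * X)%type (S * X)%type R numu _ H).
Qed.

Let hb s x := conjc (h (s, x)).
Let Ihb s : cintegrable mu (hb s).
split; first exact: cmeasJ.
by under eq_int => z' _ do rewrite /hb cabsJ; exact: (Iht s).2.
Qed.

Let mT t : cmeasurable (fun z : S * X => ts_op t z.1 (hb z.1) z.2).
apply: (@cmeas_int _ _ (S * X)%type X R mu (fun q : (S * X) * X =>
  ((A t * A q.1.1)%:C)%C * J (t, q.1.2) (q.1.1, q.2) * conjc (h (q.1.1, q.2)))).
have m11 : mfunT (fun q : (S * X) * X => q.1.1).
  by apply: mcompT; [exact: mfst|exact: mfst].
have m12 : mfunT (fun q : (S * X) * X => q.1.2).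
  by apply: mcompT; [exact: msnd|exact: mfst].
have mp : mfunT (fun q : (S * X) * X => (q.1.1, q.2)).
  by apply/mfun_pair => //; exact: msnd.
apply: cmeasM; last by apply: cmeasJ; exact: cmeas_comp mh mp.
apply: cmeasM.
  by apply: cmeas_real; apply: mfunM => //; exact: mcompT.
apply: (cmeas_comp mJ (h := fun q : (S * X) * X => ((t, q.1.2), (q.1.1, q.2)))).
by apply/mfun_pair => //; apply/mfun_pair.
Qed.

(** With the second time variable integrated last, the triangle inequality reduces the expanded
    square to single slices [ts_op]. *)
Let A_Phi_le t x : ((A t * cabs (Phi (t, x)))%:E <= \int[nu]_s (cabs (ts_op t s (hb s) x))%:E)%E.
rewrite /Phi cintegral_prod_sf; last exact: IPhi.
have mI : cmeasurable (fun s => cintegral mu setT (fun x' => conjc (F (s, x')) * J (t, x) (s, x'))).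
  apply: (@cmeas_int _ _ S X R mu (fun z' => conjc (F z') * J (t, x) z')).
  exact: (IPhi (t, x)).1.
have mcI : mfunT (fun s => (cabs (cintegral mu setT (fun x' => conjc (F (s, x')) * J (t, x) (s, x'))))%:E).
  meas.
apply: (@le_trans _ _ ((A t)%:E * \int[nu]_s (cabs (cintegral mu setT (fun x' => conjc (F (s, x')) * J (t, x) (s, x'))))%:E)%E).
  rewrite EFinM; apply: lee_wpmul2l; first by rewrite lee_fin.
  exact: cabs_cint_le.
rewrite -integralZlT//; last nonneg.
apply: le_of_eq; apply: eq_int => s _.
have Is : cintegrable mu (fun x' => conjc (F (s, x')) * J (t, x) (s, x')).
  rewrite (_ : (fun x' => _) = (fun x' => (J (t, x) (s, x') * ((A s)%:C)%C) * hb s x')); last first.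
    apply/funext => x'; rewrite /F /hb.
    have -> (a : R) (z : R[i]) : conjc ((a%:C)%C * z) = (a%:C)%C * conjc z.
      by apply: complexE; rewrite ?ReJ ?ImJ ?ReM ?ImM ?ReJ ?ImJ /=; ring.
    by rewrite mulrC mulrA.
  apply: (@cintg_mulb R _ _ mu _ _ (W * A s)) => //.
    apply: cmeasM; last exact: cmeas_cst.
    by apply: (cmeas_comp mJ (h := fun x' => ((t, x), (s, x')))); apply/mfun_pair => //; apply/mfun_pair.
  by move=> x'; rewrite cabsM cabs_real ger0_norm// ler_wpM2r.
rewrite -EFinM -{1}(ger0_norm (A0 t)) -cabs_real -cabsM -(@cintegralZ R _ _ mu ((A t)%:C)%C _ Is).
congr ((cabs _)%:E); apply: eq_cintegral => x'; rewrite /F /hb -/(J (t, x) (s, x')).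
have -> (a : R) (z : R[i]) : conjc ((a%:C)%C * z) = (a%:C)%C * conjc z.
  by apply: complexE; rewrite ?ReJ ?ImJ ?ReM ?ImM ?ReJ ?ImJ /=; ring.
have -> : ((A t * A s)%:C)%C = ((A t)%:C)%C * ((A s)%:C)%C by exact: rmorphM.
by move: (J _ _) (conjc _) => a b; rewrite /=; ring.
Qed.

Let g_bounded : exists M, forall y, cabs (g y) <= M.
pose M := fine (\int[numu]_z (cabs (F z))%:E)%E.
have ME : (\int[numu]_z (cabs (F z))%:E = M%:E)%E.
  rewrite /M fineK// ge0_finE ?IF.2// int_ge0// => z _; rewrite lee_fin cabs_ge0//.
exists M => y; rewrite -lee_fin -ME.
have mey : cmeasurable (fun z => e (z, y)).
  by apply: cmeas_comp me _; exact: mpair2.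
have mm : cmeasurable (fun z => e (z, y) * F z) by exact: cmeasM.
apply: (le_trans (cabs_cint_le _ mm)); apply: le_integralT.
- nonneg.
- meas.
- meas.
- by move=> z; rewrite lee_fin cabsM ler_piMl ?cabs_ge0.
Qed.

Let mg : cmeasurable g.
have H : cmeasurable (fun z : Y * (S * X) => e (z.2, z.1) * F z.2).
  apply: cmeasM; last by apply: cmeas_comp mF _; exact: msnd.
  apply: (cmeas_comp me (h := fun z : Y * (S * X) => (z.2, z.1))).
  by apply/mfun_pair; [exact: msnd|exact: mfst].
exact: (@cmeas_int _ _ Y (S * X)%type R numu _ H).
Qed.

Let wg (y : Y) : R := wh y * cabs (g y).
Let mwg : mfunT wg.
by apply: mfunM => //; exact: cmeas_cabs. Qed.

(** For fixed $t$: Hoelder between $h(t)$ in $L^{r'}$ and each slice in $L^r$, then the operator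
    bound [Tbd], valid for almost every [s]. *)
Let inner t : (\int[mu]_x (cabs (F (t, x)) * cabs (Phi (t, x)))%:E <= \int[nu]_s (f t * kk (t, s) * f s)%:E)%E.
have [TT [mTT TT0 TTE TTb]] : exists TT : S * X -> R, [/\ mfunT TT, forall z, 0 <= TT z,
    forall x, ((A t * cabs (Phi (t, x)))%:E <= \int[nu]_s (TT (s, x))%:E)%E &
    {ae nu, forall s, ('N[mu]_r%:E[(fun x => (TT (s, x))%:E)] <= (kk (t, s))%:E * (f s)%:E)%E}].
  exists (fun z => cabs (ts_op t z.1 (hb z.1) z.2)); split.
  - exact: (cmeas_cabs (mT t)).
  - by move=> z; exact: cabs_ge0.
  - by move=> x; exact: A_Phi_le.
  apply: filterS (Tbd t) => s Ts; apply: (le_trans (Ts (hb s) (Ihb s))).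
  apply: lee_wpmul2l; first by rewrite lee_fin.
  apply: le_trans (hf s); rewrite le_eqVlt; apply/orP; left; apply/eqP; congr Lnorm.
  by apply/funext => x; congr (_%:E); exact: cabsJ.
have mPhi : cmeasurable (fun x => Phi (t, x)).
  exact: (cmeas_comp mPhi0 (mpair1 t)).
have mh2 : mfunT (fun z : S * X => cabs (h (t, z.2))).
  by apply: cmeas_cabs; apply: (cmeas_comp (mht t)); exact: msnd.
have mG : mfunT (fun z : S * X => (cabs (h (t, z.2)) * TT z)%:E).
  meas.
have G0 (z : S * X) : (0 <= (cabs (h (t, z.2)) * TT z)%:E)%E.
  by rewrite lee_fin mulr_ge0 ?cabs_ge0.
apply: (@le_trans _ _ (\int[mu]_x \int[nu]_s (cabs (h (t, x)) * TT (s, x))%:E)%E).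
  apply: le_integralT.
  - by move=> x; rewrite lee_fin mulr_ge0 ?cabs_ge0.
  - apply/mEFinP; apply: mfunM; apply: cmeas_cabs => //.
    exact: (cmeas_comp mF (mpair1 t)).
  - exact: (@mfubiniG _ _ S X R nu _ mG G0).
  move=> x; rewrite cabsF (_ : A (t, x).1 * _ * _ = cabs (h (t, x)) * (A t * cabs (Phi (t, x)))); last first.
    by move: (cabs _) (cabs _) => a b; ring.
  rewrite EFinM.
  apply: (@le_trans _ _ ((cabs (h (t, x)))%:E * \int[nu]_s (TT (s, x))%:E)%E).
    by apply: lee_wpmul2l; [rewrite lee_fin cabs_ge0|exact: TTE].
  rewrite -integralZlT ?cabs_ge0//.
  - by move=> s; rewrite lee_fin.
  - by apply/mEFinP; exact: (mcompT mTT (mpair2 x)).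
rewrite -(@fubini_tonelli _ _ S X R nu mu _ mG G0).
apply: ae_ge0_le_integral => //.
- by move=> s _; apply: int_ge0.
- exact: (@mfubiniF _ _ S X R mu _ mG G0).
- by move=> s _; rewrite lee_fin !mulr_ge0.
- apply/mEFinP; apply: mfunM => //; apply: mfunM => //.
  exact: mcompT mkk (mpair1 t).
apply: filterS TTb => s Ts _; rewrite /fubini_F /=.
have r'r : r'^-1 + r^-1 = 1 by rewrite addrC.
under eq_int => x _ do rewrite EFinM.
apply: (le_trans (@ge0_hoelder _ X R mu r' r (fun x => (cabs (h (t, x)))%:E) (fun x => (TT (s, x))%:E) r'1 r'r _ _ _ _)).
- by apply/mEFinP; exact: cmeas_cabs.
- by apply/mEFinP; exact: (mcompT mTT (mpair1 s)).
- by move=> x; rewrite lee_fin cabs_ge0.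
- by move=> x; rewrite lee_fin.
rewrite -mulrA EFinM; apply: lee_pmul; [exact: Lnorm_ge0|exact: Lnorm_ge0|exact: hf|].
by rewrite EFinM; exact: Ts.
Qed.

(** By [cintegral_ttstar] the squared norm of the adjoint applied to [h] is the form just estimated
    in [inner], so the assumption on [f] and [kk] bounds it by $c^2$. *)
Let wg_L2 : (\int[rho]_y (wg y ^+ 2)%:E <= (c ^+ 2)%:E)%E.
have [M gM] := g_bounded.
have I1 : rho.-integrable setT (EFin \o (fun y => wg y ^+ 2)).
  have := integrableZl measurableT (M ^+ 2) (cintg_cabs Iw).
  apply: le_integrable => //; first by apply/mEFinP; exact: mfunX.
  move=> y _; rewrite -EFinM; have M0 : 0 <= M := le_trans (cabs_ge0 (g y)) (gM y).
  change ((`|wg y ^+ 2|)%:E <= (`|M ^+ 2 * cabs (w y)|)%:E)%E.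
  rewrite lee_fin cabs_real exprMn !ger0_norm ?mulr_ge0 ?sqr_ge0 ?exprn_ge0 ?cabs_ge0//.
  rewrite mulrC ler_wpM2r ?sqr_ge0//= ler_pXn2r ?nnegrE ?cabs_ge0//.
  by rewrite (le_trans _ (gM y)) ?cabs_ge0.
have -> : (\int[rho]_y (wg y ^+ 2)%:E = (\int[rho]_y (wg y ^+ 2))%:E)%E.
  by rewrite /Rintegral fineK//; exact: integrable_fin_num.
have -> : \int[rho]_y (wg y ^+ 2) = cabs (cintegral rho setT (fun y => w y * (g y * conjc (g y)))).
  have -> : cintegral rho setT (fun y => w y * (g y * conjc (g y))) = cintegral rho setT (fun y => ((wg y ^+ 2)%:C)%C).
    by apply: eq_cintegral => y; rewrite mulcJ /w /wg exprMn; exact/esym/rmorphM.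
  rewrite cintegral_ReE cabs_real ger0_norm// fine_ge0// int_ge0// => y _.
  by rewrite lee_fin sqr_ge0.
rewrite (cintegral_ttstar me e1 IF Iw).
have mFP : cmeasurable (fun z => F z * Phi z) by exact: cmeasM.
apply: (le_trans (cabs_cint_le _ mFP)); apply: le_trans fkf.
have mG : mfunT (fun z => (cabs (F z) * cabs (Phi z))%:E).
  by apply/mEFinP; apply: mfunM; exact: cmeas_cabs.
have G0 z : (0 <= (cabs (F z) * cabs (Phi z))%:E)%E by rewrite lee_fin mulr_ge0 ?cabs_ge0.
under eq_int => z _ do rewrite cabsM.
rewrite (@integral_prod_sf _ _ S X R nu mu _ mG G0).
apply: le_integralT => //.
- by move=> t; apply: int_ge0.
- exact: (@mfubiniF _ _ S X R mu _ mG G0).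
apply: (@mfubiniF _ _ S S R nu (fun z => (f z.1 * kk z * f z.2)%:E)).
  apply/mEFinP; apply: mfunM; first apply: mfunM => //.
    by apply: mcompT => //; exact: mfst.
  by apply: mcompT => //; exact: msnd.
by move=> z; rewrite lee_fin !mulr_ge0.
Qed.

(** Fubini moves the operator onto [h]; Cauchy-Schwarz then separates [phi] from the adjoint, whose
    norm is controlled by [wg_L2]. *)
Lemma ttstar_pairing (phi : Y -> R[i]) : cmeasurable phi -> (Lp_norm rho 2%:E phi < +oo)%E ->
  ((cabs (cintegral numu setT (fun z => (((A z.1)%:C)%C *
     cintegral rho setT (fun y => e (z, y) * (((wh y)%:C)%C * phi y))) * h z)))%:E <=
   Lp_norm rho 2%:E phi * c%:E)%E.
Proof.
move=> mphi phi2.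
have h2 : (2 : R)^-1 + 2^-1 = 1 by field.
have l12 : 1 < 2 :> R by rewrite ltr1n.
have phi0 y : (0 <= (cabs (phi y))%:E)%E by rewrite lee_fin cabs_ge0.
have whE0 y : (0 <= (EFin \o wh) y)%E by rewrite lee_fin.
have mE (k : Y -> R) : mfunT k -> mfunT (fun y => (k y)%:E).
  by move=> mk; apply/mEFinP.
have mcphi := cmeas_cabs mphi.
have sqE (k : Y -> R) : (forall y, 0 <= k y) -> (\int[rho]_y ((k y)%:E `^ 2) = \int[rho]_y (k y ^+ 2)%:E)%E.
  by move=> k0; apply: eq_int => y _; rewrite poweR_EFin powR_mulrn.
have L2 (k : Y -> R) (a : R) : (forall y, 0 <= k y) -> 0 <= a -> (\int[rho]_y (k y ^+ 2)%:E <= (a ^+ 2)%:E)%E ->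
    ('N[rho]_2%:E[EFin \o k] <= a%:E)%E.
  move=> k0 a0 ka; apply/(@Lnorm_le _ _ _ rho 2 (EFin \o k) a%:E) => //.
  by rewrite (sqE k k0) poweR_EFin powR_mulrn.
have wh2 : ('N[rho]_2%:E[EFin \o wh] < +oo)%E.
  apply: le_lt_trans (ltry (Num.sqrt W)); apply: L2 => //; rewrite ?sqrtr_ge0//.
  by rewrite sqr_sqrtr// WE.
have Iwp : cintegrable rho (fun y => ((wh y)%:C)%C * phi y).
  split; first by apply: cmeasM => //; exact: cmeas_real.
  have := @ge0_hoelder _ Y R rho 2 2 (EFin \o wh) (fun y => (cabs (phi y))%:E) l12 h2 (mE _ mw) (mE _ mcphi) whE0 phi0.
  move=> H; apply: (@le_lt_trans _ _ ('N[rho]_2%:E[EFin \o wh] * Lp_norm rho 2%:E phi)%E); last first.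
    by rewrite lte_mul_pinfty// ?Lnorm_ge0// ge0_finE// Lnorm_ge0.
  apply: le_trans H.
  by apply: le_of_eq; apply: eq_int => y _; rewrite cabsM cabs_real ger0_norm// EFinM.
pose Fy (q : (S * X) * Y) := e q * (((wh q.2)%:C)%C * phi q.2) * F q.1.
have mFy : cmeasurable Fy.
  apply: cmeasM; last by apply: cmeas_comp mF _; exact: mfst.
  by apply: cmeasM => //; apply: (cmeas_comp Iwp.1); exact: msnd.
have Foo : (\int[numu]_z \int[rho]_y (cabs (Fy (z, y)))%:E < +oo)%E.
  apply: (@integral_product_lty _ _ Y (S * X)%type R rho numu (fun q => cabs (Fy q)) (fun z => cabs (F z)) (fun y => cabs (((wh y)%:C)%C * phi y))).
  - meas.
  - nonneg.
  - exact: cintg_cabs IF.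
  - exact: cintg_cabs Iwp.
  - nonneg.
  - nonneg.
  by move=> z y; rewrite /Fy cabsM [leRHS]mulrC ler_wpM2r ?cabs_ge0// cabsM ler_piMl ?cabs_ge0.
have fub := cintegral_fubini mFy Foo.
have mey z : cmeasurable (fun y => e (z, y)) by exact: cmeas_comp me (mpair1 z).
have mez y : cmeasurable (fun z => e (z, y)) by exact: cmeas_comp me (mpair2 y).
have -> : cintegral numu setT (fun z => (((A z.1)%:C)%C *
     cintegral rho setT (fun y => e (z, y) * (((wh y)%:C)%C * phi y))) * h z) =
     cintegral numu setT (fun z => cintegral rho setT (fun y => Fy (z, y))).
  apply: eq_cintegral => z.
  have Ie : cintegrable rho (fun y => e (z, y) * (((wh y)%:C)%C * phi y)).
    exact: (@cintg_mulb R _ _ rho _ _ 1 (mey z) _ Iwp).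
  rewrite [LHS]mulrAC -/(F z) -(@cintegralZ R _ _ rho (F z) _ Ie).
  by apply: eq_cintegral => y; rewrite /Fy [LHS]mulrC.
rewrite fub.
have -> : cintegral rho setT (fun y => cintegral numu setT (fun z => Fy (z, y))) =
    cintegral rho setT (fun y => ((wh y)%:C)%C * phi y * g y).
  apply: eq_cintegral => y.
  have Ie : cintegrable numu (fun z => e (z, y) * F z).
    exact: (@cintg_mulb R _ _ _ _ _ 1 (mez y) _ IF).
  rewrite -(@cintegralZ R _ _ _ (((wh y)%:C)%C * phi y) _ Ie).
  apply: eq_cintegral => z.
  have -> : Fy (z, y) = e (z, y) * (((wh y)%:C)%C * phi y) * F z by [].
  by rewrite mulrAC mulrC.
have mm : cmeasurable (fun y => ((wh y)%:C)%C * phi y * g y) by apply: cmeasM => //; exact: Iwp.1.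
apply: (le_trans (cabs_cint_le _ mm)).
have := @ge0_hoelder _ Y R rho 2 2 (fun y => (cabs (phi y))%:E) (EFin \o wg) l12 h2 (mE _ mcphi) (mE _ mwg) phi0.
have wg0 y : 0 <= wg y by rewrite mulr_ge0 ?cabs_ge0.
move=> H; apply: (@le_trans _ _ (Lp_norm rho 2%:E phi * 'N[rho]_2%:E[EFin \o wg])%E); last first.
  by apply: lee_wpmul2l; [exact: Lnorm_ge0|exact: (L2 wg c wg0 c0 wg_L2)].
apply: le_trans (H _); last by move=> y; rewrite lee_fin.
apply: le_of_eq; apply: eq_int => y _.
by rewrite !cabsM cabs_real ger0_norm// -EFinM /wg mulrAC mulrC mulrA.
Qed.

End TestFunction.
Section Homogeneous.
Variable phi : Y -> R[i].
Hypotheses (mphi : cmeasurable phi) (phi2 : (Lp_norm rho 2%:E phi < +oo)%E).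

Definition mixed_op (z : S * X) : R[i] :=
  ((A z.1)%:C)%C * cintegral rho setT (fun y => e (z, y) * (((wh y)%:C)%C * phi y)).
Let v := mixed_op.

Lemma cmeas_mixed_op : cmeasurable mixed_op.
apply: cmeasM; first by apply: cmeas_real; apply: mcompT => //; exact: mfst.
have H : cmeasurable (fun q : (S * X) * Y => e q * (((wh q.2)%:C)%C * phi q.2)).
  apply: cmeasM => //; apply: cmeasM.
    by apply: cmeas_real; apply: mcompT mw _; exact: msnd.
  by apply: cmeas_comp mphi _; exact: msnd.
exact: (@cmeas_int _ _ (S * X)%type Y R rho _ H).
Qed.
Let mv : cmeasurable v := cmeas_mixed_op.

(** The pairing is applied to the extremal function $f(t)n(t)^{1-r}|v|^{r-2}\bar v$ on [G], where
    $n(t)$ is the $L^r$ norm of the truncated slice. Its $L^{r'}$ norm is at most $f(t)$ and its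
    pairing with $v$ is $\int fn$. Truncation makes $n$ finite. *)
Let truncated_bound (G : set (S * X)) (Om : set X) (M : R) (f : S -> R) (c : R) :
  measurable G -> measurable Om -> (mu Om < +oo)%E -> (forall z, G z -> Om z.2) -> 0 <= M ->
  (forall z, G z -> cabs (v z) <= M) ->
  mfunT f -> (forall t, 0 <= f t) ->
  (\int[nu]_t (f t)%:E < +oo)%E -> (\int[nu]_t (A t * f t)%:E < +oo)%E -> 0 <= c ->
  (\int[nu]_t \int[nu]_s (f t * kk (t, s) * f s)%:E <= (c ^+ 2)%:E)%E ->
  (\int[nu]_t ('N[mu]_r%:E[(fun x => (cabs (v (t, x)))%:E * (\1_G (t, x))%:E)] * (f t)%:E) <=
    Lp_norm rho 2%:E phi * c%:E)%E.
Proof.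
move=> mG mOm Omoo GOm M0 vM mf f0 If IAf c0 fkf.
pose a z : R := cabs (v z) * \1_G z.
have a0 z : 0 <= a z by rewrite mulr_ge0 ?cabs_ge0 ?indic_fun_ge0.
have ma : mfunT a by apply: mfunM; [exact: cmeas_cabs|exact: mindic].
have aM z : a z <= M * \1_Om z.2.
  rewrite /a !indicE; have [/set_mem Gz|_] := boolP (z \in G); last by rewrite mulr0 mulr_ge0.
  by rewrite mem_set ?mulr1; [exact: vM|exact: GOm].
pose I t : \bar R := (\int[mu]_x (a (t, x) `^ r)%:E)%E.
pose N t : \bar R := ('N[mu]_r%:E[(fun x => (a (t, x))%:E)])%E.
have mar : mfunT (fun z => (a z `^ r)%:E).
  meas.
have I0 t : (0 <= I t)%E by apply: int_ge0 => x _; rewrite lee_fin powR_ge0.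
have NE t : N t = (I t `^ r^-1)%E.
  rewrite /N Lnorm_ge0E; last by move=> x; rewrite lee_fin.
  by congr (_ `^ _)%E; apply: eq_int => x _; rewrite poweR_EFin.
pose K := (M `^ r * fine (mu Om)) `^ r^-1.
have K0 : 0 <= K by exact: powR_ge0.
have fO0 : 0 <= fine (mu Om) by rewrite fine_ge0.
have NK t : (N t <= K%:E)%E.
  rewrite NE /K -poweR_EFin; apply: lee_poweR => //; first by rewrite invr_ge0 ltW.
  rewrite EFinM fineK ?ge0_finE//.
  have -> : ((M `^ r)%:E * mu Om = \int[mu]_x ((M `^ r)%:E * (\1_Om x : R)%:E))%E.
    have i0 x : (0 <= (\1_Om x : R)%:E)%E by rewrite lee_fin indic_fun_ge0.
    have mi : mfunT (fun x => (\1_Om x : R)%:E) by meas.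
    rewrite (@integralZlT _ X R mu _ (M `^ r) i0 mi (powR_ge0 _ _)).
    by rewrite integral_indic// setIT.
  apply: le_integralT.
  - nonneg.
  - exact: (meas_slice mar).
  - meas.
  move=> x; rewrite -EFinM lee_fin; apply: le_trans (le_powR (ltW r0) (a0 _) (aM _)) _ => /=.
  by rewrite indicE; case: (x \in Om); rewrite ?mulr1// mulr0 powR0 ?mulr0// gt_eqF.
have N0 t : (0 <= N t)%E by exact: Lnorm_ge0.
pose n t := fine (N t).
have n0 t : 0 <= n t by rewrite fine_ge0.
have nE t : (n t)%:E = N t by rewrite fineK// ge0_finE// (le_lt_trans (NK t)) ?ltry.
have nI t : ((n t) `^ r)%:E = I t.
  by rewrite -poweR_EFin nE NE poweRVK// gt_eqF.
have mn : mfunT n.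
  apply: mcompT => //.
  apply: (@mLnorm_slice _ _ S X R mu r (fun z => (a z)%:E)) => [|z]; last by rewrite lee_fin.
  meas.
(* Where $n(t)=0$ the convention for powers of 0 makes this factor vanish. *)
pose k t := f t * n t `^ (1 - r).
have k0 t : 0 <= k t by rewrite mulr_ge0 ?powR_ge0.
have mk : mfunT k by apply: mfunM => //; exact: mfun_powR.
have mk1 : mfunT (fun z : S * X => k z.1) by apply: mcompT => //; exact: mfst.
have mar2 : mfunT (fun z => a z `^ (r - 2)) by meas.
have kn t : k t * n t `^ r = f t * n t.
  rewrite /k -mulrA; congr (_ * _); have [->|nn] := eqVneq (n t) 0.
    by rewrite (@powR0 _ r) ?mulr0// gt_eqF.
  rewrite -powRD ?nn ?implybT//.
  by rewrite (_ : 1 - r + r = 1) ?powRr1//; ring.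
pose h (z : S * X) : R[i] := ((k z.1 * a z `^ (r - 2) * \1_G z)%:C)%C * conjc (v z).
have mh : cmeasurable h.
  apply: cmeasM; last exact: cmeasJ.
  by apply: cmeas_real; apply: mfunM; [exact: mfunM|exact: mindic].
have ch z : cabs (h z) = k z.1 * a z `^ (r - 1).
  rewrite cabsM cabsJ cabs_real ger0_norm; last by rewrite !mulr_ge0 ?powR_ge0 ?indic_fun_ge0.
  have -> : k z.1 * a z `^ (r - 2) * \1_G z * cabs (v z) = k z.1 * (a z * a z `^ (r - 2)) by rewrite /a; ring.
  by congr (_ * _); rewrite (_ : r - 2 = (r - 1) - 1) ?mulr_powRB1 ?subr_gt0//; ring.
have vh z : v z * h z = ((k z.1 * a z `^ r)%:C)%C.
  have -> : v z * h z = ((k z.1 * a z `^ (r - 2) * \1_G z)%:C)%C * (v z * conjc (v z)) by rewrite /h mulrCA.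
  rewrite mulcJ; transitivity (((k z.1 * a z `^ (r - 2) * \1_G z * cabs (v z) ^+ 2)%:C)%C); first exact/esym/rmorphM.
  congr (_%:C)%C.
  have -> : k z.1 * a z `^ (r - 2) * \1_G z * cabs (v z) ^+ 2 = k z.1 * (a z * (a z * a z `^ (r - 2))).
    have aE : a z = cabs (v z) * \1_G z by [].
    by move: (a z `^ (r - 2)) => p; rewrite aE indicE; case: (z \in G) => /=; ring.
  by congr (_ * _); rewrite (_ : r - 2 = (r - 1) - 1) ?mulr_powRB1 ?subr_gt0//; ring.
have hf t : (Lp_norm mu r'%:E (fun x => h (t, x)) <= (f t)%:E)%E.
  apply/Lnorm_le => //; first by rewrite lee_fin.
    nonneg.
  have -> : (\int[mu]_x ((cabs (h (t, x)))%:E `^ r') = \int[mu]_x ((k t `^ r')%:E * (a (t, x) `^ r)%:E))%E.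
    apply: eq_int => x _; rewrite poweR_EFin ch powRM ?powR_ge0// -powRrM -EFinM.
    by have [_ -> _] := conj_exp_gt1 r1 rr'.
  rewrite integralZlT ?powR_ge0//; last 2 first.
  - nonneg.
  - exact: (meas_slice mar).
  rewrite -/(I t) -nI poweR_EFin -EFinM lee_fin.
  rewrite /k powRM ?powR_ge0// -powRrM -mulrA ler_piMr ?powR_ge0//.
  have -> : (1 - r) * r' = - r by have [_ H _] := conj_exp_gt1 r1 rr'; rewrite -[in RHS]H; ring.
  have [->|nn] := eqVneq (n t) 0; first by rewrite (@powR0 _ r) ?mulr0// gt_eqF.
  by rewrite -powRD ?nn ?implybT// addNr powRr0.
have hOm z : ~ Om z.2 -> h z = 0.
  move=> Oz; rewrite /h indicE memNset ?mulr0 ?mul0r//; by move=> /GOm.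
have := ttstar_pairing mh mf f0 hf mOm Omoo hOm IAf c0 fkf mphi phi2.
have -> : cintegral numu setT (fun z => (((A z.1)%:C)%C *
     cintegral rho setT (fun y => e (z, y) * (((wh y)%:C)%C * phi y))) * h z) =
     cintegral numu setT (fun z => ((k z.1 * a z `^ r)%:C)%C).
  by apply: eq_cintegral => z; exact: vh.
have mka : mfunT (fun z => (k z.1 * a z `^ r)%:E).
  meas.
have ka0 z : (0 <= (k z.1 * a z `^ r)%:E)%E by rewrite lee_fin mulr_ge0 ?powR_ge0.
have Ika : (\int[numu]_z (k z.1 * a z `^ r)%:E = \int[nu]_t (f t * n t)%:E)%E.
  rewrite (@integral_prod_sf _ _ S X R nu mu _ mka ka0); apply: eq_int => t _.
  have -> : (\int[mu]_x (k (t, x).1 * a (t, x) `^ r)%:E = \int[mu]_x ((k t)%:E * (a (t, x) `^ r)%:E))%E.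
    by apply: eq_int => x _; rewrite EFinM.
  rewrite integralZlT ?k0//; last 2 first.
  - nonneg.
  - exact: (meas_slice mar).
  by rewrite -/(I t) -nI -EFinM kn.
have fn0 t : (0 <= (f t * n t)%:E)%E by rewrite lee_fin mulr_ge0.
have fnoo : (\int[nu]_t (f t * n t)%:E < +oo)%E.
  apply: (@le_lt_trans _ _ (\int[nu]_t (K%:E * (f t)%:E))%E); last first.
    rewrite integralZlT//; last meas.
    by rewrite lte_mul_pinfty ?lee_fin.
  apply: le_integralT => //.
  - meas.
  - meas.
  by move=> t; rewrite -EFinM lee_fin mulrC ler_wpM2r// -lee_fin nE.
have -> : (\int[nu]_t ('N[mu]_r%:E[(fun x => (cabs (v (t, x)))%:E * (\1_G (t, x))%:E)] * (f t)%:E) =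
  \int[nu]_t (f t * n t)%:E)%E.
  by apply: eq_int => t _; rewrite EFinM nE muleC.
rewrite cintegral_ReE cabs_real /Rintegral Ika ger0_norm ?fineK//.
- by rewrite ge0_finE// int_ge0.
- by rewrite fine_ge0// int_ge0.
Qed.

(** The cuts in size, space and amplitude that make the test functions admissible are removed by
    exhaustion and Fatou; the quadratic form in [f] only decreases under the cut. *)
Theorem mixed_ttstar (f : S -> R) (c : R) : mfunT f -> (forall t, 0 <= f t) ->
  (\int[nu]_t (f t)%:E < +oo)%E -> 0 <= c ->
  (\int[nu]_t \int[nu]_s (f t * kk (t, s) * f s)%:E <= (c ^+ 2)%:E)%E ->
  (\int[nu]_t (Lp_norm mu r%:E (fun x => mixed_op (t, x)) * (f t)%:E) <=
    Lp_norm rho 2%:E phi * c%:E)%E.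
Proof.
move=> mf f0 If c0 fkf.
have /sigma_finiteP[Om [TOm ndOm Omoo]] := sigma_finiteT mu.
have mcv := cmeas_cabs mv.
pose G k : set (S * X) := [set z | Om k z.2 /\ cabs (v z) <= k%:R].
have mle d (T : measurableType d) (b : T -> R) k : mfunT b -> measurable [set z | b z <= k%:R].
  move=> mb; rewrite (_ : [set z | _] = b @^-1` `]-oo, k%:R]).
    by rewrite -[X in measurable X]setTI; exact: mb.
  by apply/seteqP; split => z /=; rewrite in_itv.
have mG k : measurable (G k).
  apply: measurableI; last exact: mle.
  by rewrite -[X in measurable X]setTI; apply: msnd => //; exact: (Omoo k).1.
have ndG : {homo G : n m / (n <= m)%N >-> n `<=` m}.
  move=> k m km z [Oz vz]; split; last by rewrite (le_trans vz)// ler_nat.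
  by move: Oz; exact/subsetPset/ndOm.
have arch (x : R) : exists k, x <= k%:R.
  exists (Num.bound `|x|); apply: (le_trans (ler_norm x)); apply: ltW.
  by rewrite archi_boundP// normr_ge0.
have exG z : exists k, G k z.
  have : setT z.2 by []; rewrite TOm => -[j _ Oj]; have [l vl] := arch (cabs (v z)).
  exists (maxn j l); split; first by move: Oj; exact/subsetPset/ndOm/leq_maxl.
  by rewrite (le_trans vl)// ler_nat leq_maxr.
(* A bounded amplitude is a condition on time alone; it is imposed on [f], where it makes the
   integral of [A t * f t] finite. *)
pose E k : set S := [set t | A t <= k%:R].
have mE k : measurable (E k) by exact: mle.
pose fk k t : R := f t * \1_(E k) t.
have mfk k : mfunT (fk k) by apply: mfunM => //; exact: mindic.
have fk0 k t : 0 <= fk k t by rewrite mulr_ge0 ?indic_fun_ge0.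
have fkf' k t : fk k t <= f t by rewrite /fk indicE; case: (t \in E k); rewrite ?mulr1// mulr0.
have mEf (b : S -> R) : mfunT b -> mfunT (fun t => (b t)%:E) by move=> mb; apply/mEFinP.
pose NN k t : \bar R := ('N[mu]_r%:E[(fun x => (cabs (v (t, x)))%:E * (\1_(G k) (t, x))%:E)])%E.
have mcvE : mfunT (fun z => (cabs (v z))%:E) by apply/mEFinP.
have mcv1 k : mfunT (fun z : S * X => ((cabs (v z))%:E * (\1_(G k) z)%:E)%E).
  by apply: emfunM => //; apply/mEFinP; exact: mindic.
have cv0 z : (0 <= (cabs (v z))%:E)%E by rewrite lee_fin cabs_ge0.
have cv1 k z : (0 <= (cabs (v z))%:E * (\1_(G k) z : R)%:E)%E by rewrite mule_ge0// lee_fin indic_fun_ge0.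
apply: (@fatou_le _ S R nu (fun k t => (NN k t * (fk k t)%:E)%E)).
- move=> k; apply: emfunM; last exact: mEf.
  exact: (@mLnorm_slice _ _ S X R mu r _ (mcv1 k) (cv1 k)).
- by move=> k t; rewrite mule_ge0 ?Lnorm_ge0// lee_fin.
- apply: emfunM; last exact: mEf.
  exact: (@mLnorm_slice _ _ S X R mu r _ mcvE cv0).
- by move=> t; rewrite mule_ge0 ?Lnorm_ge0// lee_fin.
- apply/aeW => t; rewrite muleC.
  have cN : NN ^~ t @ \oo --> Lp_norm mu r%:E (fun x => mixed_op (t, x)).
    apply: (@cvg_Lnorm_indic _ X R mu r (fun x => (cabs (v (t, x)))%:E) (fun k => [set x | G k (t, x)])) => //.
    - exact: (meas_slice mcvE).
    - by move=> k; have := @measurable_xsection _ _ S X (G k) t (mG k); rewrite /xsection; congr measurable; apply/seteqP; split => x /=; [move/set_mem|move/mem_set].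
    - by move=> k m km x; exact: ndG.
    - by move=> x; exact: (exG (t, x)).
  have cZ := cvgeZl (y := (f t)%:E) isT cN.
  apply: cvg_trans cZ; apply: near_eq_cvg.
  have [k0 Ak0] := arch (A t); exists k0 => // k /= k0k.
  rewrite /fk indicE mem_set ?mulr1 1?muleC//.
  by rewrite /E/=; rewrite (le_trans Ak0)// ler_nat.
move=> k; apply: (truncated_bound (Om := Om k) (M := k%:R)) => //.
- exact: (Omoo k).1.
- exact: (Omoo k).2.
- by move=> z [].
- by move=> z [].
- apply: le_lt_trans If; apply: le_integralT; [by move=> t; rewrite lee_fin|exact: mEf|exact: mEf|].
  by move=> t; rewrite lee_fin.
- apply: (@le_lt_trans _ _ (\int[nu]_t (k%:R%:E * (f t)%:E))%E); last first.
    rewrite integralZlT//; last exact: mEf.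
    by rewrite lte_mul_pinfty ?lee_fin.
  apply: le_integralT; first by move=> t; rewrite lee_fin mulr_ge0.
  + by apply: mEf; exact: mfunM.
  + by apply: emfunM => //; exact: mEf.
  move=> t; rewrite -EFinM lee_fin /fk indicE; have [/set_mem Et|_] := boolP (t \in E k).
    by rewrite mulr1 ler_wpM2r.
  by rewrite !mulr0 mulr_ge0.
apply: le_trans fkf.
have mff (b : S -> R) : mfunT b -> mfunT (fun z : S * S => (b z.1 * kk z * b z.2)%:E).
  move=> mb; apply/mEFinP; apply: mfunM; first apply: mfunM => //.
    by apply: mcompT => //; exact: mfst.
  by apply: mcompT => //; exact: msnd.
have ff0 (b : S -> R) (z : S * S) : (forall t, 0 <= b t) -> (0 <= (b z.1 * kk z * b z.2)%:E)%E.
  by move=> b0; rewrite lee_fin !mulr_ge0.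
apply: le_integralT.
- by move=> t; apply: int_ge0 => s _; exact: (ff0 (fk k) (t, s)).
- exact: (@mfubiniF _ _ S S R nu _ (mff (fk k) (mfk k)) (fun z => ff0 (fk k) z (fk0 k))).
- exact: (@mfubiniF _ _ S S R nu _ (mff f mf) (fun z => ff0 f z f0)).
move=> t; apply: le_integralT.
- by move=> s; exact: (ff0 (fk k) (t, s)).
- exact: (meas_slice (mff (fk k) (mfk k))).
- exact: (meas_slice (mff f mf)).
by move=> s; rewrite lee_fin; apply: ler_pM => //; rewrite ?mulr_ge0//; exact: ler_wpM2r.
Qed.

End Homogeneous.
End MixedTTStar.

Lemma ge0_integralZD d (T : measurableType d) (R : realType) (mu : {measure set T -> \bar R})
    (k : R) (a b : T -> \bar R) : 0 <= k -> mfunT a -> mfunT b ->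
  (forall x, 0 <= a x)%E -> (forall x, 0 <= b x)%E ->
  (\int[mu]_x (k%:E * (a x + b x)) = k%:E * (\int[mu]_x a x + \int[mu]_x b x))%E.
Proof.
move=> k0 ma mb a0 b0; rewrite integralZlT//.
- by rewrite ge0_integralD.
- by move=> x; exact: adde_ge0.
- exact: emeasurable_funD.
Qed.

(** * Domination of the dispersive kernel by powers of time *)

Section Kernel.
Context (R : realType) (n : nat) (Q B : 'M[R]_n).
Hypotheses (sQ : Defs.symmetric Q) (pQ : psd Q) (V0 : forall t : R, 0 < t -> 0 < volume Q B t).
Variables (D : nat) (Dinf r q qinf gam : R).
Hypotheses (Dinf2 : 2 <= Dinf) (DinfD : Dinf < D%:R) (gam0 : 0 < gam).
Hypothesis volge : forall t : R, 0 < t -> gam * Num.min (t ^+ D) (t `^ Dinf) <= vol Q B t.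
Hypotheses (r2 : 2 < r) (rD : (2 < D)%N -> r < 2 * D%:R / (D%:R - 2)).
Hypotheses (qE : 2 / q = D%:R * (2^-1 - r^-1)) (qinf1 : 1 < qinf)
  (qinfE : 2 / qinf <= Dinf * (2^-1 - r^-1)).
Local Notation vec := 'cV[R]_n.
Local Notation leb := (@lebesgue_measure R).
Local Notation lebn := (lebesgue_cV R n).
Local Notation A := (amp Q B).
Local Notation del := (2^-1 - r^-1).

Lemma cmeas_prop_joint d (T : measurableType d) (tau : T -> R) (f : T * vec -> R[i]) :
  mfunT tau -> cmeasurable f ->
  cmeasurable (fun z : T * vec => prop Q B (tau z.1) (fun y => f (z.1, y)) z.2).
Proof.
move=> mt mf; apply: cmeasM.
  apply: cmeas_real; apply: mcompT (meas_amp V0) _.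
  by apply: mcompT mt _; exact: mfst.
have m2 : mfunT (fun q : (T * vec) * vec => q.2) by meas.
have m11 : mfunT (fun q : (T * vec) * vec => q.1.1).
  by apply: mcompT; [exact: mfst|exact: mfst].
have m12 : mfunT (fun q : (T * vec) * vec => q.1.2).
  by apply: mcompT; [exact: msnd|exact: mfst].
have H : cmeasurable (fun q : (T * vec) * vec => expi (phase Q B (tau q.1.1) q.1.2 q.2) * f (q.1.1, q.2)).
  apply: cmeasM.
    apply: cmeas_expi.
    have mq : mfunT (fun q : (T * vec) * vec => ((tau q.1.1 : mtypeR R, q.1.2), q.2)).
      by apply/mfun_pair => //; apply/mfun_pair => //; exact: (mcompT mt m11).
    exact: (mcompT (meas_phase V0) mq).
  by apply: (cmeas_comp mf (h := fun q : (T * vec) * vec => (q.1.1, q.2))); apply/mfun_pair.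
exact: (@cmeas_int _ _ (T * vec)%type vec R lebn _ H).
Qed.

Let r0 : 0 < r. Proof. exact: lt_trans r2. Qed.
Let del0 : 0 < del.
by rewrite subr_gt0 ltf_pV2 ?posrE. Qed.
Let D2 : 2 < D%:R :> R. Proof. exact: le_lt_trans DinfD. Qed.

(** The hypothesis $r<2D/(D-2)$ in the form $2/q<1$; it is in force because $D>D_\infty\ge2$. *)
Let Ddel1 : D%:R * del < 1.
have D2' : (2 < D)%N by rewrite -(ltr_nat R).
have := rD D2'; rewrite ltr_pdivlMr ?subr_gt0// => h.
have D0 : 0 < D%:R :> R by apply: lt_trans D2.
have -> : D%:R * del = (D%:R * r - 2 * D%:R) / (2 * r) by field; rewrite gt_eqF.
by rewrite ltr_pdivrMr ?mulr_gt0//; nra.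
Qed.

Lemma strichartz_q_gt2 : 2 < q.
Proof.
have qi : 0 < 2 / q by rewrite qE mulr_gt0//; apply: lt_trans D2.
have q0 : 0 < q by rewrite -invr_gt0; move: qi; rewrite pmulr_rgt0.
by move: Ddel1; rewrite -qE ltr_pdivrMr// mul1r.
Qed.
Let q2 := strichartz_q_gt2.

(** With $\delta=\frac12-\frac1r$, one has $2/q_\infty\le D_\infty\delta<D\delta=2/q$. The strict
    order is used for splitting the sum space, and together with $q>2$ it admits $q_\infty$ as a
    Hardy-Littlewood-Sobolev exponent. *)
Lemma strichartz_q_lt_qinf : q < qinf.
have q0 : 0 < q by apply: lt_trans q2.
have qi0 : 0 < qinf by apply: lt_trans qinf1.
have h : 2 / qinf < 2 / q.
  by rewrite qE; apply: le_lt_trans qinfE _; rewrite ltr_pM2r.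
by move: h; rewrite ltr_pM2l// ltf_pV2 ?posrE.
Qed.
Let qinf2 : 2 < qinf. Proof. exact: lt_trans q2 strichartz_q_lt_qinf. Qed.

Definition decay_cst : R := interp_cst r * ((4 * pi) `^ (- (n%:R / 2))) `^ (1 - 2 / r) * gam `^ (- del).
Lemma decay_cst_gt0 : 0 < decay_cst.
rewrite !mulr_gt0 ?powR_gt0 ?mulr_gt0 ?pi_gt0//.
by rewrite invr_gt0 subr_gt0.
Qed.

(** A sum of two powers rather than a kernel defined piecewise: each power is then treated on the
    whole line by its own Hardy-Littlewood-Sobolev inequality. *)
Definition decay_kernel (t : R) : R := decay_cst * (rkernel q t + rkernel qinf t).

Lemma decay_kernel_ge0 t : 0 <= decay_kernel t.
Proof. by rewrite mulr_ge0 ?(ltW decay_cst_gt0)// addr_ge0 ?rkernel_ge0. Qed.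

Lemma meas_decay_kernel : mfunT decay_kernel.
Proof. by apply: mfunM => //; apply: mfunD; exact: mrkernel. Qed.

(** The exponent $1-2/r$ turns the power $-1/2$ of [vol] into $-\delta$ with
    $\delta=\frac12-\frac1r$. For $|t|\le1$ the minimum is $|t|^D$ and $D\delta=2/q$; for $|t|>1$ it
    is $|t|^{D_\infty}$ and $D_\infty\delta\ge2/q_\infty$. *)
Lemma interp_amp_le t : t != 0 -> interp_cst r * A t `^ (1 - 2 / r) <= decay_kernel t.
Proof.
move=> t0; have v0 := vol_gt0 V0 t; have nt : 0 < `|t| by rewrite normr_gt0.
have i0 : 0 <= interp_cst r by exact: powR_ge0.
have c0 : 0 <= (4 * pi) `^ (- (n%:R / 2)) :> R by exact: powR_ge0.
have -> : A t `^ (1 - 2 / r) = ((4 * pi) `^ (- (n%:R / 2))) `^ (1 - 2 / r) * vol Q B t `^ (- del).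
  rewrite /amp powRM ?invr_ge0 ?sqrtr_ge0//; congr (_ * _).
  rewrite -powR12_sqrt ?(ltW v0)// -powRN -powRrM; congr (_ `^ _).
  by field; rewrite gt_eqF.
have vt : vol Q B t = vol Q B `|t| by case: (ger0P t) => h //; rewrite volN.
pose m := Num.min (`|t| ^+ D) (`|t| `^ Dinf).
have m0 : 0 < m by rewrite lt_min exprn_gt0// powR_gt0.
have Vm : vol Q B t `^ (- del) <= gam `^ (- del) * m `^ (- del).
  have gm0 : 0 < gam * m by exact: mulr_gt0.
  rewrite -powRM ?(ltW gam0) ?(ltW m0)// !powRN lef_pV2 ?posrE ?(powR_gt0 _ v0) ?(powR_gt0 _ gm0)//.
  apply: le_powR; [exact: ltW|by rewrite mulr_ge0 ?ltW|].
  by rewrite vt; exact: volge.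
rewrite /decay_kernel /decay_cst -!mulrA; apply: ler_wpM2l => //; apply: ler_wpM2l; first exact: powR_ge0.
apply: (le_trans Vm); apply: ler_wpM2l; first exact: powR_ge0.
have rk a : rkernel a t = `|t| `^ (- (2 / a)) by [].
have xD : `|t| ^+ D = `|t| `^ D%:R by rewrite powR_mulrn// ltW.
rewrite /m xD; have [t1|t1] := leP `|t| 1.
  have -> : Num.min (`|t| `^ D%:R) (`|t| `^ Dinf) = `|t| `^ D%:R.
    by apply/min_idPl; apply: ger_powR; [rewrite nt|exact: ltW].
  by rewrite -powRrM mulrN -qE -rk lerDl rkernel_ge0.
have -> : Num.min (`|t| `^ D%:R) (`|t| `^ Dinf) = `|t| `^ Dinf.
  by apply/min_idPr; apply: ler_powR; exact: ltW.
rewrite -powRrM mulrN; apply: (@le_trans _ _ (rkernel qinf t)); last by rewrite lerDr rkernel_ge0.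
by rewrite rk; apply: ler_powR; [exact: ltW|rewrite lerN2].
Qed.

Local Notation q' := (q / (q - 1)).
Local Notation qi' := (qinf / (qinf - 1)).

Definition rcap (f : R -> R) : \bar R := ('N[leb]_q'%:E[EFin \o f] + 'N[leb]_qi'%:E[EFin \o f])%E.

Definition hls_sum_cst : R := decay_cst * (hls_cst q `^ q^-1 + hls_cst qinf `^ qinf^-1).

Lemma hls_sum_cst_gt0 : 0 < hls_sum_cst.
Proof. by rewrite mulr_gt0 ?decay_cst_gt0// addr_gt0// powR_gt0// hls_cst_gt0. Qed.

Lemma decay_bilinear (f g : R -> R) (M N : R) :
  mfunT f -> (forall t, 0 <= f t) -> mfunT g -> (forall t, 0 <= g t) ->
  (rcap f <= M%:E)%E -> (rcap g <= N%:E)%E ->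
  (\int[leb]_t \int[leb]_s (f t * decay_kernel (t - s) * g s)%:E <= (hls_sum_cst * M * N)%:E)%E.
Proof.
move=> mf f0 mg g0 fM gN.
have part (h : R -> R) (a b K : R) : (rcap h <= K%:E)%E -> a = q' \/ a = qi' -> ('N[leb]_a%:E[EFin \o h] <= K%:E)%E.
  by move=> hK [->|->]; apply: le_trans hK; [rewrite leeDl|rewrite leeDr]; rewrite // Lnorm_ge0.
have fq := part f q' 0 M fM (or_introl erefl); have fi := part f qi' 0 M fM (or_intror erefl).
have gq := part g q' 0 N gN (or_introl erefl); have gi := part g qi' 0 N gN (or_intror erefl).
have c0 := ltW decay_cst_gt0.
have mr (a : R) (h : R -> R) : mfunT h -> (forall s, 0 <= h s) -> mfunT (riesz a h) by exact: meas_riesz.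
have r0' (a : R) (h : R -> R) (t : R) : (forall s, 0 <= h s) -> (0 <= riesz a h t)%E by exact: riesz_ge0.
have E t : (\int[leb]_s (f t * decay_kernel (t - s) * g s)%:E = decay_cst%:E * ((riesz q g t * (f t)%:E) + (riesz qinf g t * (f t)%:E)))%E.
  have mk a : mfunT (fun s : R => rkernel a (t - s)).
    by apply: mcompT (mrkernel a) _; exact: mfunB.
  have mkg a : mfunT (fun s : R => (rkernel a (t - s) * g s)%:E).
    by apply/mEFinP; apply: mfunM.
  have kg0 a s : (0 <= (rkernel a (t - s) * g s)%:E)%E by rewrite lee_fin mulr_ge0 ?rkernel_ge0.
  have := @ge0_integralZD _ (mtypeR R) R leb (f t * decay_cst) _ _ (mulr_ge0 (f0 t) c0) (mkg q) (mkg qinf) (kg0 q) (kg0 qinf).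
  rewrite -/(riesz q g t) -/(riesz qinf g t) mulrC EFinM -muleA => H.
  rewrite -ge0_muleDl ?r0'// [(_ * (f t)%:E)%E]muleC -H.
  by apply: eq_int => s _; rewrite -EFinD -!EFinM /decay_kernel; congr (_%:E); ring.
under eq_int => t _ do rewrite E.
have m1 a : mfunT (fun t : R => riesz a g t * (f t)%:E)%E.
  by apply: emfunM; [exact: mr|exact/mEFinP].
have p1 a t : (0 <= riesz a g t * (f t)%:E)%E by rewrite mule_ge0 ?r0'// lee_fin.
rewrite (@ge0_integralZD _ (mtypeR R) R leb decay_cst _ _ c0 (m1 q) (m1 qinf) (p1 q) (p1 qinf)).
have -> : hls_sum_cst * M * N = decay_cst * (hls_cst q `^ q^-1 * N * M + hls_cst qinf `^ qinf^-1 * N * M).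
  by rewrite /hls_sum_cst; move: decay_cst (hls_cst q `^ q^-1) (hls_cst qinf `^ qinf^-1) => a b c; ring.
rewrite [leRHS]EFinM EFinD; apply: lee_wpmul2l; first by rewrite lee_fin.
apply: leeD; first exact: (hls_bilinear q2 mg g0 mf f0 gq fq).
exact: (hls_bilinear qinf2 mg g0 mf f0 gi fi).
Qed.

Section Homogeneous.
Variables (r' eps : R).
Hypotheses (rr' : r^-1 + r'^-1 = 1) (eps0 : 0 < eps).

Let e (z : (mtypeR R * vec) * vec) : R[i] := expi (phase Q B z.1.1 z.1.2 z.2).
(** Set to 0 at time 0, where [qmx] is a placeholder, so that the bound required by [mixed_ttstar]
    holds for every [t]. *)
Let A' (t : mtypeR R) : R := if t == 0 then 0 else A t.
(** Half the rate [eps], because its square is the weight inside [ttstar_op]. *)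
Let wh (y : vec) : R := gaussn (eps / 2) y.
Let kk (z : mtypeR R * mtypeR R) : R := decay_kernel (z.1 - z.2).

Let wh2 y : wh y ^+ 2 = gaussn eps y.
by rewrite /wh /gaussn -expRM_natl; congr expR; field. Qed.

(** The right side is free of [eps], so the damping of the data can be removed afterwards by
    Fatou. *)
Lemma homogeneous_estimate (phi : vec -> R[i]) (f : R -> R) (M : R) :
  in_Lp lebn 2%:E phi -> mfunT f -> (forall t, 0 <= f t) ->
  (\int[leb]_t (f t)%:E < +oo)%E -> (rcap f <= M%:E)%E ->
  (\int[leb]_t (Lp_norm lebn r%:E (prop Q B t (fun y => ((gaussn (eps / 2) y)%:C)%C * phi y)%R) * (f t)%:E) <=
    Lp_norm lebn 2%:E phi * (Num.sqrt hls_sum_cst * M)%:E)%E.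
Proof.
move=> [mphi phi2] mf f0 If fM.
have M0 : 0 <= M by rewrite -lee_fin; apply: le_trans fM; rewrite adde_ge0 ?Lnorm_ge0.
have c0 := hls_sum_cst_gt0.
have me : cmeasurable e by apply: cmeas_expi; exact: (meas_phase V0).
have e1 z : cabs (e z) <= 1 by rewrite cabs_expi.
have mA' : mfunT A'.
  apply: mfun_ifT; [exact: measurable_fun_eqr|exact: mcst|exact: (meas_amp V0)].
have A'0 t : 0 <= A' t by rewrite /A'; case: ifP => // _; exact: ltW (amp_gt0 V0 _).
have mw : mfunT wh by exact: meas_gaussn.
have w0 y : 0 <= wh y by exact: gaussn_ge0.
have w2 : (\int[lebn]_y (wh y ^+ 2)%:E < +oo)%E.
  under eq_int => y _ do rewrite wh2.
  by rewrite integral_gaussn// ltry.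
have mkk : mfunT kk.
  apply: mcompT meas_decay_kernel _.
  by apply: mfunB; [exact: mfst|exact: msnd].
have kk0 z : 0 <= kk z by exact: decay_kernel_ge0.
have Tbd (t : mtypeR R) : {ae leb, forall s : mtypeR R, forall h, cintegrable lebn h ->
  (Lp_norm lebn r%:E (ts_op lebn lebn e A' wh t s h) <= (kk (t, s))%:E * Lp_norm lebn r'%:E h)%E}.
  (* The kernel bound is for distinct times; the diagonal is a null set for each [t]. *)
  have : {ae leb, forall s : mtypeR R, s != t}.
    exists [set t]; split; [exact: measurable_set1|exact: lebesgue_measure_set1|].
    by move=> s /=; apply: contra_notP => /eqP.
  apply: filterS => s st h Ih.
  have [A0|A0] := eqVneq (A' t * A' s) 0.
    have -> : ts_op lebn lebn e A' wh t s h = (fun=> 0).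
      apply/funext => x; rewrite /ts_op A0 (_ : (fun x' => _) = (fun=> 0)); last first.
        by apply/funext => x'; rewrite (_ : (0 : R)%:C%C = 0)// !mul0r.
      have := @cintegralZ R _ _ lebn 0 h Ih.
      by under eq_cintegral do rewrite mul0r; rewrite mul0r.
    have -> : Lp_norm lebn r%:E (fun=> 0 : R[i]) = 0%E.
      have := @Lp_normZ _ _ _ lebn r 0 (fun=> 0) r0 (cmeas_cst _ _).
      by under eq_fun do rewrite mul0r; rewrite cabs0 mul0e.
    by rewrite mule_ge0 ?lee_fin// Lp_norm_ge0.
  have t0 : t != 0 by apply: contra_neq A0 => ->; rewrite /A' eqxx mul0r.
  have s0 : s != 0 by apply: contra_neq A0 => ->; rewrite /A' eqxx mulr0.
  have ts : t != s by rewrite eq_sym.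
  have -> : ts_op lebn lebn e A' wh t s h = ttstar_op Q B t s eps h.
    apply/funext => x; apply: eq_cintegral => x'; congr (_ * _ * _).
      by rewrite /A' (negPf t0) (negPf s0).
    by apply: eq_cintegral => y; rewrite wh2.
  apply: (le_trans (ttstar_op_Lr sQ V0 t0 s0 ts eps0 r2 rr' Ih)).
  apply: lee_wpmul2r; first exact: Lp_norm_ge0.
  by rewrite lee_fin; apply: interp_amp_le; rewrite subr_eq0.
have csq : (\int[leb]_t \int[leb]_s (f t * kk (t, s) * f s)%:E <= ((Num.sqrt hls_sum_cst * M) ^+ 2)%:E)%E.
  rewrite exprMn sqr_sqrtr ?(ltW c0)// expr2 mulrA.
  exact: decay_bilinear.
have cc0 : 0 <= Num.sqrt hls_sum_cst * M by rewrite mulr_ge0 ?sqrtr_ge0.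
have := @mixed_ttstar _ _ _ (mtypeR R) vec vec R leb lebn lebn e A' wh kk r r'
  me e1 mA' A'0 mw w0 w2 mkk kk0 r2 rr' Tbd phi mphi phi2 f _ mf f0 If cc0 csq.
apply: le_trans; apply: le_of_eq.
pose g0 (z : mtypeR R * vec) : R[i] := ((gaussn (eps / 2) z.2)%:C)%C * phi z.2.
have mg0 : cmeasurable g0.
  apply: cmeasM; last by apply: cmeas_comp mphi _; exact: msnd.
  by apply: cmeas_real; apply: mcompT mw _; exact: msnd.
have mid : mfunT (id : mtypeR R -> R) by exact: measurable_id.
have mp1 := cmeas_cabs (cmeas_prop_joint mid mg0).
have mp2 := cmeas_cabs (@cmeas_mixed_op _ _ _ (mtypeR R) vec vec R lebn e A' wh me mA' mw phi mphi).
have mE d (T : measurableType d) (h : T -> R) : mfunT h -> mfunT (fun z => (h z)%:E).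
  by move=> mh; apply/mEFinP.
have mL (h : mtypeR R * vec -> R) : mfunT h -> (forall z, 0 <= h z) ->
    mfunT (fun t : mtypeR R => 'N[lebn]_r%:E[(fun x => (h (t, x))%:E)] * (f t)%:E)%E.
  move=> mh h0; apply: emfunM; last exact: (mE _ (mtypeR R)).
  apply: (@mLnorm_slice _ _ (mtypeR R) vec R lebn r (fun z => (h z)%:E)); first exact: mE.
  by move=> z; rewrite lee_fin.
apply: (@ge0_ae_eq_integral _ (mtypeR R) R leb setT) => //.
- exact: (mL _ mp1 (fun z => cabs_ge0 _)).
- exact: (mL _ mp2 (fun z => cabs_ge0 _)).
- by move=> t _; rewrite mule_ge0 ?Lp_norm_ge0// lee_fin.
- by move=> t _; rewrite mule_ge0 ?Lp_norm_ge0// lee_fin.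
exists [set 0]; split; [exact: measurable_set1|exact: lebesgue_measure_set1|].
move=> t /=; apply: contra_notP => /eqP t0 _; congr (Lp_norm _ _ _ * _)%E.
by apply/funext => x; rewrite /prop /mixed_op /A' (negPf t0).
Qed.

End Homogeneous.

End Kernel.

(** * Measurable limits and extension by density *)

Section ComplexLimit.
Context (R : realType).

(** A limit defined for every sequence and measurable in parameters: the upper limit, with infinite
    values sent to a default. *)
Definition rlim (u : nat -> R) : R := fine (limn_esup (EFin \o u)).
Definition clim (u : nat -> R[i]) : R[i] :=
  Complex (rlim (fun k => complex.Re (u k))) (rlim (fun k => complex.Im (u k))).

Lemma rlimE (u : nat -> R) (l : R) : u @ \oo --> l -> rlim u = l.
Proof.
move=> ul; have : (EFin \o u) @ \oo --> l%:E by apply: cvg_EFin => //; exact: nearW.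
by move/cvg_limn_einf_sup => [_]; rewrite /rlim => ->.
Qed.

Lemma cvg_Re_Im (u : nat -> R[i]) (l : R[i]) : (cabs (u k - l) @[k --> \oo] --> (0 : R)) ->
  (fun k => complex.Re (u k)) @ \oo --> complex.Re l /\ (fun k => complex.Im (u k)) @ \oo --> complex.Im l.
Proof.
move=> ul; split; apply/cvgrPdist_lt => e e0.
  move/cvgrPdist_lt : ul => /(_ e e0); apply: filterS => k; rewrite sub0r normrN ger0_norm ?cabs_ge0//.
  by apply: le_lt_trans; rewrite distrC -ReN -ReD; exact: abs_Re.
move/cvgrPdist_lt : ul => /(_ e e0); apply: filterS => k; rewrite sub0r normrN ger0_norm ?cabs_ge0//.
by apply: le_lt_trans; rewrite distrC -ImN -ImD; exact: abs_Im.
Qed.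

Lemma climE (u : nat -> R[i]) (l : R[i]) : (cabs (u k - l) @[k --> \oo] --> (0 : R)) -> clim u = l.
Proof. by move=> /cvg_Re_Im[/rlimE Rl /rlimE Il]; apply: complexE; rewrite /clim /= ?Rl ?Il. Qed.

Lemma cmeas_clim d (T : measurableType d) (u : nat -> T -> R[i]) :
  (forall j, cmeasurable (u j)) -> cmeasurable (fun x => clim (u ^~ x)).
Proof.
move=> mu; split; apply: mcompT => //.
  apply: (@measurable_fun_limn_esup _ T R setT (fun k x => (complex.Re (u k x))%:E)) => k.
  by apply/mEFinP; exact: (mu k).1.
apply: (@measurable_fun_limn_esup _ T R setT (fun k x => (complex.Im (u k x))%:E)) => k.
by apply/mEFinP; exact: (mu k).2.
Qed.

Lemma summable_real_cvg (u : nat -> R) (M : R) :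
  (forall k, \sum_(i < k) `|u i.+1 - u i| <= M) -> exists l : R, u @ \oo --> l.
Proof.
move=> uM; pose w i := u i.+1 - u i.
have cw : cvgn [normed series w].
  apply: nondecreasing_is_cvgn.
    apply/nondecreasing_seqP => k; rewrite /= /series /= big_nat_recr//= lerDl//.
  exists M => _ [k _ <-]; rewrite /= /series /= big_mkord; exact: uM.
have := normed_cvg cw; rewrite (_ : series w = fun k => u k - u 0%N); last first.
  by apply/funext => k; rewrite /series /= telescope_sumr.
move=> /cvg_ex[/= l ul]; exists (l + u 0%N).
apply: cvg_trans (cvgD ul (cvg_cst (u 0%N))); apply: near_eq_cvg; apply: nearW => k /=.
by rewrite subrK.
Qed.

Lemma summable_complex_cvg (u : nat -> R[i]) (M : R) :
  (forall k, \sum_(i < k) cabs (u i.+1 - u i) <= M) ->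
  exists l : R[i], cabs (u k - l) @[k --> \oo] --> (0 : R).
Proof.
move=> uM.
have [a ua] : exists a : R, (fun k => complex.Re (u k)) @ \oo --> a.
  apply: (@summable_real_cvg _ M) => k; apply: le_trans (uM k); apply: ler_sum => i _.
  by rewrite -ReN -ReD abs_Re.
have [b ub] : exists b : R, (fun k => complex.Im (u k)) @ \oo --> b.
  apply: (@summable_real_cvg _ M) => k; apply: le_trans (uM k); apply: ler_sum => i _.
  by rewrite -ImN -ImD abs_Im.
exists (Complex a b).
have h k : cabs (u k - Complex a b) <= `|complex.Re (u k) - a| + `|complex.Im (u k) - b|.
  by apply: (le_trans (cabs_ReIm _)); rewrite ReD ImD ReN ImN.
have c0 : (fun k => `|complex.Re (u k) - a| + `|complex.Im (u k) - b|) @ \oo --> (0 : R).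
  apply/cvgrPdist_lt => e e0; have e2 : 0 < e / 2 by rewrite divr_gt0.
  move/cvgrPdist_lt : ua => /(_ _ e2) Ha; move/cvgrPdist_lt : ub => /(_ _ e2) Hb.
  apply: filterS2 Ha Hb => k ha hb; rewrite sub0r normrN ger0_norm ?addr_ge0// [e]splitr.
  by apply: ltrD; rewrite distrC.
apply: (@squeeze_cvgr _ _ _ _ (fun=> 0) (fun k => `|complex.Re (u k) - a| + `|complex.Im (u k) - b|)) => //.
- by apply: nearW => k; rewrite cabs_ge0 h.
- exact: cvg_cst.
Qed.

Lemma cvg_powR (u : nat -> R) (a p : R) : 0 < p -> 0 <= a -> (forall k, 0 <= u k) ->
  u @ \oo --> a -> (fun k => u k `^ p) @ \oo --> a `^ p.
Proof.
move=> p0; rewrite le_eqVlt => /orP[/eqP <- u0 ua|a0 u0 ua].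
  by rewrite powR0 ?gt_eqF//; exact: cvg_powR_0.
have E x : 0 < x -> x `^ p = expR (p * ln x) by move=> x0; rewrite /powR gt_eqF.
rewrite (E a a0).
have c1 : (fun k => expR (p * ln (u k))) @ \oo --> expR (p * ln a).
  apply: (@continuous_cvg _ _ _ _ _ _ expR); first exact: continuous_expR.
  apply: cvgM; first exact: cvg_cst.
  by apply: continuous_cvg => //; exact: continuous_ln.
apply: cvg_trans c1; apply: near_eq_cvg; near=> k; rewrite E//.
by near: k; exact: (cvgr_gt a).
Unshelve. all: by end_near. Qed.

Lemma sum_half_le k : \sum_(i < k) (2^-1 : R) ^+ i <= 2.
Proof.
suff -> : \sum_(i < k) (2^-1 : R) ^+ i = 2 - 2 * 2^-1 ^+ k.
  by rewrite lerBlDr lerDl mulr_ge0// exprn_ge0.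
by elim: k => [|k IH]; rewrite ?big_ord0 ?big_ord_recr /= ?IH ?expr0 ?exprS; field.
Qed.

End ComplexLimit.

Section LpLimits.
Context d (X : measurableType d) (R : realType) (mu : sfmeasure X R).
Local Notation "'half^' j" := ((2^-1 : R) ^+ j) (at level 5, j at level 4).

Lemma Lp_distC (p : R) (f g : X -> R[i]) : Lp_norm mu p%:E (fun x => f x - g x) = Lp_norm mu p%:E (fun x => g x - f x).
Proof. by congr Lnorm; apply/funext => x; congr (_%:E); exact: cabs_distC. Qed.

Lemma Lp_triangle (p : R) (f g h : X -> R[i]) : 1 <= p -> cmeasurable f -> cmeasurable g -> cmeasurable h ->
  (Lp_norm mu p%:E (fun x => f x - h x)%R <=
   Lp_norm mu p%:E (fun x => f x - g x)%R + Lp_norm mu p%:E (fun x => g x - h x)%R)%E.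
Proof.
move=> p1 mf mg mh; apply: le_trans (Lp_normD mu p1 (cmeasB mf mg) (cmeasB mg mh)).
rewrite le_eqVlt; apply/orP; left; apply/eqP; congr Lnorm; apply/funext => x.
by congr ((cabs _)%:E); rewrite addrA subrK.
Qed.

Lemma Lp_norm_eq0 (p : R) (f : X -> R[i]) : 0 < p -> cmeasurable f -> Lp_norm mu p%:E f = 0%E ->
  {ae mu, forall x, f x = 0}.
Proof.
move=> p0 mf; rewrite /Lp_norm Lnorm_ge0E; last nonneg.
have I0 : (0 <= \int[mu]_x ((cabs (f x))%:E `^ p))%E by apply: int_ge0 => x _; exact: poweR_ge0.
move=> E; have : ((\int[mu]_x ((cabs (f x))%:E `^ p)) `^ p^-1 `^ p)%E = 0%E.
  by rewrite E poweR0r ?gt_eqF.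
rewrite poweRVK ?gt_eqF// => Iz.
have mfp : mfunT (fun x => ((cabs (f x))%:E `^ p)%E).
  meas.
have : (\int[mu]_x `|((cabs (f x))%:E `^ p)%E| = 0)%E.
  by rewrite -[RHS]Iz; apply: eq_int => x _; rewrite gee0_abs ?poweR_ge0.
move=> H; have := (ae_eq_integral_abs mu measurableT mfp).1 H; apply: filterS => x /(_ I) /= h.
by apply: cabs0_eq0; case: h => /eqP; rewrite powR_eq0 => /andP[/eqP].
Qed.

Lemma Lp_fatou (p C : R) (g : nat -> X -> R[i]) (G h : X -> R[i]) (N : nat) : 0 < p -> 0 <= C ->
  (forall k, cmeasurable (g k)) -> cmeasurable G -> cmeasurable h ->
  {ae mu, forall x, cabs (g k x - G x) @[k --> \oo] --> (0 : R)} ->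
  (forall k, (N <= k)%N -> (Lp_norm mu p%:E (fun x => g k x - h x)%R <= C%:E)%E) ->
  (Lp_norm mu p%:E (fun x => G x - h x)%R <= C%:E)%E.
Proof.
move=> p0 C0 mg mG mh gG gC.
have m0 (f : X -> R[i]) : cmeasurable f -> mfunT (fun x => ((cabs (f x))%:E `^ p)%E).
  by move=> mf; apply: mfun_poweR; apply/mEFinP; exact: cmeas_cabs.
apply/Lnorm_le => //; first nonneg.
apply: (@fatou_le _ X R mu (fun k x => (cabs (g (k + N)%N x - h x))%:E `^ p)%E) => //.
- by move=> k; apply: m0; exact: cmeasB.
- nonneg.
- by apply: m0; exact: cmeasB.
- nonneg.
- apply: filterS gG => x gGx; rewrite poweR_EFin.
  have c1 : (fun k => cabs (g (k + N)%N x - h x)) @ \oo --> cabs (G x - h x).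
    apply/cvgrPdist_lt => e e0; move/cvgrPdist_lt : gGx => /(_ e e0)[K _ HK]; exists K => // k /= Kk.
    have := HK (k + N)%N (leq_trans Kk (leq_addr _ _)) => /=.
    rewrite sub0r normrN ger0_norm ?cabs_ge0//; apply: le_lt_trans.
    rewrite ler_norml; apply/andP; split.
      rewrite lerNl opprB lerBlDr; apply: (le_trans _ (cabsD _ _)).
      by rewrite le_eqVlt; apply/orP; left; apply/eqP; congr cabs; rewrite addrA subrK.
    rewrite lerBlDr [cabs (g _ x - G x)]cabs_distC; apply: (le_trans _ (cabsD _ _)).
    rewrite le_eqVlt; apply/orP; left; apply/eqP; congr cabs.
    by rewrite addrA subrK.
  have := @cvg_powR R _ _ p p0 (cabs_ge0 _) (fun k => cabs_ge0 _) c1.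
  move=> c2; under eq_fun do rewrite poweR_EFin.
  by apply: cvg_EFin => //; exact: nearW.
move=> k; apply/Lnorm_le => //; first nonneg.
by apply: gC; exact: leq_addl.
Qed.

End LpLimits.

Section FastConvergence.
Context (R : realType) (n : nat).
Local Notation vec := 'cV[R]_n.
Local Notation lebn := (lebesgue_cV R n).

(** A Gaussian weight turns the $L^p$ bounds on the increments into summable $L^1$ bounds by
    Hoelder. The weighted sum of increments is then integrable, hence finite almost everywhere, and
    the weight vanishes nowhere. *)
Lemma fast_cvg (p p' c : R) (g : nat -> vec -> R[i]) : 1 < p -> p^-1 + p'^-1 = 1 -> 0 <= c ->
  (forall j, cmeasurable (g j)) ->
  (forall j, (Lp_norm lebn p%:E (fun x => g j.+1 x - g j x)%R <= (c * (2^-1) ^+ j)%:E)%E) ->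
  {ae lebn, forall x, cabs (g k x - clim (g ^~ x)) @[k --> \oo] --> (0 : R)}.
Proof.
move=> p1 pp' c0 mg gc.
have [p'1 _ _] := conj_exp_gt1 p1 pp'; have p'0 : 0 < p' by apply: lt_trans p'1.
pose w (x : vec) : R := gaussn 1 x.
have w0 x : 0 < w x by exact: expR_gt0.
have mw : mfunT w by exact: meas_gaussn.
have mwE : mfunT (fun x => (w x)%:E) by exact: mEFin_cV.
have wE0 x : (0 <= (w x)%:E)%E by rewrite lee_fin ltW.
pose W := fine ('N[lebn]_p'%:E[(fun x => (w x)%:E)]).
have Wfin : ('N[lebn]_p'%:E[(fun x => (w x)%:E)] < +oo)%E.
  rewrite Lnorm_ge0E//; apply: poweR_lty.
  have -> : (\int[lebn]_x ((w x)%:E `^ p') = \int[lebn]_x (gaussn p' x)%:E)%E.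
    apply: eq_int => x _; rewrite poweR_EFin /w /gaussn; congr (_%:E).
    by rewrite -expRM_natl || rewrite /powR gt_eqF ?expR_gt0// expRK; congr expR; ring.
  by rewrite integral_gaussn// ltry.
have WE : ('N[lebn]_p'%:E[(fun x => (w x)%:E)] = W%:E)%E by rewrite fineK// ge0_finE// Lnorm_ge0.
have W0 : 0 <= W by rewrite fine_ge0// Lnorm_ge0.
pose D j x := cabs (g j.+1 x - g j x).
have mD j : mfunT (D j) by apply: cmeas_cabs; exact: cmeasB.
have D0 j x : 0 <= D j x by exact: cabs_ge0.
pose a j x := (w x * D j x)%:E.
have ma j : mfunT (a j) by apply: mEFin_cV; exact: mfunM.
have a0 j x : (0 <= a j x)%E by rewrite lee_fin mulr_ge0 ?(ltW (w0 x)).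
have Ia j : (\int[lebn]_x a j x <= (W * c * (2^-1) ^+ j)%:E)%E.
  have mDE : mfunT (fun x => (D j x)%:E) by exact: mEFin_cV.
  have DE0 x : (0 <= (D j x)%:E)%E by rewrite lee_fin.
  have := @ge0_hoelder _ vec R lebn p p' _ _ p1 pp' mDE mwE DE0 wE0.
  rewrite WE => H; apply: (@le_trans _ _ (\int[lebn]_x ((D j x)%:E * (w x)%:E))%E).
    by apply: le_of_eq; apply: eq_int => x _; rewrite -EFinM mulrC.
  apply: (le_trans H); rewrite -mulrA EFinM muleC.
  by apply: lee_wpmul2l; rewrite ?lee_fin//; exact: gc.
have If : (\int[lebn]_x (\sum_(0 <= j <oo) a j x) < +oo)%E.
  rewrite integral_nneseries//.
  apply: (@le_lt_trans _ _ (W * c * 2)%:E); last exact: ltry.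
  apply: lime_le.
    by apply: is_cvg_ereal_nneg_natsum => j _; exact: int_ge0.
  apply: nearW => k; apply: (@le_trans _ _ (\sum_(0 <= j < k) (W * c * (2^-1) ^+ j)%:E)%E).
    by apply: lee_sum => j _; exact: Ia.
  rewrite sumEFin lee_fin -mulr_sumr; apply: ler_wpM2l; first exact: mulr_ge0.
  by rewrite big_mkord; exact: sum_half_le.
have mS : mfunT (fun x => \sum_(0 <= j <oo) a j x)%E.
  by apply: ge0_emeasurable_sum => // *; exact: a0.
have S0 x : (0 <= \sum_(0 <= j <oo) a j x)%E by apply: nneseries_ge0 => *; exact: a0.
have IS : lebn.-integrable setT (fun x => \sum_(0 <= j <oo) a j x)%E.
  by apply/integrableP; split => //; under eq_int do rewrite gee0_abs//.
apply: filterS (integrable_ae measurableT IS) => x /(_ I) Sfin.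
pose S := fine (\sum_(0 <= j <oo) a j x)%E.
have SE : (\sum_(0 <= j <oo) a j x)%E = S%:E by rewrite fineK.
have [l ul] : exists l, cabs (g k x - l) @[k --> \oo] --> (0 : R).
  apply: (@summable_complex_cvg R (g ^~ x) (S / w x)) => k.
  rewrite ler_pdivlMr// mulrC mulr_sumr -lee_fin -SE -sumEFin.
  have H := @nneseries_lim_ge R (a ^~ x) predT 0%N k (fun j _ _ => a0 j x).
  by rewrite big_mkord in H.
by rewrite (climE ul).
Qed.

Section Extension.
Variables (T : (vec -> R[i]) -> vec -> R[i]) (p p1 p1' K : R).
Hypotheses (p_ge1 : 1 <= p) (p1_gt1 : 1 < p1) (pp1 : p1^-1 + p1'^-1 = 1) (K0 : 0 < K).
Hypothesis mT : forall h, cintegrable lebn h -> cmeasurable (T h).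
Hypothesis TB : forall h1 h2, cintegrable lebn h1 -> cintegrable lebn h2 ->
  forall x, T (fun y => h1 y - h2 y) x = T h1 x - T h2 x.
Hypothesis Tb : forall h, cintegrable lebn h ->
  (Lp_norm lebn p1%:E (T h) <= K%:E * Lp_norm lebn p%:E h)%E.

(** With $T=U(t)$ this unfolds to [U_ext]. An abstract operator is used because the same facts serve
    $L^2\to L^2$ for the data and $L^{r'}\to L^r$ for the source. *)
Definition extends (f g : vec -> R[i]) : Prop :=
  [/\ in_Lp lebn p%:E f, in_Lp lebn p1%:E g &
      forall eps : R, 0 < eps -> exists psi : vec -> R[i],
        [/\ schwartz psi, (Lp_norm lebn p%:E (f \- psi)%R < eps%:E)%E &
            (Lp_norm lebn p1%:E (g \- T psi)%R < eps%:E)%E]].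

Let p0 : 0 < p. Proof. by apply: lt_le_trans p_ge1. Qed.
Let p10 : 0 < p1. Proof. by apply: lt_trans p1_gt1. Qed.
Let p1_ge1 : 1 <= p1. Proof. exact: ltW. Qed.
Local Notation Np f := (Lp_norm lebn p%:E f).
Local Notation N1 f := (Lp_norm lebn p1%:E f).

Let IB h1 h2 : cintegrable lebn h1 -> cintegrable lebn h2 -> cintegrable lebn (fun y => h1 y - h2 y).
move=> I1 I2; have := cintgD I1 (cintgZ (-1) I2).
by under [X in cintegrable _ X -> _]eq_fun do rewrite mulN1r.
Qed.

Let Tdist h1 h2 : cintegrable lebn h1 -> cintegrable lebn h2 ->
  (N1 (fun x => T h1 x - T h2 x)%R <= K%:E * Np (fun y => h1 y - h2 y)%R)%E.
move=> I1 I2; rewrite (_ : (fun x => _) = T (fun y => h1 y - h2 y)).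
  by apply: Tb; exact: IB.
by apply/funext => x; rewrite TB.
Qed.

(** Compares a closure value with [T] on any integrable function, Schwartz or not; uniqueness and
    the norm bound follow from it. *)
Lemma extends_dist f g h : extends f g -> cintegrable lebn h ->
  (N1 (fun x => g x - T h x)%R <= K%:E * Np (fun y => f y - h y)%R)%E.
Proof.
move=> [[mf _] [mg _] H] Ih; have [foo|] := eqVneq (Np (fun y => f y - h y)%R) +oo%E.
  by rewrite foo gt0_muley ?leey ?lte_fin.
rewrite -ltey => foo; apply/lee_addgt0Pr => e e0.
have e1 : 0 < e / (1 + K) by rewrite divr_gt0// addr_gt0.
have [psi [Spsi fpsi gpsi]] := H _ e1; have Ipsi := schwartz_cintegrable Spsi.
apply: (le_trans (Lp_triangle lebn p1_ge1 mg (mT Ipsi) (mT Ih))).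
apply: (@le_trans _ _ ((e / (1 + K))%:E + K%:E * (Np (fun y => f y - h y)%R + (e / (1 + K))%:E))%E).
  apply: leeD; first exact: ltW.
  apply: (le_trans (Tdist Ipsi Ih)); apply: lee_wpmul2l; first by rewrite lee_fin ltW.
  apply: (le_trans (Lp_triangle lebn p_ge1 Ipsi.1 mf Ih.1)); rewrite addeC; apply: leeD => //.
  by rewrite Lp_distC; exact: ltW.
have Nfin : Np (fun y => f y - h y)%R \is a fin_num by rewrite ge0_finE// Lp_norm_ge0.
rewrite -(fineK Nfin) -EFinD -!EFinM -!EFinD lee_fin.
rewrite le_eqVlt; apply/orP; left; apply/eqP; move: (fine _) => N.
by field; rewrite gt_eqF// addr_gt0.
Qed.

Let T0 x : T (fun=> 0) x = 0.
have I0 : cintegrable lebn (fun=> 0 : R[i]).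
  split; first exact: cmeas_cst.
  by under eq_int do rewrite cabs0; rewrite integral0 ltry.
by have := TB I0 I0 x; rewrite !subrr.
Qed.

Lemma extends_norm f g : extends f g -> (N1 g <= K%:E * Np f)%E.
Proof.
have I0 : cintegrable lebn (fun=> 0 : R[i]).
  split; first exact: cmeas_cst.
  by under eq_int do rewrite cabs0; rewrite integral0 ltry.
move=> fg; have := extends_dist fg I0.
rewrite (_ : (fun x => g x - _) = g); last by apply/funext => x; rewrite T0 subr0.
by rewrite (_ : (fun x => f x - _) = f)//; apply/funext => x; rewrite subr0.
Qed.

Lemma extends_uniq f g g' : extends f g -> extends f g' -> {ae lebn, forall x, g x = g' x}.
Proof.
move=> fg fg'; have [[mf _] [mg _] H] := fg; have [_ [mg' _] _] := fg'.
have mgg : cmeasurable (fun x => g x - g' x) by exact: cmeasB.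
suff E : N1 (fun x => g x - g' x)%R = 0%E.
  by have := Lp_norm_eq0 p10 mgg E; apply: filterS => x /eqP; rewrite subr_eq0 => /eqP.
apply/eqP; rewrite eq_le Lp_norm_ge0 andbT; apply/lee_addgt0Pr => e e0; rewrite add0e.
have e1 : 0 < e / (1 + K) by rewrite divr_gt0// addr_gt0.
have [psi [Spsi fpsi gpsi]] := H _ e1; have Ipsi := schwartz_cintegrable Spsi.
apply: (le_trans (Lp_triangle lebn p1_ge1 mg (mT Ipsi) mg')).
rewrite (_ : e = e / (1 + K) + K * (e / (1 + K))); last by field; rewrite gt_eqF// addr_gt0.
rewrite EFinD; apply: leeD; first exact: ltW.
rewrite Lp_distC; apply: (le_trans (extends_dist fg' Ipsi)); rewrite EFinM.
by apply: lee_wpmul2l; [rewrite lee_fin ltW|exact: ltW].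
Qed.

(** The extension is obtained as a pointwise limit along integrable approximations converging like
    $2^{-j}$. Being given by a formula, it becomes jointly measurable when the approximations depend
    measurably on time. *)
Lemma extends_lim f (h : nat -> vec -> R[i]) (c : R) : in_Lp lebn p%:E f -> 0 <= c ->
  (forall j, cintegrable lebn (h j)) ->
  (forall j, (Np (fun y => f y - h j y)%R <= (c * (2^-1) ^+ j)%:E)%E) ->
  extends f (fun x => clim (fun j => T (h j) x)) /\
  {ae lebn, forall x, cabs (T (h k) x - clim (fun j => T (h j) x)) @[k --> \oo] --> (0 : R)}.
Proof.
move=> Lf c0 Ih fh; have [mf foo] := Lf.
have mTh j : cmeasurable (T (h j)) by exact: mT.
have hj_dist j k : (j <= k)%N -> (N1 (fun x => T (h k) x - T (h j) x)%R <= (2 * K * c * (2^-1) ^+ j)%:E)%E.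
  move=> jk; apply: (le_trans (Tdist (Ih k) (Ih j))).
  apply: (@le_trans _ _ (K%:E * ((c * (2^-1) ^+ k)%:E + (c * (2^-1) ^+ j)%:E))%E).
    apply: lee_wpmul2l; first by rewrite lee_fin ltW.
    apply: (le_trans (Lp_triangle lebn p_ge1 (Ih k).1 mf (Ih j).1)).
    by apply: leeD => //; rewrite Lp_distC.
  rewrite -EFinD -EFinM lee_fin -mulrDr.
  have -> : 2 * K * c * 2^-1 ^+ j = K * (c * (2^-1 ^+ j + 2^-1 ^+ j)) by ring.
  apply: ler_wpM2l; first exact: ltW.
  apply: ler_wpM2l => //; rewrite lerD2r ler_wiXn2l//.
  by rewrite invf_le1 ?ler1n.
pose G x := clim (fun j => T (h j) x).
have cvG : {ae lebn, forall x, cabs (T (h k) x - G x) @[k --> \oo] --> (0 : R)}.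
  apply: (@fast_cvg p1 p1' (2 * K * c) (fun j => T (h j))) => //.
    by rewrite !mulr_ge0// ltW.
  by move=> j; exact: hj_dist.
have mG : cmeasurable G by apply: (@cmeas_clim R _ vec (fun j => T (h j))).
have Gj j : (N1 (fun x => G x - T (h j) x)%R <= (2 * K * c * (2^-1) ^+ j)%:E)%E.
  apply: (@Lp_fatou _ vec R lebn p1 _ (fun k => T (h k)) G (T (h j)) j) => //.
    by rewrite !mulr_ge0 ?exprn_ge0// ltW.
  by move=> k; exact: hj_dist.
have appr (eps : R) : 0 < eps -> exists psi : vec -> R[i],
    [/\ schwartz psi, (Np (f \- psi)%R < eps%:E)%E & (N1 (G \- T psi)%R < eps%:E)%E].
  move=> eps0; have c3 : 0 < 3 * K * c + K + 1 by rewrite ltr_wpDl// addr_ge0 ?mulr_ge0 ?(ltW K0).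
  (* The total error is at most $(3Kc+K)d$; the extra 1 makes the inequality strict and the
     denominator positive. *)
  pose d := Num.min eps (eps / (3 * K * c + K + 1)).
  have d0 : 0 < d by rewrite lt_min eps0 divr_gt0.
  have [psi [Spsi fpsi]] := schwartz_dense p_ge1 Lf d0.
  have Ipsi := schwartz_cintegrable Spsi.
  have [j jd] : exists j, (2^-1 : R) ^+ j <= d.
    have := @cvg_expr R 2^-1; rewrite ger0_norm// invf_lt1 ?ltr1n// => /(_ isT) /cvgrPdist_le /(_ d d0)[N _ HN].
    by exists N; have := HN N (leqnn N); rewrite sub0r normrN ger0_norm ?exprn_ge0.
  exists psi; split => //.
    by apply: (lt_le_trans fpsi); rewrite lee_fin ge_min lexx.
  apply: (le_lt_trans (Lp_triangle lebn p1_ge1 mG (mTh j) (mT Ipsi))).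
  apply: (@le_lt_trans _ _ ((2 * K * c * d)%:E + K%:E * ((c * d)%:E + d%:E))%E).
    apply: leeD.
      by apply: (le_trans (Gj j)); rewrite lee_fin ler_wpM2l// !mulr_ge0// ltW.
    apply: (le_trans (Tdist (Ih j) Ipsi)); apply: lee_wpmul2l; first by rewrite lee_fin ltW.
    apply: (le_trans (Lp_triangle lebn p_ge1 (Ih j).1 mf Ipsi.1)); apply: leeD; last exact: ltW.
    by rewrite Lp_distC; apply: (le_trans (fh j)); rewrite lee_fin ler_wpM2l.
  rewrite -(EFinD (c * d) d) -(EFinM K) -EFinD lte_fin.
  have -> : 2 * K * c * d + K * (c * d + d) = (3 * K * c + K) * d by ring.
  apply: (@lt_le_trans _ _ ((3 * K * c + K + 1) * d)).
    by rewrite ltr_pM2r// ltrDl.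
  by rewrite mulrC -ler_pdivlMr// /d ge_min lexx orbT.
split => //; split => //; split => //.
have [psi [Spsi fpsi gpsi]] := appr 1 ltr01; have Ipsi := schwartz_cintegrable Spsi.
have -> : N1 G = N1 (fun x => (G x - T psi x) + T psi x)%R by congr Lnorm; apply/funext => x; rewrite subrK.
apply: (le_lt_trans (Lp_normD lebn p1_ge1 (cmeasB mG (mT Ipsi)) (mT Ipsi))).
apply: lte_add_pinfty; first exact: lt_trans gpsi (ltry _).
apply: (le_lt_trans (Tb Ipsi)); apply: lte_mul_pinfty; rewrite ?lee_fin ?(ltW K0)//.
have -> : Np psi = Np (fun x => (psi x - f x) + f x)%R by congr Lnorm; apply/funext => x; rewrite subrK.
apply: (le_lt_trans (Lp_normD lebn p_ge1 (cmeasB Ipsi.1 mf) mf)).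
by apply: lte_add_pinfty => //; rewrite Lp_distC; exact: lt_trans fpsi (ltry _).
Qed.

End Extension.
End FastConvergence.

(** * Solutions by Duhamel's formula *)

Section Group.
Context (R : realType) (n : nat) (Q B : 'M[R]_n).
Hypotheses (sQ : Defs.symmetric Q) (V0 : forall t : R, 0 < t -> 0 < volume Q B t).
Local Notation vec := 'cV[R]_n.
Local Notation lebn := (lebesgue_cV R n).

(** The factor between $U(t)$ and [prop t]: the weight removed by the normalisation and the phase
    $e^{\mp i\pi n/4}$ that depends on the sign of time. *)
Definition coef (t : R) : R[i] := ((expR (- (t * \tr B / 2)))%:C)%C *
  expi (if 0 < t then - (pi * n%:R / 4) else pi * n%:R / 4).

Lemma cabs_coef t : cabs (coef t) = expR (- (t * \tr B / 2)).
Proof. by rewrite cabsM cabs_expi mulr1 cabs_real ger0_norm// expR_ge0. Qed.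

Lemma cmeas_coef : cmeasurable (coef : mtypeR R -> R[i]).
Proof.
apply: cmeasM.
  apply: cmeas_real; apply: mcompT => //; apply: mfunN.
  by apply: mfunM => //; exact: mfunM.
apply: cmeas_expi; apply: mfun_ifT; [|exact: mcst|exact: mcst].
by apply: mfun_ltr; [exact: mcst|exact: measurable_id].
Qed.

Lemma amp_pos t : 0 < t ->
  amp Q B t = (4 * pi) `^ (- (n%:R / 2)) / Num.sqrt (volume Q B t) * expR (t * \tr B / 2).
Proof.
move=> t0; have v0 := V0 t0; rewrite /amp vol_pos// (@sqrtrM _ (volume Q B t)) ?(ltW v0)//.
have -> : expR (- (t * \tr B)) = expR (- (t * \tr B / 2)) ^+ 2.
  by rewrite -expRM_natl; congr expR; field.
rewrite sqrtr_sqr ger0_norm ?expR_ge0// expRN invfM invrK.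
by rewrite mulrA.
Qed.

(** For $t=-\tau<0$ one has $x-e^{\tau B}y=-e^{\tau B}(y-e^{tB}x)$, and the conjugation this causes
    is the one in [qmx] at negative times. The factor $e^{\tau\operatorname{tr}B}$ of the definition
    splits evenly between [coef] and the amplitude. *)
Lemma U_prop t phi x : t != 0 -> U Q B t phi x = coef t * prop Q B t phi x.
Proof.
move=> t0; rewrite /U (negPf t0) /coef; have [tp|tn] := ltP 0 t.
  rewrite gtr0_norm// /prop amp_pos//; set c := _ / Num.sqrt _.
  have -> : cintegral lebn setT (fun y => expi (phase Q B t x y) * phi y) =
      cintegral lebn setT (fun y => expi (4^-1 * dotmul (invmx (gramian Q B t) *m (y - expmx (t *: B) *m x)) (y - expmx (t *: B) *m x)) * phi y).
    by apply: eq_cintegral => y; rewrite /phase /pmx qmx_pos.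
  have -> : ((c * expR (t * \tr B / 2))%:C)%C = (c%:C)%C * ((expR (t * \tr B / 2))%:C)%C :> R[i] by exact: rmorphM.
  have E1 : ((expR (- (t * \tr B / 2)))%:C)%C * ((expR (t * \tr B / 2))%:C)%C = 1 :> R[i].
    by rewrite -[LHS](rmorphM (real_complex R)) /= -expRD addNr expR0.
  have key (e c1 a b I : R[i]) : a * b = 1 -> c1 * e * I = a * e * (c1 * b * I).
    by move=> h; rewrite -[LHS]mul1r -h; ring.
  exact: key E1.
have {t0}tn : t < 0 by rewrite lt_neqAle t0.
rewrite ltr0_norm//; have [tau [tauE tau0]] : exists tau, t = - tau /\ 0 < tau.
  by exists (- t); rewrite opprK oppr_gt0.
rewrite tauE opprK /prop /amp volN// -/(amp Q B tau) amp_pos//; set c := _ / Num.sqrt _.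
have -> : cintegral lebn setT (fun y => expi (phase Q B (- tau) x y) * phi y) =
    cintegral lebn setT (fun y => expi (- (4^-1 * dotmul (invmx (gramian Q B tau) *m (x - expmx (tau *: B) *m y)) (x - expmx (tau *: B) *m y))) * phi y).
  apply: eq_cintegral => y; congr (expi _ * _); rewrite /phase /pmx qmx_neg//; rewrite -[RHS]mulrN; congr (4^-1 * _).
  have uG : gramian Q B tau \in unitmx by rewrite unitmxE unitfE gt_eqF// V0.
  have EE : expmx (- tau *: B) *m expmx (tau *: B) = 1%:M by rewrite -expmxD addNr expmx0.
  have EE' : expmx (tau *: B) *m expmx (- tau *: B) = 1%:M by rewrite -expmxD subrr expmx0.
  move: (expmx (- tau *: B)) (expmx (tau *: B)) (gramian Q B tau) uG EE EE' => E E' G uG EE EE'.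
  have uE : E \in unitmx by case: (mulmx1_unit EE).
  have -> : invmx (- (E *m G *m E^T)) = - (E'^T *m invmx G *m E').
    have H : - (E *m G *m E^T) *m - (E'^T *m invmx G *m E') = 1%:M.
      rewrite mulmxN mulNmx opprK !mulmxA -[E *m G *m E^T *m E'^T]mulmxA -trmx_mul EE' trmx1 mulmx1.
      by rewrite -[E *m G *m _]mulmxA mulmxV// mulmx1.
    have uH : - (E *m G *m E^T) \in unitmx by case: (mulmx1_unit H).
    by rewrite -[LHS]mulmx1 -H mulKmx.
  rewrite mulNmx dotmulNl -!mulmxA; congr (- _).
  have -> : E' *m (y - E *m x) = - (x - E' *m y).
    by rewrite mulmxBr mulmxA EE' mul1mx opprB.
  rewrite dotmul_mul trmxK (_ : E' *m (y - E *m x) = - (x - E' *m y)); last first.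
    by rewrite mulmxBr mulmxA EE' mul1mx opprB.
  by rewrite mulmxN dotmulNl dotmulNr opprK.
have -> : ((c * expR (tau * \tr B))%:C)%C = (c%:C)%C * ((expR (- (- tau * \tr B / 2)))%:C)%C * ((expR (tau * \tr B / 2))%:C)%C :> R[i].
  rewrite -mulrA -(rmorphM (real_complex R)) /= -expRD.
  have -> : - (- tau * \tr B / 2) + tau * \tr B / 2 = tau * \tr B by field.
  exact: (rmorphM (real_complex R)).
have -> : ((c * expR (tau * \tr B / 2))%:C)%C = (c%:C)%C * ((expR (tau * \tr B / 2))%:C)%C :> R[i].
  exact: (rmorphM (real_complex R)).
have key (e c1 a b I : R[i]) : c1 * a * b * e * I = a * e * (c1 * b * I) by ring.
exact: key.
Qed.

Lemma U_0 phi x : U Q B 0 phi x = phi x.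
Proof. by rewrite /U eqxx. Qed.

Lemma cmeas_U t h : cintegrable lebn h -> cmeasurable (U Q B t h).
Proof.
move=> [mh _]; have [->|t0] := eqVneq t 0.
  by rewrite (_ : U Q B 0 h = h)//; apply/funext => x; exact: U_0.
rewrite (_ : U Q B t h = fun x => coef t * prop Q B t h x); last by apply/funext => x; exact: U_prop.
by apply: cmeasM; [exact: cmeas_cst|exact: cmeas_prop].
Qed.

Lemma prop_sub t h1 h2 x : cintegrable lebn h1 -> cintegrable lebn h2 ->
  prop Q B t (fun y => h1 y - h2 y) x = prop Q B t h1 x - prop Q B t h2 x.
Proof.
move=> I1 I2; rewrite /prop -mulrBr; congr (_ * _).
have Ie h : cintegrable lebn h -> cintegrable lebn (fun y => expi (phase Q B t x y) * h y).
  move=> Ih; apply: (@cintg_mulb R _ _ lebn _ h 1 _ _ Ih); last by move=> y; rewrite cabs_expi.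
  have := @cmeas_prop_integrand R n Q B t x (fun=> 1) (cmeas_cst _ _).
  by under eq_fun do rewrite mulr1.
rewrite -(cintegralB (Ie _ I1) (Ie _ I2)); apply: eq_cintegral => y; exact: mulrBr.
Qed.

Lemma U_sub t h1 h2 : cintegrable lebn h1 -> cintegrable lebn h2 ->
  forall x, U Q B t (fun y => h1 y - h2 y) x = U Q B t h1 x - U Q B t h2 x.
Proof.
move=> I1 I2 x; have [->|t0] := eqVneq t 0; first by rewrite !U_0.
by rewrite !U_prop// prop_sub// mulrBr.
Qed.

Lemma Lp_U t (p : R) h : 0 < p -> t != 0 -> cintegrable lebn h ->
  Lp_norm lebn p%:E (U Q B t h) = ((expR (- (t * \tr B / 2)))%:E * Lp_norm lebn p%:E (prop Q B t h))%E.
Proof.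
move=> p0 t0 [mh _]; rewrite (_ : U Q B t h = fun x => coef t * prop Q B t h x); last first.
  by apply/funext => x; exact: U_prop.
by rewrite Lp_normZ ?cabs_coef//; exact: cmeas_prop.
Qed.

Lemma Lp_U_Lr (r r' : R) t h : 2 < r -> r^-1 + r'^-1 = 1 -> t != 0 -> cintegrable lebn h ->
  (Lp_norm lebn r%:E (U Q B t h) <=
   (expR (- (t * \tr B / 2)) * (interp_cst r * amp Q B t `^ (1 - 2 / r)))%:E * Lp_norm lebn r'%:E h)%E.
Proof.
move=> r2 rr' t0 Ih; have r0 : 0 < r by apply: lt_trans r2.
rewrite Lp_U// EFinM -muleA; apply: lee_wpmul2l; first by rewrite lee_fin expR_ge0.
exact: (prop_Lr sQ V0).
Qed.

Lemma Lp_U_L2 t h : cintegrable lebn h ->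
  (Lp_norm lebn 2%:E (U Q B t h) <= (expR (- (t * \tr B / 2)))%:E * Lp_norm lebn 2%:E h)%E.
Proof.
move=> Ih; have [->|t0] := eqVneq t 0.
  rewrite (_ : U Q B 0 h = h); last by apply/funext => x; exact: U_0.
  by rewrite !mul0r oppr0 expR0 mul1e.
rewrite Lp_U//; apply: lee_wpmul2l; first by rewrite lee_fin expR_ge0.
rewrite /Lp_norm !Lnorm_ge0E; last 2 first.
- nonneg.
- nonneg.
apply: lee_poweR; first by rewrite invr_ge0.
  by apply: int_ge0 => x _; exact: poweR_ge0.
have E g : (\int[lebn]_x ((cabs (g x))%:E `^ 2) = \int[lebn]_x (cabs (g x) ^+ 2)%:E)%E.
  by apply: eq_int => x _; rewrite poweR_EFin powR_mulrn ?cabs_ge0.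
by rewrite !E; exact: (prop_L2 sQ V0).
Qed.

End Group.

Lemma meas_sublevel d (T : measurableType d) (R : realType) (b : T -> R) (a : R) :
  mfunT b -> measurable [set z | b z <= a].
Proof.
move=> mb; rewrite (_ : [set z | _] = b @^-1` `]-oo, a]).
  by rewrite -[X in measurable X]setTI; exact: mb.
by apply/seteqP; split => z /=; rewrite in_itv.
Qed.

(** * Truncation of the source, measurable in time *)

Section Truncation.
Context d1 d2 (S : measurableType d1) (X : measurableType d2) (R : realType)
  (mu : sfmeasure X R).
Variables (F : S * X -> R[i]) (p : R) (Om : nat -> set X).
Hypotheses (mF : cmeasurable F) (p1 : 1 <= p).
Hypotheses (TOm : [set: X] = \bigcup_k Om k) (ndOm : {homo Om : n m / (n <= m)%N >-> n `<=` m}).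
Hypothesis Omoo : forall k, measurable (Om k) /\ (mu (Om k) < +oo)%E.
Let p0 : 0 < p. by apply: lt_le_trans p1. Qed.

Let Lev (k : nat) : set (S * X) := [set z | Om k z.2 /\ cabs (F z) <= k%:R].
Let N (G : set (S * X)) (s : S) : \bar R := ('N[mu]_p%:E[(fun x => (cabs (F (s, x)) * \1_G (s, x))%:E)])%E.
(** The times at which cutting at level [k] loses at most a fraction $2^{-j}$ of the norm. *)
Let E (j k : nat) : set S := [set s | (N (~` Lev k) s <= (2^-1 ^+ j)%:E * N setT s)%E].
(** At time [s] the complement is the intersection of all admissible levels, which is the least one
    because the levels increase. The level is thus chosen measurably in time without a selection
    theorem. *)
Let H (j : nat) : set (S * X) := \bigcup_k [set z | E j k z.1 /\ ~ Lev k z].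
Definition slice_trunc (j : nat) : S * X -> R[i] := restr (~` H j) F.

Let mcF := cmeas_cabs mF.

Let mLev k : measurable (Lev k).
apply: measurableI; last exact: (meas_sublevel k%:R mcF).
by rewrite -[X in measurable X]setTI; apply: msnd => //; exact: (Omoo k).1.
Qed.

Let mN G : measurable G -> mfunT (N G).
move=> mG; apply: (@mLnorm_slice _ _ S X R mu p (fun z => (cabs (F z) * \1_G z)%:E)).
  meas.
by move=> z; rewrite lee_fin mulr_ge0 ?cabs_ge0 ?indic_fun_ge0.
Qed.

Let mH j : measurable (H j).
apply: bigcup_measurable => k _; apply: measurableI.
  rewrite -[X in measurable X]setTI; apply: mfst => //.
  rewrite (_ : E j k = [set: S] `&` [set s | (N (~` Lev k) s <= (2^-1 ^+ j)%:E * N setT s)%E]); last by rewrite setTI.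
  apply: emeasurable_fun_le => //; first by apply: mN; exact: measurableC.
  by apply: emfunM => //; exact: mN.
exact: measurableC.
Qed.

Lemma cmeas_slice_trunc j : cmeasurable (slice_trunc j).
Proof. by apply: cmeas_indic => //; exact: measurableC. Qed.

Let NE s : N setT s = Lp_norm mu p%:E (fun x => F (s, x)).
by congr Lnorm; apply/funext => x; rewrite indicT mulr1. Qed.

Let arch (x : R) : exists k, x <= k%:R.
by exists (Num.bound `|x|); apply: (le_trans (ler_norm x)); apply: ltW; rewrite archi_boundP// normr_ge0. Qed.

Let ndLev k m : (k <= m)%N -> Lev k `<=` Lev m.
move=> km z [Oz Fz]; split; first exact: ndOm Oz.
by rewrite (le_trans Fz)// ler_nat.
Qed.

(** Dominated convergence brings the loss below a positive number, so a slice of norm zero is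
    treated apart. *)
Let exE j s : (Lp_norm mu p%:E (fun x => F (s, x)) < +oo)%E -> exists k, E j k s.
move=> foo; have [F0|Fn0] := eqVneq (Lp_norm mu p%:E (fun x => F (s, x))) 0%E.
  exists 0%N; rewrite /E /= NE F0 mule0 -F0 -NE; apply: le_Lnorm => //.
  - apply/mEFinP; apply: mfunM.
      exact: mcompT mcF (mpair1 s).
    apply: mcompT (mpair1 s); apply: mindic.
    by apply: measurableC; exact: mLev.
  - by apply/mEFinP; apply: mfunM; [exact: mcompT mcF (mpair1 s)|exact: mcompT (mindic _) (mpair1 s)].
  - by move=> x; rewrite lee_fin mulr_ge0 ?cabs_ge0 ?indic_fun_ge0.
  move=> x; rewrite lee_fin; apply: ler_wpM2l; first exact: cabs_ge0.
  by rewrite indicT indicE; case: (_ \in _); rewrite ?lexx ?ler01.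
have mFs : cmeasurable (fun x => F (s, x)) by exact: cmeas_comp mF (mpair1 s).
pose fk k x : R[i] := restr [set x | Lev k (s, x)] (fun x => F (s, x)) x.
have mLs k : measurable [set x | Lev k (s, x)].
  have := @measurable_xsection _ _ S X (Lev k) s (mLev k); rewrite /xsection.
  by congr measurable; apply/seteqP; split => x /=; [move/set_mem|move/mem_set].
have mfk k : cmeasurable (fk k) by exact: cmeas_indic.
have diff k x : cabs (fk k x - F (s, x)) = cabs (F (s, x)) * \1_(~` Lev k) (s, x).
  rewrite /fk /restr !indicE in_setC.
  rewrite (_ : (x \in [set x | Lev k (s, x)]) = ((s, x) \in Lev k)); last by apply/idP/idP => /set_mem h; apply/mem_set.
  by case: (_ \in _); rewrite ?mul1r ?subrr ?cabs0 ?mulr0// mul0r sub0r cabsN mulr1.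
have cf x : cabs (fk k x - F (s, x)) @[k --> \oo] --> (0 : R).
  have : [set: X] x by []; rewrite TOm => -[k0 _ Ok0]; have [k1 Fk1] := arch (cabs (F (s, x))).
  apply: cvg_near_cst; exists (maxn k0 k1) => // k /= kk; rewrite diff indicE in_setC mem_set ?mulr0//.
  apply: (@ndLev (maxn k0 k1)) => //; split; first by move: Ok0; exact/ndOm/leq_maxl.
  by rewrite (le_trans Fk1)// ler_nat leq_maxr.
have Fp : (\int[mu]_x (cabs (F (s, x)) `^ p)%:E < +oo)%E by apply/Lp_norm_lty.
have bd k x : cabs (fk k x - F (s, x)) <= cabs (F (s, x)).
  by rewrite diff ler_piMr ?cabs_ge0// indicE; case: (_ \in _).
have := @Lp_dominated_cvg _ X R mu p fk (fun x => F (s, x)) (fun x => cabs (F (s, x))) p0 mfk mFs cf bd (cmeas_cabs mFs) Fp.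
have e0 : 0 < fine (Lp_norm mu p%:E (fun x => F (s, x))) * 2^-1 ^+ j.
  by rewrite mulr_gt0 ?exprn_gt0// fine_gt0// foo lt_neqAle eq_sym Fn0 Lp_norm_ge0.
move=> /(_ _ e0)[K _ HK]; exists K; rewrite /E /= NE; have := HK K (leqnn K).
rewrite EFinM fineK ?ge0_finE ?Lp_norm_ge0// muleC => /ltW; apply: le_trans.
rewrite le_eqVlt; apply/orP; left; apply/eqP; congr Lnorm; apply/funext => x; congr (_%:E).
by rewrite -diff.
Qed.

Lemma slice_truncP j s : (Lp_norm mu p%:E (fun x => F (s, x)) < +oo)%E ->
  cintegrable mu (fun x => slice_trunc j (s, x)) /\
  (Lp_norm mu p%:E (fun x => F (s, x) - slice_trunc j (s, x))%R <=
    (2^-1 ^+ j)%:E * Lp_norm mu p%:E (fun x => F (s, x)))%E.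
Proof.
move=> foo; have [k0 Ek0] := exE j foo.
have exk : exists k, `[< E j k s >] by exists k0; apply/asboolP.
case: (ex_minnP exk) => k /asboolP Ek kmin.
have HE x : H j (s, x) <-> ~ Lev k (s, x).
  split=> [[m _ [/= Em nL]] Lk|nL]; last by exists k.
  by apply: nL; apply: (@ndLev k m) => //; apply: kmin; apply/asboolP.
have trE x : slice_trunc j (s, x) = ((\1_(Lev k) (s, x) : R)%:C)%C * F (s, x).
  rewrite /slice_trunc /restr !indicE in_setC; congr (((_ : bool)%:R)%:C%C * _).
  have [/set_mem /HE nL|nH] := boolP ((s, x) \in H j); first by rewrite memNset.
  by rewrite mem_set//; apply: contrapT => nL; move: nH; rewrite mem_set//; exact/HE.
have mst : cmeasurable (fun x => slice_trunc j (s, x)).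
  exact: cmeas_comp (cmeas_slice_trunc j) (mpair1 s).
split; last first.
  rewrite -NE; apply: le_trans Ek; rewrite le_eqVlt; apply/orP; left; apply/eqP; congr Lnorm.
  apply/funext => x; congr (_%:E); rewrite trE !indicE in_setC.
  by case: (_ \in _); rewrite ?mul1r ?subrr ?mulr0 ?cabs0// mul0r subr0 mulr1.
split => //; have [mO Ok] := Omoo k.
apply: (@le_lt_trans _ _ (\int[mu]_x (k%:R%:E * (\1_(Om k) x : R)%:E))%E).
  apply: le_integralT.
  - nonneg.
  - meas.
  - meas.
  move=> x; rewrite -EFinM lee_fin trE cabsM cabs_real !indicE.
  have [/set_mem [/= Ox Fx]|_] := boolP ((s, x) \in Lev k).
    by rewrite mem_set// normr1 mul1r mulr1.
  by rewrite normr0 mul0r mulr_ge0.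
have i0 x : (0 <= (\1_(Om k) x : R)%:E)%E by rewrite lee_fin indic_fun_ge0.
have mi : mfunT (fun x => (\1_(Om k) x : R)%:E) by meas.
rewrite (@integralZlT _ X R mu _ k%:R i0 mi (ler0n _ _)).
by rewrite integral_indic// setIT lte_mul_pinfty ?lee_fin.
Qed.

End Truncation.

Section AeFubini.
Context d1 d2 (S : measurableType d1) (X : measurableType d2) (R : realType)
  (nu : sfmeasure S R) (mu : sfmeasure X R).

Lemma ge0_integral0_ae d (T : measurableType d) (m : {measure set T -> \bar R}) (f : T -> \bar R) :
  mfunT f -> (forall x, 0 <= f x)%E ->
  (\int[m]_x f x = 0)%E <-> {ae m, forall x, f x = 0%E}.
Proof.
move=> mf f0; have E : (\int[m]_x `|f x| = \int[m]_x f x)%E.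
  by apply: eq_int => x _; rewrite gee0_abs.
split=> [I0|f00].
  have := (ae_eq_integral_abs m measurableT mf).1; rewrite E => /(_ I0).
  by apply: filterS => x /(_ I).
rewrite -E; apply/(ae_eq_integral_abs m measurableT mf).
by apply: filterS f00 => x fx _.
Qed.

Lemma ae_imp2 d (T : measurableType d) (m : {measure set T -> \bar R}) (P P' G : T -> Prop) :
  {ae m, forall x, P x} -> {ae m, forall x, P' x} -> (forall x, P x -> P' x -> G x) ->
  {ae m, forall x, G x}.
Proof. by move=> h h' H; apply: filterS2 h h' => x; exact: H. Qed.

(** Both sides express that the double integral of [f] vanishes. *)
Lemma fubini_ae (f : S * X -> \bar R) : mfunT f -> (forall z, 0 <= f z)%E ->
  {ae nu, forall s, {ae mu, forall x, f (s, x) = 0%E}} ->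
  {ae mu, forall x, {ae nu, forall s, f (s, x) = 0%E}}.
Proof.
move=> mf f0 H.
have ms s : mfunT (fun x => f (s, x)) by exact: meas_slice.
have mx x : mfunT (fun s => f (s, x)) by exact: mcompT mf (mpair2 x).
have I0 : (\int[nu]_s \int[mu]_x f (s, x) = 0)%E.
  apply/ge0_integral0_ae.
  - exact: (@mfubiniF _ _ S X R mu f mf f0).
  - by move=> s; exact: int_ge0.
  by apply: filterS H => s Hs; apply/ge0_integral0_ae.
have := I0; rewrite -[X in X = _](@fubini_tonelli1 _ _ S X R nu mu f mf f0) (@fubini_tonelli2 _ _ S X R nu mu f mf f0).
move/ge0_integral0_ae => /(_ (@mfubiniG _ _ S X R nu f mf f0)) J.
have := J (fun x => @int_ge0 _ S R nu setT _ (fun s _ => f0 (s, x))).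
by apply: filterS => x /ge0_integral0_ae; apply.
Qed.

Lemma cintegral_restr d (T : measurableType d) (m : {measure set T -> \bar R}) (A : set T) (f : T -> R[i]) :
  cintegral m A f = cintegral m setT (restr A f).
Proof.
have h (g : T -> R) : \int[m]_(x in A) g x = \int[m]_x (\1_A x * g x).
  rewrite /Rintegral [in LHS]integral_mkcond; congr fine; apply: eq_int => x _.
  by rewrite patchE indicE; case: (x \in A); rewrite ?mul1r// mul0r.
rewrite /cintegral !h; congr Complex; congr fine; apply: eq_int => x _; rewrite /restr.
  by rewrite ReM /= mul0r subr0.
by rewrite ImM /= mul0r addr0.
Qed.

Lemma meas_limn_einf d (T : measurableType d) (f : nat -> T -> \bar R) :
  (forall k, mfunT (f k)) -> mfunT (fun x => limn_einf (f ^~ x)).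
Proof.
move=> mf; under eq_fun do rewrite -[X in limn_einf X](funext (fun y => oppeK (f y _))).
under eq_fun do rewrite (limn_einfN (fun y => - f y _)%E).
apply: mcompT => //; apply: measurable_fun_limn_esup => k.
exact: mcompT.
Qed.

Lemma limn_einf_ge0 (u : nat -> \bar R) : (forall k, 0 <= u k)%E -> (0 <= limn_einf u)%E.
Proof.
move=> u0; rewrite limn_einf_lim; apply: lime_ge; first exact: is_cvg_einfs.
by apply: nearW => k; apply: le_ereal_inf_tmp => _ [m /= _ <-].
Qed.

(** From [Lp_fatou] along indices at which the norm is within [e] of its lower limit. *)
Lemma Lp_liminf (p : R) (g : nat -> X -> R[i]) (G : X -> R[i]) : 0 < p ->
  (forall k, cmeasurable (g k)) -> cmeasurable G ->
  {ae mu, forall x, cabs (g k x - G x) @[k --> \oo] --> (0 : R)} ->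
  (Lp_norm mu p%:E G <= limn_einf (fun k => Lp_norm mu p%:E (g k)))%E.
Proof.
move=> p0 mg mG gG; set L := limn_einf _.
have infL N : (ereal_inf [set Lp_norm mu p%:E (g k) | k in [set k | (N <= k)%N]] <= L)%E.
  rewrite /L limn_einf_lim (cvg_lim _ (ereal_nondecreasing_cvgn (nondecreasing_einfs _)))//.
  by apply: ereal_sup_ubound; exists N.
have L0 : (0 <= L)%E.
  by apply: le_trans (infL 0%N); apply: le_ereal_inf_tmp => _ [k _ <-]; exact: Lp_norm_ge0.
have [->|] := eqVneq L +oo%E; first by rewrite leey.
rewrite -ltey => Loo; have Lfin : L \is a fin_num by rewrite ge0_finE.
apply/lee_addgt0Pr => e e0; rewrite -(fineK Lfin) -EFinD.
have /choice[h hP] : forall N, exists k, (N <= k)%N /\ (Lp_norm mu p%:E (g k) <= (fine L + e)%:E)%E.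
  move=> N; have : (ereal_inf [set Lp_norm mu p%:E (g k) | k in [set k | (N <= k)%N]] < (fine L + e)%:E)%E.
    by apply: (le_lt_trans (infL N)); rewrite EFinD fineK// lteDl// lte_fin.
  by move=> /ereal_inf_lt[_ [k /= Nk <-] /ltW kL]; exists k.
have C0 : 0 <= fine L + e by rewrite addr_ge0 ?fine_ge0// ltW.
have := @Lp_fatou _ X R mu p (fine L + e) (fun k => g (h k)) G (fun=> 0) 0%N p0 C0 (fun k => mg (h k)) mG (cmeas_cst _ _).
have E (f : X -> R[i]) : (fun x => f x - 0) = f by apply/funext => x; rewrite subr0.
rewrite E => H; apply: H => [|k _]; last by rewrite E; exact: (hP k).2.
apply: filterS gG => x gx; apply/cvgrPdist_lt => d d0.
move/cvgrPdist_lt : gx => /(_ d d0)[K _ HK]; exists K => // k /= Kk.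
by apply: HK; rewrite /= (leq_trans Kk)//; exact: (hP k).1.
Qed.

End AeFubini.

Section Evolution.
Context (R : realType) (n : nat) (Q B : 'M[R]_n).
Hypotheses (sQ : Defs.symmetric Q) (V0 : forall t : R, 0 < t -> 0 < volume Q B t).
Variables (r r' : R) (kA : R -> R).
Hypotheses (r2 : 2 < r) (rr' : r^-1 + r'^-1 = 1).
Hypotheses (mkA : mfunT kA) (kA0 : forall t, 0 <= kA t).
Hypothesis kAle : forall t, t != 0 -> interp_cst r * amp Q B t `^ (1 - 2 / r) <= kA t.
Local Notation vec := 'cV[R]_n.
Local Notation leb := (@lebesgue_measure R).
Local Notation lebn := (lebesgue_cV R n).
Local Notation mR := (mtypeR R).
Local Notation wt t := (expR (- (t * \tr B / 2))).

Let r1 : 1 < r. Proof. by apply: lt_trans r2; rewrite ltr1n. Qed.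
Let r0 : 0 < r. Proof. exact: lt_trans r1. Qed.
Let r'1 : 1 < r'. Proof. by have [] := conj_exp_gt1 r1 rr'. Qed.
Let r'0 : 0 < r'. Proof. exact: lt_trans r'1. Qed.

Let kApos t : t != 0 -> 0 < kA t.
move=> t0; apply: lt_le_trans (kAle t0); rewrite mulr_gt0// ?powR_gt0 ?(amp_gt0 V0)//.
by rewrite mulr_gt0 ?powR_gt0// divr_gt0 ?mulr_gt0 ?subr_gt0.
Qed.

Let Lr_bound t h : t != 0 -> cintegrable lebn h ->
  (Lp_norm lebn r%:E (U Q B t h) <= (wt t * kA t)%:E * Lp_norm lebn r'%:E h)%E.
move=> t0 Ih; apply: (le_trans (Lp_U_Lr sQ V0 r2 rr' t0 Ih)).
apply: lee_wpmul2r; first exact: Lp_norm_ge0.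
by rewrite lee_fin; apply: ler_wpM2l; [exact: expR_ge0|exact: kAle].
Qed.

Let wk0 t : t != 0 -> 0 < wt t * kA t.
by move=> t0; rewrite mulr_gt0 ?expR_gt0// kApos. Qed.

Let h2 : (2 : R)^-1 + 2^-1 = 1. by field. Qed.

Section HomogeneousPart.
Variable phi : vec -> R[i].
Hypothesis Lphi : in_Lp lebn 2%:E phi.
Let damp (e : R) (y : vec) : R[i] := ((gaussn (e / 2) y)%:C)%C * phi y.

Let mdamp e : cmeasurable (damp e).
by apply: cmeasM; [apply: cmeas_real; exact: meas_gaussn|exact: Lphi.1]. Qed.

Let Idamp e : 0 < e -> cintegrable lebn (damp e).
move=> e0; split => //; have [mphi phi2] := Lphi.
have e4 : 0 < e / 2 by rewrite divr_gt0.
have l12 : 1 < 2 :> R by rewrite ltr1n.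
have mg : mfunT (fun y : vec => (gaussn (e / 2) y)%:E) by apply: mEFin_cV; exact: meas_gaussn.
have mp : mfunT (fun y => (cabs (phi y))%:E) by apply: mEFin_cV; exact: cmeas_cabs.
have g0 (y : vec) : (0 <= (gaussn (e / 2) y)%:E)%E by rewrite lee_fin gaussn_ge0.
have p0 y : (0 <= (cabs (phi y))%:E)%E by rewrite lee_fin cabs_ge0.
have := @ge0_hoelder _ vec R lebn 2 2 _ _ l12 h2 mg mp g0 p0 => H.
apply: (@le_lt_trans _ _ ('N[lebn]_2%:E[(fun y => (gaussn (e / 2) y)%:E)] * Lp_norm lebn 2%:E phi)%E).
  apply: le_trans H; apply: le_of_eq; apply: eq_int => y _.
  by rewrite cabsM cabs_real ger0_norm ?gaussn_ge0// EFinM.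
have gfin : ('N[lebn]_2%:E[(fun y : vec => (gaussn (e / 2) y)%:E)] < +oo)%E.
  rewrite Lnorm_ge0E//; apply: poweR_lty.
  have -> : (\int[lebn]_y ((gaussn (e / 2) y)%:E `^ 2) = \int[lebn]_y (gaussn e y)%:E)%E.
    apply: eq_int => y _; rewrite poweR_EFin powR_mulrn ?gaussn_ge0// /gaussn; congr (_%:E).
    by rewrite -expRM_natl; congr expR; field.
  by rewrite integral_gaussn// ltry.
by rewrite lte_mul_pinfty// ?Lnorm_ge0// ge0_finE ?Lnorm_ge0.
Qed.

Let exists_damp : exists eps : nat -> R, (forall j, 0 < eps j) /\
  forall j, (Lp_norm lebn 2%:E (fun y => phi y - damp (eps j) y)%R <= (1 * 2^-1 ^+ j)%:E)%E.
have [mphi phi2] := Lphi.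
(* The factor 2 undoes the halving in [damp], so that the Gaussian rates are $1/(k+1)$. *)
pose e (k : nat) : R := harmonic k * 2.
have e0 k : 0 < e k by rewrite mulr_gt0// invr_gt0.
have diff k y : cabs (damp (e k) y - phi y) = (1 - gaussn (harmonic k) y) * cabs (phi y).
  rewrite /damp /e mulfK//.
  have -> : ((gaussn (harmonic k) y)%:C)%C * phi y - phi y = ((- (1 - gaussn (harmonic k) y))%:C)%C * phi y.
    by case: (phi y) => a b; apply: complexE => /=; ring.
  rewrite cabsM cabs_real normrN ger0_norm// subr_ge0 gaussn_le1//.
  by rewrite invr_ge0.
have cv y : cabs (damp (e k) y - phi y) @[k --> \oo] --> (0 : R).
  under eq_fun do rewrite diff.
  have c1 : gaussn (harmonic k) y @[k --> \oo] --> (1 : R).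
    have c0 : (fun k => - (harmonic k * dotmul y y)) @ \oo --> - (0 * dotmul y y).
      by apply: cvgN; apply: cvgM; [exact: cvg_harmonic|exact: cvg_cst].
    have c2 : (fun k => expR (- (harmonic k * dotmul y y))) @ \oo --> expR (- (0 * dotmul y y)).
      by apply: continuous_cvg => //; exact: continuous_expR.
    by move: c2; rewrite mul0r oppr0 expR0.
  have c4 : (fun k => (1 - gaussn (harmonic k) y) * cabs (phi y)) @ \oo --> (1 - 1) * cabs (phi y).
    by apply: cvgM; [apply: cvgB => //; exact: cvg_cst|exact: cvg_cst].
  by move: c4; rewrite subrr mul0r.
have bd k y : cabs (damp (e k) y - phi y) <= cabs (phi y).
  rewrite diff ler_piMl ?cabs_ge0// gerBl gaussn_ge0//.
have p2 : (\int[lebn]_y (cabs (phi y) `^ 2)%:E < +oo)%E by apply/(Lp_norm_lty lebn phi (ltr0n _ 2)).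
have D := @Lp_dominated_cvg _ vec R lebn 2 (fun k => damp (e k)) phi (fun y => cabs (phi y)) (ltr0n _ 2)
  (fun k => mdamp (e k)) mphi cv bd (cmeas_cabs mphi) p2.
have /choice[eps epsP] : forall j, exists a, 0 < a /\
    (Lp_norm lebn 2%:E (fun y => phi y - damp a y)%R <= (1 * 2^-1 ^+ j)%:E)%E.
  move=> j; have hj : 0 < (2^-1 : R) ^+ j by rewrite exprn_gt0.
  have [K _ HK] := D _ hj; exists (e K); split => //.
  by rewrite mul1r Lp_distC; apply: ltW; exact: (HK K (leqnn K)).
by exists eps; split => j; [exact: (epsP j).1|exact: (epsP j).2].
Qed.

(** [v] is the pointwise limit of the damped evolutions, hence jointly measurable, and [extends_lim]
    identifies each slice as the closure value. The estimate for damped data survives by two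
    lower-limit arguments, in space and then in time. The predicate [adm] leaves the class of test
    functions open. *)
Lemma homogeneous_solution (ch : R) (adm : (R -> R) -> R -> Prop) :
  (forall f M, adm f M -> mfunT f /\ (forall t, 0 <= f t)) ->
  (forall eps f M, 0 < eps -> adm f M ->
    (\int[leb]_t (Lp_norm lebn r%:E (prop Q B t (fun y => ((gaussn (eps / 2) y)%:C)%C * phi y)%R) * (f t)%:E) <=
     Lp_norm lebn 2%:E phi * (ch * M)%:E)%E) ->
  exists v : R -> vec -> R[i],
    [/\ cmeasurable (fun z : mR * vec => v z.1 z.2),
        forall t, t != 0 -> U_ext Q B 2%:E 2%:E t phi (v t) &
        forall f M, adm f M ->
          (\int[leb]_t ((expR (\tr B / 2 * t))%:E * Lp_norm lebn r%:E (v t) * (f t)%:E) <=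
           Lp_norm lebn 2%:E phi * (ch * M)%:E)%E].
Proof.
move=> admP hom; have [eps [eps0 epsP]] := exists_damp.
pose u (j : nat) (z : mR * vec) : R[i] := coef B z.1 * prop Q B z.1 (damp (eps j)) z.2.
have mid : mfunT (id : mR -> R) by exact: measurable_id.
have mu j : cmeasurable (u j).
  apply: cmeasM; first by apply: cmeas_comp (cmeas_coef B) _; exact: mfst.
  apply: (@cmeas_prop_joint R n Q B V0 _ mR id (fun z => damp (eps j) z.2) mid).
  by apply: (cmeas_comp (mdamp (eps j))); exact: msnd.
pose v (t : R) (x : vec) : R[i] := clim (fun j => u j (t, x)).
have mv : cmeasurable (fun z : mR * vec => v z.1 z.2).
  have := @cmeas_clim R _ (mR * vec)%type u mu.
  by rewrite (_ : (fun z => clim _) = (fun z : mR * vec => v z.1 z.2))//; apply/funext => -[].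
have ext t : t != 0 -> extends (U Q B t) 2 2 phi (v t) /\
    {ae lebn, forall x, cabs (u k (t, x) - v t x) @[k --> \oo] --> (0 : R)}.
  move=> t0; have l12 : 1 < 2 :> R by rewrite ltr1n.
  have := @extends_lim R n (U Q B t) 2 2 2 (wt t) (ltW l12) l12 h2 (expR_gt0 _)
    (@cmeas_U R n Q B V0 t) (@U_sub R n Q B V0 t) (@Lp_U_L2 R n Q B sQ V0 t)
    phi (fun j => damp (eps j)) 1 Lphi ler01 (fun j => Idamp (eps0 j)) epsP.
  have -> : (fun x => clim (fun j => U Q B t (damp (eps j)) x)) = v t.
    by apply/funext => x; congr clim; apply/funext => j; exact: U_prop.
  move=> [H1 H2]; split; [exact: H1|apply: filterS H2 => x].
  have -> : clim (fun j => U Q B t (damp (eps j)) x) = v t x.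
    by congr clim; apply/funext => j; exact: U_prop.
  by under eq_fun do rewrite U_prop//.
exists v; split; [exact: mv|move=> t t0; exact: (ext t t0).1|move=> f M af].
move: af => af; have [mf f0] := admP _ _ af.
(* Multiplied by the modulus of [coef] it gives back [f]. *)
pose cc t : R := f t * expR (\tr B / 2 * t).
have cc0 t : 0 <= cc t by rewrite mulr_ge0 ?expR_ge0.
pose Nj j (t : mR) : \bar R := (Lp_norm lebn r%:E (prop Q B t (damp (eps j))) * (f t)%:E)%E.
have mNv (h : mR * vec -> R[i]) : cmeasurable h -> mfunT (fun t : mR => Lp_norm lebn r%:E (fun x => h (t, x))).
  move=> mh; apply: (@mLnorm_slice _ _ mR vec R lebn r (fun z => (cabs (h z))%:E)).
    meas.
  nonneg.
have mfE : mfunT (fun t : mR => (f t)%:E) by meas.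
have mp j : cmeasurable (fun z : mR * vec => prop Q B z.1 (damp (eps j)) z.2).
  apply: (@cmeas_prop_joint R n Q B V0 _ mR id (fun z => damp (eps j) z.2) mid).
  by apply: (cmeas_comp (mdamp (eps j))); exact: msnd.
have mNj j : mfunT (Nj j).
  by apply: emfunM => //; exact: (mNv _ (mp j)).
have Nj0 j t : (0 <= Nj j t)%E by rewrite mule_ge0 ?Lp_norm_ge0// lee_fin.
have mexp : mfunT (fun t : mR => (expR (\tr B / 2 * t))%:E).
  by apply/mEFinP; apply: mcompT => //; exact: mfunM.
have mlhs : mfunT (fun t : mR => ((expR (\tr B / 2 * t))%:E * Lp_norm lebn r%:E (v t) * (f t)%:E)%E).
  by apply: emfunM => //; apply: emfunM => //; exact: (mNv _ mv).
have pw t : t != 0 -> ((expR (\tr B / 2 * t))%:E * Lp_norm lebn r%:E (v t) * (f t)%:E <= limn_einf (Nj ^~ t))%E.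
  move=> t0; have [_ cvt] := ext t t0.
  have mut j : cmeasurable (fun x => u j (t, x)) by exact: cmeas_comp (mu j) (mpair1 (t : mR)).
  have mvt : cmeasurable (v t) by exact: (cmeas_comp mv (mpair1 (t : mR))).
  have mpt j : cmeasurable (prop Q B t (damp (eps j))) by exact: cmeas_prop.
  have cE : cabs ((cc t)%:C)%C = cc t by rewrite cabs_real ger0_norm.
  have := @Lp_liminf _ vec R lebn r (fun j x => ((cc t)%:C)%C * u j (t, x)) (fun x => ((cc t)%:C)%C * v t x) r0.
  rewrite (@Lp_normZ _ vec R lebn r _ (v t) r0 mvt) cE.
  have -> : ((expR (\tr B / 2 * t))%:E * Lp_norm lebn r%:E (v t) * (f t)%:E = (cc t)%:E * Lp_norm lebn r%:E (v t))%E.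
    by rewrite muleC muleA -EFinM.
  have -> : (fun j => Lp_norm lebn r%:E (fun x => ((cc t)%:C)%C * u j (t, x))%R) = Nj ^~ t.
    apply/funext => j; rewrite (@Lp_normZ _ vec R lebn r _ (fun x => u j (t, x)) r0 (mut j)) cE.
    have -> : (fun x => u j (t, x)) = (fun x => coef B t * prop Q B t (damp (eps j)) x) by [].
    rewrite (@Lp_normZ _ vec R lebn r _ (prop Q B t (damp (eps j))) r0 (mpt j)) cabs_coef.
    rewrite /Nj /cc muleA -EFinM muleC; congr (_ * (_)%:E)%E.
    rewrite -[f t * _ * _]mulrA -expRD (_ : \tr B / 2 * t + - (t * \tr B / 2) = 0) ?expR0 ?mulr1//.
    by field.
  move=> H; apply: H.
  - by move=> j; apply: cmeasM => //; exact: cmeas_cst.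
  - by apply: cmeasM => //; exact: cmeas_cst.
  apply: filterS cvt => x ux.
  have E j : cabs (((cc t)%:C)%C * u j (t, x) - ((cc t)%:C)%C * v t x) = cc t * cabs (u j (t, x) - v t x).
    by rewrite -mulrBr cabsM cE.
  under eq_fun do rewrite E.
  have c5 : (fun j => cc t * cabs (u j (t, x) - v t x)) @ \oo --> cc t * 0 by apply: cvgM => //; exact: cvg_cst.
  by move: c5; rewrite mulr0.
apply: (@le_trans _ _ (\int[leb]_t limn_einf (Nj ^~ t))%E).
  apply: (@ae_ge0_le_integral _ mR R leb setT) => //.
  - by move=> t _; rewrite !mule_ge0 ?Lp_norm_ge0// lee_fin ?expR_ge0.
  - by move=> t _; apply: limn_einf_ge0.
  - exact: (@meas_limn_einf R _ mR Nj mNj).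
  exists [set 0]; split; [exact: measurable_set1|exact: lebesgue_measure_set1|].
  by move=> t /=; apply: contra_notP => /eqP t0 _; exact: pw.
apply: (le_trans (@fatou _ mR R leb setT measurableT Nj mNj (fun j t _ => Nj0 j t))).
by apply: limn_einf_le => j; exact: hom.
Qed.

End HomogeneousPart.
Section InhomogeneousPart.
Variable F : R -> vec -> R[i].
Hypothesis mF : cmeasurable (fun z : mR * vec => F z.1 z.2).
Local Notation NF s := (Lp_norm lebn r'%:E (F s)).
Hypothesis Foo : {ae leb, forall s, (NF s < +oo)%E}.

Let exOm : exists Om : nat -> set vec, [/\ [set: vec] = \bigcup_k Om k,
  {homo Om : n m / (n <= m)%N >-> n `<=` m} & forall k, measurable (Om k) /\ (lebn (Om k) < +oo)%E].
have /sigma_finiteP[G [TG ndG Goo]] := sigma_finiteT lebn.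
by exists G; split => // k m km; exact/subsetPset/ndG.
Qed.
Let Om := projT1 (cid exOm).
Let OmP := projT2 (cid exOm).
Let TOm : [set: vec] = \bigcup_k Om k. Proof. by case: OmP. Qed.
Let ndOm : {homo Om : n m / (n <= m)%N >-> n `<=` m}. Proof. by case: OmP. Qed.
Let Omoo k : measurable (Om k) /\ (lebn (Om k) < +oo)%E. by case: OmP. Qed.

Let ST (j : nat) : mR * vec -> R[i] := slice_trunc lebn (fun z : mR * vec => F z.1 z.2) r' Om j.

Let mST j : cmeasurable (ST j).
exact: (@cmeas_slice_trunc _ _ mR vec R lebn _ r' Om mF Omoo j). Qed.

Let STP j (s : mR) : (NF s < +oo)%E -> cintegrable lebn (fun x => ST j (s, x)) /\
  (Lp_norm lebn r'%:E (fun x => F s x - ST j (s, x))%R <= (2^-1 ^+ j)%:E * NF s)%E.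
exact: (@slice_truncP _ _ mR vec R lebn _ r' Om mF (ltW r'1) TOm ndOm Omoo j s). Qed.

Let gj (j : nat) (z : (mR * mR) * vec) : R[i] :=
  coef B (z.1.1 - z.1.2) * prop Q B (z.1.1 - z.1.2) (fun y => ST j (z.1.2, y)) z.2.

(** The variables are ((t, s), x): outer time, integration time, space. The limit runs over the
    slice truncations of [F], on which [prop] is an absolutely convergent integral. *)
Definition duhamel_integrand (z : (mR * mR) * vec) : R[i] := clim (gj ^~ z).
Local Notation Gd t s x := (duhamel_integrand ((t, s), x)).

Let msub : mfunT (fun z : mR * mR => (z.1 - z.2 : R)).
by apply: mfunB; [exact: mfst|exact: msnd]. Qed.

Lemma cmeas_duhamel_integrand : cmeasurable duhamel_integrand.
Proof.
apply: cmeas_clim => j; apply: cmeasM.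
  apply: (cmeas_comp (cmeas_coef B) (h := fun z : (mR * mR) * vec => (z.1.1 - z.1.2 : mR))).
  exact: (mcompT msub mfst).
apply: (@cmeas_prop_joint R n Q B V0 _ (mR * mR)%type (fun z => z.1 - z.2) (fun q : (mR * mR) * vec => ST j (q.1.2, q.2)) msub).
apply: (cmeas_comp (mST j) (h := fun q : (mR * mR) * vec => (q.1.2, q.2))).
apply/mfun_pair; last exact: msnd.
by apply: mcompT; [exact: msnd|exact: mfst].
Qed.
Let mG := cmeas_duhamel_integrand.

Let mGt (t : mR) : cmeasurable (fun z : mR * vec => Gd t z.1 z.2).
apply: (cmeas_comp mG (h := fun z : mR * vec => ((t, z.1), z.2))).
by apply/mfun_pair => //; apply/mfun_pair.
Qed.

(** The truncations converge like $2^{-j}$ relative to the norm of the slice, so [extends_lim]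
    applies with that norm as its constant [c]. *)
Lemma duhamel_integrand_ext (t s : R) : t != s -> (NF s < +oo)%E ->
  U_ext Q B r'%:E r%:E (t - s) (F s) (fun x => Gd t s x).
Proof.
move=> ts Fs; have ts0 : t - s != 0 by rewrite subr_eq0.
have mFs : cmeasurable (F s) by exact: (cmeas_comp mF (mpair1 (s : mR))).
have c0 : 0 <= fine (NF s) by rewrite fine_ge0// Lp_norm_ge0.
have Ih j : cintegrable lebn (fun y => ST j ((s : mR), y)) by exact: (STP j Fs).1.
have hF j : (Lp_norm lebn r'%:E (fun y => F s y - ST j ((s : mR), y))%R <= (fine (NF s) * 2^-1 ^+ j)%:E)%E.
  apply: (le_trans (STP j Fs).2); rewrite mulrC EFinM fineK// ge0_finE// Lp_norm_ge0//.
have [H _] := @extends_lim R n (U Q B (t - s)) r' r r' (wt (t - s) * kA (t - s)) (ltW r'1) r1 rr' (wk0 ts0)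
  (@cmeas_U R n Q B V0 (t - s)) (@U_sub R n Q B V0 (t - s)) (fun h => @Lr_bound (t - s) h ts0)
  (F s) (fun j y => ST j ((s : mR), y)) _ (conj mFs Fs) c0 Ih hF.
move: H; rewrite (_ : (fun x => clim _) = (fun x => Gd t s x))//.
by apply/funext => x; congr clim; apply/funext => j; exact: U_prop.
Qed.

Let ext_norm (t s : R) g : t != s -> U_ext Q B r'%:E r%:E (t - s) (F s) g ->
  (Lp_norm lebn r%:E g <= (wt (t - s) * kA (t - s))%:E * NF s)%E.
move=> ts; have ts0 : t - s != 0 by rewrite subr_eq0.
exact: (@extends_norm R n (U Q B (t - s)) r' r (wt (t - s) * kA (t - s)) (ltW r'1) r1 (wk0 ts0)
  (@cmeas_U R n Q B V0 (t - s)) (@U_sub R n Q B V0 (t - s)) (fun h => @Lr_bound (t - s) h ts0)).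
Qed.

Let ext_uniq (t s : R) g g' : t != s -> U_ext Q B r'%:E r%:E (t - s) (F s) g ->
  U_ext Q B r'%:E r%:E (t - s) (F s) g' -> {ae lebn, forall x, g x = g' x}.
move=> ts; have ts0 : t - s != 0 by rewrite subr_eq0.
exact: (@extends_uniq R n (U Q B (t - s)) r' r (wt (t - s) * kA (t - s)) (ltW r'1) r1 (wk0 ts0)
  (@cmeas_U R n Q B V0 (t - s)) (@U_sub R n Q B V0 (t - s)) (fun h => @Lr_bound (t - s) h ts0)).
Qed.

Let Ival (t : R) : set R := `[Num.min 0 t, Num.max 0 t]%classic.

Definition duhamel_fun (t : R) (x : vec) : R[i] :=
  ((Num.sg t)%:C)%C * cintegral leb (Ival t) (fun s => Gd t s x).

Definition time_conv (t : R) : \bar R :=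
  (\int[leb]_s ((kA (t - s))%:E * ((expR (\tr B / 2 * s))%:E * NF s)))%E.

Let ae_neq (t : R) : {ae leb, forall s : R, t != s}.
exists [set t]; split; [exact: measurable_set1|exact: lebesgue_measure_set1|].
by move=> s /= /negP; rewrite negbK => /eqP ->.
Qed.

Let mNF : mfunT (fun s : mR => NF s).
apply: (@mLnorm_slice _ _ mR vec R lebn r' (fun z => (cabs (F z.1 z.2))%:E)).
  meas.
nonneg.
Qed.

Let mNG (t : mR) : mfunT (fun s : mR => Lp_norm lebn r%:E (fun x => Gd t s x)).
apply: (@mLnorm_slice _ _ mR vec R lebn r (fun z => (cabs (Gd t z.1 z.2))%:E)).
  by apply/mEFinP; exact: (cmeas_cabs (mGt t)).
nonneg.
Qed.

(** Since $e^{-(t-s)\operatorname{tr}B/2}=e^{-t\operatorname{tr}B/2}e^{s\operatorname{tr}B/2}$, one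
    part of the weight comes out and the other joins [F]. The instant $s=t$ is a null set. *)
Let integral_NG (t : R) : (\int[leb]_s Lp_norm lebn r%:E (fun x => Gd t s x) <= (wt t)%:E * time_conv t)%E.
have mk : mfunT (fun s : mR => (kA (t - s))%:E).
  by apply/mEFinP; apply: mcompT mkA _; exact: mfunB.
have me : mfunT (fun s : mR => (expR (\tr B / 2 * s))%:E).
  by apply/mEFinP; apply: mcompT => //; exact: mfunM.
have m1 : mfunT (fun s : mR => (kA (t - s))%:E * ((expR (\tr B / 2 * s))%:E * NF s))%E.
  by apply: emfunM => //; exact: emfunM.
have p1 s : (0 <= (kA (t - s))%:E * ((expR (\tr B / 2 * s))%:E * NF s))%E.
  by rewrite !mule_ge0 ?Lp_norm_ge0 ?lee_fin ?expR_ge0.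
rewrite /time_conv -(@integralZlT _ mR R leb _ (wt t) p1 m1 (expR_ge0 _)).
apply: (@ae_ge0_le_integral _ mR R leb setT) => //.
- by move=> s _; exact: Lp_norm_ge0.
- by move=> s _; rewrite mule_ge0 ?lee_fin ?expR_ge0.
- meas.
apply: (@ae_imp2 R _ mR leb _ _ _ Foo (ae_neq t)) => s Fs ts _.
apply: (le_trans (ext_norm ts (duhamel_integrand_ext ts Fs))).
rewrite muleA -EFinM muleA -EFinM le_eqVlt; apply/orP; left; apply/eqP; congr ((_)%:E * _)%E.
rewrite [RHS]mulrAC -expRD; congr (expR _ * _).
by field.
Qed.

Let mIval t : measurable (Ival t). Proof. exact: measurable_itv. Qed.

Lemma cmeas_duhamel_fun : cmeasurable (fun z : mR * vec => duhamel_fun z.1 z.2).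
apply: cmeasM.
  apply: cmeas_real; apply: mcompT mfst.
  rewrite (_ : (Num.sg : mR -> R) = (fun t => \1_([set u : R | 0 < u]) t - \1_([set u : R | u < 0]) t)).
    have mp : measurable [set u : R | 0 < u].
      rewrite (_ : [set u | _] = `]0, +oo[%classic); first exact: measurable_itv.
      by apply/seteqP; split => u /=; rewrite in_itv /= andbT.
    have mn : measurable [set u : R | u < 0].
      rewrite (_ : [set u | _] = `]-oo, 0[%classic); first exact: measurable_itv.
      by apply/seteqP; split => u /=; rewrite in_itv.
    by apply: mfunB; exact: mindic.
  apply/funext => t; rewrite !indicE; have [t0|t0|->] := ltgtP t 0.
  - by rewrite ltr0_sg// memNset ?mem_set//= ?sub0r// => h; have := lt_trans t0 h; rewrite ltxx.
  - by rewrite gtr0_sg// mem_set// memNset ?subr0// => h; have := lt_trans t0 h; rewrite ltxx.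
  - by rewrite sgr0 !memNset ?subr0//= ltxx.
under eq_fun do rewrite cintegral_restr.
pose D : set ((mR * vec) * mR) := [set z | Num.min 0 z.1.1 <= z.2 /\ z.2 <= Num.max 0 z.1.1].
have m11 : mfunT (fun z : (mR * vec) * mR => z.1.1 : R).
  by apply: mcompT; [exact: mfst|exact: mfst].
have m2 : mfunT (fun z : (mR * vec) * mR => z.2 : R) by meas.
have mD : measurable D.
  have h (a b : (mR * vec) * mR -> R) : mfunT a -> mfunT b -> measurable [set z | a z <= b z].
    move=> ma mb; rewrite (_ : [set z | _] = [set z | a z - b z <= 0]).
      by apply: meas_sublevel; exact: mfunB.
    by apply/seteqP; split => z /=; rewrite subr_le0.
  apply: measurableI; apply: h => //.
    by apply: measurable_minr => //; exact: mcst.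
  by apply: measurable_maxr => //; exact: mcst.
have mK : cmeasurable (fun z : (mR * vec) * mR => ((\1_D z : R)%:C)%C * Gd z.1.1 z.2 z.1.2).
  apply: (cmeas_indic mD).
  apply: (cmeas_comp mG (h := fun z : (mR * vec) * mR => ((z.1.1, z.2), z.1.2))).
  apply/mfun_pair; first by apply/mfun_pair.
  by apply: mcompT; [exact: msnd|exact: mfst].
have := @cmeas_int _ _ (mR * vec)%type mR R leb _ mK.
rewrite (_ : (fun x => cintegral _ _ _) = (fun z : mR * vec => cintegral leb setT (restr (Ival z.1) (fun s => Gd z.1 s z.2))))//.
apply/funext => z; apply: eq_cintegral => s; rewrite /restr !indicE; congr (((_ : bool)%:R)%:C%C * _).
by apply/idP/idP => /set_mem h; apply/mem_set; move: h; rewrite /Ival /D /= in_itv /= => /andP.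
Qed.

(** Minkowski's integral inequality, after enlarging the time interval to the whole line. *)
Lemma Lp_duhamel_fun t : (Lp_norm lebn r%:E (duhamel_fun t) <= (wt t)%:E * time_conv t)%E.
Proof.
apply: le_trans (integral_NG t).
have mcG : mfunT (fun z : mR * vec => (cabs (Gd t z.1 z.2))%:E).
  by apply/mEFinP; exact: (cmeas_cabs (mGt t)).
have cG0 (z : mR * vec) : (0 <= (cabs (Gd t z.1 z.2))%:E)%E by rewrite lee_fin cabs_ge0.
apply: le_trans (@minkowski_integral _ _ mR vec R leb lebn r _ r1 mcG cG0).
apply: le_Lnorm => //.
- apply/mEFinP; apply: cmeas_cabs.
  exact: (cmeas_comp cmeas_duhamel_fun (mpair1 (t : mR))).
- exact: (@mfubiniG _ _ mR vec R leb _ mcG cG0).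
- nonneg.
move=> x; rewrite /duhamel_fun cabsM cabs_real normr_sg cintegral_restr.
have mGx : cmeasurable (fun s : mR => Gd t s x) by exact: (cmeas_comp (mGt t) (mpair2 x)).
have mrG : cmeasurable (restr (Ival t) (fun s : mR => Gd t s x)) by apply: cmeas_indic => //; exact: mIval.
apply: (@le_trans _ _ (\int[leb]_s (cabs (restr (Ival t) (fun s : mR => Gd t s x) s))%:E)%E).
  apply: (@le_trans _ _ (cabs (cintegral leb setT (restr (Ival t) (fun s : mR => Gd t s x))))%:E); last exact: (cabs_cint_le leb mrG).
  by rewrite lee_fin ler_piMl ?cabs_ge0//; case: (t != 0).
apply: (@le_integralT _ mR R leb).
- nonneg.
- by apply/mEFinP; exact: (cmeas_cabs mrG).
- by apply/mEFinP; exact: (cmeas_cabs mGx).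
by move=> s; rewrite lee_fin cabs_restr ler_piMl ?cabs_ge0// indicE; case: (_ \in _).
Qed.

Lemma duhamel_duhamel_fun t : hoelder_conjugate r%:E = r'%:E -> (time_conv t < +oo)%E ->
  duhamel Q B r F t (duhamel_fun t).
Proof.
move=> hr too; have wtoo : ((wt t)%:E * time_conv t < +oo)%E.
  by rewrite lte_mul_pinfty ?lee_fin ?expR_ge0.
rewrite /duhamel hr; split.
  split; first exact: (cmeas_comp cmeas_duhamel_fun (mpair1 (t : mR))).
  exact: le_lt_trans (Lp_duhamel_fun t) wtoo.
exists (fun s x => Gd t s x); split; first exact: mGt.
- apply: (@ae_imp2 R _ mR leb _ _ _ Foo (ae_neq t)) => s Fs ts _.
  exact: duhamel_integrand_ext.
- apply: le_lt_trans (le_lt_trans (integral_NG t) wtoo).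
  rewrite integral_mkcond; apply: (@le_integralT _ mR R leb).
  + by move=> s; rewrite patchE; case: ifP => // _; exact: Lp_norm_ge0.
  + apply: (measurable_restrict _ (mIval t) measurableT).1; rewrite setTI.
    by apply: mfunTS; exact: mNG.
  + exact: mNG.
  by move=> s; rewrite patchE; case: ifP => // _; exact: Lp_norm_ge0.
- by apply/aeW => x.
Qed.

(** Closure values are unique for almost every [s], up to a null set of [x] that depends on [s].
    [fubini_ae] exchanges the two null sets, after which the time integrals agree for almost every
    [x]. *)
Lemma duhamel_unique t w : hoelder_conjugate r%:E = r'%:E -> duhamel Q B r F t w ->
  {ae lebn, forall x, w x = duhamel_fun t x}.
Proof.
move=> hr; rewrite /duhamel hr => -[_ [G' [mG' extG' _ wG']]].
pose d (z : mR * vec) : \bar R := (\1_(Ival t) z.1 * cabs (G' z.1 z.2 - Gd t z.1 z.2))%:E.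
have md : mfunT d.
  apply/mEFinP; apply: mfunM.
    apply: mcompT mfst; apply: mindic; exact: mIval.
  exact: (cmeas_cabs (cmeasB mG' (mGt t))).
have d0 z : (0 <= d z)%E by rewrite lee_fin mulr_ge0 ?cabs_ge0 ?indic_fun_ge0.
have H1 : {ae leb, forall s : mR, {ae lebn, forall x, d (s, x) = 0%E}}.
  apply: (@ae_imp2 R _ mR leb _ _ _ extG' (ae_neq t)) => s eG ts.
  have [It|nIt] := pselect (Ival t s); last first.
    by apply/aeW => x; rewrite /d indicE memNset ?mul0r.
  have e1 := eG It; have Fs : (NF s < +oo)%E by case: e1 => -[].
  apply: filterS (ext_uniq ts e1 (duhamel_integrand_ext ts Fs)) => x gx.
  by rewrite /d /= gx subrr cabs0 mulr0.
have H2 := @fubini_ae _ _ mR vec R leb lebn d md d0 H1.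
apply: filterS2 wG' H2 => x -> dx; rewrite /duhamel_fun; congr (_ * _).
have E1 := @cintegral_restr R _ mR leb (Ival t) (fun s => G' s x).
have E2 := @cintegral_restr R _ mR leb (Ival t) (fun s => Gd t s x).
apply: (etrans E1); apply: (etrans _ (esym E2)); apply: (@ae_eq_cintegral R _ mR leb).
- by apply: cmeas_indic; [exact: mIval|exact: (cmeas_comp mG' (mpair2 x))].
- by apply: cmeas_indic; [exact: mIval|exact: (cmeas_comp (mGt t) (mpair2 x))].
apply: filterS dx => s [] ds; rewrite /restr; move: ds; rewrite indicE.
case: (_ \in _); rewrite ?mul0r// !mul1r => /cabs0_eq0 /eqP.
by rewrite subr_eq0 => /eqP.
Qed.

End InhomogeneousPart.
End Evolution.

(** * Norms in time and the final estimate *)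

Section TimeNorms.
Context (R : realType).
Local Notation leb := (@lebesgue_measure R).
Local Notation mR := (mtypeR R).

Lemma hoelder_conjugate_EFin (p : R) : 1 < p -> hoelder_conjugate p%:E = (p / (p - 1))%:E.
Proof.
move=> p1; rewrite /hoelder_conjugate /= eqe gt_eqF ?(lt_trans _ p1)//.
by rewrite -EFinB inver gt_eqF ?subr_gt0// -EFinM.
Qed.

Lemma conj_exp_div (p : R) : 1 < p -> p^-1 + (p / (p - 1))^-1 = 1.
Proof.
move=> p1; have p0 : p != 0 by rewrite gt_eqF// (lt_trans _ p1).
have p10 : p - 1 != 0 by rewrite subr_eq0 gt_eqF.
by field; rewrite p0 p10.
Qed.

(** Supplies a test function that is positive everywhere, by which an integral bound yields
    finiteness almost everywhere. *)
Lemma rcap_gauss (q qinf : R) : 1 < q -> 1 < qinf ->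
  exists M : R, (rcap q qinf (fun t => expR (- (1 * t ^+ 2))) <= M%:E)%E.
Proof.
move=> q1 qi1.
have fin (p : R) : 1 < p -> ('N[leb]_(p / (p - 1))%:E[EFin \o (fun t => expR (- (1 * t ^+ 2)))] < +oo)%E.
  move=> p1; have [c1 _ _] := conj_exp_gt1 p1 (conj_exp_div p1); move: (p / (p - 1)) c1 => c c1.
  rewrite Lnorm_ge0E; last nonneg.
  apply: poweR_lty.
  have -> : (\int[leb]_t ((EFin \o (fun t => expR (- (1 * t ^+ 2)))) t `^ c) = \int[leb]_t (expR (- (c * t ^+ 2)))%:E)%E.
    apply: eq_int => t _ /=; congr (_%:E).
    by rewrite /powR gt_eqF ?expR_gt0// expRK; congr expR; ring.
  by rewrite integral_gauss0 ?ltry// (lt_trans _ c1).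
exists (fine (rcap q qinf (fun t => expR (- (1 * t ^+ 2))))).
rewrite fineK// ge0_finE; first by apply: lte_add_pinfty; exact: fin.
by rewrite adde_ge0 ?Lnorm_ge0.
Qed.

(** Dividing by $l=2(A+e/4)$ reduces to [sum_norm_dual_half]; the two pieces then have norm at most
    $l$ each, and $2l=4A+e$. The term in [e] keeps $l$ positive when $A=0$. *)
Lemma sum_norm_le_of_dual (q qinf A : R) (g wn : R -> \bar R) : 1 < q -> q < qinf -> 0 <= A ->
  mfunT (g : mR -> \bar R) -> (forall t, 0 <= g t)%E ->
  {ae leb, forall t : mR, wn t = g t} ->
  (forall (f : R -> R) (M : R), mfunT f -> (forall t, 0 <= f t) ->
     (\int[leb]_t (f t)%:E < +oo)%E -> (rcap q qinf f <= M%:E)%E ->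
     (\int[leb]_t (g t * (f t)%:E) <= (A * M)%:E)%E) ->
  (sum_norm q%:E qinf%:E wn <= (4 * A)%:E)%E.
Proof.
move=> q1 qqi A0 mg g0 wng H; have qi1 : 1 < qinf by exact: lt_trans qqi.
have q0 : 0 < q by exact: lt_trans q1.
have qi0 : 0 < qinf by exact: lt_trans qi1.
apply/lee_addgt0Pr => e e0.
pose l := 2 * (A + e / 4); have l0 : 0 < l by rewrite mulr_gt0// ltr_wpDl// divr_gt0.
pose h (t : mR) : \bar R := ((l^-1)%:E * g t)%E.
have mh : mfunT h by exact: emfunM.
have h0 t : (0 <= h t)%E by rewrite mule_ge0// lee_fin invr_ge0 ltW.
have gE t : g t = (l%:E * h t)%E by rewrite /h muleA -EFinM mulfV ?mul1e// gt_eqF.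
have := @sum_norm_dual_half R q qinf (q / (q - 1)) (qinf / (qinf - 1)) h q1 qqi (conj_exp_div q1) (conj_exp_div qi1) mh h0.
set h1 := (fun t => if (1 < h t)%E then h t else 0%E).
set h2 := (fun t => if (1 < h t)%E then 0%E else h t).
move=> D; have {D}[N1 N2] : ('N[leb]_q%:E[h1] <= 1)%E /\ ('N[leb]_qinf%:E[h2] <= 1)%E.
  apply: D => f mf f0 [K fK] [S [mS Soo] fS]; rewrite -/(rcap q qinf f).
  have c0 : (0 <= rcap q qinf f)%E by rewrite adde_ge0 ?Lnorm_ge0.
  have [->|] := eqVneq (rcap q qinf f) +oo%E; first by rewrite gt0_muley ?leey ?lte_fin ?invr_gt0.
  rewrite -ltey => coo; have cE : rcap q qinf f = (fine (rcap q qinf f))%:E by rewrite fineK// ge0_finE.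
  have mfE : mfunT (fun t : mR => (f t)%:E) by meas.
  have If : (\int[leb]_t (f t)%:E < +oo)%E.
    apply: (@le_lt_trans _ _ (\int[leb]_t ((Num.max K 0)%:E * (\1_S t : R)%:E))%E).
      apply: (@le_integralT _ mR R leb) => //.
      - meas.
      move=> t; rewrite -EFinM lee_fin indicE; have [/set_mem St|nS] := boolP (t \in S).
        by rewrite mulr1 le_max fK.
      by rewrite mulr0 fS// => St; move: nS; rewrite mem_set.
    have i0 (t : mR) : (0 <= (\1_S t : R)%:E)%E by rewrite lee_fin indic_fun_ge0.
    have mi : mfunT (fun t : mR => (\1_S t : R)%:E) by meas.
    have K0 : 0 <= Num.max K 0 by rewrite le_max lexx orbT.
    rewrite (@integralZlT _ mR R leb _ _ i0 mi K0) (@integral_indic _ mR R leb setT)// setIT.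
    by rewrite lte_mul_pinfty ?lee_fin.
  have := H f (fine (rcap q qinf f)) mf f0 If; rewrite -cE lexx => /(_ isT) Hf.
  have gf0 (t : mR) : (0 <= g t * (f t)%:E)%E by rewrite mule_ge0 ?lee_fin.
  have mgf : mfunT (fun t : mR => g t * (f t)%:E)%E by meas.
  have li0 : 0 <= l^-1 by rewrite invr_ge0 ltW.
  have -> : (\int[leb]_t (h t * (f t)%:E) = (l^-1)%:E * \int[leb]_t (g t * (f t)%:E))%E.
    rewrite -(@integralZlT _ mR R leb _ _ gf0 mgf li0).
    by apply: eq_int => t _; rewrite /h muleA.
  rewrite cE in c0 *; move: (fine _) c0 Hf => M; rewrite lee_fin => M0 Hf.
  apply: (@le_trans _ _ ((l^-1)%:E * (A * M)%:E)%E); first by apply: lee_wpmul2l; rewrite ?lee_fin.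
  rewrite -!EFinM lee_fin mulrA; apply: ler_wpM2r => //.
  rewrite mulrC ler_pdivrMr// /l mulrA mulVf// mul1r lerDl.
  by rewrite ltW// divr_gt0.
have mlt : mfunT (fun t => 1 < h t)%E by exact: meas_fun_elt.
have mh1 : mfunT h1 by apply: mfun_ifT => //; exact: mcst.
have mh2 : mfunT h2 by apply: mfun_ifT => //; exact: mcst.
have h10 t : (0 <= h1 t)%E by rewrite /h1; case: ifP.
have h20 t : (0 <= h2 t)%E by rewrite /h2; case: ifP.
have lh (k : mR -> \bar R) : mfunT k -> (forall t, 0 <= k t)%E ->
    mfunT (fun t : mR => fine (l%:E * k t)%E) /\
    forall p, 0 < p -> ('N[leb]_p%:E[k] <= 1 -> 'N[leb]_p%:E[EFin \o (fun t => fine (l%:E * k t))] <= l%:E)%E.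
  move=> mk k0; have mlk : mfunT (fun t : mR => l%:E * k t)%E by meas.
  have lk0 t : (0 <= l%:E * k t)%E by rewrite mule_ge0// lee_fin ltW.
  have mf : mfunT (fun t : mR => fine (l%:E * k t)%E) by exact: mcompT.
  split => // p p0 Nk.
  have := @Lnorm_scale R p l k p0 (ltW l0) mk k0 => E.
  apply: (@le_trans _ _ (l%:E * 'N[leb]_p%:E[k])%E); last first.
    by rewrite -[leRHS]mule1; apply: lee_wpmul2l; rewrite ?lee_fin ?(ltW l0).
  rewrite -E; apply: (@le_Lnorm _ mR R leb p) => //.
  - meas.
  - by move=> t; rewrite lee_fin fine_ge0.
  by move=> t /=; have := lk0 t; case: (l%:E * k t)%E => //=.
have [m1 B1] := lh h1 mh1 h10; have [m2 B2] := lh h2 mh2 h20.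
(* The pieces must be real-valued: the part above the cut has finite norm, so it is infinite only on
   a null set, and below the cut values are at most 1. *)
have h1fin : {ae leb, forall t : mR, (h1 t < +oo)%E}.
  have mh1q : mfunT (fun t : mR => h1 t `^ q)%E by meas.
  have I1 : leb.-integrable (setT : set mR) (fun t : mR => h1 t `^ q)%E.
    apply/integrableP; split => //.
    have Nq : (\int[leb]_t (h1 t `^ q) <= 1%E `^ q)%E by apply/(@Lnorm_le _ mR R leb q h1 1%E) => //.
    apply: (@le_lt_trans _ _ (1%E `^ q)%E); last by rewrite poweR_EFin ltry.
    apply: le_trans Nq; apply: le_of_eq.
    by apply: eq_int => t _; rewrite gee0_abs ?poweR_ge0.
  have := @integrable_ae _ mR R leb setT measurableT _ I1; apply: filterS => t /(_ I).
  by move: (h10 t); case: (h1 t) => [x| |]//; rewrite ?ltry// poweRyr ?gt_eqF.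
apply: (@le_trans _ _ (l + l)%:E); last first.
  rewrite -EFinD lee_fin /l le_eqVlt; apply/orP; left; apply/eqP.
  by field.
apply: (@le_trans _ _ ('N[leb]_q%:E[EFin \o (fun t => fine (l%:E * h1 t))] + 'N[leb]_qinf%:E[EFin \o (fun t => fine (l%:E * h2 t))])%E); last first.
  by rewrite EFinD; apply: leeD; [exact: B1|exact: B2].
apply: ereal_inf_lbound; exists (fun t => fine (l%:E * h1 t)%E), (fun t => fine (l%:E * h2 t)%E); split => //.
apply: (@ae_imp2 R _ mR leb _ _ _ wng h1fin) => t -> h1t; rewrite gE EFinD.
move: h1t; rewrite /h1 /h2; case: (ltP 1%E (h t)) => ht; last first.
  move=> _; have hfin : h t \is a fin_num by rewrite ge0_finE// (le_lt_trans ht)// ltry.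
  by rewrite mule0 /= add0e fineK// fin_numM.
move=> hoo; have hfin : h t \is a fin_num by rewrite ge0_finE.
by rewrite mule0 /= adde0 fineK// fin_numM.
Qed.

End TimeNorms.

Section Strichartz.
Context (R : realType) (n : nat) (Q B : 'M[R]_n).
Hypotheses (sQ : Defs.symmetric Q) (V0 : forall t : R, 0 < t -> 0 < volume Q B t).
Variables (D : nat) (Dinf r q qinf gam : R).
Hypotheses (Dinf2 : 2 <= Dinf) (DinfD : Dinf < D%:R) (gam0 : 0 < gam).
Hypothesis volge : forall t : R, 0 < t -> gam * Num.min (t ^+ D) (t `^ Dinf) <= vol Q B t.
Hypotheses (r2 : 2 < r) (rD : (2 < D)%N -> r < 2 * D%:R / (D%:R - 2)).
Hypotheses (qE : 2 / q = D%:R * (2^-1 - r^-1)) (qinf1 : 1 < qinf)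
  (qinfE : 2 / qinf <= Dinf * (2^-1 - r^-1)).
Local Notation vec := 'cV[R]_n.
Local Notation leb := (@lebesgue_measure R).
Local Notation lebn := (lebesgue_cV R n).
Local Notation mR := (mtypeR R).
Local Notation r' := (r / (r - 1)).
Local Notation kA := (decay_kernel n r q qinf gam).
Local Notation C1 := (hls_sum_cst n r q qinf gam).

Let r1 : 1 < r. Proof. by apply: lt_trans r2; rewrite ltr1n. Qed.
Let r0 : 0 < r. Proof. exact: lt_trans r1. Qed.
Let rr' : r^-1 + r'^-1 = 1. Proof. exact: conj_exp_div. Qed.
Let r'1 : 1 < r'. Proof. by have [] := conj_exp_gt1 r1 rr'. Qed.
Let q2 : 2 < q. Proof. exact: (strichartz_q_gt2 Dinf2 DinfD r2 rD qE). Qed.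
Let q1 : 1 < q. Proof. by apply: lt_trans q2; rewrite ltr1n. Qed.
Let qqi : q < qinf. exact: (strichartz_q_lt_qinf Dinf2 DinfD r2 rD qE qinf1 qinfE). Qed.
Let C10 : 0 < C1. Proof. exact: (hls_sum_cst_gt0 n Dinf2 DinfD gam0 r2 rD qE qinf1 qinfE). Qed.
Let kA0 t : 0 <= kA t. Proof. exact: decay_kernel_ge0. Qed.
Let mkA : mfunT kA. Proof. exact: meas_decay_kernel. Qed.
Let kAle t : t != 0 -> interp_cst r * amp Q B t `^ (1 - 2 / r) <= kA t.
exact: (interp_amp_le V0 DinfD gam0 volge r2 qE qinfE). Qed.
Let hr : hoelder_conjugate r%:E = r'%:E. Proof. exact: hoelder_conjugate_EFin. Qed.

(** The square root comes from the TT* bound for the free part, [C1] itself from the bilinear bound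
    for the Duhamel part. *)
Definition strichartz_cst : R := Num.sqrt C1 + C1.
Lemma strichartz_cst_gt0 : 0 < strichartz_cst.
by rewrite addr_gt0// sqrtr_gt0. Qed.

Let adm (f : R -> R) (M : R) : Prop := [/\ mfunT f, (forall t, 0 <= f t),
  (\int[leb]_t (f t)%:E < +oo)%E & (rcap q qinf f <= M%:E)%E].

Variables (phi : vec -> R[i]) (F : R -> vec -> R[i]).
Hypotheses (Lphi : in_Lp lebn 2%:E phi) (mF : cmeasurable (fun z : mR * vec => F z.1 z.2)).
Local Notation wF := (weighted_norm B r'%:E F).
Local Notation capF := ('N[leb]_(q / (q - 1))%:E[wF] + 'N[leb]_(qinf / (qinf - 1))%:E[wF])%E.
Hypothesis Fcap : (capF < +oo)%E.

Let mNF : mfunT (fun s : mR => Lp_norm lebn r'%:E (F s)).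
apply: (@mLnorm_slice _ _ mR vec R lebn r' (fun z => (cabs (F z.1 z.2))%:E)).
  meas.
nonneg.
Qed.

Let mwt : mfunT (fun s : mR => (expR (\tr B / 2 * s))%:E).
by apply/mEFinP; apply: mcompT => //; exact: mfunM. Qed.

Let mwF : mfunT (wF : mR -> \bar R).
exact: emfunM. Qed.

Let wF0 s : (0 <= wF s)%E.
by rewrite mule_ge0 ?Lp_norm_ge0// lee_fin expR_ge0. Qed.

Let q'1 : 1 < q / (q - 1). Proof. by have [] := conj_exp_gt1 q1 (conj_exp_div q1). Qed.

Let wFfin : {ae leb, forall s : mR, (wF s < +oo)%E}.
have q'0 : 0 < q / (q - 1) by exact: lt_trans q'1.
have mwq : mfunT (fun s : mR => wF s `^ (q / (q - 1)))%E by exact: mfun_poweR.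
have N1 : ('N[leb]_(q / (q - 1))%:E[wF] < +oo)%E.
  by apply: le_lt_trans Fcap; rewrite leeDl ?Lnorm_ge0.
have I1 : leb.-integrable (setT : set mR) (fun s : mR => wF s `^ (q / (q - 1)))%E.
  apply/integrableP; split => //.
  have -> : (\int[leb]_s `|wF s `^ (q / (q - 1))| = \int[leb]_s (wF s `^ (q / (q - 1))))%E.
    by apply: eq_int => s _; rewrite gee0_abs ?poweR_ge0.
  move: N1; rewrite Lnorm_ge0E// => N1; apply: contraTT N1; rewrite -!leNgt !leye_eq => /eqP ->.
  have q'n : (q / (q - 1))^-1 != 0 by rewrite gt_eqF// invr_gt0.
  by rewrite (poweRyr q'n).
have := @integrable_ae _ mR R leb setT measurableT _ I1; apply: filterS => s /(_ I).
by move: (wF0 s); case: (wF s) => [x| |]//; rewrite ?ltry// poweRyr ?gt_eqF.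
Qed.

Let Foo : {ae leb, forall s : mR, (Lp_norm lebn r'%:E (F s) < +oo)%E}.
apply: filterS wFfin => s; apply: contraTT; rewrite -!leNgt !leye_eq /weighted_norm => /eqP ->.
by rewrite gt0_muley// lte_fin expR_gt0.
Qed.

Let wFr (s : R) : R := fine (wF s).
Let wFr0 s : 0 <= wFr s. Proof. exact: fine_ge0. Qed.
Let mwFr : mfunT (wFr : mR -> R). Proof. exact: mcompT. Qed.

Let N := fine capF.
Let NE : capF = N%:E.
by rewrite /N fineK// ge0_finE// adde_ge0 ?Lnorm_ge0. Qed.
Let N0 : 0 <= N. Proof. by rewrite fine_ge0// adde_ge0 ?Lnorm_ge0. Qed.

Let wFr_cap : (rcap q qinf wFr <= N%:E)%E.
have part (p : R) : 0 < p -> ('N[leb]_p%:E[EFin \o wFr] <= 'N[leb]_p%:E[wF])%E.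
  move=> p0; apply: (@le_Lnorm _ mR R leb p) => //.
  - exact/mEFinP.
  by move=> s /=; rewrite /wFr; have := wF0 s; case: (wF s).
have qi1 : 1 < qinf by exact: lt_trans qqi.
have [qi'1 _ _] := conj_exp_gt1 qi1 (conj_exp_div qi1).
by rewrite -NE; apply: leeD; apply: part; [exact: lt_trans q'1|exact: lt_trans qi'1].
Qed.

(** [time_conv] with the weighted norm of the source made real-valued, as the bilinear estimate
    requires; the two agree because that norm is finite almost everywhere. *)
Let TC (t : mR) : \bar R := (\int[leb]_s (kA (t - s) * wFr s)%:E)%E.

Let mkw : mfunT (fun z : mR * mR => (kA (z.1 - z.2) * wFr z.2)%:E).
apply/mEFinP; apply: mfunM; last exact: mcompT mwFr msnd.
by apply: (mcompT mkA); apply: mfunB; [exact: mfst|exact: msnd].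
Qed.
Let kw0 (z : mR * mR) : (0 <= (kA (z.1 - z.2) * wFr z.2)%:E)%E.
by rewrite lee_fin mulr_ge0. Qed.
Let mTC : mfunT TC.
exact: (@mfubiniF _ _ mR mR R leb _ mkw kw0). Qed.
Let TC0 t : (0 <= TC t)%E.
by apply: int_ge0 => s _; exact: (kw0 (t, s)). Qed.

Let time_convE t : time_conv B r' kA F t = TC t.
have mk : mfunT (fun s : mR => (kA (t - s))%:E).
  by apply/mEFinP; apply: mcompT mkA _; exact: mfunB.
apply: (@ge0_ae_eq_integral _ mR R leb setT) => //.
- meas.
- exact: (meas_slice mkw).
- by move=> s _; rewrite mule_ge0 ?lee_fin//; exact: wF0.
- by move=> s _; exact: (kw0 (t, s)).
apply: filterS wFfin => s ws _.
have E : (wFr s)%:E = wF s by rewrite /wFr fineK// ge0_finE ?wF0.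
by rewrite [RHS]EFinM; congr (_ * _)%E; exact: esym E.
Qed.

Let TC_bound f M : adm f M -> (\int[leb]_t (TC t * (f t)%:E) <= (C1 * M * N)%:E)%E.
move=> [mf f0 _ fM].
have := decay_bilinear n Dinf2 DinfD gam0 r2 rD qE qinf1 qinfE mf f0 mwFr wFr0 fM wFr_cap.
apply: le_trans; apply: le_of_eq; apply: eq_int => t _.
rewrite muleC -(@integralZlT _ mR R leb _ _ (fun s => kw0 (t, s)) (meas_slice mkw t) (f0 t)).
by apply: eq_int => s _; rewrite -EFinM mulrA.
Qed.

(** The convolution is integrable against a Gaussian, which is positive everywhere, so it is finite
    almost everywhere and the constructed Duhamel term is legitimate at almost every time. *)
Let TCfin : {ae leb, forall t : mR, (TC t < +oo)%E}.
have [M fM] := rcap_gauss q1 (lt_trans q1 qqi).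
pose f (t : R) : R := expR (- (1 * t ^+ 2)).
have f0 t : 0 < f t by exact: expR_gt0.
have mf : mfunT (f : mR -> R).
  by apply: mcompT => //; apply: mfunN; apply: mfunM => //.
have af : adm f M.
  split => //; first by move=> t; exact: ltW.
  by rewrite integral_gauss0// ltry.
have mTf : mfunT (fun t : mR => TC t * (f t)%:E)%E.
  meas.
have Tf0 t : (0 <= TC t * (f t)%:E)%E by rewrite mule_ge0// lee_fin ltW.
have I1 : leb.-integrable (setT : set mR) (fun t : mR => TC t * (f t)%:E)%E.
  apply/integrableP; split => //.
  have -> : (\int[leb]_t `|TC t * (f t)%:E| = \int[leb]_t (TC t * (f t)%:E))%E.
    by apply: eq_int => s _; rewrite gee0_abs.
  exact: le_lt_trans (TC_bound af) (ltry _).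
have := @integrable_ae _ mR R leb setT measurableT _ I1; apply: filterS => t /(_ I).
by move: (TC0 t); case: (TC t) => [x| |]//; rewrite ?ltry// gt0_mulye ?lte_fin.
Qed.

Let U2_uniq t v v' : U_ext Q B 2%:E 2%:E t phi v -> U_ext Q B 2%:E 2%:E t phi v' ->
  {ae lebn, forall x, v x = v' x}.
have l12 : 1 < 2 :> R by rewrite ltr1n.
exact: (@extends_uniq R n (U Q B t) 2 2 _ (ltW l12) l12 (expR_gt0 _) (@cmeas_U R n Q B V0 t) (@U_sub R n Q B V0 t) (@Lp_U_L2 R n Q B sQ V0 t)).
Qed.

Let ae_neq0 : {ae leb, forall t : mR, t != 0}.
exists [set 0]; split; [exact: measurable_set1|exact: lebesgue_measure_set1|].
by move=> s /= /negP; rewrite negbK => /eqP ->.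
Qed.

(** The free part and the Duhamel part are built once, jointly measurable. Any solution coincides
    with their sum at almost every time up to null sets in space, so its weighted norm is that of
    the construction, and duality in time concludes. *)
Theorem strichartz_estimate :
  (exists u : R -> vec -> R[i], is_solution Q B r phi F u) /\
  forall u : R -> vec -> R[i], is_solution Q B r phi F u ->
    (sum_norm q%:E qinf%:E (weighted_norm B r%:E u) <=
      (4 * strichartz_cst)%:E * (Lp_norm lebn 2%:E phi + capF))%E.
Proof.
pose Nphi := fine (Lp_norm lebn 2%:E phi).
have NphiE : Lp_norm lebn 2%:E phi = Nphi%:E by rewrite fineK// ge0_finE ?Lp_norm_ge0//; exact: Lphi.2.
have Nphi0 : 0 <= Nphi by rewrite fine_ge0// Lp_norm_ge0.
have [v [mv extv homv]] : exists v : R -> vec -> R[i],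
    [/\ cmeasurable (fun z : mR * vec => v z.1 z.2),
        forall t, t != 0 -> U_ext Q B 2%:E 2%:E t phi (v t) &
        forall f M, adm f M ->
          (\int[leb]_t ((expR (\tr B / 2 * t))%:E * Lp_norm lebn r%:E (v t) * (f t)%:E) <=
           Lp_norm lebn 2%:E phi * (Num.sqrt C1 * M)%:E)%E].
  apply: (homogeneous_solution sQ V0 r2 Lphi (adm := adm)); first by move=> f M [].
  move=> eps f M eps0 [mf f0 If fM].
  exact: (homogeneous_estimate sQ V0 Dinf2 DinfD gam0 volge r2 rD qE qinf1 qinfE rr' eps0 Lphi mf f0 If fM).
pose w := duhamel_fun Q B r' F.
have mw : cmeasurable (fun z : mR * vec => w z.1 z.2) by exact: cmeas_duhamel_fun.
have slice (h : R -> vec -> R[i]) (t : R) : cmeasurable (fun z : mR * vec => h z.1 z.2) -> cmeasurable (h t).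
  by move=> mh; exact: (cmeas_comp mh (mpair1 (t : mR))).
pose uu t x := v t x + w t x.
have muu : cmeasurable (fun z : mR * vec => uu z.1 z.2) by exact: cmeasD.
split.
  exists uu; apply: (@ae_imp2 R _ mR leb _ _ _ ae_neq0 TCfin) => t t0 Tt.
  split; first exact: slice.
  exists (v t), (w t); split; [exact: extv| |by apply/aeW].
  apply: (duhamel_duhamel_fun sQ V0 r2 rr' mkA kA0 kAle mF Foo hr).
  by rewrite time_convE.
move=> u solu.
have mNorm (h : R -> vec -> R[i]) : cmeasurable (fun z : mR * vec => h z.1 z.2) ->
    mfunT (fun t : mR => Lp_norm lebn r%:E (h t)).
  move=> mh; apply: (@mLnorm_slice _ _ mR vec R lebn r (fun z => (cabs (h z.1 z.2))%:E)).
    by apply/mEFinP; exact: (cmeas_cabs mh).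
  nonneg.
pose g (t : R) : \bar R := ((expR (\tr B / 2 * t))%:E * Lp_norm lebn r%:E (uu t))%E.
have mg : mfunT (g : mR -> \bar R) by apply: emfunM => //; exact: mNorm.
have g0 t : (0 <= g t)%E by rewrite mule_ge0 ?Lp_norm_ge0// lee_fin expR_ge0.
(* Closure values are unique for the free part and for the Duhamel part, so only the constructed
   functions remain in the norm. *)
have ug : {ae leb, forall t : mR, weighted_norm B r%:E u t = g t}.
  apply: (@ae_imp2 R _ mR leb _ _ _ solu ae_neq0) => t [mut [v' [w' [ev dw uvw]]]] t0.
  congr (_ * _)%E; apply: (@ae_eq_Lp_norm _ vec R lebn r _ _ r0 mut (slice _ t muu)).
  have e1 := U2_uniq ev (extv t t0).
  have e2 := duhamel_unique sQ V0 r2 rr' kAle mF hr dw.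
  apply: (@ae_imp2 R _ vec lebn _ _ _ uvw (filterI e1 e2)) => x -> [-> ->].
  by [].
have A0 : 0 <= strichartz_cst * (Nphi + N) by rewrite mulr_ge0 ?addr_ge0// ltW// strichartz_cst_gt0.
have -> : ((4 * strichartz_cst)%:E * (Lp_norm lebn 2%:E phi + capF) = (4 * (strichartz_cst * (Nphi + N)))%:E)%E.
  by rewrite NphiE NE -EFinD -EFinM mulrA.
apply: (sum_norm_le_of_dual q1 qqi A0 mg g0 ug) => f M mf f0 If fM.
have af : adm f M by split.
have M0 : 0 <= M by rewrite -lee_fin; apply: le_trans fM; rewrite adde_ge0 ?Lnorm_ge0.
pose a (t : mR) : \bar R := ((expR (\tr B / 2 * t))%:E * Lp_norm lebn r%:E (v t) * (f t)%:E)%E.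
pose b (t : mR) : \bar R := (TC t * (f t)%:E)%E.
have mfE : mfunT (fun t : mR => (f t)%:E) by meas.
have ma : mfunT a by apply: emfunM => //; apply: emfunM => //; exact: mNorm.
have mb : mfunT b by exact: emfunM.
have a0 t : (0 <= a t)%E by rewrite !mule_ge0 ?Lp_norm_ge0// lee_fin ?expR_ge0.
have b0 t : (0 <= b t)%E by rewrite mule_ge0// lee_fin.
apply: (@le_trans _ _ (\int[leb]_t (a t + b t))%E).
  apply: (@le_integralT _ mR R leb).
  - by move=> t; rewrite mule_ge0// lee_fin.
  - meas.
  - exact: emeasurable_funD.
  move=> t; rewrite /a /b -ge0_muleDl//; last by rewrite mule_ge0 ?Lp_norm_ge0// lee_fin expR_ge0.
  apply: lee_wpmul2r; first by rewrite lee_fin.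
  apply: (@le_trans _ _ ((expR (\tr B / 2 * t))%:E * (Lp_norm lebn r%:E (v t) + Lp_norm lebn r%:E (w t)))%E).
    apply: lee_wpmul2l; first by rewrite lee_fin expR_ge0.
    exact: (Lp_normD lebn (ltW r1) (slice _ t mv) (slice _ t mw)).
  rewrite muleDr ?ge0_adde_def ?inE ?Lp_norm_ge0//; apply: leeD => //.
  have H := Lp_duhamel_fun sQ V0 r2 rr' mkA kA0 kAle mF Foo t.
  apply: (@le_trans _ _ ((expR (\tr B / 2 * t))%:E * ((expR (- (t * \tr B / 2)))%:E * time_conv B r' kA F t))%E).
    by apply: lee_wpmul2l; rewrite ?lee_fin ?expR_ge0.
  rewrite muleA -EFinM -expRD (_ : _ + _ = 0) ?expR0 ?mul1e ?time_convE//.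
  by field.
rewrite (@ge0_integralD _ mR R leb setT measurableT a b (fun t _ => a0 t) ma (fun t _ => b0 t) mb).
apply: (@le_trans _ _ ((Nphi * (Num.sqrt C1 * M))%:E + (C1 * M * N)%:E)%E).
  by apply: leeD; [rewrite EFinM -NphiE; exact: homv|exact: TC_bound].
rewrite -EFinD lee_fin /strichartz_cst.
have s0 : 0 <= Num.sqrt C1 by exact: sqrtr_ge0.
have c0 : 0 <= C1 by exact: ltW.
move: (Num.sqrt C1) s0 => sc s0; move: C1 c0 => c c0.
(* The nonnegative cross terms are added only to bring the bound into product form. *)
have -> : (sc + c) * (Nphi + N) * M = Nphi * (sc * M) + c * M * N + (sc * N * M + c * Nphi * M) by ring.
by rewrite lerDl addr_ge0 ?mulr_ge0.
Qed.

End Strichartz.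

Theorem theoremB (R : realType) (n : nat) (Q B : 'M[R]_n)
    (nu : nat) (p : 'I_nu.+1 -> nat) (np : n = (\sum_(j < nu.+1) p j)%N)
    (Dinf r q qinf : R) :
  let D : nat := local_hom_dim p in
  standing_assumptions np Q B ->
  2 <= Dinf -> Dinf < D%:R ->
  (exists2 gamma : R, 0 < gamma &
     forall t : R, 0 < t ->
       gamma * Num.min (t ^+ D) (t `^ Dinf) <= volume Q B t) ->
  2 < r -> ((2 < D)%N -> r < 2 * D%:R / (D%:R - 2)) ->
  2 / q = D%:R * (2^-1 - r^-1) ->
  1 < qinf -> 2 / qinf <= Dinf * (2^-1 - r^-1) ->
  exists C : R, 0 < C /\
    forall (phi : 'cV[R]_n -> R[i]) (F : R -> 'cV[R]_n -> R[i]),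
      let r' := hoelder_conjugate r%:E in
      let q' := hoelder_conjugate q%:E in
      let qinf' := hoelder_conjugate qinf%:E in
      in_Lp (lebesgue_cV R n) 2%:E phi ->
      cmeasurable (fun tx : mtypeR R * 'cV[R]_n => F tx.1 tx.2) ->
      (cap_norm q' qinf' (weighted_norm B r' F) < +oo)%E ->
      (exists u : R -> 'cV[R]_n -> R[i], is_solution Q B r phi F u) /\
      forall u : R -> 'cV[R]_n -> R[i], is_solution Q B r phi F u ->
        (sum_norm q%:E qinf%:E (weighted_norm B r%:E u) <=
           C%:E * (Lp_norm (lebesgue_cV R n) 2%:E phi +
                   cap_norm q' qinf' (weighted_norm B r' F)))%E.
Proof.
move=> D [_ sQ pQ _ _] Dinf2 DinfD [gamma gamma0 volge] r2 rD qE qinf1 qinfE.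
(* Positivity of the volume is read off from its assumed lower bound. *)
have V0 (t : R) : 0 < t -> 0 < volume Q B t.
  move=> t0; apply: lt_le_trans (volge t t0); rewrite mulr_gt0// lt_min exprn_gt0//.
  by rewrite powR_gt0.
have Dinf0 : 0 < Dinf by apply: lt_le_trans Dinf2.
(* The lower bound passes from $V$ to the corrected volume [vol], at the price of a new constant
   [g]. *)
have [g g0 volge'] := vol_ge sQ pQ V0 Dinf0 gamma0 volge.
exists (4 * strichartz_cst n r q qinf g); split.
  by rewrite mulr_gt0//; exact: (strichartz_cst_gt0 n Dinf2 DinfD g0 r2 rD qE qinf1 qinfE).
have q1 : 1 < q.
  by apply: (lt_trans _ (strichartz_q_gt2 Dinf2 DinfD r2 rD qE)); rewrite ltr1n.
have r1 : 1 < r by apply: lt_trans r2; rewrite ltr1n.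
move=> phi F r' q' qinf' Lphi mF.
rewrite /cap_norm /q' /qinf' /r' !hoelder_conjugate_EFin// => Fcap.
exact: (strichartz_estimate sQ V0 Dinf2 DinfD g0 volge' r2 rD qE qinf1 qinfE Lphi mF Fcap).
Qed.
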